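(* Let $n\ge 1$ and $s>0$, and let $u$ be a solution on $\mathbb{R}^n\times(0,\infty)$ of the extension problem for the Laplacian, $$\Big(\Delta+\partial_\rho^2+\frac{1-s}{\rho}\partial_\rho\Big)u(x,\rho)=0,\qquad x\in\mathbb{R}^n,\ \rho>0.$$ Then $u$ is of the form $u(x,\rho)=f\ast\rho^{s}\varphi_{s,\rho}(x)$ for some $f\in L^2(\mathbb{R}^n)$ if and only if for each $\rho>0$ the function $u(\cdot,\rho)$ extends to $\Omega_\rho$ as a holomorphic function, belongs to $\mathcal{B}_s(\Omega_\rho)$, and satisfies the uniform estimate $\|u(\cdot,\rho)\|_{\mathcal{B}_s}\le C$ for all $\rho>0$, with $C$ independent of $\rho$.
   Context: $\Delta$ is the Laplacian on $\mathbb{R}^n$ in the variable $x$. The generalised Poisson kernel is $$\varphi_{s,\rho}(x)=\pi^{-n/2}\frac{\Gamma(\frac{n+s}{2})}{|\Gamma(s)|}(\rho^2+|x|^2)^{-\frac{n+s}{2}},$$ and $\ast$ is convolution on $\mathbb{R}^n$. The tube domain is $\Omega_\rho=\{z=x+iy\in\mathbb{C}^n: |y|<\rho\}$. The weighted Bergman space $\mathcal{B}_s(\Omega_\rho)$ consists of all holomorphic functions $F$ on $\Omega_\rho$ for which $$\|F\|_{\mathcal{B}_s}^2:=\rho^{-n}\int_{\Omega_\rho}|F(x+iy)|^2\Big(1-\frac{|y|^2}{\rho^2}\Big)_+^{s-1}dx\,dy<\infty .$$ Here a solution of the extension problem means a $C^2$ function on $\mathbb{R}^n\times(0,\infty)$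 satisfying the displayed differential equation; no initial datum is prescribed in advance. *)

(* Defs.v *)
From HB Require Import structures.
From mathcomp Require Import all_boot all_order all_algebra.
From mathcomp Require Import all_classical all_reals all_analysis.
From mathcomp Require Import complex.

Set Implicit Arguments.
Unset Strict Implicit.
Unset Printing Implicit Defensive.

Import Order.TTheory GRing.Theory Num.Theory numFieldNormedType.Exports.

Local Open Scope classical_set_scope.
Local Open Scope ring_scope.
Local Open Scope complex_scope.

Definition measure_rV_display : measure_display.
Proof. exact: default_measure_display. Qed.

(* The sigma-algebra on R^n generated by the coordinates, i.e. the Borel
   sigma-algebra. *)
Section measurable_rV.
Variables (R : realType) (n : nat).

Definition rV_coord (i : 'I_n) (x : 'rV[R]_n) : R := x ord0 i.

Let rV_set0 : g_sigma_preimage rV_coord set0.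
Proof. exact: sigma_algebra0. Qed.

Let rV_setC A : g_sigma_preimage rV_coord A -> g_sigma_preimage rV_coord (~` A).
Proof. exact: sigma_algebraC. Qed.

Let rV_bigcup (F : _^nat) : (forall i, g_sigma_preimage rV_coord (F i)) ->
  g_sigma_preimage rV_coord (\bigcup_i (F i)).
Proof. exact: sigma_algebra_bigcup. Qed.

HB.instance Definition _ := @isMeasurable.Build measure_rV_display
  'rV[R]_n (g_sigma_preimage rV_coord) rV_set0 rV_setC rV_bigcup.

End measurable_rV.

Section measurable_rV_lemmas.
Variable R : realType.

Lemma measurable_rV_coord n (i : 'I_n) :
  measurable_fun [set: 'rV[R]_n] (fun x : 'rV[R]_n => x ord0 i).
Proof.
move=> _ Y mY; rewrite setTI; apply: sub_sigma_algebra => /=.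
rewrite -bigcup_seq/=; exists i => /=; first by rewrite mem_index_enum.
by exists Y => //; rewrite setTI.
Qed.

Lemma measurable_fun_rV d (T : measurableType d) n (f : T -> 'rV[R]_n) :
  (forall i, measurable_fun [set: T] (fun t => f t ord0 i)) ->
  measurable_fun [set: T] f.
Proof.
move=> mf.
have : g_sigma_preimage (fun i => @rV_coord R n i \o f) `<=` measurable.
  apply: smallest_sub; first exact: sigma_algebra_measurable.
  move=> A; rewrite -bigcup_seq => -[i _ [B mB <-]]; exact: mf.
by rewrite g_sigma_preimage_comp => prefS _ A mA; apply: prefS; exists A.
Qed.

(* Identification of R x R^n with R^(n+1). *)
Definition rV_cons n (p : measurableTypeR R * 'rV[R]_n) : 'rV[R]_n.+1 :=
  @row_mx _ 1 1 n (const_mx p.1) p.2.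

Definition rV_uncons n (x : 'rV[R]_n.+1) : measurableTypeR R * 'rV[R]_n :=
  (x ord0 ord0, @rsubmx _ 1 1 n x).

Lemma rV_cons0 n p : @rV_cons n p ord0 ord0 = p.1.
Proof.
have -> : (ord0 : 'I_n.+1) = @lshift 1 n ord0 by exact/val_inj.
by apply: (etrans (@row_mxEl _ 1 1 n _ _ ord0 ord0)); rewrite mxE.
Qed.

Lemma rV_consS n p i : @rV_cons n p ord0 (lift ord0 i) = p.2 ord0 i.
Proof.
have -> : lift ord0 i = @rshift 1 n i by exact/val_inj.
exact: (@row_mxEr _ 1 1 n).
Qed.

Lemma rV_consK n : cancel (@rV_cons n) (@rV_uncons n).
Proof.
move=> [a v]; rewrite /rV_uncons rV_cons0; congr (_, _).
exact: (@row_mxKr _ 1 1 n).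
Qed.

Lemma measurable_rV_cons n : measurable_fun [set: _] (@rV_cons n).
Proof.
apply: measurable_fun_rV => i; have [j ->|->] := unliftP ord0 i.
- under eq_fun do rewrite rV_consS.
  apply: (@measurableT_comp _ _ _ _ _ _ (fun x : 'rV[R]_n => x ord0 j)).
    exact: measurable_rV_coord.
  exact: measurable_snd.
- under eq_fun do rewrite rV_cons0.
  exact: measurable_fst.
Qed.

Lemma measurable_rV_uncons n : measurable_fun [set: _] (@rV_uncons n).
Proof.
apply: (@measurable_fun_pair _ _ _ _ (measurableTypeR R) _
  (fun x : 'rV[R]_n.+1 => x ord0 ord0) (fun x => @rsubmx _ 1 1 n x)).
  exact: measurable_rV_coord.
apply: measurable_fun_rV => i; under eq_fun do rewrite mxE.
exact: measurable_rV_coord.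
Qed.

HB.instance Definition _ n :=
  isMeasurableFun.Build _ _ _ _ (@rV_cons n) (@measurable_rV_cons n).

Section rV_cons_measure.
Variables (n : nat) (mu : {sigma_finite_measure set 'rV[R]_n -> \bar R}).

Definition rV_cons_measure : set 'rV[R]_n.+1 -> \bar R :=
  pushforward (lebesgue_measure \x mu)%E (@rV_cons n).

Let rV_cons_measure0 : rV_cons_measure set0 = 0%E.
Proof. exact: measure0. Qed.

Let rV_cons_measure_ge0 A : (0 <= rV_cons_measure A)%E.
Proof. exact: measure_ge0. Qed.

Let rV_cons_measure_sigma_additive : semi_sigma_additive rV_cons_measure.
Proof. exact: measure_semi_sigma_additive. Qed.

HB.instance Definition _ := isMeasure.Build _ _ _ rV_cons_measure
  rV_cons_measure0 rV_cons_measure_ge0 rV_cons_measure_sigma_additive.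

Let rV_cons_measure_sigma_finite : sigma_finite setT rV_cons_measure.
Proof.
have /sigma_finiteP[F [FT ndF Foo]] :=
  sigma_finiteT (@lebesgue_measure R : {sigma_finite_measure set _ -> \bar R}).
have /sigma_finiteP[G [GT ndG Goo]] := sigma_finiteT mu.
exists (fun k => @rV_uncons n @^-1` (F k `*` G k)).
  rewrite -preimage_bigcup (_ : \bigcup_k _ = setT) ?preimage_setT//.
  rewrite -subTset => -[x y] _.
  have [k _ Fkx] : (\bigcup_k F k) x by rewrite -FT.
  have [l _ Gly] : (\bigcup_l G l) y by rewrite -GT.
  exists (maxn k l) => //; split => /=.
    by move: Fkx; exact/subsetPset/ndF/leq_maxl.
  by move: Gly; exact/subsetPset/ndG/leq_maxr.
move=> k; have [mFk Fkoo] := Foo k; have [mGk Gkoo] := Goo k; split.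
  rewrite -[X in measurable X]setTI; apply: measurable_rV_uncons => //.
  exact: measurableX.
rewrite /rV_cons_measure /pushforward -comp_preimage.
rewrite (_ : _ \o _ = idfun); last by apply/funext => p /=; rewrite rV_consK.
by rewrite preimage_id product_measure1E// lte_mul_pinfty// ge0_fin_numE.
Qed.

HB.instance Definition _ := Measure_isSigmaFinite.Build _ _ _
  rV_cons_measure rV_cons_measure_sigma_finite.

End rV_cons_measure.

End measurable_rV_lemmas.

(* The Lebesgue measure on R^n, as an iterated product measure. *)
Fixpoint lebesgue_rV (R : realType) (n : nat) :
    {sigma_finite_measure set 'rV[R]_n -> \bar R} :=
  match n with
  | 0 => dirac (0 : 'rV[R]_0)
  | m.+1 => rV_cons_measure (lebesgue_rV R m)
  end.

Lemma lebesgue_rV_box (R : realType) (n : nat) (A : 'I_n -> set R) :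
  (forall i, measurable (A i)) ->
  lebesgue_rV R n [set x | forall i, A i (x ord0 i)] =
  (\prod_(i < n) @lebesgue_measure R (A i))%E.
Proof.
elim: n A => [|n IHn] A mA.
  by rewrite big_ord0 /= diracE mem_set//= => -[].
rewrite big_ord_recl -IHn => [|i]; last exact: mA.
have mB : measurable [set x : 'rV[R]_n | forall i, A (lift ord0 i) (x ord0 i)].
  rewrite (_ : [set _ | _] = \bigcap_(i in [set: 'I_n])
      ((fun x : 'rV[R]_n => x ord0 i) @^-1` A (lift ord0 i))).
    apply: fin_bigcap_measurable => // i _.
    rewrite -[X in measurable X]setTI.
    by apply: measurable_rV_coord => //; exact: mA.
  by apply/seteqP; split => x /= Ax i; [move=> _; exact: Ax|exact: Ax].
rewrite -product_measure1E//; last exact: mA.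
rewrite /= /rV_cons_measure /pushforward; congr (_ _).
apply/seteqP; split => -[a v] /=.
  move=> Av; split=> [|i]; first by have := Av ord0; rewrite rV_cons0.
  by have := Av (lift ord0 i); rewrite rV_consS.
by move=> [Aa Av] i; have [j ->|->] := unliftP ord0 i;
  rewrite ?rV_cons0 ?rV_consS.
Qed.

(* Frechet differentiability over the scalar field K; for K = R[i] this is
   complex differentiability. *)
Definition holomorphic_on (K : numFieldType) n (D : set 'rV[K]_n)
    (F : 'rV[K]_n -> K) : Prop :=
  forall z, D z -> differentiable F z.

Section definitions.
Variable R : realType.
Local Notation C := R[i].

(* The library norm on 'rV[R]_n is the sup norm. *)
Definition enorm n (x : 'rV[R]_n) : R := Num.sqrt (\sum_(i < n) x ord0 i ^+ 2).

Definition Gamma (t : R) : R :=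
  \int[@lebesgue_measure R]_(x in `]0, +oo[) (x `^ (t - 1) * expR (- x)).

Definition gen_poisson n (s rho : R) (x : 'rV[R]_n) : R :=
  pi `^ (- (n%:R / 2)) * (Gamma ((n%:R + s) / 2) / `|Gamma s|)
  * (rho ^+ 2 + enorm x ^+ 2) `^ (- ((n%:R + s) / 2)).

Definition cintegral n (f : 'rV[R]_n -> C) : C :=
  (\int[lebesgue_rV R n]_x complex.Re (f x)) +i*
  (\int[lebesgue_rV R n]_x complex.Im (f x)).

Definition convolution n (f g : 'rV[R]_n -> C) (x : 'rV[R]_n) : C :=
  cintegral (fun y => f y * g (x - y)).

Definition L2 n (f : 'rV[R]_n -> C) : Prop :=
  [/\ measurable_fun [set: 'rV[R]_n] (fun x => complex.Re (f x)),
      measurable_fun [set: 'rV[R]_n] (fun x => complex.Im (f x)) &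
      (\int[lebesgue_rV R n]_x (Normc.normc (f x) ^+ 2)%:E < +oo)%E].

(* Functions on R^n x (0, oo) are total functions on 'rV[R]_n * R, of which
   only the values on the open half-space are used. *)
Definition half_space n : set ('rV[R]_n * R) := [set p | 0 < p.2].

Definition dir_x n (j : 'I_n) : 'rV[R]_n * R := (delta_mx ord0 j, 0).
Definition dir_rho n : 'rV[R]_n * R := (0, 1).

Definition coord_dir n (v : 'rV[R]_n * R) : Prop :=
  (exists j, v = dir_x j) \/ v = dir_rho n.

Definition C1_on n (D : set ('rV[R]_n * R)) (g : 'rV[R]_n * R -> R) : Prop :=
  forall v, coord_dir v -> forall p, D p ->
    derivable g p v /\ {for p, continuous ('D_v g : 'rV[R]_n * R -> R)}.

Definition C2_on n (D : set ('rV[R]_n * R)) (g : 'rV[R]_n * R -> R) : Prop :=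
  C1_on D g /\
  forall v, coord_dir v -> C1_on D ('D_v g : 'rV[R]_n * R -> R).

(* Real directional derivative of a complex-valued function. *)
Definition cderive n (v : 'rV[R]_n * R) (u : 'rV[R]_n * R -> C)
    (p : 'rV[R]_n * R) : C :=
  ('D_v (fun q => complex.Re (u q)) p) +i* ('D_v (fun q => complex.Im (u q)) p).

Definition extension_operator n (s : R) (u : 'rV[R]_n * R -> C)
    (p : 'rV[R]_n * R) : C :=
  \sum_(j < n) cderive (dir_x j) (cderive (dir_x j) u) p
  + cderive (dir_rho n) (cderive (dir_rho n) u) p
  + ((1 - s) / p.2)%:C * cderive (dir_rho n) u p.

Definition extension_solution n (s : R) (u : 'rV[R]_n * R -> C) : Prop :=
  [/\ C2_on (@half_space n) (fun p => complex.Re (u p)),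
      C2_on (@half_space n) (fun p => complex.Im (u p)) &
      forall p, half_space p -> extension_operator s u p = 0].

Definition cpoint n (x y : 'rV[R]_n) : 'rV[C]_n :=
  \row_j (x ord0 j +i* y ord0 j).

Definition tube n (rho : R) : set 'rV[C]_n :=
  [set z | enorm (map_mx (@complex.Im R) z) < rho].

Definition extends_to_tube n (rho : R) (g : 'rV[R]_n -> C)
    (F : 'rV[C]_n -> C) : Prop :=
  holomorphic_on (tube rho) F /\ forall x, F (cpoint x 0) = g x.

Definition bergman_sqnorm n (s rho : R) (F : 'rV[C]_n -> C) : \bar R :=
  ((rho ^- n)%:E *
   \int[(lebesgue_rV R n \x lebesgue_rV R n)%E]_(p in
       [set p : 'rV[R]_n * 'rV[R]_n | tube rho (cpoint p.1 p.2)])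
     (Normc.normc (F (cpoint p.1 p.2)) ^+ 2
      * (Num.max (1 - enorm p.2 ^+ 2 / rho ^+ 2) 0) `^ (s - 1))%:E)%E.

Definition bergman_norm n (s rho : R) (F : 'rV[C]_n -> C) : \bar R :=
  (bergman_sqnorm s rho F `^ 2^-1)%E.

Definition bergman_space n (s rho : R) (F : 'rV[C]_n -> C) : Prop :=
  holomorphic_on (tube rho) F /\ (bergman_sqnorm s rho F < +oo)%E.

End definitions.

(* Main.v *)
Require Import Defs.
From HB Require Import structures.
From mathcomp Require Import all_boot all_order all_algebra.
From mathcomp Require Import all_classical all_reals all_analysis.
From mathcomp Require Import complex.
From mathcomp Require Import measurable_realfun ring lra.

(* For f in L^2 the function f * rho^s phi_(s,rho) extends to the tube by the kernel
   (rho^2 + (z-t)^2)^(-p), p = (n+s)/2, which is holomorphic because Re (rho^2 + z^2) > 0 on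
   the tube; a second-order Taylor estimate of the kernel gives complex differentiability of
   the integral.  By Young's inequality the Bergman norm is controlled by the L^1 norms of the
   kernel on horizontal slices; the trivial bound |1 + z^2| >= d + |x|^2, d = 1 - |y|^2, just
   fails logarithmically, and |1 + z^2| >= 2 |x.y| provides the missing power of d.
   Conversely, the mean value inequality for |F|^2 on squares bounds the L^2 norm of u(., rho)
   by its Bergman norm, so that this norm is bounded uniformly in rho.  Cut-off energy
   estimates in the variable rho^s show that it is then nonincreasing in rho; applying this to
   differences of translates and of mollifications, u(., rho) is Cauchy in L^2 as rho -> 0, and
   by monotonicity u coincides with the Poisson extension of its limit. *)

Set Implicit Arguments.
Unset Strict Implicit.
Unset Printing Implicit Defensive.

Import Order.TTheory GRing.Theory Num.Theory numFieldNormedType.Exports.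

Local Open Scope classical_set_scope.
Local Open Scope ring_scope.

(** * Lebesgue measure and square integrable functions on R^n *)

(** Instead of a Fourier transform in $x$, the converse rests on one monotonicity principle. In
    $t=\rho^s$ the radial operator is a positive multiple of $\partial_t^2$, so the squared $L^2$
    norm of a solution is convex in $t$; being bounded on a half-line, it cannot increase. This is
    used three times. For $u+\tau_y u$, with the parallelogram law, it bounds $\|u-\tau_y u\|$
    uniformly as $\rho\to0$, so mollifying $u(\cdot,\rho)$ costs little uniformly in $\rho$. The
    mollified part is handled by pairing with a fixed test function: the pairing satisfies a Bessel
    equation with bounded right-hand side and so has a modulus of continuity at $\rho=0$. For $u$
    minus a Poisson integral, monotonicity is uniqueness: small for small $\rho$ means small for all
    $\rho$. In the direct half the exponents decide. Young's inequality squares the $L^1$ mass of a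
    kernel slice; the trivial mass $d^{-s/2}$ against the weight $d^{s-1}$ leaves $d^{-1}$. Spending
    a small power $b$ of $|1+z^2|$ on $|x\cdot y|$ lowers the mass to $d^{-(s-b)/2}$, and $d^{b-1}$
    is integrable. *)

Section rV_measurability.
Variable R : realType.

Lemma measurable_rV_comb d (T : measurableType d) n (f g : T -> 'rV[R]_n) (a b : R) :
  measurable_fun setT f -> measurable_fun setT g ->
  measurable_fun setT (fun t => a *: f t + b *: g t).
Proof.
move=> mf mg; apply: measurable_fun_rV => i.
under eq_fun do rewrite !mxE.
apply: measurable_funD; apply: measurable_funM => //.
  exact: (measurableT_comp (measurable_rV_coord i) mf).
exact: (measurableT_comp (measurable_rV_coord i) mg).
Qed.

Lemma measurable_rV_add d (T : measurableType d) n (f g : T -> 'rV[R]_n) :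
  measurable_fun setT f -> measurable_fun setT g ->
  measurable_fun setT (fun t => f t + g t).
Proof.
move=> mf mg; have := measurable_rV_comb 1 1 mf mg.
by under eq_fun do rewrite !scale1r.
Qed.

Lemma measurable_rV_sub d (T : measurableType d) n (f g : T -> 'rV[R]_n) :
  measurable_fun setT f -> measurable_fun setT g ->
  measurable_fun setT (fun t => f t - g t).
Proof.
move=> mf mg; have := measurable_rV_comb 1 (-1) mf mg.
by under eq_fun do rewrite scale1r scaleN1r.
Qed.

Lemma measurable_rV_affine n (a : R) (c : 'rV[R]_n) :
  measurable_fun setT (fun x : 'rV[R]_n => a *: x + c).
Proof.
have := @measurable_rV_comb _ _ n id (cst c) a 1 (@measurable_id _ _ _) (measurable_cst c).
by under eq_fun do rewrite scale1r.
Qed.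

End rV_measurability.

Section affine_change_of_variable.
Variable R : realType.
Local Notation mu := (@lebesgue_measure R).
Local Open Scope ereal_scope.

Lemma measurable_affine (a c : R) : measurable_fun setT (fun x : measurableTypeR R => a * x + c)%R.
Proof. by apply: measurable_funD => //; exact: measurable_funM. Qed.

(** By uniqueness of Lebesgue measure: the pushforward under the affine map, rescaled by $|a|$,
    gives half-open intervals their length. *)
Lemma lebesgue_measure_affine (a c : R) (A : set (measurableTypeR R)) : a != 0%R ->
  measurable A ->
  mu ((fun x => a * x + c)%R @^-1` A) = (`|a|^-1)%:E * mu A.
Proof.
move=> a0 mA.
have ia0 : (0 < `|a|^-1)%R by rewrite invr_gt0 normr_gt0.
pose phi : measurableTypeR R -> measurableTypeR R := (fun x => a * x + c)%R.
have mphi : measurable_fun setT phi := measurable_affine a c.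
pose m' : {measure set (measurableTypeR R) -> \bar R} := pushforward mu phi.
pose m'' := mscale (NngNum (normr_ge0 a)) (m' mphi).
suff H : mu A = m'' A.
  have -> : mu ((fun x => a * x + c)%R @^-1` A) = m' mphi A by [].
  by rewrite H /m'' /mscale/= muleA -EFinM mulVf ?normr_eq0// mul1e.
apply: lebesgue_measure_unique => // X [[x y] _ <-] /=.
rewrite /m'' /mscale/= /m' /pushforward/=.
have [a_gt0|a_lt0|a_eq0] := ltrgt0P a; last by rewrite a_eq0 eqxx in a0.
- have -> : (phi @^-1` `]x, y]) = `](x - c) / a, (y - c) / a]%classic%R.
    apply/seteqP; split => t /=; rewrite !in_itv/=;
      by rewrite ltr_pdivrMr// ler_pdivlMr// ltrBlDr lerBrDr mulrC.
  rewrite !lebesgue_measure_itv/= !lte_fin.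
  rewrite ltr_pM2r ?invr_gt0// ltrD2r.
  case: ifPn => _; last by rewrite mule0.
  rewrite -!EFinB -EFinM; congr EFin; field.
  by rewrite gt_eqF.
(* A negative slope reverses the interval, so its closed end changes side; the length is the
   same. *)
- have -> : (phi @^-1` `]x, y]) = `[(y - c) / a, (x - c) / a[%classic%R.
    apply/seteqP; split => t /=; rewrite !in_itv/=;
      by rewrite ltr_ndivlMr// ler_ndivrMr// ltrBlDr lerBrDr mulrC andbC.
  rewrite !lebesgue_measure_itv/= !lte_fin.
  rewrite ltr_nM2r ?invr_lt0// ltrD2r.
  case: ifPn => _; last by rewrite mule0.
  rewrite -!EFinB -EFinM; congr EFin; field.
  by rewrite lt_eqF.
Qed.

Lemma ge0_integral_affine (a c : R) (f : measurableTypeR R -> \bar R) : a != 0%R ->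
  measurable_fun setT f -> (forall x, 0 <= f x) ->
  \int[mu]_x f (a * x + c)%R = (`|a|^-1)%:E * \int[mu]_x f x.
Proof.
move=> a0 mf f0.
pose phi : measurableTypeR R -> measurableTypeR R := (fun x => a * x + c)%R.
have mphi : measurable_fun setT phi := measurable_affine a c.
have ia0 : (0 <= `|a|^-1)%R by rewrite invr_ge0.
have -> : \int[mu]_x f (a * x + c)%R = \int[pushforward mu phi]_x f x.
  by rewrite ge0_integral_pushforward// preimage_setT.
rewrite -(ge0_integral_mscale mu measurableT (NngNum ia0))//.
apply: eq_measure_integral => A mA _.
exact: (@lebesgue_measure_affine a c).
Qed.

Lemma ge0_integral_rV_cons n (f : 'rV[R]_n.+1 -> \bar R) :
  measurable_fun setT f -> (forall x, 0 <= f x) ->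
  \int[lebesgue_rV R n.+1]_x f x =
  \int[mu]_r \int[lebesgue_rV R n]_v f (rV_cons (r, v)).
Proof.
move=> mf f0.
rewrite [LHS](_ : _ = \int[pushforward (mu \x lebesgue_rV R n) (@rV_cons R n)]_x f x)//.
rewrite (ge0_integral_pushforward (@measurable_rV_cons R n))//.
rewrite preimage_setT fubini_tonelli1//; last by move=> x; exact: f0.
by apply: measurableT_comp => //; exact: measurable_rV_cons.
Qed.

Lemma measurable_rV_cons_slice n (f : 'rV[R]_n.+1 -> \bar R) r :
  measurable_fun setT f -> measurable_fun setT (fun v => f (rV_cons (r, v))).
Proof.
move=> mf; apply: measurableT_comp => //.
apply: (measurableT_comp (@measurable_rV_cons R n)).
exact: measurable_pair1.
Qed.

Lemma measurable_ge0_integral_rV_cons n (f : 'rV[R]_n.+1 -> \bar R) :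
  measurable_fun setT f -> (forall x, 0 <= f x) ->
  measurable_fun setT (fun r : measurableTypeR R => \int[lebesgue_rV R n]_v f (rV_cons (r, v))).
Proof.
move=> mf f0.
apply: (@measurable_fun_fubini_tonelli_F _ _ _ _ _ (lebesgue_rV R n) (f \o @rV_cons R n)) => //.
- by apply: measurableT_comp => //; exact: measurable_rV_cons.
- by move=> ?; exact: f0.
Qed.

Lemma rV_ext n (x y : 'rV[R]_n.+1) : x ord0 ord0 = y ord0 ord0 ->
  (forall j, x ord0 (lift ord0 j) = y ord0 (lift ord0 j)) -> x = y.
Proof.
by move=> xy0 xyS; apply/rowP => i; have [j ->|->] := unliftP ord0 i; [exact: xyS|exact: xy0].
Qed.

Lemma rV_cons_surj n (x : 'rV[R]_n.+1) : exists r v, x = rV_cons (r, v).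
Proof.
exists (x ord0 ord0), (@rsubmx _ 1 1 n x).
apply: rV_ext => [|j]; first by rewrite rV_cons0.
rewrite rV_consS/= mxE; congr (x _ _).
by apply/val_inj.
Qed.

Lemma affine_rV_cons n (a : R) r (v : 'rV[R]_n) r' v' :
  (a *: rV_cons (r, v) + rV_cons (r', v') = rV_cons (a * r + r', a *: v + v'))%R.
Proof.
have H i : (a *: rV_cons (r, v) + rV_cons (r', v'))%R ord0 i =
    (a * rV_cons (r, v) ord0 i + rV_cons (r', v') ord0 i)%R by rewrite 2!mxE.
apply: rV_ext => [|j]; rewrite H; first by rewrite !rV_cons0.
by rewrite !rV_consS/= !mxE.
Qed.

(** Induction on the dimension: Tonelli splits off the first coordinate, which contributes one
    factor $|a|^{-1}$. *)
Lemma ge0_integral_rV_affine n (a : R) (c : 'rV[R]_n) (f : 'rV[R]_n -> \bar R) : a != 0%R ->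
  measurable_fun setT f -> (forall x, 0 <= f x) ->
  \int[lebesgue_rV R n]_x f (a *: x + c)%R = (`|a| ^- n)%:E * \int[lebesgue_rV R n]_x f x.
Proof.
move=> a0; elim: n c f => [|n IH] c f mf f0.
  rewrite expr0 invr1 mul1e; apply: eq_integral => x _.
  by congr f; rewrite !thinmx0.
rewrite ge0_integral_rV_cons//; last first.
  by apply: measurableT_comp => //; exact: measurable_rV_affine.
rewrite ge0_integral_rV_cons//.
have [c0 [c' ->]] := rV_cons_surj c.
pose G r := \int[lebesgue_rV R n]_v f (rV_cons (r, v)).
have mG : measurable_fun setT G := measurable_ge0_integral_rV_cons mf f0.
have G0 r : 0 <= G r by apply: integral_ge0.
transitivity (\int[mu]_r ((`|a| ^- n)%:E * G (a * r + c0)%R)).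
  apply: eq_integral => r _; rewrite /G.
  under eq_integral => v _ do rewrite affine_rV_cons.
  rewrite (IH _ (fun v => f (rV_cons ((a * r + c0)%R, v))))//.
  exact: measurable_rV_cons_slice.
rewrite [in RHS](_ : (fun r => integral _ _ _) = G)//.
move: G mG G0 => {f mf f0 IH} G mG G0.
have mGa : measurable_fun setT (fun r => G (a * r + c0)%R).
  exact: (measurableT_comp mG (measurable_affine a c0)).
have an0 : 0 <= (`|a| ^- n)%:E by rewrite lee_fin invr_ge0 exprn_ge0.
rewrite (@ge0_integralZl _ (measurableTypeR R) R mu setT measurableT)//.
by rewrite ge0_integral_affine// muleA -EFinM -invfM -exprSr.
Qed.

Opaque lebesgue_rV.

Lemma ge0_integral_rV_shift n (c : 'rV[R]_n) (f : 'rV[R]_n -> \bar R) :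
  measurable_fun setT f -> (forall x, 0 <= f x) ->
  \int[lebesgue_rV R n]_x f (x + c)%R = \int[lebesgue_rV R n]_x f x.
Proof.
move=> mf f0; have := ge0_integral_rV_affine c (oner_neq0 _) mf f0.
under eq_integral do rewrite scale1r.
by rewrite normr1 expr1n invr1 mul1e.
Qed.

Lemma ge0_integral_rV_reflect n (c : 'rV[R]_n) (f : 'rV[R]_n -> \bar R) :
  measurable_fun setT f -> (forall x, 0 <= f x) ->
  \int[lebesgue_rV R n]_x f (c - x)%R = \int[lebesgue_rV R n]_x f x.
Proof.
move=> mf f0; have a0 : (-1 != 0 :> R)%R by rewrite oppr_eq0 oner_eq0.
have := ge0_integral_rV_affine c a0 mf f0.
under eq_integral do rewrite scaleN1r addrC.
by rewrite normrN normr1 expr1n invr1 mul1e.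
Qed.

Lemma ge0_integral_rV_scale n (a : R) (f : 'rV[R]_n -> \bar R) : a != 0%R ->
  measurable_fun setT f -> (forall x, 0 <= f x) ->
  \int[lebesgue_rV R n]_x f (a *: x)%R = (`|a| ^- n)%:E * \int[lebesgue_rV R n]_x f x.
Proof.
move=> a0 mf f0; have := ge0_integral_rV_affine 0 a0 mf f0.
by under eq_integral do rewrite addr0.
Qed.

Lemma integral_rV_affine n (a : R) (c : 'rV[R]_n) (f : 'rV[R]_n -> R) : a != 0%R ->
  (lebesgue_rV R n).-integrable setT (EFin \o f) ->
  (lebesgue_rV R n).-integrable setT (EFin \o (fun x => f (a *: x + c)%R)) /\
  (\int[lebesgue_rV R n]_x f (a *: x + c) = `|a| ^- n * \int[lebesgue_rV R n]_x f x)%R.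
Proof.
move=> a0 intf.
have mf := measurable_int _ intf.
have H := fun g mg g0 => @ge0_integral_rV_affine n a c g a0 mg g0.
have intg : (lebesgue_rV R n).-integrable setT (EFin \o (fun x => f (a *: x + c)%R)).
  apply/integrableP; split.
    by apply: (measurableT_comp mf); exact: measurable_rV_affine.
  rewrite [X in X < _](_ : _ = (`|a| ^- n)%:E * \int[lebesgue_rV R n]_x `|(f x)%:E|).
    by rewrite lte_mul_pinfty ?lee_fin ?invr_ge0 ?exprn_ge0//; case/integrableP : intf.
  by rewrite -H//; exact: measurableT_comp.
split=> //; rewrite /Rintegral.
have Hf := integrable_fin_num measurableT intf.
rewrite [X in fine X = _](_ : _ = (`|a| ^- n)%:E * \int[lebesgue_rV R n]_x (f x)%:E).
  by rewrite fineM.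
rewrite integralE [in RHS]integralE muleBr//; last first.
  rewrite fin_num_adde_defr//.
  exact: (integrable_pos_fin_num measurableT intf).
have mfp : measurable_fun setT (EFin \o f)^\+ := measurable_funepos mf.
have mfn : measurable_fun setT (EFin \o f)^\- := measurable_funeneg mf.
congr (_ - _).
  transitivity (\int[lebesgue_rV R n]_x (EFin \o f)^\+ (a *: x + c)%R); last exact: H.
  by apply: eq_integral => x _; rewrite !funeposE.
transitivity (\int[lebesgue_rV R n]_x (EFin \o f)^\- (a *: x + c)%R); last exact: H.
by apply: eq_integral => x _; rewrite !funenegE.
Qed.

End affine_change_of_variable.

(** * Square integrable functions: Cauchy-Schwarz, the parallelogram law, convergence in norm *)

Section square_integrable.
Context d (T : measurableType d) (R : realType) (m : {measure set T -> \bar R}).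
Implicit Types f g : T -> R.

Lemma fatou_le (f_ : nat -> T -> R) (f : T -> R) (c : \bar R) :
  (forall k, measurable_fun setT (f_ k)) -> (forall k x, 0 <= f_ k x) ->
  (forall x, f_ k x @[k --> \oo] --> f x) ->
  (forall k, (\int[m]_x (f_ k x)%:E <= c)%E) -> (\int[m]_x (f x)%:E <= c)%E.
Proof.
move=> mf f0 ff fc.
have := @fatou _ _ _ m setT measurableT (fun k x => (f_ k x)%:E).
move=> /(_ (fun k => (measurable_EFinP _ _).2 (mf k)) (fun k x _ => f0 k x)).
rewrite (_ : (fun x => limn_einf _) = (fun x => (f x)%:E)); last first.
  apply/funext => x.
  have : (f_ k x)%:E @[k --> \oo] --> (f x)%:E by apply: cvg_EFin; [exact: nearW|exact: ff].
  by move=> /cvg_limn_einf_sup[->].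
move=> /le_trans; apply; rewrite limn_einf_lim; apply: lime_le; first exact: is_cvg_einfs.
apply: nearW => k; apply: le_trans (fc k).
by apply: ereal_inf_lbound; exists k => /=.
Qed.

(** Hölder with exponents 2 and 2, squared to avoid roots. In the extended reals it holds with no
    finiteness assumption, so it can be used before anything is known to be integrable. *)
Lemma ge0_Cauchy_Schwarz (f g : T -> R) :
  measurable_fun setT f -> measurable_fun setT g ->
  ((\int[m]_x `|f x * g x|%:E) * (\int[m]_x `|f x * g x|%:E) <=
   (\int[m]_x (f x ^+ 2)%:E) * \int[m]_x (g x ^+ 2)%:E)%E.
Proof.
move=> mf mg.
have E2 (x : \bar R) : (0 <= x -> x * x = x `^ 2)%E.
  case: x => [r r0|_|//]; last by rewrite mulyy poweRyr ?pnatr_eq0.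
  by rewrite poweR_EFin powR_mulrn// expr2.
have N2 h : ('N[m]_2[EFin \o h] * 'N[m]_2[EFin \o h] = \int[m]_x (h x ^+ 2)%:E)%E.
  rewrite E2 ?Lnorm_ge0// powR_Lnorm//; apply: eq_integral => x _ /=.
  by rewrite -[X in X = _]/((`|h x| `^ 2)%:E) powR_mulrn// real_normK ?num_real.
have := @hoelder _ _ _ m f g 2 2 mf mg (ltr0Sn _ _) (ltr0Sn _ _).
have -> : (2^-1 + 2^-1 = 1 :> R) by field.
move=> /(_ erefl); rewrite Lnorm1 => H.
apply: le_trans (lee_pmul _ _ H H) _; [exact: integral_ge0..|].
by rewrite muleACA !N2.
Qed.

Definition sq_int (f : T -> R) : \bar R := (\int[m]_x (f x ^+ 2)%:E)%E.

Definition is_L2 (f : T -> R) := measurable_fun setT f /\ (sq_int f < +oo)%E.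

Lemma sq_int_ge0 f : (0 <= sq_int f)%E.
Proof. by apply: integral_ge0 => x _; rewrite lee_fin sqr_ge0. Qed.

Lemma is_L2_sq_integrable f : is_L2 f -> m.-integrable setT (fun x => (f x ^+ 2)%:E).
Proof.
move=> [mf f2]; apply/integrableP; split; first by apply/measurable_EFinP; exact: measurable_funX.
by under eq_integral do rewrite gee0_abs ?lee_fin ?sqr_ge0//.
Qed.

Lemma is_L2_mul_integrable f g : is_L2 f -> is_L2 g -> m.-integrable setT (fun x => (f x * g x)%:E).
Proof.
move=> hf hg; have h := integrableD measurableT (is_L2_sq_integrable hf) (is_L2_sq_integrable hg).
apply: le_integrable h => //.
  by apply/measurable_EFinP; apply: measurable_funM; [exact: hf.1|exact: hg.1].
move=> x _; rewrite -EFinD !abse_EFin lee_fin [leRHS]ger0_norm ?addr_ge0 ?sqr_ge0//.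
rewrite ler_norml.
have := sqr_ge0 (f x - g x); have := sqr_ge0 (f x + g x).
have := sqr_ge0 (f x); have := sqr_ge0 (g x).
rewrite sqrrB sqrrD -mulr_natr; set a := f x; set b := g x.
by move=> *; apply/andP; split; lra.
Qed.

Lemma sq_int_scale f (a : R) : measurable_fun setT f ->
  sq_int (fun x => a * f x) = ((a ^+ 2)%:E * sq_int f)%E.
Proof.
move=> mf; rewrite /sq_int -ge0_integralZl//.
- by apply: eq_integral => x _; rewrite exprMn EFinM.
- by apply/measurable_EFinP; exact: measurable_funX.
- by move=> x _; rewrite lee_fin sqr_ge0.
- by rewrite lee_fin sqr_ge0.
Qed.

Lemma is_L2_scale f (a : R) : is_L2 f -> is_L2 (fun x => a * f x).
Proof.
move=> [mf f2]; split; first exact: measurable_funM.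
by rewrite sq_int_scale// lte_mul_pinfty// ?lee_fin ?sqr_ge0.
Qed.

Lemma parallelogram f g : measurable_fun setT f -> measurable_fun setT g ->
  (sq_int (fun x => f x + g x)%R + sq_int (fun x => f x - g x)%R =
   2%:E * sq_int f + 2%:E * sq_int g)%E.
Proof.
move=> mf mg.
have m2 (h : T -> R) : measurable_fun setT h -> measurable_fun setT (fun x => (h x ^+ 2)%:E).
  by move=> mh; apply/measurable_EFinP; exact: measurable_funX.
have p2 (h : T -> R) x : (setT x -> 0 <= (h x ^+ 2)%:E)%E by rewrite lee_fin sqr_ge0.
have mD := m2 _ (measurable_funD mf mg); have mB := m2 _ (measurable_funB mf mg).
transitivity (\int[m]_x (((f x + g x) ^+ 2)%:E + ((f x - g x) ^+ 2)%:E))%E.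
  by rewrite ge0_integralD// => x _; rewrite lee_fin sqr_ge0.
transitivity (\int[m]_x (2%:E * (f x ^+ 2)%:E + 2%:E * (g x ^+ 2)%:E))%E.
  apply: eq_integral => x _.
  rewrite [RHS](_ : _ = (2 * f x ^+ 2 + 2 * g x ^+ 2)%:E)//.
  by rewrite -EFinD; congr EFin; ring.
rewrite ge0_integralD//.
- by rewrite !ge0_integralZl//; first [exact: m2 | by move=> x _; rewrite lee_fin sqr_ge0].
- by move=> x _; rewrite mule_ge0 ?lee_fin ?sqr_ge0.
- exact/measurable_funeM/m2.
- by move=> x _; rewrite mule_ge0 ?lee_fin ?sqr_ge0.
- exact/measurable_funeM/m2.
Qed.

Lemma sq_intD_le f g : measurable_fun setT f -> measurable_fun setT g ->
  (sq_int (fun x => f x + g x)%R <= 2%:E * sq_int f + 2%:E * sq_int g)%E.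
Proof.
by move=> mf mg; rewrite -parallelogram//; apply: leeDl; exact: sq_int_ge0.
Qed.

Lemma sq_intB_le f g : measurable_fun setT f -> measurable_fun setT g ->
  (sq_int (fun x => f x - g x)%R <= 2%:E * sq_int f + 2%:E * sq_int g)%E.
Proof.
by move=> mf mg; rewrite -parallelogram//; apply: leeDr; exact: sq_int_ge0.
Qed.

Lemma is_L2D f g : is_L2 f -> is_L2 g -> is_L2 (fun x => f x + g x).
Proof.
move=> [mf f2] [mg g2]; split; first exact: measurable_funD.
apply: le_lt_trans (sq_intD_le mf mg) _.
by apply: lte_add_pinfty; apply: lte_mul_pinfty.
Qed.

Lemma is_L2B f g : is_L2 f -> is_L2 g -> is_L2 (fun x => f x - g x).
Proof.
move=> [mf f2] [mg g2]; split; first exact: measurable_funB.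
apply: le_lt_trans (sq_intB_le mf mg) _.
by apply: lte_add_pinfty; apply: lte_mul_pinfty.
Qed.

Lemma sq_int_fin f : is_L2 f -> sq_int f = (fine (sq_int f))%:E.
Proof. by move=> [_ f2]; rewrite fineK// ge0_fin_numE// sq_int_ge0. Qed.

Lemma Cauchy_Schwarz f g : is_L2 f -> is_L2 g ->
  (\int[m]_x (f x * g x)) ^+ 2 <= fine (sq_int f) * fine (sq_int g).
Proof.
move=> hf hg.
have H := ge0_Cauchy_Schwarz hf.1 hg.1.
have ifg := is_L2_mul_integrable hf hg.
have IJ : (\int[m]_x (f x * g x)) ^+ 2 <= (\int[m]_x `|f x * g x|) ^+ 2.
  have := le_normr_Rintegral measurableT ifg; rewrite ler_norml => /andP[I1 I2].
  by rewrite -subr_ge0 subr_sqr mulr_ge0 ?subr_ge0// addrC -lerBlDr sub0r.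
apply: le_trans IJ _.
rewrite -lee_fin [leRHS]EFinM -(sq_int_fin hf) -(sq_int_fin hg) expr2 EFinM.
have J : (\int[m]_x `|(f x * g x)|)%:E = (\int[m]_x `|f x * g x|%:E)%E.
  rewrite /Rintegral fineK//; apply: integrable_fin_num => //.
  exact: (integrable_norm ifg).
by rewrite J.
Qed.

(* The identity (a - b)^2 + (a + b)^2 = 2 a^2 + 2 b^2 turns Fatou's lemma for (f_k + f)^2
   into an upper bound for the integral of (f_k - f)^2. *)
Lemma L2_cvg_of_pointwise (f_ : nat -> T -> R) (f : T -> R) :
  (forall k, measurable_fun setT (f_ k)) -> is_L2 f ->
  (forall x, f_ k x @[k --> \oo] --> f x) ->
  (forall k, (sq_int (f_ k) <= sq_int f)%E) ->
  forall e : R, 0 < e -> exists k, (sq_int (fun x => f_ k x - f x)%R < e%:E)%E.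
Proof.
move=> mf hf ff fle e e0; apply: contrapT => /forallNP H.
have F := sq_int_fin hf; set A := fine (sq_int f) in F.
have H1 k : (sq_int (fun x => f_ k x + f x)%R <= (4 * A - e)%:E)%E.
  have := parallelogram (mf k) hf.1.
  have fkoo : is_L2 (f_ k) by split=> //; apply: le_lt_trans (fle k) _; exact: hf.2.
  have hD := is_L2D fkoo hf; have hB := is_L2B fkoo hf.
  have /negP := H k; rewrite -leNgt.
  have := fle k.
  rewrite (sq_int_fin fkoo) F (sq_int_fin hD) (sq_int_fin hB) !lee_fin.
  rewrite -!EFinM -!EFinD => a1 a2 [] a3; rewrite ?lee_fin.
  move: a1 a2 a3; move: (fine _) (fine _) (fine _) => p q r; move: A {F} => A; lra.
have := @fatou_le (fun k x => (f_ k x + f x) ^+ 2) (fun x => (f x + f x) ^+ 2) _ _ _ _ H1.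
have -> : (\int[m]_x ((f x + f x) ^+ 2)%:E = (4 * A)%:E)%E.
  rewrite EFinM -F; have <- : (2 ^+ 2 = 4 :> R) by ring.
  rewrite -sq_int_scale//; last exact: hf.1.
  by apply: eq_integral => x _; congr (_ ^+ _)%:E; ring.
rewrite lee_fin => /(_ _ _ _)/wrap[]; last by apply/negP; rewrite -ltNge; lra.
- by move=> k; apply/measurable_funX/measurable_funD => //; exact: hf.1.
- by move=> k x; rewrite sqr_ge0.
- move=> x; rewrite expr2; under eq_fun do rewrite expr2.
  by apply: cvgM; apply: cvgD => //; exact: cvg_cst.
Qed.

End square_integrable.

Lemma is_derive_under_integral (R : realType) d (T : measurableType d)
    (m : {measure set T -> \bar R}) (f f' : R -> T -> R) (a u v : R) (G : T -> R) :
  a \in `]u, v[ ->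
  (forall t, t \in `]u, v[ -> m.-integrable setT (EFin \o f t)) ->
  (forall t, t \in `]u, v[ -> forall y, is_derive t 1 (fun t => f t y) (f' t y)) ->
  m.-integrable setT (EFin \o G) ->
  (forall t, t \in `]u, v[ -> forall y, `|f' t y| <= G y) ->
  is_derive a 1 (fun t => \int[m]_y f t y) (\int[m]_y f' a y).
Proof.
move=> auv fint fder Gint fG.
have d1E t y : t \in `]u, v[ -> partial1of2 f t y = f' t y.
  by move=> tuv; rewrite partial1of2E; have [_ ->] := fder t tuv y.
have G0 y : 0 <= G y by apply: le_trans (fG a auv y).
have H := @differentiation_under_integral R d T m f setT measurableT a u v.
have K := @derivable_under_integral R d T m f setT measurableT a u v.
have fd t y : t \in `]u, v[ -> setT y -> derivable (f ^~ y) t 1.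
  by move=> tuv _; have [] := fder t tuv y.
have fb t y : t \in `]u, v[ -> setT y -> `|partial1of2 f t y| <= G y.
  by move=> tuv _; rewrite d1E// fG.
apply: DeriveDef; first exact: (K _ _ _ G).
rewrite -derive1E (H auv fint fd G G0 Gint fb).
by apply: eq_Rintegral => y _; rewrite d1E.
Qed.

(** * Open sets and continuous functions are measurable for the coordinate sigma-algebra *)

Section borel.
Variable R : realType.

(** When [I] is countable this writes an open set as a countable union of balls with centres [p i]
    and radii $1/(k+1)$; with rational centres it reduces measurability of open sets to that of
    balls. *)
Lemma open_bigcup_ball (T : pseudoMetricType R) (I : Type) (p : I -> T) :
  (forall x (e : R), 0 < e -> exists i, ball x e (p i)) -> forall U, open U ->
  U = \bigcup_(k in [set k : I * nat | ball (p k.1) (k.2.+1%:R^-1 : R) `<=` U])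
        ball (p k.1) (k.2.+1%:R^-1 : R).
Proof.
move=> dense U oU; apply/seteqP; split => [x Ux|x [k kU]]; last exact: kU.
have /nbhs_ballP[e /= e0 xeU] : nbhs x U by apply: open_nbhs_nbhs.
have [N Ne] : exists N : nat, (N.+1%:R^-1 : R) < e / 2.
  have e20 : 0 < e / 2 by rewrite divr_gt0.
  have [N _ H] := near_infty_natSinv_lt (PosNum e20); exists N; exact: (H N (leqnn _)).
have N0 : 0 < (N.+1%:R^-1 : R) by rewrite invr_gt0.
have [i xi] := dense x _ N0.
exists (i, N) => /=; last exact: ball_sym.
move=> y iy; apply: xeU.
apply: (@le_ball _ _ _ (N.+1%:R^-1 + N.+1%:R^-1)); first by move: Ne; move: (N.+1%:R^-1 : R) => c; lra.
exact: (ball_triangle xi iy).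
Qed.

Lemma rV_rat_dense n (x : 'rV[R]_n) (e : R) : 0 < e ->
  exists q : 'rV[rat]_n, ball x e (map_mx (@ratr R) q).
Proof.
move=> e0.
have /choice[q Hq] : forall i : 'I_n, exists q : rat, ratr q \in `](x ord0 i - e), (x ord0 i + e)[.
  by move=> i; apply: rat_in_itvoo; lra.
exists (\row_i q i); split=> // i j; rewrite !mxE /ball/= (ord1 i).
by have := Hq j; rewrite in_itv/= => /andP[? ?]; rewrite ltr_norml; apply/andP; split; lra.
Qed.

Lemma measurable_ball_rV n (x : 'rV[R]_n) (e : R) : measurable (ball x e).
Proof.
have [e0|e0] := ltP 0 e; last first.
  rewrite (_ : ball x e = set0)//; apply/seteqP; split=> // y [e0'].
  by move: e0; rewrite leNgt e0'.
rewrite (_ : ball x e = \bigcap_(i in [set: 'I_n])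
      ((fun x : 'rV[R]_n => x ord0 i) @^-1` ball (x ord0 i) e)).
  apply: fin_bigcap_measurable => // i _.
  rewrite -[X in measurable X]setTI.
  by apply: measurable_rV_coord => //; exact: measurable_ball.
apply/seteqP; split => [y [_ xy] i _ /=|y xy]; first exact: xy.
by split=> // i j; rewrite (ord1 i); exact: (xy j I).
Qed.

Lemma open_measurable_rV n (U : set 'rV[R]_n) : open U -> measurable U.
Proof.
move=> oU; rewrite (open_bigcup_ball (@rV_rat_dense n) oU).
rewrite bigcup_mkcond; apply: countable_bigcupT_measurable => [|k]; first exact: countableP.
by case: ifP => // _; exact: measurable_ball_rV.
Qed.

Lemma open_measurable_rV2 n m (U : set ('rV[R]_n * 'rV[R]_m)) : open U -> measurable U.
Proof.
pose p (q : 'rV[rat]_n * 'rV[rat]_m) := (map_mx (@ratr R) q.1, map_mx (@ratr R) q.2).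
have dense (x : 'rV[R]_n * 'rV[R]_m) (e : R) : 0 < e -> exists i, ball x e (p i).
  move=> e0; have [q1 h1] := rV_rat_dense x.1 e0; have [q2 h2] := rV_rat_dense x.2 e0.
  by exists (q1, q2).
move=> oU; rewrite (open_bigcup_ball dense oU).
rewrite bigcup_mkcond; apply: countable_bigcupT_measurable => [|k]; first exact: countableP.
by case: ifP => // _; apply: measurableX; exact: measurable_ball_rV.
Qed.

Lemma continuous_measurable_rV n (f : 'rV[R]_n -> R) : continuous f -> measurable_fun setT f.
Proof.
move=> cf; apply: (measurability _ (RGenOInfty.measurableE R)).
move=> /= _ [_ [a ->]] <-; rewrite setTI; apply: open_measurable_rV.
by apply: open_comp => // x _; exact: cf.
Qed.

Lemma continuous_measurable_rV2 n m (D : set ('rV[R]_n * 'rV[R]_m)) (f : 'rV[R]_n * 'rV[R]_m -> R) :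
  open D -> {in D, continuous f} -> measurable_fun D f.
Proof.
move=> oD cf; apply: (measurability _ (RGenOInfty.measurableE R)).
move=> /= _ [_ [a ->]] <-; apply: open_measurable_rV2.
rewrite openE => x [Dx fx]; apply: filterI; first exact: open_nbhs_nbhs.
apply: cf; first by rewrite inE.
by apply: open_nbhs_nbhs; split => //; exact: interval_open.
Qed.

End borel.

Section Young.
Variables (R : realType) (n : nat).
Local Notation mu := (lebesgue_rV R n).
Local Open Scope ereal_scope.

Lemma measurable_rV_diff (f : 'rV[R]_n -> R) : measurable_fun setT f ->
  measurable_fun setT (fun p : 'rV[R]_n * 'rV[R]_n => f (p.1 - p.2)%R).
Proof.
move=> mf; apply: (measurableT_comp mf).
by apply: measurable_rV_sub; [exact: measurable_fst|exact: measurable_snd].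
Qed.

(** Writing $|k|=\sqrt{|k|}\sqrt{|k|}$, Cauchy-Schwarz gives $(|f|\ast|k|)^2\le\|k\|_1\,(|k|\ast
    f^2)$ pointwise; Tonelli and translation invariance integrate the right-hand side to
    $\|k\|_1^2\|f\|_2^2$. *)
Lemma Young (f k : 'rV[R]_n -> R) : measurable_fun setT f -> measurable_fun setT k ->
  \int[mu]_x ((\int[mu]_t `|f t * k (x - t)|%:E) * (\int[mu]_t `|f t * k (x - t)|%:E)) <=
  ((\int[mu]_t `|k t|%:E) * (\int[mu]_t `|k t|%:E)) * sq_int mu f.
Proof.
move=> mf mk; set K := \int[mu]_t `|k t|%:E.
have K0 : 0 <= K by apply: integral_ge0 => x _; rewrite lee_fin.
have mkx : measurable_fun setT (fun p : 'rV[R]_n * 'rV[R]_n => `|k (p.1 - p.2)%R|%R).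
  exact: measurableT_comp (measurable_rV_diff mk).
have mf2 : measurable_fun setT (fun p : 'rV[R]_n * 'rV[R]_n => (f p.2 ^+ 2)%R).
  by apply: measurable_funX; apply: (measurableT_comp mf); exact: measurable_snd.
pose H (p : 'rV[R]_n * 'rV[R]_n) := (`|k (p.1 - p.2)%R| * f p.2 ^+ 2)%:E.
have mH : measurable_fun setT H by apply/measurable_EFinP; exact: measurable_funM.
have H0 p : 0 <= H p by rewrite lee_fin mulr_ge0 ?sqr_ge0.
have step x : (\int[mu]_t `|f t * k (x - t)|%:E) * (\int[mu]_t `|f t * k (x - t)|%:E) <=
    K * \int[mu]_t H (x, t).
  have mkt : measurable_fun setT (fun t : 'rV[R]_n => k (x - t)%R).
    apply: (measurableT_comp mk); apply: measurable_rV_sub => //; exact: measurable_cst.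
  have ms : measurable_fun setT (fun t : 'rV[R]_n => Num.sqrt `|k (x - t)%R|).
    have msq : measurable_fun setT (@Num.sqrt R).
      by apply: continuous_measurable_fun => y; exact: sqrt_continuous.
    apply: (measurableT_comp msq); exact: measurableT_comp.
  have := @ge0_Cauchy_Schwarz _ _ _ mu (fun t => Num.sqrt `|k (x - t)%R|)
     (fun t => Num.sqrt `|k (x - t)%R| * f t)%R ms (measurable_funM ms mf).
  have -> : \int[mu]_t `|Num.sqrt `|k (x - t)| * (Num.sqrt `|k (x - t)| * f t)|%:E =
     \int[mu]_t `|f t * k (x - t)|%:E.
    apply: eq_integral => t _; congr EFin.
    by rewrite mulrA -expr2 sqr_sqrtr// !normrM normr_id mulrC.
  move=> /le_trans; apply; apply: lee_pmul.
  - by apply: integral_ge0 => t _; rewrite lee_fin sqr_ge0.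
  - by apply: integral_ge0 => t _; rewrite lee_fin sqr_ge0.
  - rewrite /K -(@ge0_integral_rV_reflect _ _ x (fun t => `|k t|%:E))//.
      by under eq_integral do rewrite sqr_sqrtr//.
    by apply/measurable_EFinP; exact: measurableT_comp.
  - rewrite le_eqVlt; apply/orP; left; apply/eqP; apply: eq_integral => t _; congr EFin.
    by rewrite exprMn sqr_sqrtr.
have mHx : measurable_fun setT (fun x => \int[mu]_t H (x, t)).
  exact: (@measurable_fun_fubini_tonelli_F _ _ _ _ _ mu H).
have mfk : measurable_fun setT (fun p : 'rV[R]_n * 'rV[R]_n => `|f p.2 * k (p.1 - p.2)%R|%:E).
  apply/measurable_EFinP; apply: measurableT_comp => //; apply: measurable_funM.
    by apply: (measurableT_comp mf); exact: measurable_snd.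
  exact: measurable_rV_diff.
have mL : measurable_fun setT (fun x : 'rV[R]_n => \int[mu]_t `|f t * k (x - t)|%:E).
  exact: (@measurable_fun_fubini_tonelli_F _ _ _ _ _ mu (fun p : 'rV[R]_n * 'rV[R]_n => `|f p.2 * k (p.1 - p.2)%R|%:E)).
apply: (@le_trans _ _ (\int[mu]_x (K * \int[mu]_t H (x, t)))).
  apply: ge0_le_integral => //.
  - by move=> x _; rewrite mule_ge0//; apply: integral_ge0 => t _; rewrite lee_fin.
  - exact: emeasurable_funM.
  - exact: measurable_funeM.
rewrite ge0_integralZl//; last by move=> x _; apply: integral_ge0.
rewrite -muleA; apply: lee_wpmul2l => //.
rewrite (@fubini_tonelli _ _ _ _ _ mu mu H)//.
rewrite le_eqVlt; apply/orP; left; apply/eqP.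
transitivity (\int[mu]_t (K * (f t ^+ 2)%:E)); last first.
  rewrite ge0_integralZl//; first by apply/measurable_EFinP; exact: measurable_funX.
  by move=> x _; rewrite lee_fin sqr_ge0.
apply: eq_integral => t _; rewrite /H/=.
under eq_integral do rewrite EFinM.
rewrite ge0_integralZr//.
- congr (_ * _); rewrite /K -(@ge0_integral_rV_shift _ _ (- t)%R (fun t => `|k t|%:E))//.
  by apply/measurable_EFinP; exact: measurableT_comp.
- apply/measurable_EFinP; apply: measurableT_comp => //; apply: (measurableT_comp mk).
  by apply: measurable_rV_sub => //; exact: measurable_cst.
- by rewrite lee_fin sqr_ge0.
Qed.

End Young.

(** * Convexity in the variable $r^s$ *)

Section Bessel_operator.
Variables (R : realType) (s : R).
Hypothesis s0 : 0 < s.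

Lemma is_derive_within_continuous (f df : R -> R) (a b : R) :
  (forall x, x \in `[a, b] -> is_derive x 1 f (df x)) -> {within `[a, b], continuous f}.
Proof. by move=> fdf; apply: derivable_within_continuous => x /fdf[]. Qed.

Lemma is_derive_le (f df : R -> R) (a b : R) : a <= b ->
  (forall x, x \in `[a, b] -> is_derive x 1 f (df x)) ->
  (forall x, x \in `[a, b] -> 0 <= df x) -> f a <= f b.
Proof.
move=> ab fdf df0.
have [c cab e] := MVT_segment ab (fun x xab => fdf x (subset_itv_oo_cc xab)) (is_derive_within_continuous fdf).
by rewrite -subr_ge0 e mulr_ge0 ?subr_ge0// df0.
Qed.

(* In the variable t = r^s the operator g'' + (1 - s)/r g' is a positive multiple of the
   second derivative, so its sign controls convexity. *)
Lemma Bessel_convex (g g1 g2 : R -> R) (a b c : R) : 0 < a -> a < b -> b < c ->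
  (forall r, r \in `[a, c] -> is_derive r 1 g (g1 r)) ->
  (forall r, r \in `[a, c] -> is_derive r 1 g1 (g2 r)) ->
  (forall r, r \in `[a, c] -> 0 <= g2 r + (1 - s) / r * g1 r) ->
  (g b - g a) * (c `^ s - b `^ s) <= (g c - g b) * (b `^ s - a `^ s).
Proof.
move=> a0 ab bc dg dg1 Lg.
have gt0 x : x \in `[a, c] -> 0 < x.
  by rewrite in_itv/= => /andP[ax _]; exact: lt_le_trans ax.
have dp x : x \in `[a, c] -> is_derive x 1 (fun x => x `^ s) (s * x `^ (s - 1)).
  by move=> /gt0 x0; exact: is_derive1_powR.
(* [q r / s] is the derivative of [g] with respect to $r^s$, and $q'=r^{1-s}(g''+\frac{1-s}{r}g')$,
   so the hypothesis makes [q] nondecreasing. *)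
pose q r := r `^ (1 - s) * g1 r.
have g1q x : x \in `[a, c] -> g1 x / (s * x `^ (s - 1)) = q x / s.
  move=> /gt0 x0; rewrite /q -opprB powRN invfM.
  by field; rewrite !gt_eqF// powR_gt0.
(* Cauchy's mean value theorem for [g] against $r^s$ turns each chord slope into a value of [q / s];
   the two chords are then compared by monotonicity of [q]. *)
have key x y : a <= x -> x < y -> y <= c ->
    exists2 r, r \in `]x, y[ & g y - g x = (y `^ s - x `^ s) * (q r / s).
  move=> ax xy yc.
  have sub : forall r, r \in `[x, y] -> r \in `[a, c].
    by move=> r; rewrite !in_itv/= => /andP[? ?]; apply/andP; split; [exact: le_trans ax _|exact: le_trans yc].
  have sub' r (h : r \in `]x, y[) := sub r (subset_itv_oo_cc h).
  have [r rxy e] := @cauchy_MVT _ g g1 (fun x => x `^ s) (fun x => s * x `^ (s - 1)) x y xy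
     (is_derive_within_continuous (fun r h => dg r (sub r h)))
     (is_derive_within_continuous (fun r h => dp r (sub r h)))
     (fun r h => dg r (sub' r h)) (fun r h => dp r (sub' r h))
     (fun r h => lt0r_neq0 (mulr_gt0 s0 (powR_gt0 _ (gt0 _ (sub' r h))))).
  exists r => //; rewrite g1q in e; last exact: sub'.
  rewrite e mulrC divfK// subr_eq0 gt_eqF// gt0_ltr_powR// ?nnegrE//.
    by apply: ltW; apply: lt_le_trans ax.
  by apply: ltW; apply: lt_le_trans a0 (le_trans ax (ltW xy)).
have [r1 r1ab ->] := key a b (lexx _) ab (ltW bc).
have [r2 r2bc ->] := key b c (ltW ab) bc (lexx _).
move: r1ab r2bc; rewrite !in_itv/= => /andP[ar1 r1b] /andP[br2 r2c].
have qq : q r1 <= q r2.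
  have sub x : x \in `[r1, r2] -> x \in `[a, c].
    rewrite !in_itv/= => /andP[x1 x2].
    by apply/andP; split; [exact: le_trans (ltW ar1) x1|exact: le_trans x2 (ltW r2c)].
  have D x : x \in `[r1, r2] -> is_derive x 1 q (x `^ (1 - s) * (g2 x + (1 - s) / x * g1 x)).
    move=> /sub xac; have x0 := gt0 _ xac.
    have h1 := is_derive1_powR (1 - s) x0.
    apply: is_derive_eq (is_deriveM h1 (dg1 x xac)) _.
    rewrite /GRing.scale/=.
    have -> : x `^ (1 - s - 1) = x `^ (1 - s) / x.
      by rewrite powRB ?powRr1 ?ltW// (gt_eqF x0) implybT.
    ring.
  have N x : x \in `[r1, r2] -> 0 <= x `^ (1 - s) * (g2 x + (1 - s) / x * g1 x).
    by move=> /sub xac; rewrite mulr_ge0 ?powR_ge0// Lg.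
  exact: (is_derive_le (ltW (lt_trans r1b br2)) D N).
have A0 : 0 <= b `^ s - a `^ s.
  by rewrite subr_ge0 ge0_ler_powR// ?nnegrE ?ltW// (lt_trans a0 ab).
have B0 : 0 <= c `^ s - b `^ s.
  rewrite subr_ge0 ge0_ler_powR// ?nnegrE ?ltW// ?(lt_trans a0 ab)//.
  exact: lt_trans (lt_trans a0 ab) bc.
rewrite -subr_ge0.
move: (_ - _) (_ - _) A0 B0 => A B A0 B0.
rewrite (_ : _ - _ = A * B * ((q r2 - q r1) / s)); last by field; rewrite gt_eqF.
by rewrite !mulr_ge0// ?subr_ge0// invr_ge0 ltW.
Qed.

End Bessel_operator.

(** * Energy estimates for the extension problem *)

Section derivative_lemmas.
Variable R : realType.

Lemma is_derive_seq (f : R -> R) (x df : R) : is_derive x 1 f df ->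
  k.+1%:R * (f (k.+1%:R^-1 + x) - f x) @[k --> \oo] --> df.
Proof.
move=> [dfx <-]; have /cvg_ex[l /= hl] := dfx.
have -> : 'D_1 f x = l by apply: cvg_lim.
move/cvgr_dnbhsP : hl => /(_ (fun k : nat => k.+1%:R^-1)) H.
have {}H := H (conj (fun k => _) _).
under eq_fun => k do rewrite -[X in X * _]invrK -[X in _ * (f (X + _) - _)]mulr1.
apply: H.
  by move=> k; rewrite invr_eq0 pnatr_eq0.
exact: cvg_harmonic.
Qed.

Lemma is_derive_unique (f : R -> R) (x a b : R) :
  is_derive x 1 f a -> is_derive x 1 f b -> a = b.
Proof. by move=> [_ <-] [_ <-]. Qed.

(** The derivative is the pointwise limit of the difference quotients with steps $1/(k+N+1)$, where
    [N] is so large that [x] plus a step stays below [v]. *)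
Lemma measurable_is_derive d (T : measurableType d) (f : R -> T -> R) (x : R) (df : T -> R) (u v : R) :
  x \in `]u, v[ ->
  (forall y, y \in `]u, v[ -> measurable_fun setT (f y)) ->
  (forall t, is_derive x 1 (fun y => f y t) (df t)) -> measurable_fun setT df.
Proof.
rewrite in_itv/= => /andP[ux xv] mf fdf.
have [N HN] : exists N : nat, forall k, (N <= k)%N -> (k.+1%:R^-1 : R) < v - x.
  have vx : 0 < v - x by rewrite subr_gt0.
  have [N _ H] := near_infty_natSinv_lt (PosNum vx); exists N => k Nk; exact: (H k Nk).
apply: (@measurable_fun_cvg _ _ _ _ (fun (k : nat) t => (k + N).+1%:R * (f ((k + N).+1%:R^-1 + x) t - f x t))).
- move=> k; apply: measurable_funM => //; apply: measurable_funB.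
    apply: mf; rewrite in_itv/=; apply/andP; split.
      by rewrite (lt_le_trans ux)// lerDr.
    by rewrite -ltrBrDr; apply: HN; rewrite leq_addl.
  by apply: mf; rewrite in_itv/= ux.
- move=> t _; have /is_derive_seq := fdf t.
  by rewrite -(cvg_shiftn N).
Qed.

End derivative_lemmas.

(** * Test functions and integration by parts without boundary terms *)

Section test_functions.
Variables (R : realType) (n : nat).
Local Notation mu := (lebesgue_rV R n).
Implicit Types A B : 'rV[R]_n -> R.

Definition box (N : R) : set 'rV[R]_n := [set x | forall i, `|x ord0 i| <= N].

Definition loc_bounded A := measurable_fun setT A /\
  forall N, exists M : R, forall x, box N x -> `|A x| <= M.

Definition bounded_supp B := measurable_fun setT B /\
  exists N M : R, forall x, `|B x| <= M /\ (~ box N x -> B x = 0).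

Lemma box_le N M x : N <= M -> box N x -> box M x.
Proof. by move=> NM bx i; apply: le_trans NM. Qed.

Lemma measurable_box N : measurable (box N).
Proof.
rewrite (_ : box N = \bigcap_(i in [set: 'I_n])
      ((fun x : 'rV[R]_n => x ord0 i) @^-1` `[- N, N]%classic)).
  apply: fin_bigcap_measurable => // i _.
  rewrite -[X in measurable X]setTI.
  by apply: measurable_rV_coord.
apply/seteqP; split => [x bx i _ /=|x bx i]; first by rewrite in_itv/= -ler_norml.
by have := bx i I; rewrite /= in_itv/= -ler_norml.
Qed.

Lemma box_finite N : (mu (box N) < +oo)%E.
Proof.
rewrite (_ : box N = [set x | forall i, `[- N, N]%classic (x ord0 i)]); last first.
  by apply/seteqP; split => x bx i; have := bx i; rewrite /= in_itv/= -ler_norml.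
rewrite (@lebesgue_rV_box _ _ (fun=> `[- N, N]%classic))//.
rewrite ltey_eq prode_fin_num// => i _.
by rewrite lebesgue_measure_itv/=; case: ifP.
Qed.

Lemma integrable_box_cst N (M : R) : mu.-integrable setT (fun x => (M * \1_(box N) x)%:E).
Proof.
apply: (@integrableZl _ _ _ mu _ measurableT M (EFin \o \1_(box N))).
apply/integrableP; split.
  by apply/measurable_EFinP; apply: measurable_indic; exact: measurable_box.
rewrite (eq_integral (fun x => (\1_(box N) x)%:E)); last first.
  by move=> t _; rewrite gee0_abs// lee_fin.
rewrite integral_indic ?setIT//; last exact: measurable_box.
exact: box_finite.
Qed.

Lemma bounded_supp_integrable B : bounded_supp B -> mu.-integrable setT (EFin \o B).
Proof.
move=> [mB [N [M HB]]].
apply: le_integrable (integrable_box_cst N M) => //; first exact/measurable_EFinP.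
move=> x _ /=; rewrite lee_fin indicE.
have [BM B0] := HB x.
have M0 : 0 <= M by apply: le_trans BM.
have [bx|nbx] := pselect (box N x); last by rewrite B0 ?normr0.
by rewrite mem_set// mulr1 (ger0_norm M0).
Qed.

Lemma bounded_supp_mul A B : loc_bounded A -> bounded_supp B -> bounded_supp (fun x => A x * B x).
Proof.
move=> [mA bA] [mB [N [M HB]]]; split; first exact: measurable_funM.
have [K HK] := bA N; exists N, (`|K| * M) => x; have [BM B0] := HB x.
have M0 : 0 <= M by apply: le_trans BM.
split=> [|nx]; last by rewrite B0// mulr0.
have [bx|/B0 ->] := pselect (box N x); last by rewrite mulr0 normr0 mulr_ge0.
by rewrite normrM ler_pM// (le_trans (HK x bx))// ler_norm.
Qed.

Lemma bounded_supp_loc B : bounded_supp B -> loc_bounded B.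
Proof.
move=> [mB [N [M HB]]]; split=> // K; exists M => x _; exact: (HB x).1.
Qed.

Lemma loc_boundedD A B : loc_bounded A -> loc_bounded B -> loc_bounded (fun x => A x + B x).
Proof.
move=> [mA bA] [mB bB]; split; first exact: measurable_funD.
move=> N; have [M1 H1] := bA N; have [M2 H2] := bB N; exists (M1 + M2) => x bx.
by apply: le_trans (ler_normD _ _) _; apply: lerD; [exact: H1|exact: H2].
Qed.

Lemma loc_boundedM A B : loc_bounded A -> loc_bounded B -> loc_bounded (fun x => A x * B x).
Proof.
move=> [mA bA] [mB bB]; split; first exact: measurable_funM.
move=> N; have [M1 H1] := bA N; have [M2 H2] := bB N; exists (M1 * M2) => x bx.
by rewrite normrM ler_pM//; [exact: H1|exact: H2].
Qed.

Lemma loc_bounded_cst (c : R) : loc_bounded (fun=> c).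
Proof. by split; [exact: measurable_cst|move=> N; exists `|c|]. Qed.

Lemma bounded_suppD A B : bounded_supp A -> bounded_supp B -> bounded_supp (fun x => A x + B x).
Proof.
move=> [mA [N1 [M1 H1]]] [mB [N2 [M2 H2]]]; split; first exact: measurable_funD.
exists (Num.max N1 N2), (M1 + M2) => x; have [a1 a2] := H1 x; have [b1 b2] := H2 x.
split; first by apply: le_trans (ler_normD _ _) _; exact: lerD.
move=> nb; rewrite a2 ?b2 ?addr0// => bx; apply: nb; apply: box_le bx;
  by rewrite le_max lexx ?orbT.
Qed.

Lemma bounded_supp_sum (I : Type) (r : seq I) (F : I -> 'rV[R]_n -> R) :
  (forall i, bounded_supp (F i)) -> bounded_supp (fun x => \sum_(i <- r) F i x).
Proof.
move=> bF; elim: r => [|i r IH].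
  under eq_fun do rewrite big_nil; split; first exact: measurable_cst.
  by exists 0, 0 => x; rewrite normr0.
by under eq_fun do rewrite big_cons; exact: bounded_suppD.
Qed.

(** The derivative is required along the whole line through each [x], which is the form needed to
    differentiate $h\mapsto\int B(x+he)\,dx$ under the integral sign. *)
Definition line_derive (e : 'rV[R]_n) A A1 :=
  forall (x : 'rV[R]_n) (t : R), is_derive t (1 : R) (fun h : R => A (x + h *: e)) (A1 (x + t *: e)).

Lemma line_deriveM e A A1 B B1 : line_derive e A A1 -> line_derive e B B1 ->
  line_derive e (fun x => A x * B x) (fun x => A1 x * B x + A x * B1 x).
Proof.
move=> dA dB x t; apply: is_derive_eq (is_deriveM (dA x t) (dB x t)) _.
by rewrite /GRing.scale/= addrC mulrC.
Qed.

Lemma line_deriveD e A A1 B B1 : line_derive e A A1 -> line_derive e B B1 ->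
  line_derive e (fun x => A x + B x) (fun x => A1 x + B1 x).
Proof. by move=> dA dB x t; exact: is_deriveD (dA x t) (dB x t). Qed.

Lemma measurable_line_derive e A A1 : measurable_fun setT A -> line_derive e A A1 ->
  measurable_fun setT A1.
Proof.
move=> mA dA.
apply: (@measurable_is_derive R _ _ (fun (h : R) (x : 'rV[R]_n) => A (x + h *: e)) 0 A1 (-1) 1).
- by rewrite in_itv/= ltrN10 ltr01.
- move=> y _; apply: (measurableT_comp mA).
  by apply: measurable_rV_add => //; exact: measurable_cst.
- by move=> x; have := dA x 0; rewrite scale0r addr0.
Qed.

(** By translation invariance $\int B(x+he)\,dx$ does not depend on $h$; differentiating under the
    integral at $h=0$ gives $\int B_1=0$. *)
Lemma integral_line_derive_eq0 i B B1 : line_derive (delta_mx ord0 i) B B1 ->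
  bounded_supp B -> bounded_supp B1 -> \int[mu]_x B1 x = 0.
Proof.
set e := delta_mx _ _ => dB bB [mB1 [N [M HB1]]].
have iB := bounded_supp_integrable bB.
have shiftE (h : R) : mu.-integrable setT (EFin \o (fun x => B (x + h *: e))) /\
    \int[mu]_x B (x + h *: e) = \int[mu]_x B x.
  have := @integral_rV_affine R n 1 (h *: e) B (oner_neq0 _) iB.
  rewrite normr1 expr1n invr1 mul1r.
  rewrite (_ : (fun x => B (1 *: x + h *: e)) = (fun x => B (x + h *: e)))//.
  by apply/funext => x; rewrite scale1r.
have := @is_derive_under_integral R _ _ mu (fun h x => B (x + h *: e))
  (fun h x => B1 (x + h *: e)) 0 (-1) 1 (fun x => M * \1_(box (N + 1)) x).
move=> /(_ _ _ _ _ _)/wrap[].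
- by rewrite in_itv/= ltrN10 ltr01.
- by move=> t _; exact: (shiftE t).1.
- by move=> t _ y; exact: dB.
- exact: integrable_box_cst.
(* Shifts by less than 1 keep the support of [B1] inside the box of size [N + 1], where the constant
   [M] dominates. *)
- move=> t; rewrite in_itv/= -ltr_norml => t1 y; rewrite indicE.
  have [BM B0] := HB1 (y + t *: e); have M0 : 0 <= M by apply: le_trans BM.
  have [by'|ny] := pselect (box (N + 1) y); first by rewrite mem_set// mulr1.
  rewrite memNset// mulr0 B0 ?normr0// => bx; apply: ny => j.
  have := bx j; rewrite !mxE => bxj.
  have -> : y ord0 j = (y ord0 j + t * e ord0 j) - t * e ord0 j by rewrite addrK.
  apply: le_trans (ler_normB _ _) _; apply: lerD; first by rewrite /e mxE.
  rewrite normrM /e mxE/=; apply: le_trans (ltW t1).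
  by case: (_ == _); rewrite ?normr1 ?mulr1// normr0 mulr0.
have -> : (fun t => \int[mu]_y B (y + t *: e)) = cst (\int[mu]_x B x).
  by apply/funext => t; rewrite (shiftE t).2.
move=> h; have := is_derive_unique h (is_derive_cst _ _ _).
by under eq_Rintegral do rewrite scale0r addr0.
Qed.

Lemma integral_by_parts i A A1 B B1 : line_derive (delta_mx ord0 i) A A1 ->
  line_derive (delta_mx ord0 i) B B1 -> loc_bounded A -> loc_bounded A1 ->
  bounded_supp B -> bounded_supp B1 ->
  \int[mu]_x (A1 x * B x) = - \int[mu]_x (A x * B1 x).
Proof.
move=> dA dB bA bA1 bB bB1.
have b1 := bounded_supp_mul bA1 bB; have b2 := bounded_supp_mul bA bB1.
have := integral_line_derive_eq0 (line_deriveM dA dB) (bounded_supp_mul bA bB) (bounded_suppD b1 b2).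
rewrite RintegralD//; [|exact: bounded_supp_integrable..].
by move=> /eqP; rewrite addr_eq0 => /eqP.
Qed.

Lemma integral_by_parts2 i A A1 A2 B B1 B2 :
  line_derive (delta_mx ord0 i) A A1 -> line_derive (delta_mx ord0 i) A1 A2 ->
  line_derive (delta_mx ord0 i) B B1 -> line_derive (delta_mx ord0 i) B1 B2 ->
  loc_bounded A -> loc_bounded A1 -> loc_bounded A2 ->
  bounded_supp B -> bounded_supp B1 -> bounded_supp B2 ->
  \int[mu]_x (A2 x * B x) = \int[mu]_x (A x * B2 x).
Proof.
move=> dA dA1 dB dB1 bA bA1 bA2 bB bB1 bB2.
by rewrite (integral_by_parts dA1 dB)// (integral_by_parts dA dB1)// opprK.
Qed.

Lemma is_derive_integral_test (q q1 : 'rV[R]_n -> R -> R) B (rho : R) : 0 < rho ->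
  (forall r : R, 0 < r -> forall x, is_derive r (1 : R) (q x) (q1 x r)) ->
  (forall r, 0 < r -> loc_bounded (q ^~ r)) ->
  (forall N a b : R, 0 < a -> exists M : R, forall x r, box N x -> a <= r <= b -> `|q1 x r| <= M) ->
  bounded_supp B ->
  is_derive rho (1 : R) (fun r => \int[mu]_x (q x r * B x)) (\int[mu]_x (q1 x rho * B x)).
Proof.
move=> rho0 dq bq bq1 bB; have [mB [N [M HB]]] := bB.
have [K HK] := bq1 N (rho / 2) (rho * 2) (divr_gt0 rho0 (ltr0Sn _ _)).
have pos r : r \in `]rho / 2, rho * 2[ -> 0 < r.
  by rewrite in_itv/= => /andP[h _]; apply: lt_trans h; rewrite divr_gt0.
apply: (@is_derive_under_integral R _ _ mu (fun r x => q x r * B x) (fun r x => q1 x r * B x)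
  rho (rho / 2) (rho * 2) (fun x => `|K| * M * \1_(box N) x)).
- by rewrite in_itv/=; apply/andP; split; lra.
- by move=> r /pos r0; apply: bounded_supp_integrable; apply: bounded_supp_mul => //; exact: bq.
- move=> r /pos r0 x.
  apply: is_derive_eq (is_deriveM (dq r r0 x) (is_derive_cst (B x) _ _)) _.
  by rewrite /GRing.scale/= mulr0 add0r mulrC.
- exact: integrable_box_cst.
- move=> r; rewrite in_itv/= => /andP[r1 r2] x; rewrite indicE.
  have [BM B0] := HB x; have M0 : 0 <= M by apply: le_trans BM.
  have [bx|nbx] := pselect (box N x); last by rewrite memNset// B0// !mulr0 normr0.
  rewrite mem_set// mulr1 normrM ler_pM// (le_trans _ (ler_norm K))// HK//.
  by rewrite !ltW.
Qed.

End test_functions.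

Section barrier.
Variables (R : realType) (s : R).
Hypothesis s0 : 0 < s.

Local Notation gam := (s / (s + 1)).

Lemma barrier_exponent_gt0 : 0 < s / (s + 1).
Proof. by rewrite divr_gt0// addr_gt0. Qed.

Lemma barrier_exponent_lt : s / (s + 1) < s.
Proof. by rewrite ltr_pdivrMr ?addr_gt0// mulrDr mulr1 ltrDr mulr_gt0. Qed.

Lemma barrier_exponent_lt1 : s / (s + 1) < 1.
Proof. by rewrite ltr_pdivrMr ?addr_gt0// mul1r ltrDl. Qed.

(** The Bessel operator maps $-r^\gamma$ to $\gamma(s-\gamma)r^{\gamma-2}$. Since $\gamma<2$ this is
    smallest at the right end of $(0,c]$, and the constant is the reciprocal of that minimum. *)
Definition barrier_cst (c : R) : R := c `^ (2 - gam) / (gam * (s - gam)).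

Lemma barrier_cst_ge0 c : 0 <= barrier_cst c.
Proof.
rewrite /barrier_cst divr_ge0 ?powR_ge0// mulr_ge0// ?subr_ge0 ltW//.
  exact: barrier_exponent_gt0.
exact: barrier_exponent_lt.
Qed.

(* The function - r^gam, with 0 < gam < min s 1, is a strict subsolution of the
   Bessel operator; adding a multiple of it absorbs the error term E. *)
Lemma Bessel_convex_error (g g1 g2 : R -> R) (a b c E : R) :
  0 < a -> a < b -> b < c -> 0 <= E ->
  (forall r, r \in `[a, c] -> is_derive r 1 g (g1 r)) ->
  (forall r, r \in `[a, c] -> is_derive r 1 g1 (g2 r)) ->
  (forall r, r \in `[a, c] -> - E <= g2 r + (1 - s) / r * g1 r) ->
  (g b - g a - E * barrier_cst c * (b `^ gam - a `^ gam)) * (c `^ s - b `^ s) <=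
  (g c - g b - E * barrier_cst c * (c `^ gam - b `^ gam)) * (b `^ s - a `^ s).
Proof.
move=> a0 ab bc E0 dg dg1 Lg.
have gt0 x : x \in `[a, c] -> 0 < x.
  by rewrite in_itv/= => /andP[ax _]; exact: lt_le_trans ax.
set K := E * barrier_cst c.
pose h r := g r - K * r `^ gam.
pose h1 r := g1 r - K * (gam * r `^ (gam - 1)).
pose h2 r := g2 r - K * (gam * ((gam - 1) * r `^ (gam - 1 - 1))).
have dh r : r \in `[a, c] -> is_derive r 1 h (h1 r).
  move=> rac; have p := is_derive1_powR gam (gt0 _ rac).
  exact: is_deriveB (dg r rac) (is_deriveZ K p).
have dh1 r : r \in `[a, c] -> is_derive r 1 h1 (h2 r).
  move=> rac; have p := is_derive1_powR (gam - 1) (gt0 _ rac).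
  exact: is_deriveB (dg1 r rac) (is_deriveZ K (is_deriveZ gam p)).
have Lh r : r \in `[a, c] -> 0 <= h2 r + (1 - s) / r * h1 r.
  move=> rac; have r0 := gt0 _ rac; have rn0 := lt0r_neq0 r0.
  have e1 : r `^ (gam - 1) = r * r `^ (gam - 2).
    rewrite -{2}(powRr1 (ltW r0)) -powRD ?rn0 ?implybT//; congr (_ `^ _); ring.
  have e2 : gam - 1 - 1 = gam - 2 by ring.
  have -> : h2 r + (1 - s) / r * h1 r = (g2 r + (1 - s) / r * g1 r) +
      K * (gam * (s - gam)) * r `^ (gam - 2).
    rewrite /h2 /h1 e2 e1; clear dh dh1; clearbody K; move: (r `^ (gam - 2)) => p; move: gam => g'; by field.
  have KE : E <= K * (gam * (s - gam)) * r `^ (gam - 2).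
    rewrite /K /barrier_cst.
    have D0 : gam * (s - gam) != 0.
      apply: lt0r_neq0; rewrite mulr_gt0 ?subr_gt0//.
        exact: barrier_exponent_gt0.
      exact: barrier_exponent_lt.
    move: (gam * (s - gam)) D0 => D D0.
    have -> : E * (c `^ (2 - gam) / D) * D * r `^ (gam - 2) = E * (c `^ (2 - gam) * r `^ (gam - 2)).
      by rewrite -!mulrA (mulrA D^-1) mulVf// mul1r.
    have -> : r `^ (gam - 2) = (r `^ (2 - gam))^-1 by rewrite -powRN opprB.
    rewrite ler_peMr//.
    rewrite ler_pdivlMr ?powR_gt0// mul1r.
    apply: ge0_ler_powR; rewrite ?nnegrE ?(ltW r0)//.
    - by have := barrier_exponent_lt1; move: gam => gm ?; lra.
    - exact: ltW (lt_trans a0 (lt_trans ab bc)).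
    - by move: rac; rewrite in_itv/= => /andP[].
  have := Lg r rac; move: KE; lra.
have := Bessel_convex s0 a0 ab bc dh dh1 Lh.
rewrite /h.
rewrite (_ : g b - K * b `^ gam - (g a - K * a `^ gam) = g b - g a - K * (b `^ gam - a `^ gam)); last by ring.
by rewrite (_ : g c - K * c `^ gam - (g b - K * b `^ gam) = g c - g b - K * (c `^ gam - b `^ gam)); last by ring.
Qed.

End barrier.

(** * Explicit polynomial cut-off functions and their second derivatives *)

Section cutoff.
Variable R : realType.

Definition pos_pow (k : nat) (y : R) : R := Num.max y 0 ^+ k.

Lemma is_derive_pos_pow k (y : R) : is_derive y 1 (pos_pow k.+2) (k.+2%:R * pos_pow k.+1 y).
Proof.
have [y0|y0|->] := ltrgt0P y.
- have e : \near y, pos_pow k.+2 y = (@id R ^+ k.+2) y.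
    near=> z; rewrite /pos_pow max_l ?exprfctE//; near: z.
    by apply: filterS (lt_nbhsr y0) => z /ltW.
  have h : is_derive y 1 (@id R ^+ k.+2) (k.+2%:R * pos_pow k.+1 y).
    apply: is_derive_eq (is_deriveX k.+2 (is_derive_id y (1 : R))) _.
    by rewrite /pos_pow max_l ?ltW// /GRing.scale/= mulr1 mulr_natl.
  by apply: near_eq_is_derive h => //; apply: filterS e => z ->.
- have e : \near y, pos_pow k.+2 y = 0.
    near=> z; rewrite /pos_pow max_r ?expr0n//; near: z.
    by apply: filterS (lt_nbhsl y0) => z /ltW.
  have h : is_derive y 1 (cst (0 : R)) (k.+2%:R * pos_pow k.+1 y).
    by apply: is_derive_eq (is_derive_cst _ _ _) _; rewrite /pos_pow max_r ?ltW// expr0n/= mulr0.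
  by apply: near_eq_is_derive h => //; apply: filterS e => z ->.
(* At the corner $y=0$ the slope function $\max(z,0)^{k+1}$ is continuous and vanishes, which is
   Carathéodory's criterion for derivative 0. *)
- rewrite /pos_pow maxxx expr0n/= mulr0.
  apply/is_derive1_caratheodory; exists (fun z => Num.max z 0 ^+ k.+1); split.
  + move=> z; rewrite maxxx [_ ^+ _ in X in _ - X]expr0n/= !subr0.
    have [z0|z0] := leP 0 z; first by rewrite exprSr.
    by rewrite !expr0n/= mul0r.
  + have cm : {for 0, continuous (fun z : R => Num.max z 0)}.
      by apply: (@continuous_max _ _ (id : R -> R^o) (cst (0 : R) : R -> R^o)); [exact: id|exact: cst_continuous].
    exact: (continuous_comp cm (@exprn_continuous _ k.+1 _)).
  + by rewrite maxxx expr0n.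
Unshelve. all: by end_near. Qed.

(** The cube makes the truncated polynomial twice differentiable across $|r|=L$; an explicit formula
    gives the decay $30/L^2$ of the second derivative directly. *)
Definition cutoff1 (L r : R) := pos_pow 3 (1 - (r / L) ^+ 2).
Definition dcutoff1 (L r : R) := - (6 / L ^+ 2) * (r * pos_pow 2 (1 - (r / L) ^+ 2)).
Definition ddcutoff1 (L r : R) := - (6 / L ^+ 2) * (pos_pow 2 (1 - (r / L) ^+ 2)
  - 4 * (r / L) ^+ 2 * pos_pow 1 (1 - (r / L) ^+ 2)).

Let is_derive_arg (L r : R) :
  is_derive r (1 : R) (fun r : R => 1 - (r / L) ^+ 2) (- (2 * r / L ^+ 2)).
Proof.
have h1 := is_deriveZ L^-1 (is_derive_id r (1 : R)).
have h2 := is_deriveB (is_derive_cst (1 : R) r (1 : R)) (is_deriveX 2 h1).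
have -> : (fun r : R => 1 - (r / L) ^+ 2) = cst 1 - (L^-1 \*: id) ^+ 2.
  by apply/funext => x; rewrite !fctE /= /GRing.scale/= (mulrC x).
apply: is_derive_eq h2 _.
rewrite sub0r [2.-1]/= expr1 -[(L^-1 \*: id) r]/(L^-1 * r) /GRing.scale/= mulr1 expr2 invfM.
by congr (- _); ring.
Qed.

Lemma is_derive_cutoff1 (L r : R) : is_derive r (1 : R) (cutoff1 L) (dcutoff1 L r).
Proof.
apply: is_derive_eq (is_derive1_comp (is_derive_pos_pow 1 _) (is_derive_arg L r)) _.
by rewrite /dcutoff1; ring.
Qed.

Lemma is_derive_dcutoff1 (L r : R) : is_derive r (1 : R) (dcutoff1 L) (ddcutoff1 L r).
Proof.
have h := is_derive1_comp (is_derive_pos_pow 0 _) (is_derive_arg L r).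
have h2 := is_deriveZ (- (6 / L ^+ 2)) (is_deriveM (is_derive_id r (1 : R)) h).
apply: is_derive_eq h2 _.
rewrite /ddcutoff1 /GRing.scale/= expr_div_n; ring.
Qed.

Lemma pos_pow_bound k (y : R) : y <= 1 -> 0 <= pos_pow k y <= 1.
Proof.
move=> y1; have m0 : 0 <= Num.max y 0 by rewrite le_max lexx orbT.
by rewrite /pos_pow exprn_ge0//= exprn_ile1// ge_max y1 ler01.
Qed.

Section cutoff1_bounds.
Variables (L : R) (L0 : 0 < L).

Let arg_le1 r : 1 - (r / L) ^+ 2 <= 1.
Proof. by rewrite gerBl sqr_ge0. Qed.

Lemma cutoff1_bound r : 0 <= cutoff1 L r <= 1.
Proof. exact: pos_pow_bound. Qed.

Let arg_out r : L < `|r| -> 1 - (r / L) ^+ 2 <= 0.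
Proof.
move=> Lr; rewrite subr_le0 -real_normK ?num_real// expr_ge1//.
by rewrite normf_div (gtr0_norm L0) ler_pdivlMr// mul1r ltW.
Qed.

Lemma cutoff1_out r : L < `|r| -> cutoff1 L r = 0.
Proof. by move=> /arg_out h; rewrite /cutoff1 /pos_pow max_r// expr0n. Qed.

Lemma dcutoff1_out r : L < `|r| -> dcutoff1 L r = 0.
Proof. by move=> /arg_out h; rewrite /dcutoff1 /pos_pow max_r// expr0n/= !mulr0. Qed.

Lemma ddcutoff1_out r : L < `|r| -> ddcutoff1 L r = 0.
Proof. by move=> /arg_out h; rewrite /ddcutoff1 /pos_pow max_r// !expr0n/= !mulr0 subrr mulr0. Qed.

Lemma dcutoff1_bound r : `|dcutoff1 L r| <= 6 / L.
Proof.
have [Lr|rL] := ltP L `|r|; first by rewrite dcutoff1_out// normr0 divr_ge0// ltW.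
have /andP[p0 p1] := pos_pow_bound 2 (arg_le1 r).
have c0 : 0 <= 6 / L ^+ 2 by rewrite divr_ge0// exprn_ge0// ltW.
rewrite /dcutoff1 normrM normrN (ger0_norm c0).
rewrite (_ : 6 / L = 6 / L ^+ 2 * L); last by field; rewrite gt_eqF.
apply: ler_wpM2l => //.
by rewrite normrM (ger0_norm p0) -[leRHS]mulr1 ler_pM.
Qed.

Lemma ddcutoff1_bound r : `|ddcutoff1 L r| <= 30 / L ^+ 2.
Proof.
have [Lr|rL] := ltP L `|r|; first by rewrite ddcutoff1_out// normr0 divr_ge0// exprn_ge0// ltW.
have /andP[p0 p1] := pos_pow_bound 2 (arg_le1 r).
have /andP[q0 q1] := pos_pow_bound 1 (arg_le1 r).
have c0 : 0 <= 6 / L ^+ 2 by rewrite divr_ge0// exprn_ge0// ltW.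
rewrite /ddcutoff1 normrM normrN (ger0_norm c0).
rewrite (_ : 30 / L ^+ 2 = 6 / L ^+ 2 * 5); last by field; rewrite gt_eqF.
apply: ler_wpM2l => //.
have a1 : 0 <= (r / L) ^+ 2 <= 1.
  rewrite sqr_ge0/= -real_normK ?num_real// exprn_ile1//.
  by rewrite normf_div (gtr0_norm L0) ler_pdivrMr// mul1r.
move: a1 => /andP[a0 a1]; rewrite ler_norml; apply/andP; split.
  have := mulr_ile1 a0 q0 a1 q1.
  by move: p0; move: (r / L ^+ 2) (_ ^+ 2) => *; lra.
have := mulr_ge0 a0 q0.
by move: p1; lra.
Qed.

End cutoff1_bounds.

Variable n : nat.
Local Notation mu := (lebesgue_rV R n).

Definition cutoff (L : R) (x : 'rV[R]_n) := \prod_(j < n) cutoff1 L (x ord0 j).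

(** The common shape of the cut-off and of its first and second derivatives in direction [i]: only
    the factor in coordinate [i] changes. *)
Definition cutoff_with (f : R -> R) (L : R) (i : 'I_n) (x : 'rV[R]_n) :=
  f (x ord0 i) * \prod_(j < n | j != i) cutoff1 L (x ord0 j).

Lemma cutoffE L i : cutoff L = cutoff_with (cutoff1 L) L i.
Proof. by apply/funext => x; rewrite /cutoff (bigD1 i). Qed.

Lemma line_derive_cutoff_with f df L i : (forall r : R, is_derive r (1 : R) f (df r)) ->
  line_derive (delta_mx ord0 i) (cutoff_with f L i) (cutoff_with df L i).
Proof.
move=> dF x t.
have E (h : R) j : (x + h *: delta_mx ord0 i) ord0 j = if j == i then x ord0 i + h else x ord0 j.
  rewrite !mxE/=; case: eqVneq => [->|_]; first by rewrite mulr1.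
  by rewrite mulr0 addr0.
have -> : (fun h : R => cutoff_with f L i (x + h *: delta_mx ord0 i)) =
  (fun h => (\prod_(j < n | j != i) cutoff1 L (x ord0 j)) *: f (x ord0 i + h)).
  apply/funext => h; rewrite /cutoff_with E eqxx mulrC; congr (_ * _).
  by apply: eq_bigr => j ji; rewrite E (negbTE ji).
have h1 : is_derive t (1 : R) (fun h : R => x ord0 i + h) 1.
  have := is_deriveD (is_derive_cst (x ord0 i) t (1 : R)) (is_derive_id t (1 : R)).
  by rewrite add0r.
have h2 := is_derive1_comp (dF _) h1.
apply: is_derive_eq (is_deriveZ _ h2) _.
rewrite /cutoff_with E eqxx mulr1 /GRing.scale/= mulrC; congr (_ * _).
by apply: eq_bigr => j ji; rewrite E (negbTE ji).
Qed.

Lemma prod_cutoff1_bound L (P : pred 'I_n) (x : 'rV[R]_n) : 0 <= \prod_(j < n | P j) cutoff1 L (x ord0 j) <= 1.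
Proof.
apply/andP; split.
  by apply: prodr_ge0 => j _; have /andP[] := cutoff1_bound L (x ord0 j).
by apply: prodr_ile1 => j _; exact: cutoff1_bound.
Qed.

Lemma bounded_supp_cutoff_with (f : R -> R) (L M : R) i : 0 < L -> measurable_fun setT f ->
  (forall r, `|f r| <= M) -> (forall r, L < `|r| -> f r = 0) -> bounded_supp (cutoff_with f L i).
Proof.
move=> L0 mf fM fL.
have mb : measurable_fun setT (cutoff1 L).
  apply: continuous_measurable_fun => r.
  by apply: differentiable_continuous; apply/derivable1_diffP; have [] := is_derive_cutoff1 L r.
split.
  apply: measurable_funM; first exact: (measurableT_comp mf (measurable_rV_coord i)).
  under eq_fun do rewrite -big_filter.
  elim: [seq j <- _ | _] => [|j r IH]; first by under eq_fun do rewrite big_nil; exact: measurable_cst.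
  under eq_fun do rewrite big_cons.
  by apply: measurable_funM => //; exact: (measurableT_comp mb (measurable_rV_coord j)).
exists L, M => x; have /andP[p0 p1] := prod_cutoff1_bound L (fun j => j != i) x; split.
  rewrite /cutoff_with normrM (ger0_norm p0) -[leRHS]mulr1 ler_pM//.
move=> nb; have [j jL] : exists j, L < `|x ord0 j|.
  apply: contrapT => /forallNP H; apply: nb => j.
  by have /negP := H j; rewrite -leNgt.
rewrite /cutoff_with; have [ji|ji] := eqVneq j i; first by rewrite -ji fL// mul0r.
by rewrite (bigD1 j)//= cutoff1_out// mul0r mulr0.
Qed.

End cutoff.

(** * Solutions tested against compactly supported functions *)

Section solutions.
Variables (R : realType) (n : nat) (s : R).
Hypothesis s0 : 0 < s.
Local Notation mu := (lebesgue_rV R n).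
Local Notation E i := (delta_mx ord0 i : 'rV[R]_n).
Implicit Types (w : 'rV[R]_n -> R -> R) (A B G : 'rV[R]_n -> R).

Definition loc_bounded2 w := forall N a b : R, 0 < a ->
  exists M : R, forall x r, box N x -> a <= r <= b -> `|w x r| <= M.

Definition derivatives w (w1 w2 : 'rV[R]_n -> R -> R) (d1 d2 : 'I_n -> 'rV[R]_n -> R -> R) :=
  [/\ forall r, 0 < r -> measurable_fun setT (w ^~ r),
      forall r : R, 0 < r -> forall x, is_derive r (1 : R) (w x) (w1 x r) /\
        is_derive r (1 : R) (w1 x) (w2 x r),
      forall r, 0 < r -> forall i, line_derive (E i) (w ^~ r) (d1 i ^~ r) /\
        line_derive (E i) (d1 i ^~ r) (d2 i ^~ r),
      [/\ loc_bounded2 w, loc_bounded2 w1 & loc_bounded2 w2] &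
      forall i, loc_bounded2 (d1 i) /\ loc_bounded2 (d2 i)].

(* Solutions whose derivatives exist along coordinate lines and are locally bounded; unlike
   joint continuity, this is immediate to check for convolutions. *)
Definition ext_sol w := exists w1 w2 d1 d2, derivatives w w1 w2 d1 d2 /\
  forall r, 0 < r -> forall x, \sum_(i < n) d2 i x r + w2 x r + (1 - s) / r * w1 x r = 0.

Definition is_test G (G1 G2 : 'I_n -> 'rV[R]_n -> R) := bounded_supp G /\
  forall i, [/\ bounded_supp (G1 i), bounded_supp (G2 i),
    line_derive (E i) G (G1 i) & line_derive (E i) (G1 i) (G2 i)].

Lemma loc_bounded2_at w r : 0 < r -> measurable_fun setT (w ^~ r) -> loc_bounded2 w ->
  loc_bounded (w ^~ r).
Proof.
move=> r0 mw bw; split=> // N; have [M HM] := bw N r r r0.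
by exists M => x bx; apply: HM => //; rewrite !lexx.
Qed.

Lemma loc_bounded2D w w' : loc_bounded2 w -> loc_bounded2 w' ->
  loc_bounded2 (fun x r => w x r + w' x r).
Proof.
move=> bw bw' N a b a0; have [M1 H1] := bw N a b a0; have [M2 H2] := bw' N a b a0.
by exists (M1 + M2) => x r bx ab; apply: le_trans (ler_normD _ _) _; rewrite lerD ?H1 ?H2.
Qed.

Lemma loc_bounded2M w w' : loc_bounded2 w -> loc_bounded2 w' ->
  loc_bounded2 (fun x r => w x r * w' x r).
Proof.
move=> bw bw' N a b a0; have [M1 H1] := bw N a b a0; have [M2 H2] := bw' N a b a0.
by exists (M1 * M2) => x r bx ab; rewrite normrM ler_pM// ?H1 ?H2.
Qed.

Lemma measurable_derivatives w w1 w2 d1 d2 : derivatives w w1 w2 d1 d2 ->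
  forall r, 0 < r -> [/\ measurable_fun setT (w1 ^~ r), measurable_fun setT (w2 ^~ r) &
    forall i, measurable_fun setT (d1 i ^~ r) /\ measurable_fun setT (d2 i ^~ r)].
Proof.
move=> [mw dw lw _ _].
have rI (r : R) : 0 < r -> r \in `]r / 2, r * 2[.
  by move=> r0; rewrite in_itv/=; apply/andP; split; lra.
have Ir (r y : R) : 0 < r -> y \in `]r / 2, r * 2[ -> 0 < y.
  by move=> r0; rewrite in_itv/= => /andP[h _]; apply: lt_trans h; rewrite divr_gt0.
have mw1 r : 0 < r -> measurable_fun setT (w1 ^~ r).
  move=> r0; apply: (@measurable_is_derive R _ _ (fun y x => w x y) r _ _ _ (rI r r0)).
    by move=> y /(Ir r y r0); exact: mw.
  by move=> x; exact: (dw r r0 x).1.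
have mw2 r : 0 < r -> measurable_fun setT (w2 ^~ r).
  move=> r0; apply: (@measurable_is_derive R _ _ (fun y x => w1 x y) r _ _ _ (rI r r0)).
    by move=> y /(Ir r y r0); exact: mw1.
  by move=> x; exact: (dw r r0 x).2.
move=> r r0; split; [exact: mw1|exact: mw2|move=> i].
have m1 := measurable_line_derive (mw r r0) (lw r r0 i).1.
by split=> //; exact: measurable_line_derive m1 (lw r r0 i).2.
Qed.

Lemma integral_sum_bounded_supp (F : 'I_n -> 'rV[R]_n -> R) : (forall i, bounded_supp (F i)) ->
  \int[mu]_x (\sum_(i < n) F i x) = \sum_(i < n) \int[mu]_x F i x.
Proof.
move=> bF; rewrite /index_enum; elim: (Finite.enum _) => [|i r IH].
  rewrite big_nil; under eq_Rintegral do rewrite big_nil.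
  by rewrite /Rintegral integral0.
rewrite big_cons -IH -RintegralD//; first by apply: eq_Rintegral => x _; rewrite big_cons.
  exact: bounded_supp_integrable.
by apply: bounded_supp_integrable; exact: bounded_supp_sum.
Qed.

(** Pairing with a test function and moving the Laplacian onto it turns the equation into an
    ordinary differential equation for $r\mapsto\int w(x,r)G(x)\,dx$, with Bessel operator on the
    left. Only the values of [w], not its derivatives, remain on the right, so an $L^2$ bound on [w]
    controls the source term. *)
Lemma weak_linear w G (G1 G2 : 'I_n -> 'rV[R]_n -> R) : ext_sol w -> is_test G G1 G2 ->
  exists H1 H2 : R -> R, forall r : R, 0 < r ->
    [/\ is_derive r (1 : R) (fun r => \int[mu]_x (w x r * G x)) (H1 r),
        is_derive r (1 : R) H1 (H2 r) &
        H2 r + (1 - s) / r * H1 r = - \int[mu]_x (w x r * \sum_(i < n) G2 i x)].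
Proof.
move=> [w1 [w2 [d1 [d2 [Dw PDE]]]]] [bG tG].
have mD := measurable_derivatives Dw.
have [mw dw lw [bw bw1 bw2] bd] := Dw.
exists (fun r => \int[mu]_x (w1 x r * G x)), (fun r => \int[mu]_x (w2 x r * G x)) => r r0.
have lbw r' : 0 < r' -> loc_bounded (w ^~ r').
  by move=> r0'; apply: loc_bounded2_at => //; exact: mw.
have lbw1 r' : 0 < r' -> loc_bounded (w1 ^~ r').
  by move=> r0'; apply: loc_bounded2_at => //; have [] := mD r' r0'.
have lbw2 r' : 0 < r' -> loc_bounded (w2 ^~ r').
  by move=> r0'; apply: loc_bounded2_at => //; have [] := mD r' r0'.
split.
- by apply: is_derive_integral_test => // r' r0' x; exact: (dw r' r0' x).1.
- by apply: is_derive_integral_test => // r' r0' x; exact: (dw r' r0' x).2.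
have lbd1 i : loc_bounded (d1 i ^~ r).
  by apply: loc_bounded2_at => //; have [_ _ /(_ i)[]] := mD r r0; have [] := bd i.
have lbd2 i : loc_bounded (d2 i ^~ r).
  by apply: loc_bounded2_at => //; have [_ _ /(_ i)[]] := mD r r0; have [] := bd i.
have bs2 : bounded_supp (fun x => w2 x r * G x) by apply: bounded_supp_mul => //; exact: lbw2.
have bs1 : bounded_supp (fun x => w1 x r * G x) by apply: bounded_supp_mul => //; exact: lbw1.
rewrite -RintegralZl//; last exact: bounded_supp_integrable.
rewrite -RintegralD//; last 2 first.
- exact: bounded_supp_integrable.
- apply: bounded_supp_integrable.
  exact: (bounded_supp_mul (@loc_bounded_cst R n ((1 - s) / r)) bs1).
have -> : \int[mu]_x (w x r * \sum_(i < n) G2 i x) = \sum_(i < n) \int[mu]_x (w x r * G2 i x).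
  rewrite -integral_sum_bounded_supp; first by apply: eq_Rintegral => x _; rewrite mulr_sumr.
  by move=> i; apply: bounded_supp_mul; [exact: lbw|have [] := tG i].
have -> : \sum_(i < n) \int[mu]_x (w x r * G2 i x) = \sum_(i < n) \int[mu]_x (d2 i x r * G x).
  apply: eq_bigr => i _; have [h1 h2 h3 h4] := tG i; have [k1 k2] := lw r r0 i.
  by rewrite (integral_by_parts2 k1 k2 h3 h4)//; exact: lbw.
rewrite -integral_sum_bounded_supp; last by move=> i; exact: bounded_supp_mul.
rewrite -[RHS]mulN1r -RintegralZl//; last first.
  by apply: bounded_supp_integrable; apply: bounded_supp_sum => i; exact: bounded_supp_mul.
apply: eq_Rintegral => x _; rewrite -mulr_suml.
by have := PDE r r0 x; move: (\sum_(i < n) _) => S; nra.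
Qed.

(** The square of a solution is a subsolution: applying the operator to $w^2$ leaves $2|\nabla_x
    w|^2+2(\partial_r w)^2\ge0$. Integrating against [G >= 0] keeps the sign, and the Laplacian is
    moved onto [G]. *)
Lemma weak_square w G (G1 G2 : 'I_n -> 'rV[R]_n -> R) : ext_sol w -> is_test G G1 G2 -> (forall x, 0 <= G x) ->
  exists H1 H2 : R -> R, forall r : R, 0 < r ->
    [/\ is_derive r (1 : R) (fun r => \int[mu]_x (w x r ^+ 2 * G x)) (H1 r),
        is_derive r (1 : R) H1 (H2 r) &
        - (\int[mu]_x (w x r ^+ 2 * \sum_(i < n) G2 i x)) <= H2 r + (1 - s) / r * H1 r].
Proof.
move=> [w1 [w2 [d1 [d2 [Dw PDE]]]]] [bG tG] G0.
have mD := measurable_derivatives Dw.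
have [mw dw lw [bw bw1 bw2] bd] := Dw.
pose q1 x r := 2 * (w x r * w1 x r).
pose q2 x r := 2 * (w1 x r * w1 x r + w x r * w2 x r).
exists (fun r => \int[mu]_x (q1 x r * G x)), (fun r => \int[mu]_x (q2 x r * G x)) => r r0.
have lbw r' : 0 < r' -> loc_bounded (w ^~ r').
  by move=> r0'; apply: loc_bounded2_at => //; exact: mw.
have lbw1 r' : 0 < r' -> loc_bounded (w1 ^~ r').
  by move=> r0'; apply: loc_bounded2_at => //; have [] := mD r' r0'.
have lbw2 r' : 0 < r' -> loc_bounded (w2 ^~ r').
  by move=> r0'; apply: loc_bounded2_at => //; have [] := mD r' r0'.
have c2 : loc_bounded2 (fun _ _ => 2) by move=> N a b _; exists 2 => *; rewrite ger0_norm.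
have bq1 : loc_bounded2 q1 by apply: loc_bounded2M => //; exact: loc_bounded2M.
have bq2 : loc_bounded2 q2.
  by apply: loc_bounded2M => //; apply: loc_bounded2D; exact: loc_bounded2M.
have lbq r' : 0 < r' -> loc_bounded (fun x => w x r' ^+ 2).
  by move=> r0'; under eq_fun do rewrite expr2; apply: loc_boundedM; exact: lbw.
have lbq1 r' : 0 < r' -> loc_bounded (q1 ^~ r').
  move=> r0'; apply: loc_boundedM; first exact: loc_bounded_cst.
  by apply: loc_boundedM; [exact: lbw|exact: lbw1].
have lbq2 r' : 0 < r' -> loc_bounded (q2 ^~ r').
  move=> r0'; apply: loc_boundedM; first exact: loc_bounded_cst.
  by apply: loc_boundedD; apply: loc_boundedM; do ?[exact: lbw|exact: lbw1|exact: lbw2].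
split.
- apply: is_derive_integral_test => // r' r0' x.
  have h := (dw r' r0' x).1.
  have -> : (fun r => w x r ^+ 2) = w x * w x by apply/funext => y; rewrite expr2.
  by apply: is_derive_eq (is_deriveM h h) _; rewrite /q1 /GRing.scale/=; ring.
- apply: is_derive_integral_test => // r' r0' x.
  have [h h1] := dw r' r0' x.
  apply: is_derive_eq (is_deriveZ 2 (is_deriveM h h1)) _.
  by rewrite /q2 /GRing.scale/=; ring.
have lbd1 i : loc_bounded (d1 i ^~ r).
  by apply: loc_bounded2_at => //; have [_ _ /(_ i)[]] := mD r r0; have [] := bd i.
have lbd2 i : loc_bounded (d2 i ^~ r).
  by apply: loc_bounded2_at => //; have [_ _ /(_ i)[]] := mD r r0; have [] := bd i.
pose p1 i x := d1 i x r * w x r + w x r * d1 i x r.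
pose p2 i x := (d2 i x r * w x r + d1 i x r * d1 i x r) + (d1 i x r * d1 i x r + w x r * d2 i x r).
have lbp1 i : loc_bounded (p1 i) by apply: loc_boundedD; apply: loc_boundedM => //; exact: lbw.
have lbp2 i : loc_bounded (p2 i).
  by apply: loc_boundedD; apply: loc_boundedD; apply: loc_boundedM => //; exact: lbw.
have bs2 : bounded_supp (fun x => q2 x r * G x) by apply: bounded_supp_mul => //; exact: lbq2.
have bs1 : bounded_supp (fun x => q1 x r * G x) by apply: bounded_supp_mul => //; exact: lbq1.
rewrite -RintegralZl//; last exact: bounded_supp_integrable.
have bs1' := bounded_supp_mul (@loc_bounded_cst R n ((1 - s) / r)) bs1.
rewrite -RintegralD//; last 2 first.
- exact: bounded_supp_integrable.
- exact: bounded_supp_integrable.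
have -> : \int[mu]_x (w x r ^+ 2 * \sum_(i < n) G2 i x) = \sum_(i < n) \int[mu]_x (w x r ^+ 2 * G2 i x).
  rewrite -integral_sum_bounded_supp; first by apply: eq_Rintegral => x _; rewrite mulr_sumr.
  by move=> i; apply: bounded_supp_mul; [exact: lbq|have [] := tG i].
have -> : \sum_(i < n) \int[mu]_x (w x r ^+ 2 * G2 i x) = \sum_(i < n) \int[mu]_x (p2 i x * G x).
  apply: eq_bigr => i _; have [h1 h2 h3 h4] := tG i; have [k1 k2] := lw r r0 i.
  have kk1 : line_derive (E i) (fun x => w x r ^+ 2) (p1 i).
    exact: (line_deriveM k1 k1).
  have kk2 : line_derive (E i) (p1 i) (p2 i).
    exact: (line_deriveD (line_deriveM k2 k1) (line_deriveM k1 k2)).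
  by rewrite (integral_by_parts2 kk1 kk2 h3 h4)//; exact: lbq.
rewrite -integral_sum_bounded_supp; last by move=> i; exact: bounded_supp_mul.
have bsp : bounded_supp (fun x => \sum_(i < n) (p2 i x * G x)).
  by apply: bounded_supp_sum => i; exact: bounded_supp_mul.
rewrite -[leLHS]mulN1r -RintegralZl//; last exact: bounded_supp_integrable.
apply: le_Rintegral => //.
- apply: bounded_supp_integrable.
  exact: (bounded_supp_mul (@loc_bounded_cst R n (-1)) bsp).
- by apply: bounded_supp_integrable; exact: bounded_suppD.
move=> x _; rewrite -mulr_suml mulN1r mulrA -mulrDl -mulNr ler_wpM2r//.
(* $\Delta(w^2)=2w\,\Delta w+2|\nabla w|^2$; the equation then replaces $\Delta w$ by radial
   derivatives, and everything but the squares cancels. *)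
have -> : \sum_(i < n) p2 i x = 2 * w x r * (\sum_(i < n) d2 i x r) + 2 * \sum_(i < n) d1 i x r ^+ 2.
  rewrite !mulr_sumr -big_split/=; apply: eq_bigr => i _; rewrite /p2; ring.
have S0 : 0 <= \sum_(i < n) d1 i x r ^+ 2 by apply: sumr_ge0 => i _; rewrite sqr_ge0.
have := PDE r r0 x; rewrite /q1 /q2; move: S0 (sqr_ge0 (w1 x r)).
move: (\sum_(i < n) d1 i x r ^+ 2) (\sum_(i < n) d2 i x r) => S1 S2 S10 w10 e.
have -> : S2 = - w2 x r - (1 - s) / r * w1 x r by lra.
rewrite -subr_ge0 (_ : _ - _ = 2 * w1 x r ^+ 2 + 2 * S1); last by ring.
by rewrite addr_ge0// mulr_ge0.
Qed.

End solutions.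

Lemma cvg_Rintegral_dominated (R : realType) d (T : measurableType d) (m : {measure set T -> \bar R})
    (f_ : nat -> T -> R) (f g : T -> R) :
  (forall k, measurable_fun setT (f_ k)) -> (forall x, f_ k x @[k --> \oo] --> f x) ->
  m.-integrable setT (EFin \o g) -> (forall k x, `|f_ k x| <= g x) ->
  \int[m]_x f_ k x @[k --> \oo] --> \int[m]_x f x.
Proof.
move=> mf ff ig fg.
have mlim : measurable_fun setT f by apply: (@measurable_fun_cvg _ _ _ _ f_) => // x _; exact: ff.
have [] := @dominated_convergence _ _ _ m _ measurableT (fun k => EFin \o f_ k) (EFin \o f) (EFin \o g).
- by move=> k; exact/measurable_EFinP.
- exact/measurable_EFinP.
- by apply: aeW => x _; apply: cvg_EFin; [exact: nearW|exact: ff].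
- exact: ig.
- by apply: aeW => x k _ /=; rewrite lee_fin.
move=> intf _ H; rewrite /Rintegral; apply: fine_cvg.
by rewrite fineK//; exact: integrable_fin_num.
Qed.

Lemma cvgnM (R : realType) (u v : nat -> R) (a b : R) : u k @[k --> \oo] --> a ->
  v k @[k --> \oo] --> b -> u k * v k @[k --> \oo] --> a * b.
Proof. by move=> ua vb; apply: cvgM. Qed.

Lemma cvgnMr (R : realType) (u : nat -> R) (a c : R) : u k @[k --> \oo] --> a ->
  u k * c @[k --> \oo] --> a * c.
Proof. by move=> ua; apply: cvgM => //; exact: cvg_cst. Qed.

Lemma ler_cvgn (R : realType) (u v : nat -> R) (a b : R) : u k @[k --> \oo] --> a ->
  v k @[k --> \oo] --> b -> (forall k, u k <= v k) -> a <= b.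
Proof. by move=> ua vb uv; apply: (ler_cvg_to ua vb); exact: nearW. Qed.

(** * Monotonicity in the radius of the $L^2$ norm of a bounded solution *)

Section monotone_norm.
Variables (R : realType) (n : nat) (s : R).
Hypothesis s0 : 0 < s.
Local Notation mu := (lebesgue_rV R n).
Local Notation E i := (delta_mx ord0 i : 'rV[R]_n).
Implicit Types (w : 'rV[R]_n -> R -> R).

Definition dcutoff (L : R) (i : 'I_n) := cutoff_with (dcutoff1 L) L i.
Definition ddcutoff (L : R) (i : 'I_n) := cutoff_with (ddcutoff1 L) L i.

Lemma cutoff_bound L (x : 'rV[R]_n) : 0 <= cutoff L x <= 1.
Proof. by have := prod_cutoff1_bound L xpredT x. Qed.

Lemma is_test_cutoff (L : R) : (0 < n)%N -> 0 < L -> is_test (@cutoff R n L) (dcutoff L) (ddcutoff L).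
Proof.
move=> n0 L0.
have md (f df : R -> R) : (forall r : R, is_derive r (1 : R) f (df r)) -> measurable_fun setT f.
  move=> h; apply: continuous_measurable_fun => r.
  by apply: differentiable_continuous; apply/derivable1_diffP; have [] := h r.
have md2 (f df : R -> R) : (forall r : R, is_derive r (1 : R) f (df r)) -> measurable_fun setT df.
  move=> h; apply: (@measurable_is_derive R _ (measurableTypeR R) (fun h x => f (h + x)) 0 df (-1) 1).
  - by rewrite in_itv/= ltrN10 ltr01.
  - by move=> y _; apply: (measurableT_comp (md _ _ h)); exact: measurable_funD.
  - move=> x; have e : is_derive (0 : R) (1 : R) (fun h : R => h + x) 1.
      have := is_deriveD (is_derive_id (0 : R) (1 : R)) (is_derive_cst x (0 : R) (1 : R)).
      by rewrite addr0.
    have h0 : is_derive ((fun h : R => h + x) 0) (1 : R) f (df x) by rewrite /= add0r.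
    by have := @is_derive1_comp R f (fun h : R => h + x) 0 _ _ h0 e; rewrite mulr1.
have m0 := md _ _ (is_derive_cutoff1 L); have m1 := md _ _ (is_derive_dcutoff1 L).
have m2 := md2 _ _ (is_derive_dcutoff1 L).
split.
  rewrite (cutoffE L (Ordinal n0)); apply: (@bounded_supp_cutoff_with _ _ _ L 1) => // r.
    by have /andP[b0 b1] := cutoff1_bound L r; rewrite ger0_norm.
  exact: cutoff1_out.
move=> i; split.
- apply: (@bounded_supp_cutoff_with _ _ _ L (6 / L)) => // r; first exact: dcutoff1_bound.
  exact: dcutoff1_out.
- apply: (@bounded_supp_cutoff_with _ _ _ L (30 / L ^+ 2)) => // r; first exact: ddcutoff1_bound.
  exact: ddcutoff1_out.
- by rewrite (cutoffE L i); apply: line_derive_cutoff_with => r; exact: is_derive_cutoff1.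
- by apply: line_derive_cutoff_with => r; exact: is_derive_dcutoff1.
Qed.

Lemma ddcutoff_bound (L : R) i x : 0 < L -> `|ddcutoff L i x| <= 30 / L ^+ 2.
Proof.
move=> L0; have /andP[p0 p1] := prod_cutoff1_bound L (fun j => j != i) x.
rewrite /ddcutoff /cutoff_with normrM (ger0_norm p0) -[leRHS]mulr1 ler_pM//.
exact: ddcutoff1_bound.
Qed.

Lemma sum_ddcutoff_bound (L : R) x : 0 < L -> `|\sum_(i < n) ddcutoff L i x| <= n%:R * (30 / L ^+ 2).
Proof.
move=> L0; apply: le_trans (ler_norm_sum _ _ _) _.
rewrite mulr_natl -[n in leRHS]card_ord -sumr_const; apply: ler_sum => i _.
exact: ddcutoff_bound.
Qed.

Lemma cvg_cutoff (x : 'rV[R]_n) : cutoff k.+1%:R x @[k --> \oo] --> (1 : R).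
Proof.
rewrite /cutoff; elim: (index_enum _) => [|j r IH].
  by under eq_fun do rewrite big_nil; exact: cvg_cst.
under eq_fun do rewrite big_cons.
suff H : cutoff1 k.+1%:R (x ord0 j) @[k --> \oo] --> (1 : R).
  by have := cvgnM H IH; rewrite mulr1.
have e : pos_pow 3 (1 - (x ord0 j * 0) ^+ 2) = 1 :> R.
  by rewrite mulr0 expr0n/= subr0 /pos_pow max_l// expr1n.
have c : (fun k : nat => 1 - (x ord0 j * k.+1%:R^-1) ^+ 2) @ \oo --> (1 - (x ord0 j * 0) ^+ 2 : R).
  apply: cvgB; first exact: cvg_cst.
  have h : (fun k : nat => x ord0 j * k.+1%:R^-1) @ \oo --> x ord0 j * 0.
    by apply: cvgM; [exact: cvg_cst|exact: cvg_harmonic].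
  exact: (cvgnM h h).
have cp : {for (1 - (x ord0 j * 0) ^+ 2 : R), continuous (@pos_pow R 3)}.
  apply: differentiable_continuous; apply/derivable1_diffP.
  by have [] := @is_derive_pos_pow R 1 (1 - (x ord0 j * 0) ^+ 2).
have := cvg_comp _ _ c cp; rewrite e; exact.
Qed.

Lemma fine_sq_int (f : 'rV[R]_n -> R) : fine (sq_int mu f) = \int[mu]_x (f x ^+ 2).
Proof. by []. Qed.

Hypothesis n0 : (0 < n)%N.

Lemma measurable_cutoff (L : R) : 0 < L -> measurable_fun setT (@cutoff R n L).
Proof. by move=> L0; have [[]] := is_test_cutoff n0 L0. Qed.

Lemma cvg_sq_int_cutoff (f : 'rV[R]_n -> R) : is_L2 mu f ->
  \int[mu]_x (f x ^+ 2 * cutoff k.+1%:R x) @[k --> \oo] --> fine (sq_int mu f).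
Proof.
move=> hf; rewrite fine_sq_int.
apply: (@cvg_Rintegral_dominated _ _ _ mu _ _ (fun x => f x ^+ 2)).
- move=> k; apply: measurable_funM; first by apply: measurable_funX; exact: hf.1.
  exact: measurable_cutoff.
- move=> x; rewrite -[X in _ --> X]mulr1; apply: cvgM; first exact: cvg_cst.
  exact: cvg_cutoff.
- exact: is_L2_sq_integrable.
- move=> k x; have /andP[b0 b1] := cutoff_bound k.+1%:R x.
  by rewrite ger0_norm; [rewrite ler_piMr// sqr_ge0|rewrite mulr_ge0// sqr_ge0].
Qed.

Lemma ext_sol_measurable w : ext_sol s w -> forall r, 0 < r -> measurable_fun setT (w ^~ r).
Proof. by move=> [w1 [w2 [d1 [d2 [[mw _ _ _ _] _]]]]]. Qed.

Lemma sq_int_le_real (B : R) (f : 'rV[R]_n -> R) : measurable_fun setT f ->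
  (sq_int mu f <= B%:E)%E -> is_L2 mu f /\ fine (sq_int mu f) <= B.
Proof.
move=> mf fB; have h : is_L2 mu f by split=> //; apply: le_lt_trans fB _; rewrite ltry.
by split=> //; rewrite -lee_fin -sq_int_fin.
Qed.

(** The localised energies $\int w^2\chi_k$ satisfy the Bessel inequality up to an error of order
    $k^{-2}$, which the barrier absorbs. As $k\to\infty$ the chord inequality for convexity in $r^s$
    survives for the full norm, and a bounded function convex in $r^s$ on $(0,\infty)$ cannot
    increase. *)
Lemma sq_int_nonincreasing w (B : R) : ext_sol s w ->
  (forall r, 0 < r -> (sq_int mu (w ^~ r) <= B%:E)%E) ->
  forall a b : R, 0 < a -> a < b -> fine (sq_int mu (w ^~ b)) <= fine (sq_int mu (w ^~ a)).
Proof.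
move=> sw wB a b a0 ab; have mw := ext_sol_measurable sw.
pose F r := fine (sq_int mu (w ^~ r)).
have L2 r : 0 < r -> is_L2 mu (w ^~ r) /\ F r <= B.
  by move=> r0; apply: sq_int_le_real; [exact: mw|exact: wB].
have F0 r : 0 <= F r by rewrite fine_ge0// sq_int_ge0.
have b0 := lt_trans a0 ab.
have B0 : 0 <= B by apply: le_trans (F0 a) (L2 a a0).2.
have step c : b < c -> (F b - F a) * (c `^ s - b `^ s) <= (F c - F b) * (b `^ s - a `^ s).
  move=> bc; have c0 := lt_trans b0 bc.
  pose Phi (k : nat) r := \int[mu]_x (w x r ^+ 2 * cutoff k.+1%:R x).
  (* The supremum of the Laplacian of the cut-off, times the bound on the squared norm. *)
  pose e (k : nat) := n%:R * (30 / k.+1%:R ^+ 2) * B.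
  have e0 k : 0 <= e k by rewrite /e !mulr_ge0// divr_ge0// exprn_ge0.
  set gm := s / (s + 1); set K := barrier_cst s c.
  have key k : (Phi k b - Phi k a - e k * K * (b `^ gm - a `^ gm)) * (c `^ s - b `^ s) <=
      (Phi k c - Phi k b - e k * K * (c `^ gm - b `^ gm)) * (b `^ s - a `^ s).
    have k0 : 0 < k.+1%:R :> R by [].
    have tb := is_test_cutoff n0 k0.
    have [H1 [H2 H]] := weak_square sw tb (fun x => proj1 (andP (cutoff_bound k.+1%:R x))).
    have pos r : r \in `[a, c] -> 0 < r.
      by rewrite in_itv/= => /andP[ar _]; exact: lt_le_trans ar.
    apply: (@Bessel_convex_error R s s0 (Phi k) H1 H2) => // r /pos r0; have [h1 h2 h3] := H r r0 => //.
    apply: le_trans h3; rewrite lerN2.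
    apply: le_trans (ler_norm _) _.
    have bs i : bounded_supp (ddcutoff k.+1%:R i) by have [_ /(_ i)[]] := tb.
    have bsum := bounded_supp_sum (index_enum 'I_n) bs.
    have [[mwr wroo] FB] := L2 r r0.
    have i2 : mu.-integrable setT (EFin \o (fun x => n%:R * (30 / k.+1%:R ^+ 2) * w x r ^+ 2)).
      by apply: (@integrableZl _ _ _ mu _ measurableT _ (EFin \o (fun x => w x r ^+ 2)));
        exact: is_L2_sq_integrable.
    have bd x : `|w x r ^+ 2 * \sum_(i < n) ddcutoff k.+1%:R i x| <= n%:R * (30 / k.+1%:R ^+ 2) * w x r ^+ 2.
      by rewrite normrM (ger0_norm (sqr_ge0 _)) mulrC ler_wpM2r ?sqr_ge0// sum_ddcutoff_bound.
    have i1 : mu.-integrable setT (EFin \o (fun x => w x r ^+ 2 * \sum_(i < n) ddcutoff k.+1%:R i x)).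
      apply: le_integrable i2 => //.
        by apply/measurable_EFinP; apply: measurable_funM; [exact: measurable_funX|exact: bsum.1].
      by move=> x _ /=; rewrite lee_fin; apply: le_trans (bd x) _; exact: ler_norm.
    apply: le_trans (le_normr_Rintegral measurableT i1) _.
    apply: (@le_trans _ _ (\int[mu]_x (n%:R * (30 / k.+1%:R ^+ 2) * w x r ^+ 2))).
      by apply: le_Rintegral => //; exact: integrable_norm.
    rewrite RintegralZl//; last exact: is_L2_sq_integrable.
    by rewrite ler_wpM2l// mulr_ge0// divr_ge0// exprn_ge0.
  have cP r : 0 < r -> Phi k r @[k --> \oo] --> F r by move=> r0; exact: cvg_sq_int_cutoff (L2 r r0).1.
  have ce : e k @[k --> \oo] --> (0 : R).
    have -> : e = (fun k => (n%:R * 30 * B) * (k.+1%:R^-1 * k.+1%:R^-1)).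
      by apply/funext => k; rewrite /e expr2 invfM; ring.
    rewrite -[X in _ --> X](mulr0 (n%:R * 30 * B)); apply: cvgM; first exact: cvg_cst.
    by rewrite -[X in _ --> X](mulr0 (0 : R)); apply: cvgM; exact: cvg_harmonic.
  have lim x y d : 0 < x -> 0 < y ->
    (Phi k y - Phi k x - e k * K * d) @[k --> \oo] --> F y - F x.
    move=> x0 y0; rewrite -[X in _ --> X]subr0; apply: cvgB; first by apply: cvgB; exact: cP.
    rewrite -(mul0r d); apply: cvgM; last exact: cvg_cst.
    by rewrite -(mul0r K); apply: cvgM => //; exact: cvg_cst.
  exact: (ler_cvgn (cvgnMr (lim _ _ (b `^ gm - a `^ gm) a0 b0))
    (cvgnMr (lim _ _ (c `^ gm - b `^ gm) b0 c0)) key).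
rewrite leNgt; apply/negP => Fab; have e0 : 0 < F b - F a by rewrite subr_gt0.
have A0 : 0 <= b `^ s - a `^ s.
  by rewrite subr_ge0 ge0_ler_powR// ?nnegrE ?ltW.
(* Chosen so that for [c] with $c^s=Y$ the left side of the chord inequality is $B(b^s-a^s)+1$,
   while its right side is at most $B(b^s-a^s)$. *)
pose Y := b `^ s + (B * (b `^ s - a `^ s) + 1) / (F b - F a).
have D0 : 0 < (B * (b `^ s - a `^ s) + 1) / (F b - F a).
  by rewrite divr_gt0// ltr_wpDl// mulr_ge0.
have Y0 : 0 < Y by rewrite /Y ltr_wpDl// powR_ge0.
pose c := Y `^ s^-1.
have cs : c `^ s = Y by rewrite /c -powRrM mulVf ?gt_eqF// powRr1// ltW.
have bc : b < c.
  rewrite ltNge; apply/negP => cb.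
  have : c `^ s <= b `^ s by rewrite ge0_ler_powR// ?nnegrE ?ltW// powR_gt0.
  by rewrite cs /Y gerDl leNgt D0.
have := step c bc; rewrite cs.
have -> : (F b - F a) * (Y - b `^ s) = B * (b `^ s - a `^ s) + 1.
  by rewrite /Y (addrC (b `^ s)) addrK mulrC divfK// gt_eqF.
rewrite leNgt => /negP; apply.
apply: (@le_lt_trans _ _ (B * (b `^ s - a `^ s))); last by rewrite ltrDl.
rewrite ler_wpM2r//; have := (L2 c (lt_trans b0 bc)).2; have := F0 b.
by move: (F b) (F c) => *; lra.
Qed.

Lemma ext_sol_lin (p q : R) w w' : ext_sol s w -> ext_sol s w' ->
  ext_sol s (fun x r => p * w x r + q * w' x r).
Proof.
move=> [w1 [w2 [d1 [d2 [[a1 a2 a3 [a4 a5 a6] a7] a8]]]]].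
move=> [w1' [w2' [d1' [d2' [[b1 b2 b3 [b4 b5 b6] b7] b8]]]]].
have cb (c : R) : @loc_bounded2 R n (fun _ _ => c) by move=> N a b _; exists `|c|.
have lb (g g' : 'rV[R]_n -> R -> R) : loc_bounded2 g -> loc_bounded2 g' -> loc_bounded2 (fun x r => p * g x r + q * g' x r).
  by move=> h h'; apply: loc_bounded2D; exact: loc_bounded2M.
have dl (f f' : R -> R) x df df' : is_derive x (1 : R) f df -> is_derive x (1 : R) f' df' ->
   is_derive x (1 : R) (fun r => p * f r + q * f' r) (p * df + q * df').
  by move=> h h'; exact: is_deriveD (is_deriveZ p h) (is_deriveZ q h').
exists (fun x r => p * w1 x r + q * w1' x r), (fun x r => p * w2 x r + q * w2' x r).
exists (fun i x r => p * d1 i x r + q * d1' i x r), (fun i x r => p * d2 i x r + q * d2' i x r).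
split.
  split.
  - by move=> r r0; apply: measurable_funD; apply: measurable_funM => //; [exact: a1|exact: b1].
  - by move=> r r0 x; have [? ?] := a2 r r0 x; have [? ?] := b2 r r0 x; split; exact: dl.
  - move=> r r0 i; have [h1 h2] := a3 r r0 i; have [h1' h2'] := b3 r r0 i.
    by split=> x t; apply: dl; [exact: h1|exact: h1'|exact: h2|exact: h2'].
  - by split; exact: lb.
  - by move=> i; have [? ?] := a7 i; have [? ?] := b7 i; split; exact: lb.
move=> r r0 x; have := a8 r r0 x; have := b8 r r0 x.
rewrite big_split/= -!mulr_sumr.
move: (\sum_(i < n) d2 i x r) (\sum_(i < n) d2' i x r) => S S' e' e.
transitivity (p * (S + w2 x r + (1 - s) / r * w1 x r) + q * (S' + w2' x r + (1 - s) / r * w1' x r)).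
  by ring.
by rewrite e e' !mulr0 addr0.
Qed.

Lemma ext_sol_shift (h : 'rV[R]_n) w : ext_sol s w -> ext_sol s (fun x r => w (x + h) r).
Proof.
move=> [w1 [w2 [d1 [d2 [[a1 a2 a3 [a4 a5 a6] a7] a8]]]]].
(* The box is enlarged by the sum of the $|h_i|$, which dominates each coordinate of the shift. *)
have lb (g : 'rV[R]_n -> R -> R) : loc_bounded2 g -> loc_bounded2 (fun x r => g (x + h) r).
  move=> hg N a b a0; have [M HM] := hg (N + \sum_(i < n) `|h ord0 i|) a b a0.
  exists M => x r bx; apply: HM => i; rewrite mxE.
  apply: le_trans (ler_normD _ _) _; apply: lerD; first exact: bx.
  by rewrite (bigD1 i)//= lerDl sumr_ge0.
exists (fun x => w1 (x + h)), (fun x => w2 (x + h)), (fun i x => d1 i (x + h)), (fun i x => d2 i (x + h)).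
split; last by move=> r r0 x; exact: a8.
split.
- move=> r r0; apply: (measurableT_comp (a1 r r0)).
  by apply: measurable_rV_add => //; exact: measurable_cst.
- by move=> r r0 x; exact: a2.
- move=> r r0 i; have [h1 h2] := a3 r r0 i; split=> x t.
    by have := h1 (x + h) t; rewrite addrAC; under eq_fun do rewrite addrAC.
  by have := h2 (x + h) t; rewrite addrAC; under eq_fun do rewrite addrAC.
- by split; exact: lb.
- by move=> i; have [? ?] := a7 i; split; exact: lb.
Qed.

End monotone_norm.

Lemma measurable_Rintegral_param (R : realType) d1 d2 (T1 : measurableType d1) (T2 : measurableType d2)
    (m : {sigma_finite_measure set T2 -> \bar R}) (f : T1 * T2 -> R) :
  measurable_fun setT f -> measurable_fun setT (fun x => \int[m]_y f (x, y)).
Proof.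
move=> mf; have mEf : measurable_fun setT (EFin \o f) by exact/measurable_EFinP.
apply: (measurableT_comp (@fine_measurable _ _ measurableT)).
under eq_fun do rewrite integralE.
apply: emeasurable_funB.
- have := @measurable_fun_fubini_tonelli_F _ _ T1 T2 R m ((EFin \o f)^\+)%E (measurable_funepos mEf) (funepos_ge0 _).
  by apply: eq_measurable_fun => x _; apply: eq_integral => y _; rewrite !funeposE.
- have := @measurable_fun_fubini_tonelli_F _ _ T1 T2 R m ((EFin \o f)^\-)%E (measurable_funeneg mEf) (funeneg_ge0 _).
  by apply: eq_measurable_fun => x _; apply: eq_integral => y _; rewrite !funenegE.
Qed.

(** * Continuity of translations, behaviour at radius 0, and convolutions *)

Section strong_limit.
Variables (R : realType) (n : nat).
Local Notation mu := (lebesgue_rV R n).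
Local Notation E i := (delta_mx ord0 i : 'rV[R]_n).

Lemma sq_int_shift (h : 'rV[R]_n) (f : 'rV[R]_n -> R) : measurable_fun setT f ->
  sq_int mu (fun x => f (x + h)) = sq_int mu f.
Proof.
move=> mf; rewrite /sq_int (@ge0_integral_rV_shift _ _ h (fun x => (f x ^+ 2)%:E))//.
  by apply/measurable_EFinP; exact: measurable_funX.
by move=> x; rewrite lee_fin sqr_ge0.
Qed.

Lemma measurable_shift (h : 'rV[R]_n) (f : 'rV[R]_n -> R) : measurable_fun setT f ->
  measurable_fun setT (fun x : 'rV[R]_n => f (x + h)).
Proof.
move=> mf; apply: (measurableT_comp mf).
by apply: measurable_rV_add => //; exact: measurable_cst.
Qed.

(** Otherwise some $y_k\to0$ violates the bound. Continuity gives $f(x+y_k)\to f(x)$ pointwise,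
    translation invariance gives equal norms, and these two facts force convergence in $L^2$. *)
Lemma L2_translation_continuous (f : 'rV[R]_n -> R) (e : R) : continuous f -> is_L2 mu f -> 0 < e ->
  exists2 h : R, 0 < h & forall y, box h y -> (sq_int mu (fun x => f x - f (x + y))%R < e%:E)%E.
Proof.
move=> cf hf e0; apply: contrapT => H.
have /choice[y Hy] : forall k : nat, exists y : 'rV[R]_n, box k.+1%:R^-1 y /\
    ~ (sq_int mu (fun x => f x - f (x + y))%R < e%:E)%E.
  move=> k; apply: contrapT => /forallNP Hk; apply: H; exists k.+1%:R^-1; first by rewrite invr_gt0.
  by move=> y hy; apply: contrapT => hn; apply: (Hk y).
have mfk k := measurable_shift (y k) hf.1.
have [||k Hk] := @L2_cvg_of_pointwise _ _ _ mu (fun k x => f (x + y k)) f mfk hf _ _ e e0.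
- move=> x; have xy : x + y k @[k --> \oo] --> x.
    apply/cvg_ballP => eps eps0.
    have [N _ HN] := near_infty_natSinv_lt (PosNum eps0).
    exists N => // k Nk; split=> // i j; rewrite /ball/= mxE opprD addrA subrr sub0r normrN (ord1 i).
    by apply: le_lt_trans ((Hy k).1 j) _; exact: (HN k Nk).
  exact: (cvg_comp _ _ xy (cf x)).
- by move=> k; rewrite sq_int_shift//; exact: hf.1.
apply: (Hy k).2; rewrite (_ : sq_int _ _ = sq_int mu (fun x => f (x + y k) - f x))//.
by apply: eq_integral => x _; rewrite -sqrrN opprB.
Qed.

(** A bounded function with bounded image under the Bessel operator has a limit at 0, with an
    explicit modulus. The outer radius 2 serves as anchor: for [b < 1] the chord from [b] to 2 has
    slope at most $2A/(2^s-1)$ in $r^s$, and near-convexity passes this on to the chord from [a] to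
    [b]. *)
Lemma Bessel_modulus (s : R) (H H1 H2 : R -> R) (A B a b : R) : 0 < s ->
  (forall r : R, 0 < r -> is_derive r (1 : R) H (H1 r)) ->
  (forall r : R, 0 < r -> is_derive r (1 : R) H1 (H2 r)) ->
  (forall r, 0 < r -> `|H r| <= A) ->
  (forall r, 0 < r -> `|H2 r + (1 - s) / r * H1 r| <= B) ->
  0 < a -> a < b -> b < 1 ->
  `|H b - H a| <= B * barrier_cst s 2 * (b `^ (s / (s + 1)) - a `^ (s / (s + 1)))
    + 2 * A / (2 `^ s - 1) * (b `^ s - a `^ s).
Proof.
move=> s0 dH dH1 HA HB a0 ab b1.
have b0 := lt_trans a0 ab; have b2 : b < 2 by apply: lt_trans b1 _; lra.
have B0 : 0 <= B by apply: le_trans (HB 1 ltr01).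
have A0 : 0 <= A by apply: le_trans (HA 1 ltr01).
set g := s / (s + 1); set K := barrier_cst s 2.
have g0 : 0 <= g by rewrite ltW// barrier_exponent_gt0.
have ple (x y z : R) : 0 <= z -> 0 < x -> x <= y -> x `^ z <= y `^ z.
  by move=> z0 x0 xy; rewrite ge0_ler_powR// ?nnegrE ltW// (lt_le_trans x0).
have p1 : 1 `^ s = 1 :> R by rewrite powR1.
have D1 : 1 < 2 `^ s :> R.
  by rewrite -[ltLHS]p1 gt0_ltr_powR// ?nnegrE// ltr1n.
have Ds : 2 `^ s - 1 <= 2 `^ s - b `^ s.
  by rewrite lerB// -[leRHS]p1 ple ?ltW.
have pos r : r \in `[a, 2] -> 0 < r by rewrite in_itv/= => /andP[ar _]; exact: lt_le_trans ar.
(* The one-sided estimate, applied below to [H] and to [- H]. *)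
have half (h h1 h2 : R -> R) : (forall r : R, 0 < r -> is_derive r (1 : R) h (h1 r)) ->
    (forall r : R, 0 < r -> is_derive r (1 : R) h1 (h2 r)) ->
    (forall r, 0 < r -> `|h r| <= A) -> (forall r, 0 < r -> `|h2 r + (1 - s) / r * h1 r| <= B) ->
    h b - h a <= B * K * (b `^ g - a `^ g) + 2 * A / (2 `^ s - 1) * (b `^ s - a `^ s).
  move=> dh dh1 hA hB.
  have hB' r : r \in `[a, 2] -> - B <= h2 r + (1 - s) / r * h1 r.
    by move=> /pos /hB; rewrite ler_norml => /andP[].
  have := @Bessel_convex_error R s s0 h h1 h2 a b 2 B a0 ab b2 B0 (fun r h => dh r (pos r h))
    (fun r h => dh1 r (pos r h)) hB'.
  rewrite -/g -/K.
  set X := h b - h a; set P := b `^ g - a `^ g; set Q := b `^ s - a `^ s.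
  have Q0 : 0 <= Q by rewrite subr_ge0 ple// ltW.
  have K0 : 0 <= K by exact: barrier_cst_ge0.
  have P0 : 0 <= 2 `^ g - b `^ g by rewrite subr_ge0 ple// ltW.
  have h2A : h 2 - h b <= 2 * A.
    have := hA 2 (ltr0Sn _ _); have := hA b b0; rewrite !ler_norml => /andP[? ?] /andP[? ?]; lra.
  have BKP := mulr_ge0 (mulr_ge0 B0 K0) P0.
  move=> Hc; rewrite -lerBlDl.
  have [XP|XP] := leP (X - B * K * P) 0.
    by apply: le_trans XP _; rewrite mulr_ge0// divr_ge0 ?mulr_ge0// subr_ge0 ltW.
  have D0 : 0 < 2 `^ s - 1 by rewrite subr_gt0.
  rewrite [leRHS]mulrAC ler_pdivlMr//.
  apply: (@le_trans _ _ ((X - B * K * P) * (2 `^ s - b `^ s))).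
    by rewrite ler_wpM2l// ltW.
  apply: le_trans Hc _; rewrite ler_wpM2r//.
  by move: h2A BKP; move: (B * K * _) => *; lra.
rewrite ler_norml lerNl opprB; apply/andP; split; last exact: (half H H1 H2).
have dN (h h1 : R -> R) : (forall r : R, 0 < r -> is_derive r (1 : R) h (h1 r)) ->
    forall r : R, 0 < r -> is_derive r (1 : R) (fun x => - h x) (- h1 r).
  by move=> dh r /dh hr; exact: is_deriveN hr.
have -> : H a - H b = - H b - - H a by ring.
apply: (half (fun x => - H x) (fun x => - H1 x) (fun x => - H2 x) (dN _ _ dH) (dN _ _ dH1)).
- by move=> r r0; rewrite normrN HA.
- by move=> r r0; rewrite mulrN -opprD normrN HB.
Qed.

Implicit Types g k : 'rV[R]_n -> R.

Definition rconv (g k : 'rV[R]_n -> R) (x : 'rV[R]_n) := \int[mu]_z (g z * k (x - z)).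

Lemma measurable_conv (g k : 'rV[R]_n -> R) : measurable_fun setT g -> measurable_fun setT k -> measurable_fun setT (rconv g k).
Proof.
move=> mg mk; apply: (@measurable_Rintegral_param R _ _ _ _ mu (fun p : 'rV[R]_n * 'rV[R]_n => g p.2 * k (p.1 - p.2))).
apply: measurable_funM; first by apply: (measurableT_comp mg); exact: measurable_snd.
exact: measurable_rV_diff.
Qed.

Lemma conv_integrable g k (M : R) x : mu.-integrable setT (EFin \o g) ->
  measurable_fun setT k -> (forall y, `|k y| <= M) ->
  mu.-integrable setT (EFin \o (fun z => g z * k (x - z))).
Proof.
move=> ig mk kM; have mg : measurable_fun setT g by apply/measurable_EFinP; exact: measurable_int ig.
have iM := @integrableZl _ _ _ mu _ measurableT M _ ig.
apply: le_integrable iM => //.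
  apply/measurable_EFinP; apply: measurable_funM => //; apply: (measurableT_comp mk).
  by apply: measurable_rV_sub => //; exact: measurable_cst.
move=> z _ /=; rewrite lee_fin normrM mulrC [leRHS]normrM ler_wpM2r//.
by apply: le_trans (kM _) _; exact: ler_norm.
Qed.

(** The derivative falls on the kernel, so [g] need only be integrable; [M1 * |g|] dominates. *)
Lemma line_derive_conv g k k1 e (M M1 : R) : mu.-integrable setT (EFin \o g) ->
  measurable_fun setT k -> (forall y, `|k y| <= M) -> (forall y, `|k1 y| <= M1) ->
  line_derive e k k1 -> line_derive e (rconv g k) (rconv g k1).
Proof.
move=> ig mk kM kM1 dk x t; rewrite /rconv.
have mg : measurable_fun setT g by apply/measurable_EFinP; exact: measurable_int ig.
apply: (@is_derive_under_integral R _ _ mu (fun t z => g z * k (x + t *: e - z))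
  (fun t z => g z * k1 (x + t *: e - z)) t (t - 1) (t + 1) (fun z => M1 * `|g z|)).
- by rewrite in_itv/=; apply/andP; split; lra.
- by move=> r _; exact: conv_integrable.
- move=> r _ z; have := dk (x - z) r; rewrite addrAC.
  under eq_fun do rewrite addrAC.
  by move=> h; exact: (@is_deriveZ R R R _ (g z) r 1 _ h).
- apply: (@integrableZl _ _ _ mu _ measurableT M1 (fun z => `|g z|%:E)).
  exact: (integrable_norm ig).
- by move=> r _ z; rewrite normrM mulrC ler_wpM2r.
Qed.

Lemma bounded_supp_conv g k : bounded_supp g -> bounded_supp k -> bounded_supp (rconv g k).
Proof.
move=> bg bk; have [mg [N [M Hg]]] := bg; have [mk [N' [M' Hk]]] := bk.
split; first exact: measurable_conv.
have ig := bounded_supp_integrable bg.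
exists (N + N'), (M' * \int[mu]_z `|g z|) => x; split.
  have kM y : `|k y| <= M' by have [] := Hk y.
  have ic := conv_integrable x ig mk kM.
  apply: le_trans (le_normr_Rintegral measurableT ic) _.
  rewrite -RintegralZl//; last exact: (integrable_norm ig).
  apply: le_Rintegral => //.
  - exact: integrable_norm ic.
  - apply: (@integrableZl _ _ _ mu _ measurableT M' (fun z => `|g z|%:E)).
    exact: (integrable_norm ig).
  - by move=> z _; rewrite normrM mulrC ler_wpM2r.
move=> nx; rewrite /rconv.
under eq_Rintegral => z _.
  have -> : g z * k (x - z) = 0.
    have [bz|/(Hg z).2 ->] := pselect (box N z); last by rewrite mul0r.
    rewrite ((Hk (x - z)).2 _) ?mulr0// => bxz; apply: nx => i.
    have := bxz i; rewrite !mxE => h.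
    rewrite -(subrK (z ord0 i) (x ord0 i)) addrC.
    by apply: le_trans (ler_normD _ _) _; exact: lerD.
  over.
by rewrite /Rintegral integral0.
Qed.

Lemma is_test_conv g k (k1 k2 : 'I_n -> 'rV[R]_n -> R) : bounded_supp g -> is_test k k1 k2 ->
  is_test (rconv g k) (fun i => rconv g (k1 i)) (fun i => rconv g (k2 i)).
Proof.
move=> bg [bk tk]; split; first exact: bounded_supp_conv.
have ig := bounded_supp_integrable bg.
have [mk [N [M Hk]]] := bk.
move=> i; have [b1 b2 l1 l2] := tk i.
have [m1 [N1 [M1 H1]]] := b1; have [m2 [N2 [M2 H2]]] := b2.
split; [exact: bounded_supp_conv|exact: bounded_supp_conv| |].
- apply: (@line_derive_conv _ _ _ _ M M1) => //; [move=> y|move=> y].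
    exact: (Hk y).1.
  exact: (H1 y).1.
- apply: (@line_derive_conv _ _ _ _ M1 M2) => //; [move=> y|move=> y].
    exact: (H1 y).1.
  exact: (H2 y).1.
Qed.

(** Young's inequality, transferred from the absolute integral to the real-valued convolution. *)
Lemma sq_int_conv_le g k : is_L2 mu g -> mu.-integrable setT (EFin \o k) ->
  (sq_int mu (rconv g k) <= ((\int[mu]_z `|k z|) ^+ 2)%:E * sq_int mu g)%E.
Proof.
move=> hg ik; have mk : measurable_fun setT k by apply/measurable_EFinP; exact: measurable_int ik.
have ink := integrable_norm ik.
have eK : (\int[mu]_t `|k t|%:E)%E = (\int[mu]_z `|k z|)%:E.
  by rewrite /Rintegral fineK//; exact: integrable_fin_num ink.
have := Young hg.1 mk; rewrite eK -EFinM -expr2; apply: le_trans.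
have mH : measurable_fun setT (fun x : 'rV[R]_n => \int[mu]_t `|g t * k (x - t)|%:E)%E.
  apply: (@measurable_fun_fubini_tonelli_F _ _ _ _ _ mu (fun p : 'rV[R]_n * 'rV[R]_n => `|g p.2 * k (p.1 - p.2)%R|%:E)) => //.
  apply/measurable_EFinP; apply: measurableT_comp => //; apply: measurable_funM.
    by apply: (measurableT_comp hg.1); exact: measurable_snd.
  exact: measurable_rV_diff.
apply: ge0_le_integral => //.
- by move=> x _; rewrite lee_fin sqr_ge0.
- by apply/measurable_EFinP; apply: measurable_funX; apply: measurable_conv => //; exact: hg.1.
- exact: emeasurable_funM.
move=> x _; set I := (\int[mu]_t _)%E.
have I0 : (0 <= I)%E by apply: integral_ge0 => t _; rewrite lee_fin.
have cI : (`|rconv g k x|%:E <= I)%E.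
  rewrite /rconv /Rintegral -abse_EFin.
  have mgk : measurable_fun setT (fun t => (g t * k (x - t))%:E).
    apply/measurable_EFinP; apply: measurable_funM; first exact: hg.1.
    by apply: (measurableT_comp mk); apply: measurable_rV_sub => //; exact: measurable_cst.
  have := le_abse_integral mu measurableT mgk.
  (* Where the inner integral is infinite the real-valued convolution is 0 by the convention for
     [fine], and the bound holds trivially. *)
  by case: (integral _ _ _) => [r| |] //= _; rewrite normr0.
rewrite -real_normK ?num_real// expr2 EFinM.
by apply: lee_pmul => //; rewrite lee_fin.
Qed.

End strong_limit.

Section strong_Cauchy.
Variables (R : realType) (n : nat).
Local Notation mu := (lebesgue_rV R n).
Implicit Types d g k : 'rV[R]_n -> R.

Lemma bounded_supp_reflect (x : 'rV[R]_n) k : bounded_supp k -> bounded_supp (fun z => k (x - z)).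
Proof.
move=> [mk [N [M Hk]]]; split.
  by apply: (measurableT_comp mk); apply: measurable_rV_sub => //; exact: measurable_cst.
exists (N + \sum_(i < n) `|x ord0 i|), M => z; split; first exact: (Hk _).1.
move=> nb; apply: (Hk _).2 => bx; apply: nb => i.
have := bx i; rewrite !mxE => xi.
rewrite -[z ord0 i](subKr (x ord0 i)).
apply: le_trans (ler_normB _ _) _; rewrite addrC lerD//.
by rewrite (bigD1 i)//= lerDl sumr_ge0.
Qed.

Lemma bounded_supp_is_L2 k : bounded_supp k -> is_L2 mu k.
Proof.
move=> bk; split; first by have [] := bk.
have := integrableP _ _ _ (bounded_supp_integrable (bounded_supp_mul (bounded_supp_loc bk) bk)).
move=> [_]; apply: le_lt_trans; rewrite le_eqVlt; apply/orP; left; apply/eqP.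
by apply: eq_integral => x _; rewrite /= -expr2 ger0_norm// sqr_ge0.
Qed.

Lemma is_L2_reflect (x : 'rV[R]_n) k : is_L2 mu k -> is_L2 mu (fun z => k (x - z)).
Proof.
move=> [mk k2]; split.
  by apply: (measurableT_comp mk); apply: measurable_rV_sub => //; exact: measurable_cst.
rewrite /sq_int (ge0_integral_rV_reflect x (f := fun y => (k y ^+ 2)%:E))//.
  by apply/measurable_EFinP; exact: measurable_funX.
by move=> y; rewrite lee_fin sqr_ge0.
Qed.

Lemma integrable_reflect (x : 'rV[R]_n) k : mu.-integrable setT (EFin \o k) ->
  mu.-integrable setT (EFin \o (fun z => k (x - z))).
Proof.
move=> /integrableP[/measurable_EFinP mk k1]; apply/integrableP; split.
  apply/measurable_EFinP; apply: (measurableT_comp mk).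
  by apply: measurable_rV_sub => //; exact: measurable_cst.
rewrite /= (ge0_integral_rV_reflect x (f := fun y => `|k y|%:E))//.
by apply/measurable_EFinP; exact: measurableT_comp.
Qed.

(** With $c=\int k$, $c\,d(x)-(d\ast k)(x)=\int k(x-y)(d(x)-d(y))\,dy$. Cauchy-Schwarz for the
    measure $k(x-y)\,dy$ bounds its square, and Tonelli turns the result into an average over $y$ of
    translation moduli of [d]. *)
Lemma sq_int_conv_diff d k : is_L2 mu d -> mu.-integrable setT (EFin \o k) -> is_L2 mu k ->
  (forall x, 0 <= k x) ->
  (sq_int mu (fun x => (\int[mu]_y k y) * d x - rconv d k x)%R <=
   (\int[mu]_y k y)%:E * \int[mu]_y ((k y)%:E * sq_int mu (fun x => d x - d (x - y))%R))%E.
Proof.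
move=> hd ik k2 k0; have mk := k2.1; have md := hd.1.
set c := \int[mu]_y k y.
have c0 : 0 <= c by apply: Rintegral_ge0 => x _.
have ck (x : 'rV[R]_n) : \int[mu]_y k (x - y) = c.
  rewrite /c /Rintegral (ge0_integral_rV_reflect x (f := fun y => (k y)%:E))//.
  by apply/measurable_EFinP.
pose S (p : 'rV[R]_n * 'rV[R]_n) := k p.2 * (d p.1 - d (p.1 - p.2)) ^+ 2.
have mS : measurable_fun setT S.
  apply: measurable_funM; first by apply: (measurableT_comp mk); exact: measurable_snd.
  apply: measurable_funX; apply: measurable_funB; last exact: measurable_rV_diff.
  by apply: (measurableT_comp md); exact: measurable_fst.
have S0 p : 0 <= S p by rewrite mulr_ge0// sqr_ge0.
have mES : measurable_fun setT (EFin \o S) by exact/measurable_EFinP.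
have pt x : (((c * d x - rconv d k x) ^+ 2)%:E <= c%:E * \int[mu]_y (S (x, y))%:E)%E.
  have bx := integrable_reflect x ik; have L2x := is_L2_reflect x k2; have mx := L2x.1.
  have i1 : mu.-integrable setT (fun y => (d x * k (x - y))%:E).
    exact: (integrableZl measurableT (d x) bx).
  have i2 := is_L2_mul_integrable hd L2x.
  have -> : c * d x - rconv d k x = \int[mu]_y (d x * k (x - y) - d y * k (x - y)).
    by rewrite RintegralB// RintegralZl ?ck ?(mulrC c).
  have ms : measurable_fun setT (fun y : 'rV[R]_n => Num.sqrt (k (x - y))).
    have msq : measurable_fun setT (@Num.sqrt R).
      by apply: continuous_measurable_fun => y; exact: sqrt_continuous.
    exact: (measurableT_comp msq).
  have mdd : measurable_fun setT (fun y : 'rV[R]_n => d x - d y) by apply: measurable_funB.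
  have CS := @ge0_Cauchy_Schwarz _ _ _ mu (fun y => Num.sqrt (k (x - y)))
     (fun y => Num.sqrt (k (x - y)) * (d x - d y))%R ms (measurable_funM ms mdd).
  have id12 := integrableB measurableT i1 i2.
  have eI : (\int[mu]_y `|Num.sqrt (k (x - y)) * (Num.sqrt (k (x - y)) * (d x - d y))|%:E =
     \int[mu]_y `|d x * k (x - y) - d y * k (x - y)|%:E)%E.
    apply: eq_integral => y _; congr EFin.
    by rewrite mulrA -expr2 sqr_sqrtr// mulrC mulrBl.
  rewrite eI in CS.
  have -> : (((\int[mu]_y (d x * k (x - y) - d y * k (x - y))) ^+ 2)%:E =
     `|\int[mu]_y (d x * k (x - y) - d y * k (x - y))%:E| *
     `|\int[mu]_y (d x * k (x - y) - d y * k (x - y))%:E|)%E.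
    have fi : (\int[mu]_y (d x * k (x - y) - d y * k (x - y))%:E \is a fin_num)%E.
      exact: integrable_fin_num.
    by rewrite -(fineK fi) abse_EFin -EFinM -expr2 real_normK// num_real.
  have le1 := le_abse_integral mu measurableT (measurable_int _ id12).
  apply: le_trans (lee_pmul (abse_ge0 _) (abse_ge0 _) le1 le1) _.
  apply: le_trans CS _; rewrite le_eqVlt; apply/orP; left; apply/eqP; congr (_ * _)%E.
    under eq_integral do rewrite sqr_sqrtr//.
    by rewrite -(ck x) /Rintegral fineK//; exact: integrable_fin_num.
  rewrite -[RHS](ge0_integral_rV_reflect x (f := fun y => (S (x, y))%:E)).
  - apply: eq_integral => y _; congr EFin; rewrite /S/= exprMn sqr_sqrtr//.
    by rewrite subKr.
  - apply/measurable_EFinP; apply: (measurableT_comp mS).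
    by apply: measurable_fun_pair => //; exact: measurable_cst.
  - by move=> y; rewrite lee_fin.
have mI : measurable_fun setT (fun x => \int[mu]_y (S (x, y))%:E)%E.
  exact: (@measurable_fun_fubini_tonelli_F _ _ _ _ _ mu (EFin \o S)).
have I0 x : (0 <= \int[mu]_y (S (x, y))%:E)%E by apply: integral_ge0 => y _; rewrite lee_fin.
apply: (@le_trans _ _ (\int[mu]_x (c%:E * \int[mu]_y (S (x, y))%:E))%E).
  apply: ge0_le_integral => //.
  - by move=> x _; rewrite lee_fin sqr_ge0.
  - apply/measurable_EFinP; apply: measurable_funX; apply: measurable_funB; last exact: measurable_conv.
    by apply: measurable_funM => //; exact: measurable_cst.
  - by apply: measurable_funeM.
rewrite ge0_integralZl//.
rewrite (@fubini_tonelli _ _ _ _ _ mu mu (EFin \o S))//.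
apply: lee_wpmul2l; first by rewrite lee_fin.
rewrite le_eqVlt; apply/orP; left; apply/eqP; apply: eq_integral => y _; rewrite /S/=.
under eq_integral do rewrite EFinM.
rewrite ge0_integralZl//.
- apply/measurable_EFinP; apply: measurable_funX; apply: measurable_funB => //.
  by apply: (measurableT_comp md); apply: measurable_rV_sub => //; exact: measurable_cst.
- by move=> x _; rewrite lee_fin sqr_ge0.
- by rewrite lee_fin.
Qed.

Lemma measurable_sq_int_diff d : measurable_fun setT d ->
  measurable_fun setT (fun y : 'rV[R]_n => sq_int mu (fun x => d x - d (x - y))%R).
Proof.
move=> md; pose S (p : 'rV[R]_n * 'rV[R]_n) := (d p.1 - d (p.1 - p.2)) ^+ 2.
have mS : measurable_fun setT (EFin \o S).
  apply/measurable_EFinP; apply: measurable_funX; apply: measurable_funB; last exact: measurable_rV_diff.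
  by apply: (measurableT_comp md); exact: measurable_fst.
apply: (@measurable_fun_fubini_tonelli_G _ _ _ _ _ mu (EFin \o S)) => //.
by move=> p; rewrite lee_fin sqr_ge0.
Qed.

Lemma sq_int_conv_diff_le d k (e : R) : is_L2 mu d -> bounded_supp k -> (forall x, 0 <= k x) -> 0 <= e ->
  (forall y, k y != 0 -> (sq_int mu (fun x => d x - d (x - y))%R <= e%:E)%E) ->
  (sq_int mu (fun x => (\int[mu]_y k y) * d x - rconv d k x)%R <= ((\int[mu]_y k y) ^+ 2 * e)%:E)%E.
Proof.
move=> hd bk k0 e0 He; have ik := bounded_supp_integrable bk; have [mk _] := bk.
apply: le_trans (sq_int_conv_diff hd ik (bounded_supp_is_L2 bk) k0) _.
set c := \int[mu]_y k y; have c0 : 0 <= c by apply: Rintegral_ge0 => x _.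
rewrite expr2 -mulrA EFinM; apply: lee_wpmul2l; first by rewrite lee_fin.
apply: (@le_trans _ _ (\int[mu]_y (e%:E * (k y)%:E))%E).
  apply: ge0_le_integral => //.
  - by move=> y _; rewrite mule_ge0 ?lee_fin// sq_int_ge0.
  - by apply: emeasurable_funM; [exact/measurable_EFinP|exact: measurable_sq_int_diff hd.1].
  - by apply: measurable_funeM; apply/measurable_EFinP.
  move=> y _; have [ky|ky] := eqVneq (k y) 0; first by rewrite ky mule0 mul0e.
  by rewrite muleC lee_wpmul2r ?lee_fin//; exact: He.
rewrite ge0_integralZl//; first last.
- by move=> x _; rewrite lee_fin.
- exact/measurable_EFinP.
rewrite muleC -[X in (X * _)%E]fineK//.
exact: integrable_fin_num.
Qed.

(** Convolution with an even kernel is self-adjoint, by Fubini. It is used to move the mollifier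
    from the difference of two slices of a solution onto a test function. *)
Lemma integral_conv_sym g d k : is_L2 mu g -> is_L2 mu d -> bounded_supp k -> (forall x, k (- x) = k x) ->
  \int[mu]_x (g x * rconv d k x) = \int[mu]_x (d x * rconv g k x).
Proof.
move=> hg hd bk kN; have [mk _] := bk.
pose S (p : 'rV[R]_n * 'rV[R]_n) := g p.1 * (d p.2 * k (p.1 - p.2)).
have mS : measurable_fun setT S.
  apply: measurable_funM; first by apply: (measurableT_comp hg.1); exact: measurable_fst.
  apply: measurable_funM; first by apply: (measurableT_comp hd.1); exact: measurable_snd.
  exact: measurable_rV_diff.
have mES : measurable_fun setT (EFin \o S) by exact/measurable_EFinP.
have hdn : is_L2 mu (fun x => `|d x|).
  split; first by apply: measurableT_comp => //; exact: hd.1.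
  by rewrite /sq_int; under eq_integral do rewrite real_normK ?num_real//; exact: hd.2.
have hgn : is_L2 mu (fun x => `|g x|).
  split; first by apply: measurableT_comp => //; exact: hg.1.
  by rewrite /sq_int; under eq_integral do rewrite real_normK ?num_real//; exact: hg.2.
have bkn : bounded_supp (fun x => `|k x|).
  have [_ [N [M Hk]]] := bk; split; first exact: measurableT_comp.
  by exists N, M => x; rewrite normr_id; have [? H0] := Hk x; split=> // /H0 ->; rewrite normr0.
have hc : is_L2 mu (rconv (fun x => `|d x|) (fun x => `|k x|)).
  split; first by apply: measurable_conv; [exact: hdn.1|exact: bkn.1].
  apply: le_lt_trans (sq_int_conv_le hdn (bounded_supp_integrable bkn)) _.
  by rewrite (sq_int_fin hdn) -EFinM ltry.
(* Absolute integrability of the double integral: $|g|$ is paired with $|d|\ast|k|$, which is in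
   $L^2$ by Young. *)
have iS : (mu \x mu)%E.-integrable setT (EFin \o S).
  apply/integrable12ltyP => //=.
  have := integrableP _ _ _ (is_L2_mul_integrable hgn hc) => -[_]; apply: le_lt_trans.
  rewrite le_eqVlt; apply/orP; left; apply/eqP; apply: eq_integral => x _.
  have bx := bounded_supp_is_L2 (bounded_supp_reflect x bkn).
  have ix := is_L2_mul_integrable hdn bx.
  rewrite /S/= normrM normr_id EFinM ger0_norm; last by apply: Rintegral_ge0 => z _; rewrite mulr_ge0.
  rewrite /rconv /Rintegral fineK; last exact: integrable_fin_num.
  rewrite -ge0_integralZl//.
  - by apply: eq_integral => y _; rewrite !normrM EFinM.
  - by apply: (measurable_int mu); exact: ix.
have := Fubini iS; rewrite /= => F.
have -> : \int[mu]_x (g x * rconv d k x) = fine (\int[mu]_x \int[mu]_y (S (x, y))%:E)%E.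
  rewrite /Rintegral; congr fine; apply: eq_integral => x _.
  have bx := bounded_supp_is_L2 (bounded_supp_reflect x bk).
  have ix := is_L2_mul_integrable hd bx.
  rewrite EFinM /rconv /Rintegral fineK; last exact: integrable_fin_num.
  by rewrite -integralZl.
rewrite F; congr fine; apply: eq_integral => y _.
have bx := bounded_supp_is_L2 (bounded_supp_reflect y bk).
have ix := is_L2_mul_integrable hg bx.
rewrite EFinM /rconv /Rintegral fineK; last exact: integrable_fin_num.
transitivity (\int[mu]_x ((d y)%:E * (g x * k (y - x))%:E))%E; last exact: integralZl.
apply: eq_integral => x _.
by rewrite /S/= -(kN (x - y)) opprB -EFinM; congr EFin; ring.
Qed.

End strong_Cauchy.

Lemma lebesgue_box (R : realType) n (N : R) : 0 <= N -> lebesgue_rV R n (box N) = ((N *+ 2) ^+ n)%:E.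
Proof.
move=> N0; rewrite (_ : box N = [set x | forall i, `[- N, N]%classic (x ord0 i)]); last first.
  by apply/seteqP; split => x bx i; have := bx i; rewrite /= in_itv/= -ler_norml.
rewrite (@lebesgue_rV_box _ _ (fun=> `[- N, N]%classic))//.
under eq_bigr => i _ do rewrite lebesgue_measure_itv/=.
rewrite big_const_ord; have NN : - N <= N by lra.
have -> : (if ((- N)%:E < N%:E)%E then (N%:E - (- N)%:E)%E else 0%E) = (N *+ 2)%:E.
  rewrite lte_fin; case: ltP => h; first by rewrite -EFinB opprK mulr2n.
  have -> : N = 0 by lra.
  by rewrite mul0rn.
elim: (n) => [|m IH]; first by rewrite expr0.
by rewrite iterS IH exprS EFinM.
Qed.

Lemma integral_cutoff_gt0 (R : realType) n (L : R) : (0 < n)%N -> 0 < L ->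
  0 < \int[lebesgue_rV R n]_x cutoff L x.
Proof.
move=> n0 L0; set mu := lebesgue_rV R n.
have [bc _] := is_test_cutoff n0 L0.
have p0 : 0 < (27 / 64 : R) ^+ n by rewrite exprn_gt0// divr_gt0.
(* On the half-size box every factor of the cut-off is at least $(1-1/4)^3=27/64$. *)
have H : (((27 / 64 : R) ^+ n)%:E * mu (box (L / 2)) <= \int[mu]_x (cutoff L x)%:E)%E.
  rewrite -(@integral_cst _ _ _ mu _ (measurable_box (L / 2))).
  apply: (@le_trans _ _ (\int[mu]_(x in box (L / 2)) (cutoff L x)%:E)%E); last first.
    apply: ge0_subset_integral => //; first exact: measurable_box.
      by apply/measurable_EFinP; exact: bc.1.
    by move=> x _; rewrite lee_fin; have /andP[] := cutoff_bound L x.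
  apply: ge0_le_integral.
  - exact: measurable_box.
  - by move=> x _; rewrite lee_fin ltW.
  - exact: measurable_cst.
  - by apply/measurable_EFinP; apply: measurable_funTS; exact: bc.1.
  move=> x bx; rewrite lee_fin /cutoff -[n in leLHS]card_ord -prodr_const.
  apply: ler_prod => i _; rewrite divr_ge0//=.
  have := bx i; move: (x ord0 i) => r rL.
  have h : (r / L) ^+ 2 <= 1 / 4.
    rewrite -real_normK ?num_real// (_ : 1 / 4 = (1 / 2) ^+ 2) ?lerXn2r ?nnegrE//; last by field.
    by rewrite normrM normfV (gtr0_norm L0) ler_pdivrMr// mulrC mulrA mulr1.
  rewrite /cutoff1 /pos_pow max_l; last by lra.
  rewrite (_ : 27 / 64 = (3 / 4) ^+ 3) ?lerXn2r ?nnegrE//; [lra|lra|by field].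
rewrite -lte_fin /Rintegral fineK; last by apply: integrable_fin_num => //; exact: bounded_supp_integrable.
apply: lt_le_trans H; rewrite lebesgue_box ?divr_ge0 ?ltW// -EFinM lte_fin mulr_gt0// exprn_gt0//.
by rewrite mulrn_wgt0// divr_gt0.
Qed.

(** * The slices of a bounded solution are Cauchy in $L^2$ as the radius tends to 0 *)

Section ext_sol_Cauchy.
Variables (R : realType) (n : nat) (s : R).
Hypotheses (s0 : 0 < s) (n0 : (0 < n)%N).
Local Notation mu := (lebesgue_rV R n).
Local Notation N2 f := (fine (sq_int mu f)).
Implicit Types f g : 'rV[R]_n -> R.

Lemma N2_ge0 f : 0 <= N2 f. Proof. by rewrite fine_ge0// sq_int_ge0. Qed.

Lemma parallelogram_fine f g : is_L2 mu f -> is_L2 mu g ->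
  N2 (fun x => f x + g x) + N2 (fun x => f x - g x) = 2 * N2 f + 2 * N2 g.
Proof.
move=> hf hg; apply: EFin_inj; rewrite !EFinD !EFinM -!sq_int_fin//; first exact: parallelogram hf.1 hg.1.
- exact: is_L2B.
- exact: is_L2D.
Qed.

Lemma sq_int_cutoff_le (L : R) f : is_L2 mu f -> 0 < L ->
  bounded_supp (fun x => f x * cutoff L x) ->
  N2 (fun x => f x * cutoff L x) <= \int[mu]_x (f x ^+ 2 * cutoff L x) /\
  \int[mu]_x (f x ^+ 2 * cutoff L x) <= N2 f.
Proof.
move=> hf L0 bg; have mc := measurable_cutoff n0 L0.
have i2 := is_L2_sq_integrable hf.
have ip : mu.-integrable setT (fun x => (f x ^+ 2 * cutoff L x)%:E).
  apply: le_integrable i2 => //.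
    by apply/measurable_EFinP; apply: measurable_funM => //; apply: measurable_funX; exact: hf.1.
  move=> x _ /=; have /andP[c0 c1] := cutoff_bound L x.
  by rewrite lee_fin !normrM ler_piMr// ger0_norm.
split.
  rewrite fine_sq_int; apply: le_Rintegral => //.
    exact: is_L2_sq_integrable (bounded_supp_is_L2 bg).
  move=> x _; have /andP[c0 c1] := cutoff_bound L x.
  by rewrite exprMn ler_wpM2l ?sqr_ge0// expr2 ler_piMr.
apply: le_Rintegral => // x _.
by have /andP[c0 c1] := cutoff_bound L x; rewrite ler_piMr ?sqr_ge0.
Qed.

(** Let $d=v_b-v_a$ and let $k$ be a cut-off of mass $c$. Then $c\,d$ is the sum of $c\,d-d\ast k$,
    small in norm because $v_a$ and $v_b$ have small translation moduli, and of $d\ast k$, whose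
    pairing with [d] is small because pairings of [v] with fixed test functions have a modulus at 0.
    One factor [d] is cut off at scale [L] to become a legitimate test function, with bounds
    independent of [L]. *)
Lemma ext_sol_Cauchy (v : 'rV[R]_n -> R -> R) (B : R) : ext_sol s v ->
  (forall r, 0 < r -> continuous (v ^~ r)) ->
  (forall r, 0 < r -> (sq_int mu (v ^~ r) <= B%:E)%E) ->
  forall e, 0 < e -> exists2 dl : R, 0 < dl & forall a b, 0 < a -> a < b -> b < dl ->
    N2 (fun x => v x b - v x a) <= e.
Proof.
move=> sv cv vB e e0; have mv := ext_sol_measurable sv.
have L2v r : 0 < r -> is_L2 mu (v ^~ r) /\ N2 (v ^~ r) <= B.
  by move=> r0; apply: sq_int_le_real; [exact: mv|exact: vB].
have B0 : 0 <= B by exact: le_trans (N2_ge0 _) (L2v 1 ltr01).2.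
(* The final inequality reads $X\le(20e_1+X)/2+e_1$, that is $X\le22e_1$. *)
pose e1 := e / 22.
have e10 : 0 < e1 by rewrite divr_gt0.
pose A := [set N2 (v ^~ r) | r in [set r : R | 0 < r]].
have sA : has_sup A.
  split; first by exists (N2 (v ^~ 1)), 1 => //=.
  by exists B => _ [r r0 <-]; exact: (L2v r r0).2.
(* At [r1] the squared norm is within [e1] of its supremum; by monotonicity little can still be
   gained at smaller radii. *)
have [_ [r1 r10 <-] HM] := sup_adherent e10 sA.
have [h h0 Hh] := L2_translation_continuous (cv r1 r10) (L2v r1 r10).1 e10.
(* Parallelogram: $\|v_r-\tau v_r\|^2=4\|v_r\|^2-\|v_r+\tau v_r\|^2$. The last norm belongs to a
   solution, hence is at least its value at $r_1$, so the left side exceeds the one at $r_1$ by at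
   most $4(\|v_r\|^2-\|v_{r_1}\|^2)\le4e_1$; the one at $r_1$ is below $e_1$. *)
have tr r y : 0 < r -> r < r1 -> box h y -> N2 (fun x => v x r - v (x + y) r) <= 5 * e1.
  move=> rr0 rr1 hy.
  have sw := @ext_sol_lin R n s 1 1 _ _ sv (ext_sol_shift y sv).
  have wE : (fun x r => 1 * v x r + 1 * v (x + y) r) = (fun x r => v x r + v (x + y) r).
    by apply/funext => x; apply/funext => t; rewrite !mul1r.
  rewrite wE in sw.
  have L2s t : 0 < t -> is_L2 mu (fun x => v (x + y) t) /\ N2 (fun x => v (x + y) t) = N2 (v ^~ t).
    move=> t0; have E := sq_int_shift y (mv t t0); split; last by rewrite E.
    by split; [exact: measurable_shift (mv t t0)|rewrite E; exact: (L2v t t0).1.2].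
  have par t (t0 : 0 < t) := parallelogram_fine (L2v t t0).1 (L2s t t0).1.
  have wB t : 0 < t -> (sq_int mu (fun x => v x t + v (x + y) t)%R <= (4 * B)%:E)%E.
    move=> t0; rewrite sq_int_fin; last exact: is_L2D (L2v t t0).1 (L2s t t0).1.
    rewrite lee_fin; have := par t t0; rewrite (L2s t t0).2.
    have := (L2v t t0).2; have := N2_ge0 (fun x => v x t - v (x + y) t).
    by move=> ? ? ?; lra.
  have mono := sq_int_nonincreasing s0 n0 sw wB rr0 rr1.
  have := Hh y hy; rewrite sq_int_fin; last exact: is_L2B (L2v r1 r10).1 (L2s r1 r10).1.
  rewrite lte_fin.
  have := par r rr0; have := par r1 r10; rewrite (L2s r rr0).2 (L2s r1 r10).2.
  have : N2 (v ^~ r) <= sup A by apply: ub_le_sup sA.2 _ _; exists r.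
  move: mono HM; rewrite /=.
  move: (N2 _) (N2 _) (N2 _) (N2 _) (N2 _) (N2 _) => *; lra.
(* The cut-off at scale [h] is the mollifier: its support lies in the box where [tr] applies. *)
have [[bk tk] kb] := (is_test_cutoff n0 h0, fun x => proj1 (andP (@cutoff_bound R n h x))).
have tk' := is_test_cutoff n0 h0.
set c := \int[mu]_x cutoff h x.
have c0 : 0 < c by exact: integral_cutoff_gt0.
have bD : bounded_supp (fun x => \sum_(i < n) ddcutoff h i x).
  by apply: bounded_supp_sum => i; have [] := tk i.
pose K := \int[mu]_z `|\sum_(i < n) ddcutoff h i z|.
have K0 : 0 <= K by apply: Rintegral_ge0 => x _.
(* [A'] and [B'] will bound $\int v_r\,(g\ast k)$ and its image under the Bessel operator, for any
   [g] of squared norm at most [4 * B]; neither depends on [a], [b] or the scale of localisation. *)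
pose A' := Num.sqrt B * (c * Num.sqrt (4 * B)).
pose B' := Num.sqrt B * (K * Num.sqrt (4 * B)).
have A'0 : 0 <= A' by rewrite !mulr_ge0 ?sqrtr_ge0// ltW.
have B'0 : 0 <= B' by rewrite !mulr_ge0 ?sqrtr_ge0.
have g0 := barrier_exponent_gt0 s0; set gm := s / (s + 1) in g0.

have gms : gm <= s by rewrite /gm ler_pdivrMr ?addr_gt0// mulrDr mulr1 lerDr mulr_ge0// ltW.
have D1 : 0 < 2 `^ s - 1 :> R.
  have p1 : 1 `^ s = 1 :> R by rewrite powR1.
  by rewrite subr_gt0 -[ltLHS]p1 gt0_ltr_powR// ?nnegrE// ltr1n.
pose P := B' * barrier_cst s 2; pose Q := 2 * A' / (2 `^ s - 1).
have P0 : 0 <= P by rewrite mulr_ge0// barrier_cst_ge0.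
have Q0 : 0 <= Q by rewrite divr_ge0 ?mulr_ge0// ltW.
have ple (x y z : R) : 0 <= z -> 0 < x -> x <= y -> x `^ z <= y `^ z.
  by move=> z0 x0 xy; rewrite ge0_ler_powR// ?nnegrE ltW// (lt_le_trans x0).
(* The threshold comes from the modulus at 0. Since $\gamma\le s$ and [dl <= 1], both powers are at
   most $dl^\gamma$, so it is enough to make $dl^\gamma$ small. *)
have [dl [dl0 dl1 Hdl]] : exists dl : R, [/\ 0 < dl, dl <= 1 & P * dl `^ gm + Q * dl `^ s <= c * e1].
  pose q := c * e1 / (P + Q + 1).
  have PQ0 : 0 < P + Q + 1 by lra.
  have q0 : 0 < q by rewrite divr_gt0 ?mulr_gt0.
  pose dl := Num.min 1 (q `^ gm^-1).
  have dl0 : 0 < dl by rewrite lt_min ltr01 powR_gt0.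
  have dl1 : dl <= 1 by rewrite ge_min lexx.
  exists dl; split=> //.
  have dlq : dl `^ gm <= q.
    have qE : (q `^ gm^-1) `^ gm = q by rewrite -powRrM mulVf ?lt0r_neq0// powRr1// ltW.
    by rewrite -[leRHS]qE; apply: ple => //; [exact: ltW|rewrite ge_min lexx orbT].
  have dls : dl `^ s <= dl `^ gm.
    have [->|] := eqVneq dl 1; first by rewrite !powR1.
    move=> dn; have dl1' : dl < 1 by rewrite lt_neqAle dn.
    by rewrite /powR gt_eqF// ler_expR ler_wnM2r// ln_le0.
  apply: (@le_trans _ _ ((P + Q + 1) * q)); last by rewrite /q mulrC divfK ?gt_eqF.
  have := ler_wpM2l P0 dlq; have := ler_wpM2l Q0 (le_trans dls dlq); move: (ltW q0).
  by rewrite !mulrDl mul1r => ? ? ?; lra.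
exists (Num.min dl r1); first by rewrite lt_min dl0.
move=> a b a0 ab; rewrite lt_min => /andP[bdl br1]; have b0 := lt_trans a0 ab.
have ar1 := lt_trans ab br1.
pose d x := v x b - v x a.
have L2d : is_L2 mu d by apply: is_L2B; [exact: (L2v b b0).1|exact: (L2v a a0).1].
have d4 : N2 d <= 4 * B.
  rewrite /d; have := parallelogram_fine (L2v b b0).1 (L2v a a0).1.
  have := N2_ge0 (fun x => v x b + v x a); have := (L2v b b0).2; have := (L2v a a0).2.
  by move: (N2 _) (N2 _) (N2 _) (N2 _) => *; lra.
have ld : loc_bounded d.
  have [w1 [w2 [d1 [d2 [[_ _ _ [lv _ _] _] _]]]]] := sv.
  have lN : loc_bounded (fun x => -1 * v x a).
    by apply: loc_boundedM; [exact: loc_bounded_cst|exact: loc_bounded2_at (mv a a0) lv].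
  have := loc_boundedD (loc_bounded2_at b0 (mv b b0) lv) lN.
  by under eq_fun do rewrite mulN1r.
(* $20=2\cdot5+2\cdot5$: the translation moduli of the two slices, added in $L^2$. *)
have trd y : cutoff h y != 0 -> (sq_int mu (fun x => d x - d (x - y))%R <= (20 * e1)%:E)%E.
  move=> ky; have bh : box h (- y).
    move=> i; rewrite mxE normrN leNgt; apply: contra ky => hy.
    by rewrite /cutoff (bigD1 i)//= cutoff1_out// mul0r.
  have L2s t : 0 < t -> is_L2 mu (fun x => v x t - v (x - y) t).
    move=> t0; apply: is_L2B; first exact: (L2v t t0).1.
    have E := sq_int_shift (- y) (mv t t0).
    by split; [exact: measurable_shift (mv t t0)|rewrite E; exact: (L2v t t0).1.2].
  rewrite (_ : (fun x => _) = (fun x => (v x b - v (x - y) b) - (v x a - v (x - y) a))); last first.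
    by apply/funext => x; rewrite /d; ring.
  rewrite sq_int_fin; last exact: is_L2B (L2s b b0) (L2s a a0).
  rewrite lee_fin; have := parallelogram_fine (L2s b b0) (L2s a a0).
  have := tr b (- y) b0 br1 bh; have := tr a (- y) a0 ar1 bh.
  have := N2_ge0 (fun x => (v x b - v (x - y) b) + (v x a - v (x - y) a)).
  by move: (N2 _) (N2 _) (N2 _) (N2 _) => *; lra.
have kN x : cutoff h (- x) = cutoff h x.
  by apply: eq_bigr => j _; rewrite mxE /cutoff1 mulNr sqrrN.
have e20 : 0 <= 20 * e1 by rewrite mulr_ge0// ltW.
have DD := sq_int_conv_diff_le L2d bk kb e20 trd; rewrite -/c in DD.
have mrc g k : measurable_fun setT g -> measurable_fun setT k -> is_L2 mu g -> bounded_supp k -> is_L2 mu (rconv g k).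
  move=> mg mk hg hk; split; first exact: measurable_conv.
  apply: le_lt_trans (sq_int_conv_le hg (bounded_supp_integrable hk)) _.
  by rewrite (sq_int_fin hg) -EFinM ltry.
have L2c : is_L2 mu (rconv d (cutoff h)) by apply: mrc => //; [exact: L2d.1|exact: bk.1].
have L2D : is_L2 mu (fun x => c * d x - rconv d (cutoff h) x).
  by apply: is_L2B L2c; exact: is_L2_scale.
have {}DD : N2 (fun x => c * d x - rconv d (cutoff h) x) <= c ^+ 2 * (20 * e1).
  by rewrite -lee_fin -sq_int_fin.
(* Uniform in the localisation, so that letting [k] grow recovers the whole norm of [d]. *)
have key (k : nat) : \int[mu]_x (d x ^+ 2 * cutoff k.+1%:R x) <= e.
  set L : R := k.+1%:R; have L0 : 0 < L by [].
  have [bL _] := is_test_cutoff n0 L0.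
  pose g x := d x * cutoff L x.
  have bg : bounded_supp g by exact: bounded_supp_mul.
  have hg := bounded_supp_is_L2 bg.
  have [gX XN] := sq_int_cutoff_le L2d L0 bg.
  set X := \int[mu]_x _ in gX XN *.
  have X0 : 0 <= X by exact: le_trans (N2_ge0 _) gX.
  have cX : c * X = \int[mu]_x ((c * d x - rconv d (cutoff h) x) * g x) + \int[mu]_x (g x * rconv d (cutoff h) x).
    rewrite -RintegralD//; [|exact: is_L2_mul_integrable..].
    rewrite -RintegralZl//; last first.
      have := is_L2_mul_integrable L2d hg; rewrite (_ : (fun x => (d x * g x)%:E) = (fun x => (d x ^+ 2 * cutoff L x)%:E))//.
      by apply/funext => x; rewrite /g mulrA -expr2.
    by apply: eq_Rintegral => x _; rewrite /g; ring.
  (* Cauchy-Schwarz followed by $20e_1X\le((20e_1+X)/2)^2$; half of [X] is later absorbed on the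
     left. *)
  have t1 : \int[mu]_x ((c * d x - rconv d (cutoff h) x) * g x) <= c * ((20 * e1 + X) / 2).
    have CS := Cauchy_Schwarz L2D hg.
    have h2 : (\int[mu]_x ((c * d x - rconv d (cutoff h) x) * g x)) ^+ 2 <= (c * ((20 * e1 + X) / 2)) ^+ 2.
      apply: le_trans CS _; apply: (@le_trans _ _ (c ^+ 2 * (20 * e1) * X)).
        by rewrite ler_pM// N2_ge0.
      rewrite -subr_ge0 (_ : _ - _ = c ^+ 2 * ((20 * e1 - X) ^+ 2 / 4)); last by field.
      by rewrite mulr_ge0 ?sqr_ge0// divr_ge0// sqr_ge0.
    apply: le_trans (ler_norm _) _.
    rewrite -[leRHS]ger0_norm; first by rewrite -ler_sqr ?nnegrE// !real_normK ?num_real.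
    apply: mulr_ge0; first exact: ltW.
    by rewrite divr_ge0// addr_ge0.
  (* After the mollifier is moved onto [g], the integral is the increment from [a] to [b] of the
     pairing of [v] with the fixed test function [rconv g (cutoff h)]. *)
  have t2 : \int[mu]_x (g x * rconv d (cutoff h) x) <= c * e1.
    rewrite integral_conv_sym//.
    have tG := is_test_conv bg tk'.
    have [H1 [H2 HH]] := weak_linear sv tG.
    have bG := tG.1; have hG := bounded_supp_is_L2 bG.
    pose H r := \int[mu]_x (v x r * rconv g (cutoff h) x).
    have gB : N2 g <= 4 * B by exact: le_trans gX (le_trans XN d4).
    have sB : forall q : R, 0 <= q -> q <= 4 * B -> Num.sqrt q <= Num.sqrt (4 * B).
      by move=> q q0; exact: ler_wsqrtr.
    have CSb (f G : 'rV[R]_n -> R) (C : R) : is_L2 mu f -> is_L2 mu G -> 0 <= C -> N2 f <= B ->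
        N2 G <= C ^+ 2 * (4 * B) -> `|\int[mu]_x (f x * G x)| <= Num.sqrt B * (C * Num.sqrt (4 * B)).
      move=> hf hG' C0 fB GB.
      rewrite -ler_sqr ?nnegrE ?mulr_ge0 ?sqrtr_ge0// real_normK ?num_real//.
      apply: le_trans (Cauchy_Schwarz hf hG') _.
      rewrite !exprMn !sqr_sqrtr ?mulr_ge0//.
      by rewrite ler_pM ?N2_ge0.
    have GN : N2 (rconv g (cutoff h)) <= c ^+ 2 * (4 * B).
      have := sq_int_conv_le hg (bounded_supp_integrable bk).
      rewrite (sq_int_fin hG) (sq_int_fin hg) -EFinM lee_fin => /le_trans; apply.
      have -> : \int[mu]_z `|cutoff h z| = c by apply: eq_Rintegral => z _; rewrite ger0_norm.
      by rewrite ler_wpM2l ?sqr_ge0.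
    have sE x : \sum_(i < n) rconv g (ddcutoff h i) x = rconv g (fun y => \sum_(i < n) ddcutoff h i y) x.
      rewrite /rconv -integral_sum_bounded_supp; last first.
        move=> i; have [_ bd2 _ _] := tk i.
        exact: bounded_supp_mul (bounded_supp_loc bg) (bounded_supp_reflect x bd2).
      by apply: eq_Rintegral => z _; rewrite mulr_sumr.
    have hS : is_L2 mu (rconv g (fun y => \sum_(i < n) ddcutoff h i y)).
      by apply: mrc => //; [exact: hg.1|exact: bD.1].
    have SN : N2 (rconv g (fun y => \sum_(i < n) ddcutoff h i y)) <= K ^+ 2 * (4 * B).
      have := sq_int_conv_le hg (bounded_supp_integrable bD).
      rewrite (sq_int_fin hS) (sq_int_fin hg) -EFinM lee_fin => /le_trans; apply.
      by rewrite ler_wpM2l ?sqr_ge0.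
    have BM := @Bessel_modulus R s H H1 H2 A' B' a b s0.
    have {}BM : `|H b - H a| <= P * (b `^ gm - a `^ gm) + Q * (b `^ s - a `^ s).
      apply: BM => //.
      - by move=> r r0; have [] := HH r r0.
      - by move=> r r0; have [] := HH r r0.
      - by move=> r r0; apply: CSb => //; [exact: (L2v r r0).1|exact: ltW|exact: (L2v r r0).2].
      - move=> r r0; have [_ _ ->] := HH r r0; rewrite normrN.
        under eq_Rintegral do rewrite sE.
        by apply: CSb => //; [exact: (L2v r r0).1|exact: (L2v r r0).2].
      - exact: lt_le_trans bdl dl1.
    have -> : \int[mu]_x (d x * rconv g (cutoff h) x) = H b - H a.
      rewrite /H -RintegralB//; first by apply: eq_Rintegral => x _; rewrite mulrBl.
      - by apply: is_L2_mul_integrable => //; exact: (L2v b b0).1.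
      - by apply: is_L2_mul_integrable => //; exact: (L2v a a0).1.
    apply: le_trans (ler_norm _) _; apply: le_trans BM _; apply: le_trans Hdl.
    have pdl z : 0 <= z -> b `^ z - a `^ z <= dl `^ z.
      move=> z0; apply: (@le_trans _ _ (b `^ z)); first by rewrite gerBl powR_ge0.
      by apply: ple => //; exact: ltW.
    by apply: lerD; [apply: (ler_wpM2l P0); exact/pdl/ltW|apply: (ler_wpM2l Q0); exact/pdl/ltW].
  have : c * X <= c * ((20 * e1 + X) / 2 + e1) by rewrite cX mulrDr lerD.
  rewrite ler_pM2l// => Xe; have -> : e = 22 * e1 by rewrite /e1; field.
  lra.
have := cvg_sq_int_cutoff n0 L2d => cv1.
apply: (ler_cvgn cv1 (cvg_cst e)).
exact: key.
Qed.

End ext_sol_Cauchy.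

(** * Completeness of $L^2$ for rapidly convergent sequences *)

Section L2_complete.
Context d (T : measurableType d) (R : realType) (m : {measure set T -> \bar R}).

(** Comparison of the telescoping series with a geometric one; the tail from [j] on is at most
    $2h/2^j$. It serves both for limits in $L^2$ and for the nested rectangles of the Goursat
    argument. *)
Lemma fast_Cauchy_cvg (w : nat -> R) (h : R) : 0 <= h ->
  (forall k, `|w k.+1 - w k| <= h / 2 ^+ k) ->
  exists l : R, w k @[k --> \oo] --> l /\ forall j, `|l - w j| <= 2 * h / 2 ^+ j.
Proof.
move=> h0 H.
have cs : cvgn (series (telescope w)).
  apply: normed_cvg; apply: (@series_le_cvg R _ (geometric h 2^-1)) => [k|k|k|].
  - exact: normr_ge0.
  - by rewrite geometric_ge0.
  - by rewrite /= /geometric/= exprVn; exact: H.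
  - by apply: is_cvg_geometric_series; rewrite ger0_norm ?invf_lt1// ltr1n.
have cw : w k @[k --> \oo] --> w 0 + limn (series (telescope w)).
  set l := limn _; have E : (fun k => w 0 + series (telescope w) k) = w.
    by apply/funext => k; rewrite -eq_sum_telescope.
  rewrite -[X in X k @[k --> _]]E.
  by apply: cvgD => //; exact: cvg_cst.
exists (w 0 + limn (series (telescope w))); split=> // j.
have bd p : `|w (p + j)%N - w j| <= 2 * h / 2 ^+ j - 2 * h / 2 ^+ (p + j).
  elim: p => [|p IH]; first by rewrite !subrr normr0.
  rewrite addSn -(subrKA (w (p + j)%N)).
  apply: le_trans (ler_normD _ _) _.
  apply: le_trans (lerD (H _) IH) _; rewrite le_eqVlt; apply/orP; left; apply/eqP.
  by rewrite exprS; field; rewrite !expf_neq0.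
have c1 : `|w (p + j)%N - w j| @[p --> \oo] --> `|w 0 + limn (series (telescope w)) - w j|.
  apply: cvg_norm; apply: cvgB; last exact: cvg_cst.
  by rewrite (cvg_shiftn j (fun k => w k)).
apply: (ler_cvgn c1 (cvg_cst _)) => p; apply: le_trans (bd p) _.
by rewrite gerBl divr_ge0// ?mulr_ge0// exprn_ge0.
Qed.

(** Let $H=\sum_k4^k(u_{k+1}-u_k)^2$, so that $\int H\le\sum_k4^k8^{-k}=2$. Where $H$ is finite the
    increments are at most $\sqrt H/2^k$, whence pointwise convergence and $|f-u_k|^2\le4H/4^k$;
    integration gives $8/4^k$. Where $H$ is infinite, $f$ is set to 0. *)
Lemma L2_complete (u : nat -> T -> R) : (forall k, is_L2 m (u k)) ->
  (forall k, (sq_int m (fun x => u k.+1 x - u k x)%R <= (8 ^- k)%:E)%E) ->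
  exists f, is_L2 m f /\ forall k, (sq_int m (fun x => f x - u k x)%R <= (8 / 4 ^+ k)%:E)%E.
Proof.
move=> hu du.
have mu k : measurable_fun setT (u k) := (hu k).1.
pose D k x := 4 ^+ k * (u k.+1 x - u k x) ^+ 2.
have D0 k x : 0 <= D k x by apply: mulr_ge0; [exact: exprn_ge0|exact: sqr_ge0].
have mD k : measurable_fun setT (fun x => (D k x)%:E).
  apply/measurable_EFinP; apply: measurable_funM; first exact: measurable_cst.
  by apply: measurable_funX; apply: measurable_funB.
pose H x := (\sum_(k <oo) (D k x)%:E)%E.
have mH : measurable_fun setT H by apply: ge0_emeasurable_sum => // k x _ _; rewrite lee_fin.
have H0 x : (0 <= H x)%E by apply: nneseries_ge0 => k _ _; rewrite lee_fin.
have IH : (\int[m]_x H x <= 2%:E)%E.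
  rewrite integral_nneseries//; last by move=> k x _; rewrite lee_fin.
  apply: (@le_trans _ _ (\sum_(k <oo) (2 / (2 ^ k.+1)%:R)%:E)%E); last exact: epsilon_trick0.
  apply: lee_nneseries; first by move=> k _ _; apply: integral_ge0 => x _; rewrite lee_fin.
  move=> k _; under eq_integral do rewrite EFinM.
  rewrite ge0_integralZl//.
  - apply: (@le_trans _ _ ((4 ^+ k)%:E * (8 ^- k)%:E)%E).
      by apply: lee_wpmul2l; [rewrite lee_fin exprn_ge0|exact: du].
    rewrite -EFinM lee_fin natrX exprS invfM mulrA divff// mul1r.
    by rewrite (_ : 8 = 4 * 2 :> R) ?exprMn ?invfM ?mulrA ?divff ?mul1r// ?expf_neq0//; ring.
  - by apply/measurable_EFinP; apply: measurable_funX; apply: measurable_funB.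
  - by move=> x _; rewrite lee_fin sqr_ge0.
pose A := [set x | (H x < +oo)%E].
have mA : measurable A.
  by rewrite /A -[X in measurable X]setTI; exact: emeasurable_fun_infty_o.
have cv x : A x -> exists l : R, u k x @[k --> \oo] --> l /\
    forall j, `|l - u j x| <= 2 * Num.sqrt (fine (H x)) / 2 ^+ j.
  move=> Ax; apply: fast_Cauchy_cvg => [|k]; first exact: sqrtr_ge0.
  have fH : H x = (fine (H x))%:E by rewrite fineK// ge0_fin_numE.
  have : ((D k x)%:E <= H x)%E.
    apply: le_trans (@nneseries_lim_ge R (fun k => (D k x)%:E) xpredT 0 k.+1 _); last first.
      by move=> i _ _; rewrite lee_fin.
    rewrite big_nat_recr//= leeDr//; apply: sume_ge0 => i _; by rewrite lee_fin.
  move=> DH; rewrite fH lee_fin /D in DH.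
  rewrite ler_pdivlMr ?exprn_gt0// -ler_sqr ?nnegrE ?sqrtr_ge0// ?mulr_ge0// ?exprn_ge0//.
  rewrite exprMn real_normK ?num_real// sqr_sqrtr; last by rewrite fine_ge0.
  by apply: le_trans DH; rewrite -exprM muln2 -mul2n exprM mulrC (_ : 2 ^+ 2 = 4 :> R)//; ring.
pose u' k x := u k x * \1_A x.
have /choice[f Hf] : forall x, exists l : R, u' k x @[k --> \oo] --> l /\
    (A x -> forall j, `|l - u j x| <= 2 * Num.sqrt (fine (H x)) / 2 ^+ j).
  move=> x; have [Ax|Ax] := pselect (A x).
    have [l [ul lb]] := cv x Ax; exists l; split=> //.
    by rewrite /u'; under eq_fun do rewrite indicE mem_set// mulr1.
  exists 0; split=> //; rewrite /u'; under eq_fun do rewrite indicE memNset// mulr0.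
  exact: cvg_cst.
have mf : measurable_fun setT f.
  apply: (@measurable_fun_cvg _ _ _ _ u') => [k|x _]; last exact: (Hf x).1.
  by apply: measurable_funM; [exact: mu|exact: measurable_indic].
have bd k : (sq_int m (fun x => f x - u k x)%R <= (8 / 4 ^+ k)%:E)%E.
  apply: (@le_trans _ _ (\int[m]_x ((4 / 4 ^+ k)%:E * H x))%E).
    apply: ge0_le_integral => //.
    - by move=> x _; rewrite lee_fin sqr_ge0.
    - by apply/measurable_EFinP; apply: measurable_funX; apply: measurable_funB.
    - exact: measurable_funeM.
    (* Off [A] the dominating function is infinite, so the pointwise bound holds there as well. *)
    move=> x _; have [Ax|] := pselect (A x); last first.
      move=> /negP; rewrite -leNgt leye_eq => /eqP ->.
      by rewrite gt0_muley ?leey// lte_fin divr_gt0// exprn_gt0.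
    have fH : H x = (fine (H x))%:E by rewrite fineK// ge0_fin_numE.
    rewrite fH -EFinM lee_fin; have bb := (Hf x).2 Ax k.
    set q := 2 * Num.sqrt _ / _ in bb.
    have q0 : 0 <= q by rewrite divr_ge0 ?mulr_ge0 ?sqrtr_ge0 ?exprn_ge0.
    apply: (@le_trans _ _ (q ^+ 2)).
      by rewrite -real_normK ?num_real// ler_sqr ?nnegrE.
    rewrite /q.
    rewrite expr_div_n exprMn sqr_sqrtr; last by rewrite fine_ge0.
    rewrite -exprM mulnC exprM (_ : 2 ^+ 2 = 4 :> R); last by ring.
    by rewrite mulrAC.
  rewrite ge0_integralZl//.
  apply: le_trans (lee_wpmul2l _ IH) _; first by rewrite lee_fin divr_ge0// exprn_ge0.
  by rewrite -EFinM lee_fin mulrAC -natrM.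
exists f; split=> //.
have -> : f = (fun x => (f x - u 0 x) + u 0 x) by apply/funext => x; rewrite subrK.
apply: is_L2D (hu 0); split; first exact: measurable_funB.
by apply: le_lt_trans (bd 0) _; rewrite ltry.
Qed.

End L2_complete.

(** * The Poisson kernel *)

Section integral_powR.
Variable R : realType.
Local Notation lb := (@lebesgue_measure R).

Lemma integral_powR_itv (r a b : R) : 0 < a -> a < b -> r + 1 != 0 ->
  (\int[lb]_(x in `[a, b]) (x `^ r)%:E)%E = ((b `^ (r + 1) - a `^ (r + 1)) / (r + 1))%:E.
Proof.
move=> a0 ab r1; have D (q x : R) : 0 < x -> is_derive x 1 (fun y => y `^ q) (q * x `^ (q - 1)).
  by move=> x0; exact: is_derive1_powR.
have dF (x : R) : 0 < x -> is_derive x 1 (fun y => y `^ (r + 1) / (r + 1)) (x `^ r).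
  move=> x0; have h := is_deriveM (D (r + 1) x x0) (is_derive_cst (r + 1)^-1 x (1 : R)).
  by apply: is_derive_eq h _; rewrite /GRing.scale/= mulr0 add0r addrK mulrA mulVf// mul1r.
have cF (x : R) : 0 < x -> {for x, continuous (fun y : R => y `^ (r + 1) / (r + 1))}.
  by move=> x0; apply: differentiable_continuous; apply/derivable1_diffP; have [] := dF x x0.
have cf (x : R) : 0 < x -> {for x, continuous (fun y : R => y `^ r)}.
  by move=> x0; apply: differentiable_continuous; apply/derivable1_diffP; have [] := D r x x0.
have b0 := lt_trans a0 ab.
rewrite (@continuous_FTC2 R (fun x => x `^ r) (fun y => y `^ (r + 1) / (r + 1)) a b ab).
- by rewrite -EFinB -mulrBl.
- apply: continuous_in_subspaceT => x; rewrite inE/= in_itv/= => /andP[ax _].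
  by apply: cf; exact: lt_le_trans ax.
- split.
  + move=> x; rewrite in_itv/= => /andP[ax _]; have [] := dF x (lt_trans a0 ax) => //.
  + by apply: cvg_at_right_filter; exact: cF.
  + by apply: cvg_at_left_filter; exact: cF.
- move=> x; rewrite in_itv/= => /andP[ax _].
  by rewrite derive1E; have [_ ->] := dF x (lt_trans a0 ax).
Qed.

(** Exhaustion by Fatou: it passes from compact intervals, where the primitive is explicit, to
    intervals ending at the singularity or at infinity. *)
Lemma integral_indic_le (f : R -> R) (I : nat -> set (measurableTypeR R)) (A : set (measurableTypeR R)) (c : \bar R) :
  measurable_fun [set: measurableTypeR R] f -> (forall x, 0 <= f x) -> measurable A -> (forall k, measurable (I k)) ->
  (forall k, I k `<=` A) -> (forall x, A x -> \forall k \near \oo, I k x) ->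
  (forall k, \int[lb]_(x in I k) (f x)%:E <= c)%E -> (\int[lb]_(x in A) (f x)%:E <= c)%E.
Proof.
move=> mf f0 mA mI IA Ik Hc.
have E (B : set (measurableTypeR R)) : measurable B -> (\int[lb]_(x in B) (f x)%:E = \int[lb]_x (f x * \1_B x)%:E)%E.
  move=> mB; rewrite integral_mkcond; apply: eq_integral => x _.
  by rewrite patchE indicE; case: ifP => _; rewrite ?mulr1 ?mulr0.
rewrite E//; apply: (@fatou_le _ _ _ lb (fun k x => f x * \1_(I k) x)).
- move=> k; apply: (@measurable_funM _ (measurableTypeR R) R setT f (\1_(I k)) mf).
  exact: (@measurable_indic _ (measurableTypeR R)).
- by move=> k x; rewrite mulr_ge0// indicE.
- move=> x; rewrite !indicE; have [Ax|Ax] := pselect (A x).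
    rewrite mem_set// mulr1; apply: (@cvg_near_cst).
    have := Ik x Ax; apply: filterS => k Ikx; by rewrite indicE mem_set// mulr1.
  rewrite memNset// mulr0; apply: (@cvg_near_cst); apply: nearW => k.
  by rewrite indicE memNset ?mulr0// => /IA.
- by move=> k; rewrite -(E (I k) (mI k)); exact: Hc.
Qed.

Lemma integral_powR_le1 (r : R) : -1 < r -> (\int[lb]_(x in `]0%R, 1%R]) (x `^ r)%:E <= (1 / (r + 1))%:E)%E.
Proof.
move=> r1; have r10 : 0 < r + 1 by lra.
have h (k : nat) : k.+2%:R^-1 < 1 :> R by rewrite invf_lt1// ltr1n.
apply: (@integral_indic_le (fun x => x `^ r) (fun k => `[k.+2%:R^-1, 1]%classic)) => //.
- by move=> x; exact: powR_ge0.
- by move=> k x /=; rewrite !in_itv/= => /andP[kx ->]; rewrite andbT (lt_le_trans _ kx)// invr_gt0.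
- move=> x; rewrite /= in_itv/= => /andP[x0 x1].
  have := near_infty_natSinv_lt (PosNum x0); apply: filterS => k /= kx.
  rewrite /= in_itv/= x1 andbT; apply: ltW; apply: le_lt_trans kx.
  by rewrite lef_pV2 ?posrE// ler_nat.
- move=> k; rewrite integral_powR_itv ?gt_eqF// lee_fin ler_pM2r ?invr_gt0//.
  by rewrite powR1 gerBl powR_ge0.
Qed.

Lemma integral_powR_ge1 (r : R) : r < -1 -> (\int[lb]_(x in `[1%R, +oo[) (x `^ r)%:E <= (1 / (- r - 1))%:E)%E.
Proof.
move=> r1; have r10 : 0 < - r - 1 by lra.
apply: (@integral_indic_le (fun x => x `^ r) (fun k => `[1, k.+2%:R]%classic)) => //.
- by move=> x; exact: powR_ge0.
- by move=> k x /=; rewrite !in_itv/= => /andP[-> _].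
- move=> x; rewrite /= in_itv/= andbT => x1.
  exists (Num.truncn x) => // k /= kx; rewrite in_itv/= x1/=.
  apply: ltW; apply: lt_le_trans (truncnS_gt x) _; rewrite ler_nat.
  by rewrite (leq_trans _ (leqnSn _)).
- move=> k; rewrite integral_powR_itv ?ltr1n//; last by rewrite lt_eqF//; lra.
  rewrite lee_fin powR1 -[leLHS]mulrNN -invrN opprB opprD ler_pM2r ?invr_gt0//.
Qed.

(** The one-dimensional comparison function of the development: integrable exactly because $b<1$
    tames the origin and $q>1$ tames infinity. With [b = 0] it is $\min(1,|w|^{-q})$ for $q\ge0$. *)
Definition two_powers (b q : R) (w : R) : R := if `|w| <= 1 then `|w| `^ (- b) else `|w| `^ (- q).

Lemma two_powers_ge0 b q w : 0 <= two_powers b q w.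
Proof. by rewrite /two_powers; case: ifP => _; exact: powR_ge0. Qed.

Lemma measurable_two_powers b q : measurable_fun setT (two_powers b q).
Proof.
have mp (r : R) : measurable_fun setT (fun w : R => `|w| `^ r).
  by apply: (measurableT_comp (measurable_powR r)).
apply: measurable_fun_ifT => //.
by apply: measurable_fun_ler => //; exact: measurable_cst.
Qed.

Lemma integral_two_powers (b q : R) : b < 1 -> 1 < q ->
  (\int[lb]_w (two_powers b q w)%:E <= (2 / (1 - b) + 2 / (q - 1))%:E)%E.
Proof.
move=> b1 q1; set f := two_powers b q.
have f0 x : (0 <= (f x)%:E)%E by rewrite lee_fin two_powers_ge0.
have mf : measurable_fun setT (EFin \o f) by apply/measurable_EFinP; exact: measurable_two_powers.
have half : (\int[lb]_(w in `[0%R, +oo[) (f w)%:E <= (1 / (1 - b) + 1 / (q - 1))%:E)%E.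
  rewrite -integral_itv_obnd_cbnd; last exact: measurable_funTS.
  have i01 : (BRight (0 : R) <= BRight 1)%O by rewrite bnd_simp.
  have i1y : (BRight (1 : R) <= +oo)%O by [].
  rewrite (itv_bndbnd_setU i01 i1y) ge0_integral_setU//=; first last.
  - rewrite disj_set2E; apply/eqP/seteqP; split=> // x [] /=; rewrite !in_itv/= andbT => /andP[_ x1] /(le_lt_trans x1).
    by rewrite ltxx.
  - exact: measurable_funTS.
  have E1 : -1 < - b by lra.
  have E2 : - q < -1 by lra.
  rewrite EFinD; apply: leeD.
    have := integral_powR_le1 E1; rewrite (_ : - b + 1 = 1 - b); last by ring.
    apply: le_trans; rewrite le_eqVlt; apply/orP; left; apply/eqP; apply: eq_integral => x.
    rewrite inE/= in_itv/= => /andP[x0 x1]; by rewrite /f /two_powers gtr0_norm// x1.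
  have := integral_powR_ge1 E2; rewrite opprK; apply: le_trans.
  rewrite -integral_itv_obnd_cbnd; last first.
    by apply/measurable_EFinP; apply: measurable_funTS; exact: measurable_powR.
  rewrite le_eqVlt; apply/orP; left; apply/eqP; apply: eq_integral => x.
  rewrite inE/= in_itv/= andbT => x1; have x0 : 0 < x by apply: lt_trans x1.
  by rewrite /f /two_powers gtr0_norm// leNgt x1.
pose g (x : R) : R := f x * \1_(`[0, +oo[%classic : set (measurableTypeR R)) x.
have g0 x : 0 <= g x by rewrite mulr_ge0 ?two_powers_ge0// indicE.
have mg : measurable_fun [set: measurableTypeR R] g.
  apply: (@measurable_funM _ (measurableTypeR R)); first exact: measurable_two_powers.
  exact: (@measurable_indic _ (measurableTypeR R)).
have mEg : measurable_fun [set: measurableTypeR R] (EFin \o g) by exact/measurable_EFinP.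
have mEgN : measurable_fun [set: measurableTypeR R] (fun x : R => (g (- x))%:E).
  by apply/measurable_EFinP; apply: (measurableT_comp mg); exact: oppr_measurable.
have gE : (\int[lb]_x (g x)%:E = \int[lb]_(x in `[0%R, +oo[) (f x)%:E)%E.
  rewrite [RHS]integral_mkcond; apply: eq_integral => x _.
  by rewrite patchE /g indicE; case: ifP => _; rewrite ?mulr1 ?mulr0.
have gN : (\int[lb]_x (g (- x))%:E = \int[lb]_x (g x)%:E)%E.
  have a0 : (-1 != 0 :> R) by rewrite oppr_eq0 oner_eq0.
  have h0 (x : measurableTypeR R) : (0 <= (EFin \o g) x)%E by rewrite lee_fin.
  have := ge0_integral_affine 0 a0 mEg h0; rewrite normrN1 invr1 mul1e => <-.
  by apply: eq_integral => x _; rewrite /= mulN1r addr0.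
apply: (@le_trans _ _ (\int[lb]_x ((g x)%:E + (g (- x))%:E))%E).
  apply: ge0_le_integral => //.
  - exact: (@emeasurable_funD _ (measurableTypeR R)).
  move=> x _; rewrite -EFinD lee_fin; have [x0|x0] := leP 0 x.
    apply: (@le_trans _ _ (g x)); last by rewrite lerDl.
    by rewrite /g indicE mem_set ?mulr1//= in_itv/= x0.
  apply: (@le_trans _ _ (g (- x))); last by rewrite lerDr.
  rewrite /g indicE mem_set ?mulr1//=; last by rewrite in_itv/= oppr_ge0 ltW.
  by rewrite /f /two_powers normrN.
rewrite ge0_integralD//; [|by move=> x _; rewrite lee_fin..].
rewrite gN gE; apply: le_trans (leeD half half) _.
by rewrite -EFinD lee_fin le_eqVlt; apply/orP; left; apply/eqP; ring.
Qed.

(** [Gamma] is a real-valued integral, which would be 0 if the integral diverged; positivity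
    therefore needs convergence first, by comparison with [two_powers (1 - t) 2], and then a
    positive contribution from the interval from 1 to 2. *)
Lemma Gamma_gt0 (t : R) : 0 < t -> 0 < Gamma t.
Proof.
move=> t0; rewrite /Gamma; set f := fun x : R => x `^ (t - 1) * expR (- x).
have f0 x : 0 <= f x by rewrite mulr_ge0 ?powR_ge0 ?expR_ge0.
have mf : measurable_fun [set: measurableTypeR R] f.
  apply: (@measurable_funM _ (measurableTypeR R)); first exact: measurable_powR.
  by apply: (measurableT_comp (@measurable_expR R)).
have mEf : measurable_fun [set: measurableTypeR R] (EFin \o f) by exact/measurable_EFinP.
pose N := (Num.truncn (t + 1)).+1.
have tN : t + 1 <= N%:R by rewrite ltW// truncnS_gt.
have N0 : 0 < N%:R :> R by rewrite ltr0n.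
pose C : R := 1 + N%:R ^+ N.
have C1 : 1 <= C by rewrite lerDl exprn_ge0.
have fC x : 0 < x -> f x <= C * two_powers (1 - t) 2 x.
  move=> x0; rewrite /f /two_powers gtr0_norm//; case: ifPn => x1.
    rewrite opprB mulrC; apply: ler_wpM2r; first exact: powR_ge0.
    by apply: le_trans C1; rewrite expR_le1 oppr_le0 ltW.
  rewrite -ltNge in x1.
  (* From $x/N\le e^{x/N}$ raised to the power [N], with $N\ge t+1$ and $x>1$. *)
  have e1 : x `^ (t + 1) <= N%:R ^+ N * expR x.
    apply: (@le_trans _ _ (x ^+ N)).
      by rewrite -powR_mulrn; [apply: ler_powR => //; exact: ltW|exact: ltW].
    have -> : expR x = expR (x / N%:R) ^+ N.
      by rewrite -expRM_natl mulr_natl -mulr_natr divfK// gt_eqF.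
    rewrite -exprMn; apply: lerXn2r; rewrite ?nnegrE ?mulr_ge0 ?expR_ge0 ?(ltW x0) ?(ltW N0)//.
    rewrite -ler_pdivrMl// mulrC; apply: le_trans (expR_ge1Dx _).
    by rewrite lerDr.
  rewrite expRN ler_pdivrMr ?expR_gt0//.
  rewrite (_ : t - 1 = (t + 1) + (- 2)); last by ring.
  rewrite powRD; last by rewrite (gt_eqF x0) implybT.
  rewrite mulrAC ler_wpM2r ?powR_ge0//; apply: le_trans e1 _.
  by rewrite ler_wpM2r ?expR_ge0// /C lerDr.
have fin : (\int[lb]_(x in `]0%R, +oo[) (f x)%:E < +oo)%E.
  have := integral_two_powers (b := 1 - t) (q := 2); rewrite ltr1n.
  have t1 : 1 - t < 1 by lra.
  move=> /(_ t1 isT) H.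
  apply: (@le_lt_trans _ _ (\int[lb]_x (C%:E * (two_powers (1 - t) 2 x)%:E))%E); last first.
    rewrite ge0_integralZl//.
    - by apply: lte_mul_pinfty; rewrite ?lee_fin ?(le_trans ler01)//; apply: le_lt_trans H _; rewrite ltry.
    - by apply/measurable_EFinP; exact: measurable_two_powers.
    - by move=> x _; rewrite lee_fin two_powers_ge0.
    - by rewrite lee_fin (le_trans ler01).
  apply: (@le_trans _ _ (\int[lb]_(x in `]0%R, +oo[) (C%:E * (two_powers (1 - t) 2 x)%:E))%E).
    apply: ge0_le_integral => //.
    - by move=> x _; rewrite lee_fin.
    - exact: measurable_funTS.
    - by apply: measurable_funTS; apply: measurable_funeM; apply/measurable_EFinP; exact: measurable_two_powers.
    - by move=> x; rewrite /= in_itv/= andbT => x0; rewrite -EFinM lee_fin fC.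
  apply: ge0_subset_integral => //.
    by apply: measurable_funeM; apply/measurable_EFinP; exact: measurable_two_powers.
  by move=> x _; rewrite mule_ge0// lee_fin ?two_powers_ge0// (le_trans ler01).
rewrite /Rintegral fine_gt0// fin andbT.
pose q : R := Num.min 1 (2 `^ (t - 1)) * expR (- 2).
have q0 : 0 < q by rewrite mulr_gt0 ?expR_gt0// lt_min ltr01 powR_gt0.
apply: (@lt_le_trans _ _ (\int[lb]_(x in `[1%R, 2%R]) q%:E)%E).
  rewrite integral_cst//= lebesgue_measure_itv/= lte_fin ltr1n -EFinB -EFinM lte_fin.
  by rewrite mulr_gt0// subr_gt0 ltr1n.
apply: (@le_trans _ _ (\int[lb]_(x in `[1%R, 2%R]) (f x)%:E)%E).
  apply: ge0_le_integral => //.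
  - by move=> x _; rewrite lee_fin ltW.
  - exact: measurable_funTS.
  move=> x; rewrite /= in_itv/= => /andP[x1 x2]; rewrite lee_fin /q /f.
  apply: ler_pM; rewrite ?expR_ge0 ?ler_expR ?lerN2//.
  rewrite ge_min; have [h|h] := leP 0 (t - 1).
    by apply/orP; left; rewrite -[leLHS](powRr0 x); apply: ler_powR.
  apply/orP; right; rewrite -(opprK (t - 1)) (powRN x) (powRN 2).
  rewrite lef_pV2 ?posrE ?powR_gt0//; last exact: lt_le_trans x1.
  have h' : 0 <= - (t - 1) by rewrite oppr_ge0 ltW.
  by apply: (ge0_ler_powR h') => //; rewrite nnegrE// (le_trans ler01).
apply: ge0_subset_integral => //.
- exact: measurable_funTS.
- by move=> x _; rewrite lee_fin.
- by move=> x; rewrite /= !in_itv/= andbT => /andP[x1 _]; exact: lt_le_trans x1.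
Qed.

End integral_powR.

Lemma ge0_integral_prod (R : realType) n (g : 'I_n -> R -> R) :
  (forall i, measurable_fun [set: measurableTypeR R] (g i)) -> (forall i x, 0 <= g i x) ->
  (\int[lebesgue_rV R n]_x (\prod_(i < n) g i (x ord0 i))%:E =
   \prod_(i < n) \int[@lebesgue_measure R]_w (g i w)%:E)%E.
Proof.
elim: n g => [|n IH] g mg g0.
  rewrite big_ord0; under eq_integral do rewrite big_ord0.
  by rewrite integral_cst//= diracT mul1e.
have mP m (h : 'I_m -> R -> R) : (forall i, measurable_fun [set: measurableTypeR R] (h i)) ->
    measurable_fun setT (fun x : 'rV[R]_m => (\prod_(i < m) h i (x ord0 i))%:E).
  move=> mh; apply/measurable_EFinP; apply: measurable_prod => i _.
  by apply: (measurableT_comp (mh i)); exact: measurable_rV_coord.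
rewrite ge0_integral_rV_cons; [|exact: mP|by move=> x; rewrite lee_fin prodr_ge0].
rewrite big_ord_recl -IH//.
have P0 (v : 'rV[R]_n) : 0 <= \prod_(i < n) g (lift ord0 i) (v ord0 i) by exact: prodr_ge0.
rewrite -ge0_integralZr//; first last.
- by apply: integral_ge0 => v _; rewrite lee_fin.
- by move=> x _; rewrite lee_fin.
- exact/measurable_EFinP.
apply: eq_integral => r _; have mPn := mP n (fun i => g (lift ord0 i)) (fun i => mg _).
rewrite -ge0_integralZl//; try first [by move=> v _; rewrite lee_fin|by rewrite lee_fin].
apply: eq_integral => v _; rewrite big_ord_recl rV_cons0 EFinM; congr (_ * _%:E)%E.
by apply: eq_bigr => i _; rewrite rV_consS.
Qed.

Lemma is_derive_inv (R : realType) (f : R -> R) (t df : R) : f t != 0 -> is_derive t (1 : R) f df ->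
  is_derive t (1 : R) (fun x => (f x)^-1) (- df / f t ^+ 2).
Proof.
move=> f0 h; apply: is_derive_eq (is_deriveV f0 h) _.
by rewrite /GRing.scale/= !mulNr mulrC.
Qed.

(** * The unnormalised Poisson kernel, its derivatives, and its equation *)

Section Poisson_kernel.
Variables (R : realType) (n : nat) (s : R).
Hypothesis s0 : 0 < s.
Local Notation mu := (lebesgue_rV R n).
Local Notation E i := (delta_mx ord0 i : 'rV[R]_n).
Local Notation p := ((n%:R + s) / 2).
Implicit Types (r : R) (x : 'rV[R]_n).

Let p0 : 0 < p.
Proof. by rewrite divr_gt0// ltr_wpDl. Qed.

Definition sq_dist r x : R := r ^+ 2 + \sum_(i < n) x ord0 i ^+ 2.

Definition poisson r x : R := r `^ s * sq_dist r x `^ (- p).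

(** This and the following derivatives are written as the kernel times a rational function, so that
    bounds reduce to $1/r$, $x_i/|\cdot|^2$ and the like, and the differential equation to an
    identity checked by [field]. *)
Definition poisson_r r x := poisson r x * (s / r - 2 * p * (r / sq_dist r x)).

Definition poisson_rr r x := poisson r x *
  (s * (s - 1) / r ^+ 2 - 2 * p * (2 * s + 1) / sq_dist r x + 4 * p * (p + 1) * r ^+ 2 / sq_dist r x ^+ 2).

Definition poisson_i i r x := poisson r x * (- 2 * p * (x ord0 i / sq_dist r x)).

Definition poisson_ii i r x := poisson r x *
  (- 2 * p / sq_dist r x + 4 * p * (p + 1) * x ord0 i ^+ 2 / sq_dist r x ^+ 2).

Lemma sq_dist_ge r x : r ^+ 2 <= sq_dist r x.
Proof. by rewrite lerDl sumr_ge0// => i _; exact: sqr_ge0. Qed.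

Lemma sq_dist_gt0 r x : 0 < r -> 0 < sq_dist r x.
Proof. by move=> r0; apply: lt_le_trans (sq_dist_ge r x); rewrite exprn_gt0. Qed.

Lemma poisson_gt0 r x : 0 < r -> 0 < poisson r x.
Proof. by move=> r0; rewrite mulr_gt0// powR_gt0// sq_dist_gt0. Qed.

Lemma is_derive_powR (a y : R) : 0 < y -> is_derive y (1 : R) (fun y => y `^ a) (y `^ a * (a / y)).
Proof.
move=> y0; apply: is_derive_eq (is_derive1_powR a y0) _.
by rewrite powRD ?(gt_eqF y0) ?implybT// powR_inv1 ?ltW//; ring.
Qed.

Let is_derive_sq_dist r x : is_derive r (1 : R) (sq_dist^~ x) (2 * r).
Proof.
have h := is_deriveD (is_deriveX 2 (is_derive_id r (1 : R))) (is_derive_cst (\sum_(i < n) x ord0 i ^+ 2) r (1 : R)).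
by apply: is_derive_eq h _; rewrite addr0 /GRing.scale/= expr1 mulr1.
Qed.

Let is_derive_poisson r x : 0 < r -> is_derive r (1 : R) (poisson^~ x) (poisson_r r x).
Proof.
move=> r0; have q0 := sq_dist_gt0 x r0.
have h := @is_derive1_comp R (fun y => y `^ (- p)) (sq_dist^~ x) r _ _ (is_derive_powR (- p) q0) (is_derive_sq_dist r x).
apply: is_derive_eq (is_deriveM (is_derive_powR s r0) h) _.
rewrite /poisson_r /poisson /GRing.scale/=; field.
by rewrite !gt_eqF.
Qed.

Let is_derive_inv_sq_dist r x : 0 < r ->
  is_derive r (1 : R) (fun r => (sq_dist r x)^-1) (- (2 * r) / sq_dist r x ^+ 2).
Proof.
move=> r0; have q0 := lt0r_neq0 (sq_dist_gt0 x r0).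
exact: (@is_derive_inv R (sq_dist^~ x) r _ q0 (is_derive_sq_dist r x)).
Qed.

Let is_derive_poisson_r r x : 0 < r -> is_derive r (1 : R) (poisson_r^~ x) (poisson_rr r x).
Proof.
move=> r0; have q0 := sq_dist_gt0 x r0.
have hi : is_derive r (1 : R) (fun r : R => r^-1) (- r ^- 2).
  apply: is_derive_eq (is_derive_inv (lt0r_neq0 r0) (is_derive_id r (1 : R))) _.
  by rewrite mulNr mul1r.
have h1 := @is_deriveZ R R R _ s r 1 _ hi.
have h2 := @is_deriveZ R R R _ (2 * p) r 1 _ (is_deriveM (is_derive_id r (1 : R)) (is_derive_inv_sq_dist x r0)).
have h3 : is_derive r (1 : R) (fun r => s / r - 2 * p * (r / sq_dist r x))
    (- s / r ^+ 2 - 2 * p * ((sq_dist r x)^-1 - 2 * r ^+ 2 / sq_dist r x ^+ 2)).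
  apply: is_derive_eq (is_deriveB h1 h2) _.
  by rewrite /GRing.scale/=; field; rewrite !gt_eqF.
apply: is_derive_eq (is_deriveM (is_derive_poisson x r0) h3) _.
rewrite /poisson_rr /poisson_r /GRing.scale/=; field.
by rewrite !gt_eqF.
Qed.

Let line_sq_dist r i x t : is_derive t (1 : R) (fun h : R => sq_dist r (x + h *: E i)) (2 * (x + t *: E i) ord0 i).
Proof.
have h : is_derive t (1 : R) (fun h : R => r ^+ 2 + (\sum_(j < n | j != i) x ord0 j ^+ 2) + (x ord0 i + h) ^+ 2) (2 * (x ord0 i + t)).
  have h1 := is_deriveD (is_derive_cst (x ord0 i) t (1 : R)) (is_derive_id t (1 : R)).
  have h2 := is_deriveD (is_derive_cst (r ^+ 2 + \sum_(j < n | j != i) x ord0 j ^+ 2) t (1 : R)) (is_deriveX 2 h1).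
  apply: is_derive_eq h2 _.
  by rewrite !add0r /GRing.scale/= !fctE expr1 mulr1.
have e (u : R) : (x + u *: E i) ord0 i = x ord0 i + u by rewrite !mxE !eqxx mulr1.
rewrite e (_ : (fun h0 : R => _) = (fun h : R => r ^+ 2 + (\sum_(j < n | j != i) x ord0 j ^+ 2) + (x ord0 i + h) ^+ 2))//.
apply/funext => u; rewrite /sq_dist (bigD1 i)//= e addrA addrAC; congr (_ + _ + _).
by apply: eq_bigr => j ji; rewrite !mxE (negbTE ji) andbF mulr0 addr0.
Qed.

Let line_poisson r i : 0 < r -> line_derive (E i) (poisson r) (poisson_i i r).
Proof.
move=> r0 x t; have q0 := sq_dist_gt0 (x + t *: E i) r0.
have h := @is_derive1_comp R (fun y => y `^ (- p)) (fun h : R => sq_dist r (x + h *: E i)) t _ _ (is_derive_powR (- p) q0) (line_sq_dist r i x t).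
apply: is_derive_eq (@is_deriveZ R R R _ (r `^ s) t 1 _ h) _.
rewrite /poisson_i /poisson /GRing.scale/=; field.
by rewrite !gt_eqF.
Qed.

Let line_poisson_i r i : 0 < r -> line_derive (E i) (poisson_i i r) (poisson_ii i r).
Proof.
move=> r0 x t; have q0 := sq_dist_gt0 (x + t *: E i) r0.
have hv := @is_derive_inv R (fun h : R => sq_dist r (x + h *: E i)) t _ (lt0r_neq0 q0) (line_sq_dist r i x t).
have e (u : R) : (x + u *: E i) ord0 i = x ord0 i + u by rewrite !mxE !eqxx mulr1.
have h1 : is_derive t (1 : R) (fun h : R => (x + h *: E i) ord0 i) 1.
  under eq_fun do rewrite e.
  by apply: is_derive_eq (is_deriveD (is_derive_cst (x ord0 i) t (1 : R)) (is_derive_id t (1 : R))) _; rewrite add0r.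
have h2 := @is_deriveZ R R R _ (- 2 * p) t 1 _ (is_deriveM h1 hv).
have h3 : is_derive t (1 : R) (fun h : R => - 2 * p * ((x + h *: E i) ord0 i / sq_dist r (x + h *: E i)))
    (- 2 * p * ((sq_dist r (x + t *: E i))^-1 - 2 * (x + t *: E i) ord0 i ^+ 2 / sq_dist r (x + t *: E i) ^+ 2)).
  apply: is_derive_eq h2 _.
  by rewrite /GRing.scale/=; field; rewrite !gt_eqF.
apply: is_derive_eq (is_deriveM (line_poisson i r0 x t) h3) _.
rewrite /poisson_ii /poisson_i /GRing.scale/=; field.
by rewrite !gt_eqF.
Qed.

(** Uniform in all [x], since the convolution integrates over the whole space, and local in [r] away
    from 0. *)
Definition bounded_on_strips (w : R -> 'rV[R]_n -> R) := forall a b : R, 0 < a ->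
  exists M : R, forall r x, a <= r <= b -> `|w r x| <= M.

Let poisson_pos_bound a b : 0 < a -> exists2 P : R, 0 <= P & forall r x, a <= r <= b -> `|poisson r x| <= P.
Proof.
move=> a0; exists (b `^ s * (a ^+ 2) `^ (- p)); first by rewrite mulr_ge0// powR_ge0.
move=> r x /andP[ar rb]; have r0 := lt_le_trans a0 ar.
rewrite gtr0_norm ?poisson_gt0// /poisson; apply: ler_pM; rewrite ?powR_ge0//.
  by apply: (ge0_ler_powR (ltW s0)); rewrite ?nnegrE ?(ltW r0) ?(le_trans (ltW r0) rb).
have a2 : 0 < a ^+ 2 by rewrite exprn_gt0.
rewrite !powRN lef_pV2 ?posrE ?powR_gt0 ?sq_dist_gt0//.
apply: (ge0_ler_powR (ltW p0)); rewrite ?nnegrE ?(ltW a2) ?(ltW (sq_dist_gt0 x r0))//.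
apply: le_trans (sq_dist_ge r x); rewrite ler_sqr ?nnegrE//; exact: ltW.
Qed.

Let bounded_poisson_mul (w : R -> 'rV[R]_n -> R) : bounded_on_strips w ->
  bounded_on_strips (fun r x => poisson r x * w r x).
Proof.
move=> bw a b a0; have [P P0 HP] := poisson_pos_bound b a0; have [M HM] := bw a b a0.
by exists (P * M) => r x ab; rewrite normrM ler_pM ?HP ?HM.
Qed.

Lemma bounded_poisson : bounded_on_strips poisson.
Proof. by move=> a b /(poisson_pos_bound b)[P _ HP]; exists P. Qed.

Let bounded_cst_mul (w : R -> 'rV[R]_n -> R) (c : R) : bounded_on_strips w ->
  bounded_on_strips (fun r x => c * w r x).
Proof.
move=> bw a b a0; have [M HM] := bw a b a0.
by exists (`|c| * M) => r x ab; rewrite normrM ler_wpM2l ?HM.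
Qed.

Let bounded_add (w w' : R -> 'rV[R]_n -> R) : bounded_on_strips w -> bounded_on_strips w' ->
  bounded_on_strips (fun r x => w r x + w' r x).
Proof.
move=> bw bw' a b a0; have [M HM] := bw a b a0; have [M' HM'] := bw' a b a0.
by exists (M + M') => r x ab; apply: le_trans (ler_normD _ _) _; rewrite lerD ?HM ?HM'.
Qed.

Let bounded_mul (w w' : R -> 'rV[R]_n -> R) : bounded_on_strips w -> bounded_on_strips w' ->
  bounded_on_strips (fun r x => w r x * w' r x).
Proof.
move=> bw bw' a b a0; have [M HM] := bw a b a0; have [M' HM'] := bw' a b a0.
by exists (M * M') => r x ab; rewrite normrM ler_pM ?HM ?HM'.
Qed.

Let bounded_r : bounded_on_strips (fun r _ => r).
Proof. by move=> a b a0; exists b => r x /andP[ar rb]; rewrite gtr0_norm// (lt_le_trans a0). Qed.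

Let bounded_rV : bounded_on_strips (fun r _ => r^-1).
Proof.
move=> a b a0; exists a^-1 => r x /andP[ar rb]; have r0 := lt_le_trans a0 ar.
by rewrite gtr0_norm ?invr_gt0// lef_pV2.
Qed.

Let bounded_qV : bounded_on_strips (fun r x => (sq_dist r x)^-1).
Proof.
move=> a b a0; exists (a ^+ 2)^-1 => r x /andP[ar rb]; have r0 := lt_le_trans a0 ar.
have q0 := sq_dist_gt0 x r0.
rewrite gtr0_norm ?invr_gt0// lef_pV2 ?posrE ?exprn_gt0//.
by apply: le_trans (sq_dist_ge r x); rewrite ler_sqr ?nnegrE// ltW.
Qed.

Let bounded_x2q i : bounded_on_strips (fun r x => x ord0 i ^+ 2 / sq_dist r x).
Proof.
move=> a b a0; exists 1 => r x /andP[ar rb]; have r0 := lt_le_trans a0 ar.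
have q0 := sq_dist_gt0 x r0.
rewrite ger0_norm ?divr_ge0 ?sqr_ge0 ?(ltW q0)// ler_pdivrMr// mul1r.
rewrite /sq_dist (bigD1 i)//= addrCA lerDl addr_ge0 ?sqr_ge0//.
by apply: sumr_ge0 => j _; exact: sqr_ge0.
Qed.

Let bounded_xq i : bounded_on_strips (fun r x => x ord0 i / sq_dist r x).
Proof.
move=> a b a0; have [M HM] := bounded_add bounded_qV (bounded_x2q i) b a0.
exists M => r x ab; apply: le_trans (HM r x ab).
have /andP[ar rb] := ab; have r0 := lt_le_trans a0 ar; have q0 := sq_dist_gt0 x r0.
rewrite -[X in X + _]mul1r -mulrDl !normrM ler_wpM2r//.
move: (x ord0 i) => y; rewrite [leRHS]ger0_norm ?addr_ge0 ?sqr_ge0//.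
by rewrite ler_norml; apply/andP; split; nra.
Qed.

Lemma bounded_poisson_r : bounded_on_strips poisson_r.
Proof.
apply: bounded_poisson_mul.
have := bounded_add (bounded_cst_mul s bounded_rV) (bounded_cst_mul (- (2 * p)) (bounded_mul bounded_r bounded_qV)).
by under [X in bounded_on_strips X]eq_fun do under eq_fun do rewrite mulNr.
Qed.

Lemma bounded_poisson_i i : bounded_on_strips (poisson_i i).
Proof. by apply: bounded_poisson_mul; apply: bounded_cst_mul; exact: bounded_xq. Qed.

Lemma bounded_poisson_rr : bounded_on_strips poisson_rr.
Proof.
have h1 := bounded_cst_mul (s * (s - 1)) (bounded_mul bounded_rV bounded_rV).
have h2 := bounded_cst_mul (- (2 * p * (2 * s + 1))) bounded_qV.
have rq := bounded_mul bounded_r bounded_qV.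
have h3 := bounded_cst_mul (4 * p * (p + 1)) (bounded_mul rq rq).
have := bounded_poisson_mul (bounded_add (bounded_add h1 h2) h3).
rewrite (_ : (fun r x => _) = poisson_rr)//; apply/funext => r; apply/funext => x.
by rewrite /poisson_rr; congr (_ * (_ + _ + _)); rewrite ?expr2 ?invfM; ring.
Qed.

Lemma bounded_poisson_ii i : bounded_on_strips (poisson_ii i).
Proof.
have h1 := bounded_cst_mul (- 2 * p) bounded_qV.
have h2 := bounded_cst_mul (4 * p * (p + 1)) (bounded_mul (bounded_x2q i) bounded_qV).
have := bounded_poisson_mul (bounded_add h1 h2).
rewrite (_ : (fun r x => _) = poisson_ii i)//; apply/funext => r; apply/funext => x.
by rewrite /poisson_ii; congr (_ * (_ + _)); rewrite ?expr2 ?invfM; ring.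
Qed.

Lemma measurable_poisson r : measurable_fun setT (poisson r).
Proof.
have mq : measurable_fun setT (sq_dist r).
  apply: measurable_funD; first exact: measurable_cst.
  by apply: measurable_sum => i; apply: measurable_funX; exact: measurable_rV_coord.
by apply: measurable_funM; [exact: measurable_cst|exact: (measurableT_comp (measurable_powR (- p)) mq)].
Qed.

Lemma measurable_poisson_r r : measurable_fun setT (poisson_r r).
Proof.
have mq : measurable_fun setT (fun x => (sq_dist r x)^-1).
  have -> : (fun x => (sq_dist r x)^-1) = (fun x => sq_dist r x `^ (-1)).
    apply/funext => x; rewrite powR_inv1//; apply: le_trans (sq_dist_ge r x); exact: sqr_ge0.
  apply: (measurableT_comp (measurable_powR (-1))).
  apply: measurable_funD; first exact: measurable_cst.
  by apply: measurable_sum => i; apply: measurable_funX; exact: measurable_rV_coord.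
apply: measurable_funM; first exact: measurable_poisson.
apply: measurable_funB; first exact: measurable_cst.
by apply: measurable_funM; [exact: measurable_cst|apply: measurable_funM => //; exact: measurable_cst].
Qed.

(** Summing over [i] replaces $\sum x_i^2$ by [sq_dist r x - r ^+ 2]; the rest is rational and
    vanishes because $2p=n+s$. *)
Lemma poisson_PDE r x : 0 < r ->
  \sum_(i < n) poisson_ii i r x + poisson_rr r x + (1 - s) / r * poisson_r r x = 0.
Proof.
move=> r0; have q0 := sq_dist_gt0 x r0.
have -> : \sum_(i < n) poisson_ii i r x = poisson r x *
    (- 2 * p * n%:R / sq_dist r x + 4 * p * (p + 1) * (sq_dist r x - r ^+ 2) / sq_dist r x ^+ 2).
  rewrite /poisson_ii -mulr_sumr big_split/= sumr_const card_ord.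
  rewrite -mulr_suml -mulr_sumr /sq_dist [in RHS]addrAC subrr add0r; congr (_ * (_ + _)).
  by rewrite -mulr_natr; ring.
rewrite /poisson_rr /poisson_r; field.
by rewrite !gt_eqF.
Qed.

(** All derivatives fall on the kernel and are bounded on strips, so integrability of [g] justifies
    every exchange. This is why the representation theorem works with truncated boundary data. *)
Lemma ext_sol_poisson (g : 'rV[R]_n -> R) : mu.-integrable setT (EFin \o g) ->
  ext_sol s (fun x r => rconv g (poisson r) x).
Proof.
move=> ig; have mg : measurable_fun setT g by apply/measurable_EFinP; exact: measurable_int ig.
have strip (w : R -> 'rV[R]_n -> R) : bounded_on_strips w -> (forall r, 0 < r -> measurable_fun setT (w r)) ->
    loc_bounded2 (fun x r => rconv g (w r) x).
  move=> bw mw N a b a0; have [M HM] := bw a b a0.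
  exists (M * \int[mu]_z `|g z|) => x r _ ab; have /andP[ar _] := ab.
  have ic := conv_integrable x ig (mw r (lt_le_trans a0 ar)) (fun y => HM r y ab).
  apply: le_trans (le_normr_Rintegral measurableT ic) _.
  rewrite -RintegralZl//; last exact: integrable_norm.
  apply: le_Rintegral => //.
  - exact: integrable_norm.
  - by apply: (@integrableZl _ _ _ mu _ measurableT M (fun z => `|g z|%:E)); exact: integrable_norm.
  - by move=> z _; rewrite normrM mulrC ler_wpM2r// HM.
have dr (w w1 : R -> 'rV[R]_n -> R) : bounded_on_strips w -> bounded_on_strips w1 ->
    (forall r, 0 < r -> measurable_fun setT (w r)) ->
    (forall r x, 0 < r -> is_derive r (1 : R) (w ^~ x) (w1 r x)) ->
    forall r, 0 < r -> forall x, is_derive r (1 : R) (fun r => rconv g (w r) x) (rconv g (w1 r) x).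
  move=> bw bw1 mw dw r r0 x.
  have a0 : 0 < r / 2 by rewrite divr_gt0.
  have [M HM] := bw _ (r * 2) a0; have [M1 HM1] := bw1 _ (r * 2) a0.
  have pos t : t \in `]r / 2, r * 2[ -> 0 < t /\ r / 2 <= t <= r * 2.
    by rewrite in_itv/= => /andP[h1 h2]; rewrite (lt_trans a0 h1) !ltW.
  apply: (@is_derive_under_integral R _ _ mu (fun t z => g z * w t (x - z))
    (fun t z => g z * w1 t (x - z)) r (r / 2) (r * 2) (fun z => M1 * `|g z|)).
  - by rewrite in_itv/=; apply/andP; split; lra.
  - by move=> t /pos[t0 tr]; apply: (@conv_integrable _ _ _ _ M) => //; [exact: mw|move=> y; exact: HM].
  - by move=> t /pos[t0 _] z; exact: (@is_deriveZ R R R _ (g z) t 1 _ (dw t (x - z) t0)).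
  - by apply: (@integrableZl _ _ _ mu _ measurableT M1 (fun z => `|g z|%:E)); exact: (integrable_norm ig).
  - by move=> t /pos[t0 tr] z; rewrite normrM mulrC ler_wpM2r// HM1.
have at_r (w : R -> 'rV[R]_n -> R) : bounded_on_strips w -> forall r, 0 < r -> exists M : R, forall y, `|w r y| <= M.
  by move=> bw r r0; have [M HM] := bw r r r0; exists M => y; apply: HM; rewrite !lexx.
have mpi i r : 0 < r -> measurable_fun setT (poisson_i i r).
  by move=> r0; exact: measurable_line_derive (measurable_poisson r) (line_poisson i r0).
have mpii i r : 0 < r -> measurable_fun setT (poisson_ii i r).
  by move=> r0; exact: measurable_line_derive (mpi i r r0) (line_poisson_i i r0).
have mrr r : 0 < r -> measurable_fun setT (poisson_rr r).
  move=> r0; have rI : r \in `]r / 2, r * 2[ by rewrite in_itv/=; apply/andP; split; lra.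
  apply: (@measurable_is_derive R _ _ poisson_r r _ _ _ rI).
    by move=> y _; exact: measurable_poisson_r.
  by move=> x; exact: is_derive_poisson_r.
exists (fun x r => rconv g (poisson_r r) x), (fun x r => rconv g (poisson_rr r) x),
  (fun i x r => rconv g (poisson_i i r) x), (fun i x r => rconv g (poisson_ii i r) x).
split; first split.
- by move=> r r0; apply: measurable_conv => //; exact: measurable_poisson.
- move=> r r0 x; split.
    exact: (dr poisson poisson_r bounded_poisson bounded_poisson_r (fun t _ => measurable_poisson t) (fun t y t0 => is_derive_poisson y t0) r r0 x).
  exact: (dr poisson_r poisson_rr bounded_poisson_r bounded_poisson_rr (fun t _ => measurable_poisson_r t) (fun t y t0 => is_derive_poisson_r y t0) r r0 x).
- move=> r r0 i; have [M HM] := at_r _ bounded_poisson r r0.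
  have [M1 HM1] := at_r _ (bounded_poisson_i i) r r0; have [M2 HM2] := at_r _ (bounded_poisson_ii i) r r0.
  split.
    by apply: (line_derive_conv ig (measurable_poisson r) HM HM1); exact: line_poisson.
  by apply: (line_derive_conv ig (mpi i r r0) HM1 HM2); exact: line_poisson_i.
- split; apply: strip => //; first [exact: bounded_poisson|exact: bounded_poisson_r|exact: bounded_poisson_rr|move=> r _].
    exact: measurable_poisson.
  exact: measurable_poisson_r.
- move=> i; split; apply: strip; first [exact: bounded_poisson_i|exact: bounded_poisson_ii|by move=> r r0; exact: mpi|by move=> r r0; exact: mpii].
move=> r r0 x; have [M1 HM1] := at_r _ bounded_poisson_r r r0; have [M2 HM2] := at_r _ bounded_poisson_rr r r0.
have i1 := conv_integrable x ig (measurable_poisson_r r) HM1.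
have i2 := conv_integrable x ig (mrr r r0) HM2.
have ii i : mu.-integrable setT (EFin \o (fun z => g z * poisson_ii i r (x - z))).
  by have [M HM] := at_r _ (bounded_poisson_ii i) r r0; exact: conv_integrable x ig (mpii i r r0) HM.
have isum (q : seq 'I_n) : mu.-integrable setT (EFin \o (fun z => \sum_(i <- q) g z * poisson_ii i r (x - z))) /\
    \int[mu]_z (\sum_(i <- q) g z * poisson_ii i r (x - z)) = \sum_(i <- q) rconv g (poisson_ii i r) x.
  elim: q => [|i q [IH1 IH2]].
    split; last by rewrite big_nil; under eq_Rintegral do rewrite big_nil; rewrite /Rintegral integral0.
    rewrite (_ : _ \o _ = cst 0%E); first exact: integrable0.
    by apply/funext => z; rewrite /= big_nil.
  have E0 : (fun z => \sum_(j <- i :: q) g z * poisson_ii j r (x - z)) =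
    (fun z => g z * poisson_ii i r (x - z) + \sum_(j <- q) g z * poisson_ii j r (x - z)).
    by apply/funext => z; rewrite big_cons.
  rewrite E0; split; first exact: (integrableD measurableT (ii i) IH1).
  by rewrite RintegralD// IH2 big_cons.
have [is1 <-] := isum (index_enum 'I_n).
have i3 := integrableZl measurableT ((1 - s) / r) i1.
rewrite /rconv -[X in _ + X]RintegralZl// -RintegralD// -RintegralD//; last exact: (integrableD measurableT is1 i2).
rewrite (_ : (fun z => _) = (fun=> 0)); first by rewrite /Rintegral integral0.
apply/funext => z; rewrite -mulr_sumr.
transitivity (g z * (\sum_(i < n) poisson_ii i r (x - z) + poisson_rr r (x - z) + (1 - s) / r * poisson_r r (x - z))).
  by ring.
by rewrite poisson_PDE// mulr0.
Qed.

End Poisson_kernel.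

(** * The Poisson kernel as an approximate identity *)

Section Poisson_integral.
Variables (R : realType) (n : nat) (s : R).
Hypotheses (s0 : 0 < s) (n0 : (0 < n)%N).
Local Notation mu := (lebesgue_rV R n).
Local Notation p := ((n%:R + s) / 2).
Local Notation P := (poisson s).
Local Notation N2 f := (fine (sq_int mu f)).
Implicit Types (r : R) (x : 'rV[R]_n) (f g : 'rV[R]_n -> R).

Let p0 : 0 < p.
Proof. by rewrite divr_gt0// ltr_wpDl. Qed.

Let n0R : 0 < n%:R :> R.
Proof. by rewrite ltr0n. Qed.

Lemma poisson_scale r x : 0 < r -> P r x = r ^- n * P 1 (r^-1 *: x).
Proof.
move=> r0; rewrite /poisson powR1 mul1r.
have -> : sq_dist r x = r ^+ 2 * sq_dist 1 (r^-1 *: x).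
  rewrite /sq_dist expr1n mulrDr mulr1 mulr_sumr; congr (_ + _); apply: eq_bigr => i _.
  by rewrite mxE; field; rewrite gt_eqF.
rewrite powRM ?sqr_ge0//; last by rewrite ltW// sq_dist_gt0.
rewrite mulrA; congr (_ * _).
rewrite -powR_mulrn ?ltW// -powRrM -powRD; last by rewrite (gt_eqF r0) implybT.
rewrite -powR_invn ?ltW//; congr (_ `^ _); by field.
Qed.

(** $(1+|x|^2)^{-p}$ splits into $n$ factors of exponent $-p/n$, each bounded using one coordinate
    only. The resulting decay $2p/n=1+s/n$ exceeds 1, so integrability follows one variable at a
    time. *)
Lemma poisson1_le_prod x : P 1 x <= \prod_(i < n) two_powers 0 (2 * (p / n%:R)) (x ord0 i).
Proof.
rewrite /poisson powR1 mul1r; set k := p / n%:R.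
have k0 : 0 < k by rewrite divr_gt0.
have -> : - p = - k * n%:R by rewrite /k mulNr divfK// gt_eqF.
rewrite powRrM powR_mulrn ?powR_ge0//.
rewrite [leLHS](_ : _ = \prod_(i < n) sq_dist 1 x `^ (- k)); last by rewrite prodr_const card_ord.
apply: ler_prod => i _; rewrite powR_ge0/=.
have q1 : 1 + x ord0 i ^+ 2 <= sq_dist 1 x.
  rewrite /sq_dist expr1n (bigD1 i)//= lerD2l lerDl.
  by apply: sumr_ge0 => j _; exact: sqr_ge0.
have x20 := sqr_ge0 (x ord0 i).
have dec y : 0 < y -> y <= sq_dist 1 x -> sq_dist 1 x `^ (- k) <= y `^ (- k).
  move=> y0 yq; rewrite !powRN lef_pV2 ?posrE ?powR_gt0 ?sq_dist_gt0//.
  by apply: (ge0_ler_powR (ltW k0)); rewrite ?nnegrE ?(ltW y0) ?(ltW (sq_dist_gt0 x ltr01)).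
rewrite /two_powers; case: ifPn => x1.
  rewrite oppr0 powRr0; apply: le_trans (dec 1 ltr01 _) _; last by rewrite powR1.
  by apply: le_trans q1; rewrite lerDl.
rewrite -ltNge in x1; have a0 := lt_trans ltr01 x1.
have y0 : 0 < x ord0 i ^+ 2 by rewrite -real_normK ?num_real// exprn_gt0.
apply: le_trans (dec _ y0 _) _; first by apply: le_trans q1; rewrite lerDr.
rewrite -[X in X `^ _]real_normK ?num_real// -powR_mulrn// -powRrM.
by rewrite mulrN.
Qed.

Lemma measurable_two_powers_prod : measurable_fun setT
  (fun x : 'rV[R]_n => \prod_(i < n) two_powers 0 (2 * (p / n%:R)) (x ord0 i)).
Proof.
apply: measurable_prod => i _.
by apply: (measurableT_comp (measurable_two_powers 0 (2 * (p / n%:R)))); exact: measurable_rV_coord.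
Qed.

Lemma integrable_poisson1 : mu.-integrable setT (EFin \o P 1).
Proof.
apply/integrableP; split; first by apply/measurable_EFinP; exact: measurable_poisson.
apply: (@le_lt_trans _ _ (\int[mu]_x (\prod_(i < n) two_powers 0 (2 * (p / n%:R)) (x ord0 i))%:E)%E).
  apply: ge0_le_integral => //.
  - by apply/measurable_EFinP; apply: measurableT_comp => //; exact: measurable_poisson.
  - by apply/measurable_EFinP; exact: measurable_two_powers_prod.
  by move=> x _; rewrite lee_fin gtr0_norm ?poisson_gt0//; exact: poisson1_le_prod.
rewrite (@ge0_integral_prod R n (fun=> two_powers 0 (2 * (p / n%:R)))).
- have q1 : 1 < 2 * (p / n%:R).
    by rewrite (_ : 2 * _ = 1 + s / n%:R) ?ltrDl ?divr_gt0//; field; rewrite gt_eqF.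
  have := integral_two_powers ltr01 q1; set I := (\int[_]_w _)%E; set K := (_ + _) => IK.
  have I0 : (0 <= I)%E by apply: integral_ge0 => w _; rewrite lee_fin two_powers_ge0.
  have -> : I = (fine I)%:E by rewrite fineK// ge0_fin_numE// (le_lt_trans IK) ?ltry.
  suff [c ->] : exists c : R, (\prod_(i < n) (fine I)%:E = c%:E)%E by rewrite ltry.
  rewrite big_const; elim: (#|_|) => [|k [c IH]]; first by exists 1.
  by exists (fine I * c); rewrite iterS IH EFinM.
- by move=> i; exact: measurable_two_powers.
- by move=> i w; exact: two_powers_ge0.
Qed.

Lemma ge0_integral_poisson r (h : 'rV[R]_n -> R) : 0 < r -> measurable_fun setT h -> (forall x, 0 <= h x) ->
  (\int[mu]_x (P r x * h (r^-1 *: x))%:E = \int[mu]_x (P 1 x * h x)%:E)%E.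
Proof.
move=> r0 mh h0; have rV0 : r^-1 != 0 by rewrite invr_neq0 ?gt_eqF.
have mPh : measurable_fun setT (fun x => (P 1 x * h x)%:E).
  by apply/measurable_EFinP; apply: measurable_funM => //; exact: measurable_poisson.
have Ph0 x : (0 <= (P 1 x * h x)%:E)%E by rewrite lee_fin mulr_ge0// ltW// poisson_gt0.
have := ge0_integral_rV_scale rV0 mPh Ph0; rewrite gtr0_norm ?invr_gt0// => H.
have mPhr : measurable_fun setT (fun x : 'rV[R]_n => (P 1 (r^-1 *: x) * h (r^-1 *: x))%:E).
  have ms : measurable_fun setT (fun x : 'rV[R]_n => r^-1 *: x : 'rV[R]_n).
    apply: measurable_fun_rV => i; under eq_fun do rewrite mxE.
    by apply: measurable_funM; [exact: measurable_cst|exact: measurable_rV_coord].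
  exact: (measurableT_comp mPh ms).
transitivity ((r ^- n)%:E * \int[mu]_x (P 1 (r^-1 *: x) * h (r^-1 *: x))%:E)%E.
  rewrite -ge0_integralZl//.
  - by apply: eq_integral => x _; rewrite poisson_scale// -mulrA EFinM.
  - by rewrite lee_fin invr_ge0 exprn_ge0// ltW.
by rewrite H muleA -EFinM exprVn invrK mulVf ?mul1e// expf_neq0// gt_eqF.
Qed.

Definition poisson_mass : R := \int[mu]_x P 1 x.

Lemma poissonE r : 0 < r -> (\int[mu]_x (P r x)%:E = poisson_mass%:E)%E.
Proof.
move=> r0; have := ge0_integral_poisson r0 (@measurable_cst _ _ _ _ setT (1 : R)) (fun=> ler01).
under eq_integral do rewrite mulr1; move=> ->.
under eq_integral do rewrite mulr1.
by rewrite /poisson_mass /Rintegral fineK//; apply: integrable_fin_num => //; exact: integrable_poisson1.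
Qed.

Lemma integrable_poisson r : 0 < r -> mu.-integrable setT (EFin \o P r).
Proof.
move=> r0; apply/integrableP; split; first by apply/measurable_EFinP; exact: measurable_poisson.
rewrite (eq_integral (fun x => (P r x)%:E)) ?poissonE ?ltry// => x _.
by rewrite /= gtr0_norm// poisson_gt0.
Qed.

Lemma Rintegral_poisson r : 0 < r -> \int[mu]_x P r x = poisson_mass.
Proof. by move=> r0; rewrite /Rintegral poissonE. Qed.

Lemma poisson_mass_gt0 : 0 < poisson_mass.
Proof.
have c0 : 0 < (1 + n%:R : R) `^ (- p) by rewrite powR_gt0// ltr_pwDl.
rewrite -lte_fin -(poissonE ltr01).
apply: (@lt_le_trans _ _ (((1 + n%:R) `^ (- p))%:E * mu (box 1))%E).
  by rewrite lebesgue_box// -EFinM lte_fin mulr_gt0// exprn_gt0// mulrn_wgt0.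
rewrite -(@integral_cst _ _ _ mu _ (measurable_box 1)).
have mP : measurable_fun setT (fun x => (P 1 x)%:E) by apply/measurable_EFinP; exact: measurable_poisson.
have P0 x : (0 <= (P 1 x)%:E)%E by rewrite lee_fin ltW// poisson_gt0.
apply: (@le_trans _ _ (\int[mu]_(x in box 1) (P 1 x)%:E)%E); last first.
  by apply: ge0_subset_integral => //; exact: measurable_box.
apply: ge0_le_integral.
- exact: measurable_box.
- by move=> x _; rewrite lee_fin ltW.
- exact: measurable_cst.
- exact: measurable_funTS.
move=> x bx; rewrite lee_fin /poisson powR1 mul1r !powRN.
have n1 : 0 < 1 + n%:R :> R by rewrite ltr_pwDl.
rewrite lef_pV2 ?posrE ?powR_gt0 ?sq_dist_gt0//.
apply: (ge0_ler_powR (ltW p0)); rewrite ?nnegrE ?(ltW (sq_dist_gt0 x ltr01)) ?(ltW n1)//.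
rewrite /sq_dist expr1n lerD2l -[n in leRHS]card_ord -sumr_const.
apply: ler_sum => i _; rewrite -real_normK ?num_real//.
by rewrite exprn_ile1//; exact: bx.
Qed.

Lemma poisson_bound r : 0 < r -> exists M : R, forall x, `|P r x| <= M.
Proof.
by move=> r0; have [M HM] := @bounded_poisson R n s s0 r r r0; exists M => x; apply: HM; rewrite !lexx.
Qed.

Lemma is_L2_poisson r : 0 < r -> is_L2 mu (P r).
Proof.
move=> r0; split; first exact: measurable_poisson.
have [M HM] := poisson_bound r0.
have M0 : 0 <= M by apply: le_trans (HM 0).
apply: (@le_lt_trans _ _ (\int[mu]_x (M%:E * (P r x)%:E))%E).
  apply: ge0_le_integral => //.
  - by move=> x _; rewrite lee_fin sqr_ge0.
  - by apply/measurable_EFinP; apply: measurable_funX; exact: measurable_poisson.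
  - by apply: measurable_funeM; apply/measurable_EFinP; exact: measurable_poisson.
  move=> x _; rewrite -EFinM lee_fin expr2 ler_wpM2r ?(ltW (poisson_gt0 _ _ _))//.
  by apply: le_trans (HM x); exact: ler_norm.
rewrite ge0_integralZl// ?poissonE// -?EFinM ?ltry//.
- by apply/measurable_EFinP; exact: measurable_poisson.
- by move=> x _; rewrite lee_fin ltW// poisson_gt0.
Qed.

Lemma poisson_tail e : 0 < e -> exists N : R, 0 < N /\
  (\int[mu]_x (P 1 x * \1_(~` box N) x)%:E <= e%:E)%E.
Proof.
move=> e0; have mb (N : R) : measurable (~` (@box R n N)) by apply: measurableC; exact: measurable_box.
have cv : \int[mu]_x (P 1 x * \1_(~` box k.+1%:R) x) @[k --> \oo] --> \int[mu]_x (0 : R).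
  apply: (@cvg_Rintegral_dominated _ _ _ mu (fun k x => P 1 x * \1_(~` box k.+1%:R) x) _ (P 1)).
  - by move=> k; apply: measurable_funM; [exact: measurable_poisson|exact: measurable_indic].
  - move=> x; apply: cvg_near_cst.
    exists (Num.truncn (\sum_(i < n) `|x ord0 i|)) => // k /= kN.
    rewrite indicE memNset ?mulr0//; apply: contrapT => /contrapT; apply => i.
    apply: (@le_trans _ _ (\sum_(i < n) `|x ord0 i|)); first by rewrite (bigD1 i)//= lerDl sumr_ge0.
    by apply: ltW; apply: lt_le_trans (truncnS_gt _) _; rewrite ler_nat ltnS.
  - exact: integrable_poisson1.
  - move=> k x; rewrite normrM (gtr0_norm (poisson_gt0 _ _ _))// ler_piMr ?(ltW (poisson_gt0 _ _ _))//.
    by rewrite indicE; case: (_ \in _); rewrite ?normr1 ?normr0.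
rewrite (_ : \int[mu]_x (0 : R) = 0) in cv; last by rewrite /Rintegral integral0.
have /cvgrPdist_le/(_ e e0)[k _ Hk] := cv.
exists k.+1%:R; split=> //; have := Hk k (leqnn k); rewrite /= sub0r normrN.
have ik : mu.-integrable setT (EFin \o (fun x => P 1 x * \1_(~` box k.+1%:R) x)).
  apply: le_integrable integrable_poisson1 => //.
    by apply/measurable_EFinP; apply: measurable_funM; [exact: measurable_poisson|exact: measurable_indic].
  move=> x _ /=; rewrite lee_fin normrM ler_piMr//.
  by rewrite indicE; case: (_ \in _); rewrite ?normr1 ?normr0.
move=> /(le_trans (ler_norm _)); rewrite -lee_fin /Rintegral fineK//.
exact: integrable_fin_num.
Qed.

(** The mean of the translation moduli against the kernel is split at the box of size [h]: inside,
    the modulus is small by continuity of translations; outside, it is at most [K] and the kernel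
    mass is a rescaled tail. *)
Lemma poisson_approx g e : continuous g -> is_L2 mu g -> 0 < e ->
  exists2 dl : R, 0 < dl & forall r, 0 < r -> r < dl ->
    (sq_int mu (fun x => poisson_mass * g x - rconv g (P r) x)%R <= e%:E)%E.
Proof.
move=> cg hg e0; set m := poisson_mass; have m0 := poisson_mass_gt0; rewrite -/m in m0.
(* With [e2] below, $m(e_1m+Ke_2)=e/2+e/2$, one half for each region. *)
pose e1 := e / (2 * m ^+ 2); have m20 : 0 < 2 * m ^+ 2 by rewrite mulr_gt0// exprn_gt0.
have e10 : 0 < e1 by rewrite divr_gt0.
have [h h0 Hh] := L2_translation_continuous cg hg e10.
pose K := 4 * N2 g + 1; have K0 : 0 < K by rewrite ltr_wpDl// mulr_ge0// N2_ge0.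
pose e2 := e / (2 * m * K); have mK0 : 0 < 2 * m * K by rewrite !mulr_gt0.
have e20 : 0 < e2 by rewrite divr_gt0.
have [N [N0 HN]] := poisson_tail e20.
exists (h / N); first by rewrite divr_gt0.
move=> r r0 rh.
have := @sq_int_conv_diff R n g (P r) hg (integrable_poisson r0) (is_L2_poisson r0) (fun x => ltW (poisson_gt0 s x r0)).
rewrite Rintegral_poisson// -/m => /le_trans; apply.
have P0 x : 0 <= P r x by rewrite ltW// poisson_gt0.
have mb : measurable (~` (@box R n N)) by apply: measurableC; exact: measurable_box.
have mi : measurable_fun setT (fun y : 'rV[R]_n => \1_(~` (@box R n N)) (r^-1 *: y) : R).
  have ms : measurable_fun setT (fun x : 'rV[R]_n => r^-1 *: x : 'rV[R]_n).
    apply: measurable_fun_rV => i; under eq_fun do rewrite mxE.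
    by apply: measurable_funM; [exact: measurable_cst|exact: measurable_rV_coord].
  exact: (measurableT_comp (measurable_indic mb) ms).
have S4 (y : 'rV[R]_n) : (sq_int mu (fun x => g x - g (x - y))%R <= K%:E)%E.
  have := sq_intB_le mu hg.1 (measurable_shift (- y) hg.1) => /le_trans; apply.
  rewrite (sq_int_shift (- y) hg.1) (sq_int_fin hg) -!EFinM -EFinD lee_fin /K; lra.
have bd y : ((P r y)%:E * sq_int mu (fun x => g x - g (x - y))%R <=
    e1%:E * (P r y)%:E + K%:E * (P r y * \1_(~` (@box R n N)) (r^-1 *: y))%:E)%E.
  have i0 : (0 <= K%:E * (P r y * \1_(~` (@box R n N)) (r^-1 *: y))%:E)%E.
    rewrite -EFinM lee_fin; apply: mulr_ge0; first exact: ltW.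
    by apply: mulr_ge0 => //; rewrite indicE.
  have [by_|nby] := pselect (box h y).
    apply: le_trans (leeDl _ i0); rewrite muleC lee_wpmul2r ?lee_fin//.
    apply: ltW; apply: Hh => i; rewrite mxE normrN; exact: by_.
  have Ny : (~` (@box R n N)) (r^-1 *: y).
    move=> bN; apply: nby => i; have := bN i; rewrite mxE normrM gtr0_norm ?invr_gt0//.
    rewrite ler_pdivrMl// => /le_trans; apply; rewrite ltr_pdivlMr// in rh; exact: ltW.
  rewrite indicE mem_set// mulr1; apply: (@le_trans _ _ (K%:E * (P r y)%:E)%E).
    by rewrite muleC lee_wpmul2r ?lee_fin.
  by apply: leeDr; rewrite -EFinM lee_fin mulr_ge0// ltW.
have mP : measurable_fun setT (fun y : 'rV[R]_n => (P r y)%:E) by apply/measurable_EFinP; exact: measurable_poisson.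
have mPi : measurable_fun setT (fun y : 'rV[R]_n => (P r y * \1_(~` (@box R n N)) (r^-1 *: y))%:E).
  by apply/measurable_EFinP; apply: measurable_funM => //; exact: measurable_poisson.
have Pi0 (y : 'rV[R]_n) : 0 <= P r y * \1_(~` (@box R n N)) (r^-1 *: y) by rewrite mulr_ge0// indicE.
apply: (@le_trans _ _ (m%:E * \int[mu]_y (e1%:E * (P r y)%:E + K%:E * (P r y * \1_(~` (@box R n N)) (r^-1 *: y))%:E))%E).
  apply: lee_wpmul2l; first by rewrite lee_fin ltW.
  apply: ge0_le_integral => //.
  - by move=> y _; rewrite mule_ge0 ?lee_fin// sq_int_ge0.
  - by apply: emeasurable_funM => //; exact: measurable_sq_int_diff hg.1.
  - by apply: emeasurable_funD; exact: measurable_funeM.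
rewrite ge0_integralD//; first last.
- exact: measurable_funeM.
- by move=> y _; rewrite -EFinM lee_fin mulr_ge0// ltW.
- exact: measurable_funeM.
- by move=> y _; rewrite -EFinM lee_fin mulr_ge0// ltW.
rewrite !ge0_integralZl//; try by [rewrite lee_fin ltW|move=> y _; rewrite lee_fin].
rewrite poissonE// (ge0_integral_poisson r0 (measurable_indic mb)); last by move=> y; rewrite indicE.
apply: (@le_trans _ _ (m%:E * (e1%:E * m%:E + K%:E * e2%:E))%E).
  by apply: lee_wpmul2l; [rewrite lee_fin ltW|apply: leeD => //; apply: lee_wpmul2l => //; rewrite lee_fin ltW].
have -> : (m%:E * (e1%:E * m%:E + K%:E * e2%:E) = (m * (e1 * m + K * e2))%:E)%E by [].
rewrite lee_fin /e1 /e2 le_eqVlt; apply/orP; left; apply/eqP.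
by field; rewrite !gt_eqF.
Qed.

End Poisson_integral.

Section continuous_rV.
Variables (R : numFieldType) (n : nat).
Implicit Types (f g : 'rV[R]_n -> R) (x : 'rV[R]_n).
Lemma continuous_rVD x f g : {for x, continuous f} -> {for x, continuous g} -> {for x, continuous (fun y : 'rV[R]_n => f y + g y)}.
Proof. by move=> cf cg; exact: (@cvgD _ _ _ (nbhs x) (nbhs_filter x) f g _ _ cf cg). Qed.

Lemma continuous_rVM x f g : {for x, continuous f} -> {for x, continuous g} -> {for x, continuous (fun y : 'rV[R]_n => f y * g y)}.
Proof. by move=> cf cg; exact: (@cvgM _ _ (nbhs x) (nbhs_filter x) f g _ _ cf cg). Qed.

Lemma continuous_rV_cst x (c : R) : {for x, continuous (fun=> c : R)}.
Proof. exact: (@cvg_cst _ c _ (nbhs x) (nbhs_filter x)). Qed.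

Lemma continuous_rV_coord x i : {for x, continuous (fun y : 'rV[R]_n => y ord0 i)}.
Proof. exact: coord_continuous. Qed.

Lemma continuous_rV_sum x I (q : seq I) (F : I -> 'rV[R]_n -> R) : (forall i, {for x, continuous (F i)}) ->
  {for x, continuous (fun y : 'rV[R]_n => \sum_(i <- q) F i y)}.
Proof.
move=> cF; elim: q => [|i q IH].
  rewrite (_ : (fun y => _) = fun=> 0); first exact: continuous_rV_cst.
  by apply/funext => y; rewrite big_nil.
rewrite (_ : (fun y => _) = fun y => F i y + \sum_(j <- q) F j y); first exact: continuous_rVD.
by apply/funext => y; rewrite big_cons.
Qed.

Lemma continuous_rV_prod x I (q : seq I) (F : I -> 'rV[R]_n -> R) : (forall i, {for x, continuous (F i)}) ->
  {for x, continuous (fun y : 'rV[R]_n => \prod_(i <- q) F i y)}.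
Proof.
move=> cF; elim: q => [|i q IH].
  rewrite (_ : (fun y => _) = fun=> 1); first exact: continuous_rV_cst.
  by apply/funext => y; rewrite big_nil.
rewrite (_ : (fun y => _) = fun y => F i y * \prod_(j <- q) F j y); first exact: continuous_rVM.
by apply/funext => y; rewrite big_cons.
Qed.

Lemma continuous_rV_comp x f (h : R -> R) : {for x, continuous f} -> {for f x, continuous h} ->
  {for x, continuous (fun y : 'rV[R]_n => h (f y))}.
Proof. by move=> cf ch; exact: (cvg_comp f h cf ch). Qed.

End continuous_rV.

Lemma continuous_rVP (R : realType) n (f : 'rV[R]_n -> R) (x : 'rV[R]_n) : {for x, continuous f} <->
  (forall e, 0 < e -> exists2 h : R, 0 < h & forall y, box h (y - x) -> `|f x - f y| <= e).
Proof.
split=> [cf e e0|H].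
  have := (@cvgrPdist_le _ _ _ (nbhs x) (nbhs_filter x) f (f x)).1 cf e e0.
  move=> /(nbhs_ballP x)[h /= h0 Hh]; exists (h / 2); first by rewrite divr_gt0.
  move=> y hy; apply: Hh; split=> // i j; rewrite (ord1 i) /ball/=.
  have := hy j; rewrite !mxE distrC => /le_lt_trans; apply.
  by rewrite ltr_pdivrMr// ltr_pMr// ltr1n.
apply: (@cvgrPdist_le _ _ _ (nbhs x) (nbhs_filter x) f (f x)).2 => e e0.
have [h h0 Hh] := H e e0.
apply: (nbhs_ballP x _).2; exists h => //= y [_ hy]; apply: Hh => j.
by have := hy ord0 j; rewrite /ball/= !mxE distrC => /ltW.
Qed.

Lemma cvg_sq_int_cutoff_diff (R : realType) n (f : 'rV[R]_n -> R) (e : R) : (0 < n)%N ->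
  is_L2 (lebesgue_rV R n) f -> 0 < e ->
  exists2 L : R, 0 < L & fine (sq_int (lebesgue_rV R n) (fun x => f x - f x * cutoff L x)) <= e.
Proof.
move=> n0 hf e0; set mu := lebesgue_rV R n.
have cv : \int[mu]_x ((f x - f x * cutoff k.+1%:R x) ^+ 2) @[k --> \oo] --> \int[mu]_x (0 : R).
  apply: (@cvg_Rintegral_dominated _ _ _ mu (fun k x => (f x - f x * cutoff k.+1%:R x) ^+ 2) _ (fun x => f x ^+ 2)).
  - move=> k; apply: measurable_funX; apply: measurable_funB; first exact: hf.1.
    by apply: measurable_funM; [exact: hf.1|exact: measurable_cutoff].
  - move=> x; have c1 := @cvg_cutoff R n x.
    have h1 : f x - f x * cutoff k.+1%:R x @[k --> \oo] --> f x - f x * 1.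
      by apply: cvgB; [exact: cvg_cst|apply: cvgM => //; exact: cvg_cst].
    have := cvgnM h1 h1; rewrite mulr1 subrr mulr0.
    by under eq_fun do rewrite -expr2.
  - exact: is_L2_sq_integrable.
  - move=> k x; have /andP[c0 c1] := cutoff_bound k.+1%:R x.
    rewrite ger0_norm ?sqr_ge0// -[X in (X - _) ^+ 2]mulr1 -mulrBr exprMn ler_piMr ?sqr_ge0//.
    by rewrite exprn_ile1// ?subr_ge0// gerBl.
rewrite (_ : \int[mu]_x (0 : R) = 0) in cv; last by rewrite /Rintegral integral0.
have /cvgrPdist_le/(_ e e0)[k _ Hk] := cv.
exists k.+1%:R => //; have := Hk k (leqnn k); rewrite /= sub0r normrN.
by move=> /(le_trans (ler_norm _)).
Qed.

(** * A bounded solution is the Poisson integral of its limit at radius 0 *)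

Section representation.
Variables (R : realType) (n : nat) (s : R).
Hypotheses (s0 : 0 < s) (n0 : (0 < n)%N).
Local Notation mu := (lebesgue_rV R n).
Local Notation P := (poisson s).
Local Notation N2 f := (fine (sq_int mu f)).
Implicit Types (r : R) (x : 'rV[R]_n) (f g : 'rV[R]_n -> R).

Lemma continuous_poisson r : 0 < r -> continuous (fun x : 'rV[R]_n => P r x).
Proof.
move=> r0 x; have q0 := sq_dist_gt0 x r0.
have cq : {for x, continuous (fun x : 'rV[R]_n => sq_dist r x)}.
  apply: continuous_rVD; first exact: continuous_rV_cst.
  apply: continuous_rV_sum => i.
  rewrite (_ : (fun y => _) = fun y : 'rV[R]_n => y ord0 i * y ord0 i); last by apply/funext => y; rewrite expr2.
  by apply: continuous_rVM; exact: continuous_rV_coord.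
have cp : {for sq_dist r x, continuous (fun y : R => y `^ (- ((n%:R + s) / 2)))}.
  apply: differentiable_continuous; apply/derivable1_diffP.
  by have [] := is_derive1_powR (- ((n%:R + s) / 2)) q0.
by apply: continuous_rVM; [exact: continuous_rV_cst|exact: continuous_rV_comp cq cp].
Qed.

(** Cauchy-Schwarz against the difference of two translates of [k], small by continuity of
    translations in $L^2$. *)
Lemma continuous_rconv f k : is_L2 mu f -> is_L2 mu k -> continuous k -> continuous (rconv f k).
Proof.
move=> hf hk ck x; apply/continuous_rVP => e e0.
have K0 : 0 < N2 f + 1 by rewrite ltr_wpDl// N2_ge0.
have e10 : 0 < e ^+ 2 / (N2 f + 1) by rewrite divr_gt0// exprn_gt0.
have [h h0 Hh] := L2_translation_continuous ck hk e10.
exists h => // y hy.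
have hkx := is_L2_reflect x hk; have hky := is_L2_reflect y hk.
rewrite /rconv -RintegralB//; [|exact: is_L2_mul_integrable..].
under eq_Rintegral do rewrite -mulrBr.
have CS := Cauchy_Schwarz hf (is_L2B hkx hky).
have E : N2 (fun z => k (x - z) - k (y - z)) <= e ^+ 2 / (N2 f + 1).
  have := Hh (y - x) hy; have hd : is_L2 mu (fun z => k z - k (z + (y - x))).
    apply: (is_L2B hk); split; first exact: measurable_shift hk.1.
    by rewrite sq_int_shift; [exact: hk.2|exact: hk.1].
  rewrite (sq_int_fin hd) lte_fin => /ltW; apply: le_trans; rewrite le_eqVlt; apply/orP; left; apply/eqP.
  congr fine; rewrite /sq_int.
  rewrite -[RHS](ge0_integral_rV_reflect x (f := fun z => ((k z - k (z + (y - x))) ^+ 2)%:E)).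
  - by apply: eq_integral => z _; congr (((_ - k _) ^+ 2)%:E); rewrite addrCA addrAC subrr add0r.
  - by apply/measurable_EFinP; apply: measurable_funX; exact: hd.1.
  - by move=> z; rewrite lee_fin sqr_ge0.
rewrite -ler_sqr ?nnegrE ?(ltW e0)// real_normK ?num_real//.
apply: le_trans CS _.
apply: (@le_trans _ _ ((N2 f + 1) * (e ^+ 2 / (N2 f + 1)))).
  by apply: ler_pM; rewrite ?N2_ge0// lerDl.
by rewrite mulrC divfK// gt_eqF.
Qed.

(** A nonzero value persists on a box of positive measure. It turns vanishing of an $L^2$ distance
    into equality at every point. *)
Lemma continuous_sq_int_eq0 f : continuous f -> sq_int mu f = 0%E -> forall x, f x = 0.
Proof.
move=> cf f0 x; apply: contrapT => /eqP fx.
have mf := continuous_measurable_rV cf.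
have q0 : 0 < `|f x| / 2 by rewrite divr_gt0// normr_gt0.
have [h h0 Hh] := (continuous_rVP f x).1 (cf x) _ q0.
have B y : box h (y - x) -> (`|f x| / 2) ^+ 2 <= f y ^+ 2.
  move=> by_; rewrite -[leRHS]real_normK ?num_real// ler_sqr ?nnegrE ?(ltW q0)//.
  by have := Hh y by_; have := ler_normD (f x - f y) (f y); rewrite subrK => h1 h2; lra.
suff : (0%E < sq_int mu f)%E by rewrite f0 ltxx.
have mb : measurable (@box R n h) by exact: measurable_box.
rewrite -(sq_int_shift x mf).
apply: (@lt_le_trans _ _ (((`|f x| / 2) ^+ 2)%:E * mu (box h))%E).
  by rewrite lebesgue_box ?(ltW h0)// -EFinM lte_fin mulr_gt0// exprn_gt0// mulrn_wgt0.
have mfx : measurable_fun setT (fun y : 'rV[R]_n => (f (y + x) ^+ 2)%:E).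
  by apply/measurable_EFinP; apply: measurable_funX; exact: measurable_shift.
rewrite -(@integral_cst _ _ _ mu _ mb) /sq_int.
apply: (@le_trans _ _ (\int[mu]_(y in box h) (f (y + x) ^+ 2)%:E)%E); last first.
  by apply: ge0_subset_integral => //; move=> y _; rewrite lee_fin sqr_ge0.
apply: ge0_le_integral => //.
- by move=> y _; rewrite lee_fin sqr_ge0.
- exact: measurable_funTS.
by move=> y by_; rewrite lee_fin; apply: B; rewrite addrK.
Qed.

Lemma N2D_le f g : is_L2 mu f -> is_L2 mu g -> N2 (fun x => f x + g x) <= 2 * N2 f + 2 * N2 g.
Proof.
move=> hf hg; have := parallelogram_fine hf hg; have := N2_ge0 (fun x => f x - g x); lra.
Qed.

Lemma N2Z f (c : R) : is_L2 mu f -> N2 (fun x => c * f x) = c ^+ 2 * N2 f.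
Proof.
move=> hf; rewrite !fine_sq_int -RintegralZl//; last exact: is_L2_sq_integrable.
by apply: eq_Rintegral => x _; rewrite exprMn.
Qed.

Lemma N2_sub_sym f g : N2 (fun x => f x - g x) = N2 (fun x => g x - f x).
Proof. by congr fine; apply: eq_integral => x _; rewrite -sqrrN opprB. Qed.

Lemma is_L2_rconv f k : is_L2 mu f -> measurable_fun setT k -> mu.-integrable setT (EFin \o k) ->
  is_L2 mu (rconv f k) /\ N2 (rconv f k) <= (\int[mu]_z `|k z|) ^+ 2 * N2 f.
Proof.
move=> hf mk ik; have le := sq_int_conv_le hf ik.
have h : is_L2 mu (rconv f k).
  split; first exact: measurable_conv hf.1 mk.
  by apply: le_lt_trans le _; rewrite (sq_int_fin hf) -EFinM ltry.
by split=> //; move: le; rewrite (sq_int_fin h) (sq_int_fin hf) -EFinM lee_fin.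
Qed.

(** Let $f$ be the limit at radius 0 and $g_j$ compactly supported approximations of it. The
    difference of $v$ and the normalised Poisson integral of $g_j$ is a bounded solution, small near
    radius 0 and hence, by monotonicity, at every radius; $j\to\infty$ identifies $v$ with the
    Poisson integral of $f$. *)
Lemma ext_sol_representation (v : 'rV[R]_n -> R -> R) (B : R) : ext_sol s v ->
  (forall r, 0 < r -> continuous (v ^~ r)) ->
  (forall r, 0 < r -> (sq_int mu (v ^~ r) <= B%:E)%E) ->
  exists f, is_L2 mu f /\ forall r x, 0 < r -> v x r = rconv f (P r) x.
Proof.
move=> sv cv vB; have mv := ext_sol_measurable sv.
have L2v r : 0 < r -> is_L2 mu (v ^~ r).
  by move=> r0; have [] := sq_int_le_real (mv r r0) (vB r r0).
have /choice[dl Hdl] : forall k : nat, exists dl : R, 0 < dl /\ forall a b, 0 < a -> a < b -> b < dl ->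
    N2 (fun x => v x b - v x a) <= 8 ^- k.
  move=> k; have e0 : 0 < 8 ^- k :> R by rewrite invr_gt0 exprn_gt0.
  by have [d d0 Hd] := ext_sol_Cauchy s0 n0 sv cv vB e0; exists d.
(* Decreasing radii, each below the threshold for accuracy $8^{-k}$, so that consecutive slices
   satisfy the hypothesis of [L2_complete]. *)
pose rho := fix rho (k : nat) : R := if k is k'.+1 then Num.min (rho k') (dl k) / 2 else dl 0 / 2.
have rho0 k : 0 < rho k.
  elim: k => [|k IH] /=; first by rewrite divr_gt0//; exact: (Hdl 0).1.
  by rewrite divr_gt0// lt_min IH; exact: (Hdl k.+1).1.
have rhodl k : rho k < dl k.
  have d0 := (Hdl k).1; case: k d0 => [|k] d0 /=; first by lra.
  rewrite ltr_pdivrMr//; apply: (@le_lt_trans _ _ (dl k.+1)); first by rewrite ge_min lexx orbT.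
  by lra.
have rhoS k : rho k.+1 < rho k.
  rewrite /= ltr_pdivrMr//; apply: (@le_lt_trans _ _ (rho k)); first by rewrite ge_min lexx.
  by have := rho0 k; lra.
have [f [hf Hf]] : exists f, is_L2 mu f /\ forall k, (sq_int mu (fun x => f x - v x (rho k))%R <= (8 / 4 ^+ k)%:E)%E.
  apply: (@L2_complete _ _ R mu (fun k x => v x (rho k))) => k; first exact: L2v.
  rewrite sq_int_fin ?lee_fin; last by apply: is_L2B; exact: L2v.
  by rewrite N2_sub_sym; exact: (Hdl k).2.
have {}Hf k : N2 (fun x => f x - v x (rho k)) <= 8 / 4 ^+ k.
  by rewrite -lee_fin -sq_int_fin//; apply: is_L2B hf _; exact: L2v.
have q4 k : 0 < 4 ^+ k :> R by rewrite exprn_gt0.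
(* $18=2\cdot1+2\cdot8$: the Cauchy estimate and the distance from [f] to the slice at [rho k]. *)
have cvf k e : 0 < e -> e < rho k -> N2 (fun x => v x e - f x) <= 18 / 4 ^+ k.
  move=> e0 er; have hab := (Hdl k).2 e (rho k) e0 er (rhodl k); rewrite N2_sub_sym in hab.
  have h1 : is_L2 mu (fun x => v x e - v x (rho k)) by apply: is_L2B; exact: L2v.
  have h2 : is_L2 mu (fun x => v x (rho k) - f x) by apply: is_L2B => //; exact: L2v.
  have := N2D_le h1 h2; under [in X in X <= _ -> _]eq_fun do rewrite addrA subrK.
  rewrite (N2_sub_sym (v ^~ (rho k))).
  have h84 : 8 ^- k <= 4 ^- k :> R by rewrite lef_pV2 ?posrE ?exprn_gt0// lerXn2r ?nnegrE// ler_nat.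
  have := Hf k; rewrite !(mulrC _ (4 ^- k)); move: hab h84; move: (N2 _) (N2 _) (N2 _) (4 ^- k) (8 ^- k) => *; lra.
set m := @poisson_mass R n s; have m0 : 0 < m by exact: poisson_mass_gt0.
have /choice[L HL] : forall j : nat, exists L : R, 0 < L /\
    N2 (fun x => v x (rho j) - v x (rho j) * cutoff L x) <= 1 / 4 ^+ j.
  move=> j; have e0 : 0 < 1 / 4 ^+ j :> R by rewrite divr_gt0.
  by have [l l0 Hl] := cvg_sq_int_cutoff_diff n0 (L2v _ (rho0 j)) e0; exists l.
(* A cut-off slice stands in for [f]: it is continuous, so the approximate identity applies, and
   compactly supported, so its Poisson integral is a solution. *)
pose g j x := v x (rho j) * cutoff (L j) x.
have [w1 [w2 [d1 [d2 [[_ _ _ [lv _ _] _] _]]]]] := sv.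
have bg j : bounded_supp (g j).
  apply: bounded_supp_mul; first exact: loc_bounded2_at (rho0 j) (mv _ (rho0 j)) lv.
  exact: (is_test_cutoff n0 (HL j).1).1.
have hg j := bounded_supp_is_L2 (bg j).
have ccut (l : R) (x : 'rV[R]_n) : {for x, continuous (@cutoff R n l)}.
  have c1 (y : R) : {for y, continuous (cutoff1 l)}.
    apply: differentiable_continuous; apply/derivable1_diffP.
    by have [] := is_derive_cutoff1 l y.
  apply: (@continuous_rV_prod R n x 'I_n (index_enum 'I_n) (fun i y => cutoff1 l (y ord0 i))) => i.
  have c2 := c1 (x ord0 i); exact: (continuous_rV_comp (@continuous_rV_coord R n x i) c2).
have cg j : continuous (g j).
  by move=> x; apply: continuous_rVM; [exact: cv|exact: ccut].
have fg j : N2 (fun x => f x - g j x) <= 18 / 4 ^+ j.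
  have h1 : is_L2 mu (fun x => f x - v x (rho j)) by apply: is_L2B => //; exact: L2v.
  have h2 : is_L2 mu (fun x => v x (rho j) - g j x) by apply: is_L2B => //; exact: L2v.
  have := N2D_le h1 h2; under [in X in X <= _ -> _]eq_fun do rewrite addrA subrK.
  have := Hf j; have := (HL j).2; rewrite !(mulrC _ (4 ^- j)).
  by rewrite /g; move: (N2 _) (N2 _) (N2 _) (4 ^- j) => *; lra.
pose z j x r := 1 * v x r + (- m^-1) * rconv (g j) (P r) x.
have sz j : ext_sol s (z j).
  by apply: ext_sol_lin => //; apply: ext_sol_poisson => //; exact: bounded_supp_integrable.
have absP r : 0 < r -> \int[mu]_y `|P r y| = m.
  move=> r0; rewrite /m -(Rintegral_poisson s0 n0 r0); apply: eq_Rintegral => y _.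
  by rewrite gtr0_norm// poisson_gt0.
have L2W h r : is_L2 mu h -> 0 < r -> is_L2 mu (rconv h (P r)) /\ N2 (rconv h (P r)) <= m ^+ 2 * N2 h.
  move=> hh r0; have := is_L2_rconv hh (measurable_poisson s r) (integrable_poisson s0 n0 r0).
  by rewrite absP.
have L2z j r : 0 < r -> is_L2 mu (z j ^~ r).
  move=> r0; apply: is_L2D; apply: is_L2_scale; first exact: L2v.
  exact: (L2W _ _ (hg j) r0).1.
have zB j r : 0 < r -> (sq_int mu (z j ^~ r) <= (2 * B + 2 * N2 (g j))%:E)%E.
  move=> r0; rewrite (sq_int_fin (L2z j r r0)) lee_fin.
  have [hW WN] := L2W _ _ (hg j) r0.
  have h1 := is_L2_scale 1 (L2v r r0); have h2 := is_L2_scale (- m^-1) hW.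
  apply: le_trans (N2D_le h1 h2) _; rewrite !N2Z//; last exact: L2v.
  have vb : N2 (v ^~ r) <= B by have [] := sq_int_le_real (mv r r0) (vB r r0).
  rewrite expr1n mul1r lerD// ler_wpM2l// sqrrN exprVn.
  by rewrite ler_pdivrMl ?exprn_gt0.
(* Monotonicity moves the estimate to a tiny radius [ep], where
   $z_j=(v-f)+((f-g_j)+m^{-1}(m\,g_j-g_j\ast P))$, and $112=2\cdot18+2(2\cdot18+2\cdot1)$. *)
have Hz j r : 0 < r -> N2 (z j ^~ r) <= 112 / 4 ^+ j.
  move=> r0; have e0 : 0 < m ^+ 2 / 4 ^+ j by rewrite divr_gt0// exprn_gt0.
  have [dq dq0 Hq] := poisson_approx s0 n0 (cg j) (hg j) e0.
  pose ep := Num.min (Num.min dq (rho j)) r / 2.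
  have ep0 : 0 < ep by rewrite divr_gt0// !lt_min dq0 rho0.
  have epm : ep < Num.min (Num.min dq (rho j)) r by rewrite /ep in ep0 *; lra.
  move: epm; rewrite !lt_min => /andP[/andP[epd epr] eper].
  apply: le_trans (sq_int_nonincreasing s0 n0 (sz j) (zB j) ep0 eper) _.
  have [hW _] := L2W _ _ (hg j) ep0.
  have h1 : is_L2 mu (fun x => v x ep - f x) by apply: is_L2B => //; exact: L2v.
  have h2 : is_L2 mu (fun x => f x - g j x) by exact: is_L2B.
  have h3 : is_L2 mu (fun x => m * g j x - rconv (g j) (P ep) x) by apply: is_L2B => //; exact: is_L2_scale.
  have h23 := is_L2D h2 (is_L2_scale m^-1 h3).
  have -> : (z j ^~ ep) = (fun x => (v x ep - f x) + ((f x - g j x) + m^-1 * (m * g j x - rconv (g j) (P ep) x))).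
    by apply/funext => x; rewrite /z; field; rewrite gt_eqF.
  apply: le_trans (N2D_le h1 h23) _.
  have := N2D_le h2 (is_L2_scale m^-1 h3); rewrite N2Z//.
  have Hq' : N2 (fun x => m * g j x - rconv (g j) (P ep) x) <= m ^+ 2 / 4 ^+ j.
    by rewrite -lee_fin -sq_int_fin//; exact: Hq.
  have {}Hq' : m^-1 ^+ 2 * N2 (fun x => m * g j x - rconv (g j) (P ep) x) <= 1 / 4 ^+ j.
    by rewrite exprVn ler_pdivrMl ?exprn_gt0// mul1r.
  have arith (a b c d q : R) : d <= 1 / q -> b <= 18 / q -> c <= 18 / q -> a <= 2 * b + 2 * d ->
      2 * c + 2 * a <= 112 / q by move=> *; lra.
  exact: arith Hq' (fg j) (cvf j ep ep0 epr).
exists (fun x => m^-1 * f x); split; first exact: is_L2_scale.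
move=> r x r0; apply/eqP; rewrite -subr_eq0; apply/eqP.
have hfm := is_L2_scale m^-1 hf; have hP := is_L2_poisson s0 n0 r0.
have [hW _] := L2W _ _ hfm r0.
have h0 : is_L2 mu (fun x => v x r - rconv (fun x => m^-1 * f x) (P r) x) by apply: is_L2B => //; exact: L2v.
apply: (@continuous_sq_int_eq0 (fun x => v x r - rconv (fun x => m^-1 * f x) (P r) x)).
  move=> y; apply: continuous_rVD; first exact: cv.
  rewrite (_ : (fun x : 'rV[R]_n => - rconv (fun x => m^-1 * f x) (P r) x) = fun x => -1 * rconv (fun x => m^-1 * f x) (P r) x); last first.
    by apply/funext => x'; rewrite mulN1r.
  apply: continuous_rVM; first exact: continuous_rV_cst.
  by apply: (continuous_rconv hfm hP); exact: continuous_poisson.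
rewrite (sq_int_fin h0); congr EFin; apply/eqP; rewrite eq_le N2_ge0 andbT.
(* $260=2\cdot112+2\cdot18$: the solution [z j], plus the Poisson integral of $g_j-f$, controlled by
   Young. *)
have bound j : N2 (fun x => v x r - rconv (fun x => m^-1 * f x) (P r) x) <= 260 / 4 ^+ j.
  have hd : is_L2 mu (fun x => g j x - f x) by exact: is_L2B.
  have [hD DN] := L2W _ _ hd r0.
  have hgW := (L2W _ _ (hg j) r0).1.
  have lin y : rconv (fun x => g j x - f x) (P r) y = rconv (g j) (P r) y - m * rconv (fun x => m^-1 * f x) (P r) y.
    have hr := is_L2_reflect y hP.
    rewrite /rconv -RintegralZl//; last exact: is_L2_mul_integrable hfm hr.
    rewrite -RintegralB//; first by apply: eq_Rintegral => t _; field; rewrite gt_eqF.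
    - exact: is_L2_mul_integrable.
    - apply: (@integrableZl _ _ _ mu _ measurableT m (fun t => (m^-1 * f t * P r (y - t))%:E)).
      exact: is_L2_mul_integrable hfm hr.
  have -> : (fun x => v x r - rconv (fun x => m^-1 * f x) (P r) x) = (fun x => z j x r + m^-1 * rconv (fun x => g j x - f x) (P r) x).
    by apply/funext => y; rewrite /z lin; field; rewrite gt_eqF.
  apply: le_trans (N2D_le (L2z j r r0) (is_L2_scale m^-1 hD)) _; rewrite N2Z//.
  have {}DN : m^-1 ^+ 2 * N2 (rconv (fun x => g j x - f x) (P r)) <= 18 / 4 ^+ j.
    rewrite exprVn ler_pdivrMl ?exprn_gt0//; apply: le_trans DN _.
    by rewrite ler_wpM2l ?sqr_ge0// N2_sub_sym; exact: fg.
  have arith (a b q : R) : a <= 112 / q -> b <= 18 / q -> 2 * a + 2 * b <= 260 / q by move=> *; lra.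
  exact: arith (Hz j r r0) DN.
have c4 : (geometric 260 4^-1 : nat -> R) k @[k --> \oo] --> (0 : R).
  by apply: cvg_geometric; rewrite ger0_norm ?invf_lt1// ltr1n.
apply: (ler_cvgn (cvg_cst _) c4) => j; apply: le_trans (bound j) _.
by rewrite /geometric/= exprVn.
Qed.

End representation.

(** * Mean value inequality for holomorphic functions *)

Section interval_integral.
Variable R : realType.
Local Notation lb := (@lebesgue_measure R).
Implicit Types (f : R -> R) (a b c M : R).

Definition int_ab a b f : R := \int[lb]_(t in `[a, b]) f t.

Definition cont_on a b f := forall x, a <= x <= b -> {for x, continuous f}.

Lemma cont_on_sub a b a' b' f : a <= a' -> b' <= b -> cont_on a b f -> cont_on a' b' f.
Proof.
move=> aa bb cf x /andP[ax xb]; apply: cf.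
by rewrite (le_trans aa ax) (le_trans xb bb).
Qed.

Lemma cont_on_integrable a b f : cont_on a b f -> lb.-integrable `[a, b] (EFin \o f).
Proof.
move=> cf; apply: continuous_compact_integrable; first exact: segment_compact.
by apply: continuous_in_subspaceT => x; rewrite inE/= in_itv/=; exact: cf.
Qed.

Lemma cont_onB a b f g : cont_on a b f -> cont_on a b g -> cont_on a b (fun x => f x - g x).
Proof. by move=> cf cg x xab; apply: cvgB; [exact: cf|exact: cg]. Qed.

Lemma cont_onD a b f g : cont_on a b f -> cont_on a b g -> cont_on a b (fun x => f x + g x).
Proof. by move=> cf cg x xab; apply: cvgD; [exact: cf|exact: cg]. Qed.

Lemma int_abB a b f g : cont_on a b f -> cont_on a b g ->
  int_ab a b (fun x => f x - g x) = int_ab a b f - int_ab a b g.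
Proof. by move=> cf cg; apply: RintegralB => //; exact: cont_on_integrable. Qed.

Lemma int_abD a b f g : cont_on a b f -> cont_on a b g ->
  int_ab a b (fun x => f x + g x) = int_ab a b f + int_ab a b g.
Proof. by move=> cf cg; apply: RintegralD => //; exact: cont_on_integrable. Qed.

Lemma int_ab_split a b c f : a <= b -> b <= c -> cont_on a c f ->
  int_ab a c f = int_ab a b f + int_ab b c f.
Proof.
move=> ab bc cf; have ic := cont_on_integrable cf.
have H := @Rintegral_itvB R f (BLeft a) (BRight c) b ic.
rewrite !bnd_simp in H; have {}H := H ab bc.
rewrite /int_ab -[in X in _ + X]Rintegral_itv_obnd_cbnd; last first.
  by apply: integrableS ic => //; apply: subset_itv; rewrite ?bnd_simp.
by rewrite -H addrC subrK.
Qed.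

Lemma int_ab_le a b f g : cont_on a b f -> cont_on a b g -> (forall x, a <= x <= b -> f x <= g x) ->
  int_ab a b f <= int_ab a b g.
Proof.
move=> cf cg fg; apply: le_Rintegral => //; try exact: cont_on_integrable.
Qed.

Lemma int_ab_cst a b c : a <= b -> int_ab a b (fun=> c) = c * (b - a).
Proof.
move=> ab; rewrite /int_ab Rintegral_cst//= lebesgue_measure_itv/= lte_fin.
case: ltP => h //=; have -> : a = b by apply/eqP; rewrite eq_le ab h.
by rewrite subrr.
Qed.

Lemma cont_on_cst a b c : cont_on a b (fun=> c).
Proof. by move=> x _; exact: cvg_cst. Qed.

Lemma int_ab_near_cst a b c M f : a <= b -> cont_on a b f -> (forall x, a <= x <= b -> `|f x - c| <= M) ->
  `|int_ab a b f - c * (b - a)| <= M * (b - a).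
Proof.
move=> ab cf H.
have h1 : int_ab a b f <= int_ab a b (fun=> c + M).
  apply: int_ab_le => //; first exact: cont_on_cst.
  by move=> x /H; rewrite ler_norml => /andP[_]; rewrite lerBlDl.
have h2 : int_ab a b (fun=> c - M) <= int_ab a b f.
  apply: int_ab_le => //; first exact: cont_on_cst.
  by move=> x /H; rewrite ler_norml => /andP[h _]; lra.
move: h1 h2; rewrite !int_ab_cst// mulrDl mulrBl => h1 h2.
by rewrite ler_norml; apply/andP; split; lra.
Qed.

End interval_integral.

(** * Cauchy's theorem on rectangles for real pairs *)

Section Goursat.
Variable R : realType.
Implicit Types (p q : R -> R -> R) (a b c d e : R).

(* p + i q is complex differentiable at a + i b, with derivative al + i be. *)
Definition cdiff p q a b := exists al be : R, forall e, 0 < e -> exists2 dl : R, 0 < dl &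
  forall h k, `|h| <= dl -> `|k| <= dl ->
    `|p (a + h) (b + k) - p a b - (al * h - be * k)| <= e * (`|h| + `|k|) /\
    `|q (a + h) (b + k) - q a b - (be * h + al * k)| <= e * (`|h| + `|k|).

Lemma cdiffN p q a b : cdiff p q a b -> cdiff q (fun x y => - p x y) a b.
Proof.
move=> [al [be H]]; exists be, (- al) => e /H[dl dl0 Hd]; exists dl => // h k hd kd.
have [h1 h2] := Hd h k hd kd; rewrite mulNr opprK; split => //.
rewrite (_ : _ - _ = - (p (a + h) (b + k) - p a b - (al * h - be * k))) ?normrN//; by ring.
Qed.

Lemma cdiff_continuous p q a b : cdiff p q a b ->
  {for a, continuous (fun x => p x b)} /\ {for b, continuous (fun y => p a y)}.
Proof.
move=> [al [be H]].
have [dl dl0 Hd] := H 1 ltr01.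
pose K := `|al| + `|be| + 1; have K0 : 0 < K by rewrite ltr_wpDl// addr_ge0.
have bd e h : 0 < e -> `|h| < Num.min dl (e / K) -> `|p (a + h) b - p a b| <= e /\ `|p a (b + h) - p a b| <= e.
  move=> e0; rewrite lt_min => /andP[/ltW h1 h2].
  have z0 : `|0 : R| <= dl by rewrite normr0 ltW.
  have [H1 _] := Hd h 0 h1 z0; have [H2 _] := Hd 0 h z0 h1.
  rewrite addr0 normr0 mulr0 subr0 mul1r addr0 in H1; rewrite addr0 normr0 mulr0 sub0r mul1r add0r opprK in H2.
  have hK : `|h| * K <= e by rewrite -ler_pdivlMr// ltW.
  have al_h : `|al * h| = `|al| * `|h| by rewrite normrM.
  have be_h : `|be * h| = `|be| * `|h| by rewrite normrM.
  have T1 := ler_normD (p (a + h) b - p a b - al * h) (al * h); rewrite subrK in T1.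
  have T2 := ler_normB (p a (b + h) - p a b + be * h) (be * h); rewrite addrK in T2.
  have a0 := mulr_ge0 (normr_ge0 al) (normr_ge0 h); have b0 := mulr_ge0 (normr_ge0 be) (normr_ge0 h).
  rewrite /K !mulrDr mulr1 (mulrC `|h|) (mulrC `|h| `|be|) in hK.
  by split; lra.
split; apply/cvgrPdist_le => e e0.
  have m0 : 0 < Num.min dl (e / K) by rewrite lt_min dl0 divr_gt0.
  exists (Num.min dl (e / K)) => // y /=; rewrite distrC => hy; rewrite distrC.
  by have [] := bd e (y - a) e0 hy; rewrite subrKC.
have m0 : 0 < Num.min dl (e / K) by rewrite lt_min dl0 divr_gt0.
exists (Num.min dl (e / K)) => // y /=; rewrite distrC => hy; rewrite distrC.
by have [_] := bd e (y - b) e0 hy; rewrite subrKC.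
Qed.

(* Real part of the integral of p + i q along the boundary of [a, b] x [c, d]. *)
Definition contour p q a b c d := int_ab a b (fun x => p x c - p x d) - int_ab c d (fun y => q b y - q a y).

Definition cont_rect p a b c d :=
  (forall y, c <= y <= d -> cont_on a b (fun x => p x y)) /\
  (forall x, a <= x <= b -> cont_on c d (fun y => p x y)).

Definition cdiff_rect p q a b c d := forall x y, a <= x <= b -> c <= y <= d -> cdiff p q x y.

Lemma cdiff_rect_cont p q a b c d : cdiff_rect p q a b c d -> cont_rect p a b c d /\ cont_rect q a b c d.
Proof.
move=> H; split; split => [y yd x xb|x xb y yd].
- exact: (cdiff_continuous (H x y xb yd)).1.
- exact: (cdiff_continuous (H x y xb yd)).2.
- exact: (cdiff_continuous (cdiffN (H x y xb yd))).1.
- exact: (cdiff_continuous (cdiffN (H x y xb yd))).2.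
Qed.

(* The segments in the hypotheses are exactly the ones integrated over, so that this also
   applies to an annulus cut along lines that avoid the singularity inside. *)
Lemma contour_splitx p q a m b c d : a <= m -> m <= b -> c <= d ->
  cont_on a b (fun x => p x c) -> cont_on a b (fun x => p x d) ->
  cont_on c d (q a) -> cont_on c d (q m) -> cont_on c d (q b) ->
  contour p q a b c d = contour p q a m c d + contour p q m b c d.
Proof.
move=> am mb cd pc pd qa qm qb; rewrite /contour (int_ab_split am mb); last exact: cont_onB.
rewrite !(int_abB (b := d))//.
by ring.
Qed.

Lemma contour_splity p q a b c m d : a <= b -> c <= m -> m <= d ->
  cont_on a b (fun x => p x c) -> cont_on a b (fun x => p x m) -> cont_on a b (fun x => p x d) ->
  cont_on c d (q a) -> cont_on c d (q b) ->
  contour p q a b c d = contour p q a b c m + contour p q a b m d.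
Proof.
move=> ab cm md pc pm pd qa qb; rewrite /contour (int_ab_split cm md); last exact: cont_onB.
rewrite !(int_abB (a := a) (b := b))//.
by ring.
Qed.

(** Pigeonhole: the contour integral is the sum over the four quarters, so one quarter carries more
    than a fourth of [M]. *)
Lemma contour_quarter p q x y w h M : 0 < w -> 0 < h ->
  cont_rect p x (x + (w + w)) y (y + (h + h)) -> cont_rect q x (x + (w + w)) y (y + (h + h)) ->
  M < `|contour p q x (x + (w + w)) y (y + (h + h))| ->
  exists x' y', [/\ x' = x \/ x' = x + w, y' = y \/ y' = y + h &
    M / 4 < `|contour p q x' (x' + w) y' (y' + h)|].
Proof.
move=> w0 h0 [px py] [qx qy] big; apply: contrapT => no.
have small x' y' : x' = x \/ x' = x + w -> y' = y \/ y' = y + h ->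
    `|contour p q x' (x' + w) y' (y' + h)| <= M / 4.
  by move=> hx hy; rewrite leNgt; apply/negP => lt1; apply: no; exists x', y'; split.
rewrite !(addrA x) !(addrA y) in px py qx qy big.
have x1 : x <= x <= x + w + w by apply/andP; split; lra.
have x2 : x <= x + w <= x + w + w by apply/andP; split; lra.
have x3 : x <= x + w + w <= x + w + w by apply/andP; split; lra.
have y1 : y <= y <= y + h + h by apply/andP; split; lra.
have y2 : y <= y + h <= y + h + h by apply/andP; split; lra.
have y3 : y <= y + h + h <= y + h + h by apply/andP; split; lra.
have lxw : x <= x + w by lra.
have lxw2 : x + w <= x + w + w by lra.
have lyh : y <= y + h by lra.
have lyh2 : y + h <= y + h + h by lra.
have lyy : y <= y + h + h by lra.
have lxx : x <= x + w + w by lra.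
have pl t : y <= t <= y + h + h -> cont_on x (x + w) (fun x => p x t).
  by move=> /px; exact: cont_on_sub.
have pr t : y <= t <= y + h + h -> cont_on (x + w) (x + w + w) (fun x => p x t).
  by move=> /px; exact: cont_on_sub.
have S1 : contour p q x (x + w + w) y (y + h + h) =
    (contour p q x (x + w) y (y + h) + contour p q x (x + w) (y + h) (y + h + h)) +
    (contour p q (x + w) (x + w + w) y (y + h) + contour p q (x + w) (x + w + w) (y + h) (y + h + h)).
  rewrite (contour_splitx lxw lxw2 lyy (px _ y1) (px _ y3) (qy _ x1) (qy _ x2) (qy _ x3)).
  rewrite (contour_splity lxw lyh lyh2 (pl _ y1) (pl _ y2) (pl _ y3) (qy _ x1) (qy _ x2)).
  by rewrite (contour_splity lxw2 lyh lyh2 (pr _ y1) (pr _ y2) (pr _ y3) (qy _ x2) (qy _ x3)).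
have s1 := small x y (or_introl erefl) (or_introl erefl).
have s2 := small x _ (or_introl erefl) (or_intror erefl).
have s3 := small _ y (or_intror erefl) (or_introl erefl).
have s4 := small _ _ (or_intror erefl) (or_intror erefl).
move: big; rewrite S1; apply/negP; rewrite -leNgt.
apply: le_trans (ler_normD _ _) _; apply: le_trans (lerD (ler_normD _ _) (ler_normD _ _)) _.
apply: le_trans (lerD (lerD s1 s2) (lerD s3 s4)) _; lra.
Qed.

(** For the affine approximation the horizontal and the vertical pair of sides both contribute
    $\beta wh$ and cancel; each pair then errs by at most $2m$ times its length. *)
Lemma contour_near_linear p q x y al be X Y w h m : 0 < w -> 0 < h ->
  cont_rect p X (X + w) Y (Y + h) -> cont_rect q X (X + w) Y (Y + h) ->
  (forall s t, X <= s <= X + w -> Y <= t <= Y + h ->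
    `|p s t - p x y - (al * (s - x) - be * (t - y))| <= m /\
    `|q s t - q x y - (be * (s - x) + al * (t - y))| <= m) ->
  `|contour p q X (X + w) Y (Y + h)| <= 2 * m * (w + h).
Proof.
move=> w0 h0 [px py] [qx qy] near.
have XX : X <= X + w by rewrite lerDl ltW.
have YY : Y <= Y + h by rewrite lerDl ltW.
have XI : X <= X <= X + w by rewrite lexx.
have XI' : X <= X + w <= X + w by rewrite lexx XX.
have YI : Y <= Y <= Y + h by rewrite lexx.
have YI' : Y <= Y + h <= Y + h by rewrite lexx YY.
have b1 : `|int_ab X (X + w) (fun x => p x Y - p x (Y + h)) - be * h * (X + w - X)| <= 2 * m * (X + w - X).
  apply: int_ab_near_cst => //; first by apply: cont_onB; exact: px.
  move=> s sX; have [n1 _] := near s Y sX YI; have [n2 _] := near s _ sX YI'.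
  have -> : p s Y - p s (Y + h) - be * h = (p s Y - p x y - (al * (s - x) - be * (Y - y))) -
    (p s (Y + h) - p x y - (al * (s - x) - be * (Y + h - y))) by ring.
  by apply: le_trans (ler_normB _ _) _; apply: le_trans (lerD n1 n2) _; rewrite mulrDl !mul1r.
have b2 : `|int_ab Y (Y + h) (fun y => q (X + w) y - q X y) - be * w * (Y + h - Y)| <= 2 * m * (Y + h - Y).
  apply: int_ab_near_cst => //; first by apply: cont_onB; exact: qy.
  move=> t tY; have [_ n1] := near _ t XI' tY; have [_ n2] := near X t XI tY.
  have -> : q (X + w) t - q X t - be * w = (q (X + w) t - q x y - (be * (X + w - x) + al * (t - y))) -
    (q X t - q x y - (be * (X - x) + al * (t - y))) by ring.
  by apply: le_trans (ler_normB _ _) _; apply: le_trans (lerD n1 n2) _; rewrite mulrDl !mul1r.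
rewrite /contour; set I1 := int_ab _ _ _ in b1 *; set I2 := int_ab _ _ _ in b2 *.
rewrite (_ : I1 - I2 = (I1 - be * h * (X + w - X)) - (I2 - be * w * (Y + h - Y))); last by ring.
apply: le_trans (ler_normB _ _) _; apply: le_trans (lerD b1 b2) _.
by rewrite -mulrDr (_ : X + w - X + (Y + h - Y) = w + h)//; ring.
Qed.

Lemma dist_nested (x X w s : R) : `|x - X| <= 2 * w -> X <= s <= X + w -> `|s - x| <= 3 * w.
Proof. by rewrite !ler_norml => /andP[? ?] /andP[? ?]; apply/andP; split; lra. Qed.

Theorem Goursat p q a b c d : a < b -> c < d -> cdiff_rect p q a b c d -> contour p q a b c d = 0.
Proof.
move=> ab cd H; apply/eqP; rewrite -normr_le0 leNgt; apply/negP => I0.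
pose w k := (b - a) / 2 ^+ k; pose h k := (d - c) / 2 ^+ k.
have p2 k : 0 < 2 ^+ k :> R by rewrite exprn_gt0.
have w0 k : 0 < w k by rewrite divr_gt0// subr_gt0.
have h0 k : 0 < h k by rewrite divr_gt0// subr_gt0.
have wS k : w k = w k.+1 + w k.+1 by rewrite /w exprS; field; rewrite gt_eqF.
have hS k : h k = h k.+1 + h k.+1 by rewrite /h exprS; field; rewrite gt_eqF.
(* Halving makes the initial inequality strict, as the pigeonhole step needs. *)
set ep := `|contour p q a b c d| / 2.
have ep0 : 0 < ep by rewrite divr_gt0.
pose bad k (z : R * R) := [/\ a <= z.1, z.1 + w k <= b, c <= z.2, z.2 + h k <= d &
  ep / 4 ^+ k < `|contour p q z.1 (z.1 + w k) z.2 (z.2 + h k)|].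
have sub k (z : R * R) : a <= z.1 -> z.1 + w k <= b -> c <= z.2 -> z.2 + h k <= d ->
    cdiff_rect p q z.1 (z.1 + w k) z.2 (z.2 + h k).
  move=> az zb cz zd x y /andP[x1 x2] /andP[y1 y2]; apply: H.
    by rewrite (le_trans az x1) (le_trans x2 zb).
  by rewrite (le_trans cz y1) (le_trans y2 zd).
have step k z : exists z' : R * R, bad k z -> [/\ bad k.+1 z', z.1 <= z'.1 <= z.1 + w k & z.2 <= z'.2 <= z.2 + h k].
  have [bz|] := pselect (bad k z); last by exists z.
  have [az zb cz zd big] := bz.
  have [[px py] [qx qy]] := cdiff_rect_cont (sub k z az zb cz zd).
  rewrite wS hS in px py qx qy big.
  have [x' [y' [hx hy lt1]]] := contour_quarter (w0 k.+1) (h0 k.+1) (conj px py) (conj qx qy) big.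
  exists (x', y') => _; have w1 := w0 k.+1; have h1 := h0 k.+1.
  rewrite wS in zb; rewrite hS in zd.
  have hx' : z.1 <= x' <= z.1 + w k.+1.
    by clear -hx w1; case: hx => ->; apply/andP; split; lra.
  have hy' : z.2 <= y' <= z.2 + h k.+1.
    by clear -hy h1; case: hy => ->; apply/andP; split; lra.
  rewrite wS hS; clear -az zb cz zd w1 h1 hx' hy' lt1.
  move/andP: hx' => [x1 x2]; move/andP: hy' => [y1 y2].
  split => /=; [split => /=; try lra|apply/andP; split; lra|apply/andP; split; lra].
  by rewrite exprSr invfM mulrA.
have /choice[g Hg] : forall kz : nat * (R * R), exists z' : R * R, bad kz.1 kz.2 ->
    [/\ bad kz.1.+1 z', kz.2.1 <= z'.1 <= kz.2.1 + w kz.1 & kz.2.2 <= z'.2 <= kz.2.2 + h kz.1].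
  by move=> [k z]; exact: step.
pose z := fix z k : R * R := if k is k'.+1 then g (k', z k') else (a, c).
have bz k : bad k (z k).
  elim: k => [|k IH]; last by have [] := Hg (k, z k) IH.
  rewrite /bad /= /w /h !expr0 !divr1 !subrKC; split => //; rewrite /ep.
  by rewrite ltr_pdivrMr// ltr_pMr// ltr1n.
have zx k : (z k).1 <= (z k.+1).1 <= (z k).1 + w k by have [] := Hg (k, z k) (bz k).
have zy k : (z k).2 <= (z k.+1).2 <= (z k).2 + h k by have [] := Hg (k, z k) (bz k).
have cx k : `|(z k.+1).1 - (z k).1| <= (b - a) / 2 ^+ k.
  by have /andP[h1 h2] := zx k; rewrite ger0_norm ?subr_ge0// lerBlDl.
have cy k : `|(z k.+1).2 - (z k).2| <= (d - c) / 2 ^+ k.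
  by have /andP[h1 h2] := zy k; rewrite ger0_norm ?subr_ge0// lerBlDl.
have ba0 : 0 <= b - a by rewrite subr_ge0 ltW.
have dc0 : 0 <= d - c by rewrite subr_ge0 ltW.
have [x [xl xb]] := fast_Cauchy_cvg ba0 cx.
have [y [yl yb]] := fast_Cauchy_cvg dc0 cy.
have xab : a <= x <= b.
  apply/andP; split.
    by apply: (ler_cvgn (cvg_cst a) xl) => k; have [] := bz k.
  by apply: (ler_cvgn xl (cvg_cst b)) => k; have [_ h1 _ _ _] := bz k; have := w0 k; lra.
have ycd : c <= y <= d.
  apply/andP; split.
    by apply: (ler_cvgn (cvg_cst c) yl) => k; have [] := bz k.
  by apply: (ler_cvgn yl (cvg_cst d)) => k; have [_ _ _ h1 _] := bz k; have := h0 k; lra.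
have [al [be D]] := H x y xab ycd.
set l := (b - a) + (d - c); have l0 : 0 < l by rewrite addr_gt0// subr_gt0.
(* At level [k] the linear estimate gives $2\cdot3e\,(w_k+h_k)^2=6e\,l^2/4^k$, which this choice
   makes equal to the lower bound $ep/4^k$, a contradiction. *)
pose e := ep / (6 * l ^+ 2); have l20 : 0 < 6 * l ^+ 2 by rewrite mulr_gt0// exprn_gt0.
have e0 : 0 < e by rewrite divr_gt0.
have [dl dl0 Hd] := D e e0.
have [k Hk] : exists k, 3 * l / 2 ^+ k <= dl.
  have cg : (geometric (3 * l) 2^-1 : nat -> R) k @[k --> \oo] --> (0 : R).
    by apply: cvg_geometric; rewrite ger0_norm ?invf_lt1// ltr1n.
  have /cvgrPdist_le/(_ dl dl0)[k _ Hk] := cg; exists k.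
  have := Hk k (leqnn k); rewrite /= sub0r normrN => /(le_trans (ler_norm _)).
  by rewrite /geometric/= exprVn.
have [az zb cz zd big] := bz k.
have [[px py] [qx qy]] := cdiff_rect_cont (sub k (z k) az zb cz zd).
have xk := xb k; have yk := yb k; have w1 := w0 k; have h1 := h0 k.
set X := (z k).1 in az zb px py qx qy big xk *; set Y := (z k).2 in cz zd px py qx qy big yk *.
have lk : 3 * (w k + h k) <= dl by rewrite /w /h -mulrDl mulrA.
have xk' : `|x - X| <= 2 * w k by rewrite /w mulrA.
have yk' : `|y - Y| <= 2 * h k by rewrite /h mulrA.
have near s t : X <= s <= X + w k -> Y <= t <= Y + h k ->
    `|p s t - p x y - (al * (s - x) - be * (t - y))| <= e * (3 * (w k + h k)) /\
    `|q s t - q x y - (be * (s - x) + al * (t - y))| <= e * (3 * (w k + h k)).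
  move=> sX tY; have d1 := dist_nested xk' sX; have d2 := dist_nested yk' tY.
  have e12 : `|s - x| + `|t - y| <= 3 * (w k + h k) by rewrite mulrDr lerD.
  have e1 : `|s - x| <= dl by apply: le_trans lk; apply: le_trans e12; rewrite lerDl.
  have e2 : `|t - y| <= dl by apply: le_trans lk; apply: le_trans e12; rewrite lerDr.
  have [] := Hd (s - x) (t - y) e1 e2; rewrite !subrKC => n1 n2.
  have d12 : e * (`|s - x| + `|t - y|) <= e * (3 * (w k + h k)) by rewrite ler_pM2l.
  by split; [apply: le_trans n1 d12|apply: le_trans n2 d12].
have := contour_near_linear w1 h1 (conj px py) (conj qx qy) near.
move: big; rewrite ltNge => /negP no le1; apply: no; apply: le_trans le1 _.
rewrite (_ : 2 * (e * (3 * (w k + h k))) * (w k + h k) = e * (6 * l ^+ 2) / 4 ^+ k); last first.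
  rewrite /w /h -mulrDl -/l (_ : 4 = 2 ^+ 2 :> R); last by ring.
  by rewrite -exprM mulnC exprM; field; rewrite expf_neq0.
by rewrite /e divfK// gt_eqF.
Qed.

End Goursat.

(** * Differentiability in epsilon form over a numeric field *)

Section complex_derivative.
Variable K : numFieldType.

Lemma derivable_eps (f : K -> K) (z : K) : derivable f z (1 : K) ->
  exists D : K, forall e : K, 0 < e -> exists2 d : K, 0 < d &
    forall h : K, `|h| < d -> `|f (z + h) - f z - D * h| <= e * `|h|.
Proof.
move=> /cvg_ex[D /cvgrPdist_le HD]; exists D => e e0.
have [d /= d0 Hd] := HD e e0; exists d => // h hd.
have [->|h0] := eqVneq h 0; first by rewrite addr0 subrr mulr0 subrr !normr0 mulr0.
have := Hd h; rewrite /= sub0r normrN => /(_ hd h0).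
rewrite distrC [h *: 1]mulr1 (addrC h) => H.
have -> : f (z + h) - f z - D * h = (h^-1 *: (f (z + h) - f z) - D) * h.
  by rewrite /GRing.scale/= mulrBl mulrAC mulVf// mul1r.
by rewrite normrM ler_wpM2r.
Qed.

Lemma derivable_line (n : nat) (F : 'rV[K]_n -> K) (z v : 'rV[K]_n) (t : K) :
  differentiable F (z + t *: v) -> derivable (fun s : K => F (z + s *: v)) t (1 : K).
Proof.
move=> /(@diff_derivable _ _ _ _ _ v); rewrite /derivable.
move=> df; suff <- : (fun h : K => h^-1 *: ((F \o shift (z + t *: v)) (h *: v) - F (z + t *: v))) =
  (fun h : K => h^-1 *: (((fun s : K => F (z + s *: v)) \o shift t) (h *: 1) - F (z + t *: v))) by [].
apply/funext => h /=.
by congr (_ *: (F _ - _)); rewrite [h *: 1]mulr1 scalerDl addrCA.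
Qed.

Lemma derivable_kernel (n : nat) (F : 'rV[K]_n -> K) (z v : 'rV[K]_n) (t : K) : t != 0 ->
  differentiable F (z + t *: v) -> derivable (fun s : K => F (z + s *: v) / s) t (1 : K).
Proof.
move=> t0 dF; apply: derivableM; first exact: derivable_line.
by apply: derivableV => //; exact: derivable_id.
Qed.

(** [L] is the candidate gradient; packing $h\mapsto\sum_jL_jh_j$ as a continuous linear map
    identifies it with the Fréchet differential. *)
Lemma differentiable_eps (n : nat) (F : 'rV[K]_n -> K) (z L : 'rV[K]_n) :
  (forall e : K, 0 < e -> exists2 d : K, 0 < d &
    forall h : 'rV[K]_n, `|h| < d -> `|F (z + h) - F z - \sum_(j < n) L ord0 j * h ord0 j| <= e * `|h|) ->
  differentiable F z.
Proof.
move=> H; pose l (h : 'rV[K]_n) : K := (\sum_(j < n) L ord0 j * h ord0 j).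
have ll : linear l.
  move=> a u v; rewrite /l scaler_sumr -big_split/=; apply: eq_bigr => j _.
  by rewrite !mxE mulrDr mulrCA.
pose lL : {linear 'rV[K]_n -> K} := HB.pack l (GRing.isLinear.Build _ _ _ _ l ll).
have lc : continuous lL.
  move=> x; apply: continuous_rV_sum => j.
  by apply: continuous_rVM; [exact: continuous_rV_cst|exact: continuous_rV_coord].
have E : F \o shift z = cst (F z) + lL +o_ (nbhs (0 : 'rV[K]_n)) id.
  apply/eqaddoP => e e0; have [d d0 Hd] := H e e0.
  suff : nbhs (0 : 'rV[K]_n) (fun h : 'rV[K]_n => `|F (h + z) - (F z + l h)| <= e * `|h|) by [].
  apply/(nbhs_normP (0 : 'rV[K]_n)); exists d => //= h; rewrite /= sub0r normrN => hd; have := Hd h hd.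
  by rewrite opprD addrA (addrC h).
apply/diff_locallyP; have -> := diff_unique lc E; by split.
Qed.

Lemma differentiable_continuous_eps (n : nat) (F : 'rV[K]_n -> K) (z : 'rV[K]_n) : differentiable F z ->
  forall e : K, 0 < e -> exists2 d : K, 0 < d & forall h : 'rV[K]_n, `|h| < d -> `|F (z + h) - F z| <= e.
Proof.
move=> /differentiable_continuous cF e e0.
have := (@cvgrPdist_le _ _ _ (nbhs z) (nbhs_filter z) F (F z)).1 cF e e0.
move=> /nbhs_normP[d /= d0 Hd]; exists d => // h hd; rewrite distrC; apply: Hd.
by rewrite /= opprD addrA subrr sub0r normrN.
Qed.

End complex_derivative.

(** * A mean value inequality on squares, with F/z as integrand *)

Section mean_value_square.
Variable R : realType.
Implicit Types (p q : R -> R -> R) (t e x y : R).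

(** Real and, in [quot_im], imaginary part of $(p+iq)/(x+iy)$. *)
Definition quot_re p q x y := (p x y * x + q x y * y) / (x ^+ 2 + y ^+ 2).
Definition quot_im p q x y := (q x y * x - p x y * y) / (x ^+ 2 + y ^+ 2).

Definition square_holomorphic p q t := cdiff_rect p q (- t) t (- t) t /\
  forall x y, - t <= x <= t -> - t <= y <= t -> x ^+ 2 + y ^+ 2 != 0 -> cdiff (quot_re p q) (quot_im p q) x y.

(** Multiplication by $-i$. It carries estimates of the real part at the centre over to the
    imaginary part, and applied twice it flips the sign. *)
Lemma square_holomorphic_rot p q t : square_holomorphic p q t ->
  square_holomorphic q (fun x y => - p x y) t.
Proof.
move=> [h1 h2]; split=> [x y xt yt|x y xt yt xy]; first exact: cdiffN (h1 x y xt yt).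
rewrite (_ : quot_re _ _ = quot_im p q); last first.
  by apply/funext => s; apply/funext => u; rewrite /quot_re /quot_im mulNr.
rewrite (_ : quot_im q (fun x y => - p x y) = fun x y => - quot_re p q x y); last first.
  by apply/funext => s; apply/funext => u; rewrite /quot_re /quot_im -[RHS]mulNr; congr (_ / _); ring.
exact: cdiffN (h2 x y xt yt xy).
Qed.

Lemma quot_sqr p q x y : x ^+ 2 + y ^+ 2 != 0 ->
  quot_re p q x y ^+ 2 <= (p x y ^+ 2 + q x y ^+ 2) / (x ^+ 2 + y ^+ 2) /\
  quot_im p q x y ^+ 2 <= (p x y ^+ 2 + q x y ^+ 2) / (x ^+ 2 + y ^+ 2).
Proof.
move=> r0; have rp : 0 < x ^+ 2 + y ^+ 2 by rewrite lt_neqAle eq_sym r0 addr_ge0 ?sqr_ge0.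
have E : (p x y ^+ 2 + q x y ^+ 2) / (x ^+ 2 + y ^+ 2) = quot_re p q x y ^+ 2 + quot_im p q x y ^+ 2.
  by rewrite /quot_re /quot_im; field.
by rewrite E lerDl lerDr !sqr_ge0.
Qed.

(** The integrand is $-iF(z)/z$. The region between the squares is cut into four rectangles that
    avoid 0, and Goursat annihilates each of them. *)
Lemma contour_annulus p q e t : 0 < e -> e < t -> square_holomorphic p q t ->
  contour (quot_im p q) (fun x y => - quot_re p q x y) (- t) t (- t) t =
  contour (quot_im p q) (fun x y => - quot_re p q x y) (- e) e (- e) e.
Proof.
move=> e0 et [_ H]; set A := quot_im p q; set B := fun x y => - quot_re p q x y.
have t0 := lt_trans e0 et.
have cd x y : - t <= x <= t -> - t <= y <= t -> x ^+ 2 + y ^+ 2 != 0 -> cdiff A B x y.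
  by move=> xt yt xy; exact: cdiffN (H x y xt yt xy).
have nx x y : x != 0 -> x ^+ 2 + y ^+ 2 != 0.
  by move=> x0; rewrite gt_eqF// ltr_pwDl ?sqr_ge0// lt_neqAle eq_sym sqrf_eq0 x0 sqr_ge0.
have ny x y : y != 0 -> x ^+ 2 + y ^+ 2 != 0 by move=> y0; rewrite addrC; exact: nx.
have ne : - e != 0 by rewrite oppr_eq0 gt_eqF.
have pe : e != 0 by rewrite gt_eqF.
have nt : - t != 0 by rewrite oppr_eq0 gt_eqF.
have pt : t != 0 by rewrite gt_eqF.
have l1 : - t <= - e by lra.
have l2 : - e <= e by lra.
have l3 : e <= t by lra.
have l4 : - e <= t by lra.
have l5 : - t <= t by lra.
have l6 : - t < - e by lra.
have l7 : - e < e by lra.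
have it : - t <= t <= t by rewrite l5 lexx.
have it' : - t <= - t <= t by rewrite l5 lexx.
have ie : - t <= e <= t by apply/andP; split; lra.
have ie' : - t <= - e <= t by apply/andP; split; lra.
have hA a b y : - t <= a -> b <= t -> - t <= y <= t -> y != 0 -> cont_on a b (fun x => A x y).
  move=> ta bt yt y0 x /andP[ax xb].
  by have [] := cdiff_continuous (cd x y _ yt (ny x y y0)) => //; rewrite (le_trans ta ax) (le_trans xb bt).
have hB a b x : - t <= a -> b <= t -> - t <= x <= t -> x != 0 -> cont_on a b (fun y => B x y).
  move=> ta bt xt x0 y /andP[ay yb].
  have yt : - t <= y <= t by rewrite (le_trans ta ay) (le_trans yb bt).
  by have [] := cdiff_continuous (cdiffN (cd x y xt yt (nx x y x0))).
have G a b c d : a < b -> c < d -> - t <= a -> b <= t -> - t <= c -> d <= t ->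
    (forall x y, a <= x <= b -> c <= y <= d -> x ^+ 2 + y ^+ 2 != 0) -> contour A B a b c d = 0.
  move=> ab cd' ta bt tc dt nz; apply: Goursat => // x y xab ycd; apply: cd (nz x y xab ycd).
    by case/andP: xab => x1 x2; rewrite (le_trans ta x1) (le_trans x2 bt).
  by case/andP: ycd => x1 x2; rewrite (le_trans tc x1) (le_trans x2 dt).
have tt : - t < t by lra.
have l8 : - t <= e by lra.
have l9 : - e <= t by lra.
have S1 := contour_splitx l1 l4 l5 (hA _ _ _ (lexx _) (lexx _) it' nt) (hA _ _ _ (lexx _) (lexx _) it pt)
  (hB _ _ _ (lexx _) (lexx _) it' nt) (hB _ _ _ (lexx _) (lexx _) ie' ne) (hB _ _ _ (lexx _) (lexx _) it pt).
have S2 := contour_splitx l2 l3 l5 (hA _ _ _ l1 (lexx _) it' nt) (hA _ _ _ l1 (lexx _) it pt)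
  (hB _ _ _ (lexx _) (lexx _) ie' ne) (hB _ _ _ (lexx _) (lexx _) ie pe) (hB _ _ _ (lexx _) (lexx _) it pt).
have S3 := contour_splity l2 l1 l4 (hA _ _ _ l1 l3 it' nt) (hA _ _ _ l1 l3 ie' ne) (hA _ _ _ l1 l3 it pt)
  (hB _ _ _ (lexx _) (lexx _) ie' ne) (hB _ _ _ (lexx _) (lexx _) ie pe).
have S4 := contour_splity l2 l2 l3 (hA _ _ _ l1 l3 ie' ne) (hA _ _ _ l1 l3 ie pe) (hA _ _ _ l1 l3 it pt)
  (hB _ _ _ l1 (lexx _) ie' ne) (hB _ _ _ l1 (lexx _) ie pe).
rewrite S1 S2 S3 S4.
rewrite (G (- t) (- e) (- t) t)//; last by move=> x y /andP[_ xe] _; apply: nx; rewrite lt_eqF// (le_lt_trans xe)// oppr_lt0.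
rewrite (G e t (- t) t)//; last by move=> x y /andP[xe _] _; apply: nx; rewrite gt_eqF// (lt_le_trans e0).
rewrite (G (- e) e (- t) (- e))//; last by move=> x y _ /andP[_ ye]; apply: ny; rewrite lt_eqF// (le_lt_trans ye)// oppr_lt0.
rewrite (G (- e) e e t)//; last by move=> x y _ /andP[ye _]; apply: ny; rewrite gt_eqF// (lt_le_trans e0).
by rewrite !add0r !addr0.
Qed.

(** On opposite sides of the small square the contributions of [p] add up, to at least
    $\frac32p(0)e$, whereas those of [q] are subtracted, so only the oscillation of [q] enters; the
    denominator is at most $2e^2$. *)
Lemma boundary_integrand_ge p q e x : 0 < e -> - e <= x <= e -> 0 < p 0 0 ->
  (forall s u, - e <= s <= e -> - e <= u <= e -> `|p s u - p 0 0| <= p 0 0 / 4 /\ `|q s u - q 0 0| <= p 0 0 / 4) ->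
  p 0 0 / (2 * e) <= quot_im p q x (- e) - quot_im p q x e /\
  p 0 0 / (2 * e) <= quot_re p q e x - quot_re p q (- e) x.
Proof.
move=> e0 xe p0 H.
have ee : - e <= e <= e by rewrite lexx andbT; lra.
have ee' : - e <= - e <= e by rewrite lexx /=; lra.
have xx : `|x| <= e by rewrite ler_norml.
have x2 : x ^+ 2 <= e ^+ 2 by rewrite -real_normK ?num_real// ler_sqr ?nnegrE// ltW.
have D0 : 0 < x ^+ 2 + e ^+ 2 by rewrite ltr_wpDl ?sqr_ge0// exprn_gt0.
have core (A B C D : R) : `|A - p 0 0| <= p 0 0 / 4 -> `|B - p 0 0| <= p 0 0 / 4 ->
    `|C - q 0 0| <= p 0 0 / 4 -> `|D - q 0 0| <= p 0 0 / 4 ->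
    p 0 0 / (2 * e) <= ((A + B) * e + (C - D) * x) / (x ^+ 2 + e ^+ 2).
  move=> hA hB hC hD; rewrite ler_pdivlMr// mulrAC ler_pdivrMr ?mulr_gt0//.
  have h1 : 3 / 2 * p 0 0 * e <= (A + B) * e.
    by rewrite ler_pM2r//; move: hA hB; rewrite !ler_norml => /andP[? ?] /andP[? ?]; lra.
  have h2 : - (p 0 0 / 2 * e) <= (C - D) * x.
    apply: (@le_trans _ _ (- (`|C - D| * `|x|))); last by rewrite -normrM; exact: lerNnormlW.
    rewrite lerN2 ler_pM//; have := ler_normB (C - q 0 0) (D - q 0 0).
    by rewrite opprB addrA subrK => ?; lra.
  have h3 : p 0 0 * (x ^+ 2 + e ^+ 2) <= p 0 0 * (2 * e ^+ 2) by rewrite ler_pM2l//; lra.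
  have h4 : p 0 0 * e * (2 * e) <= ((A + B) * e + (C - D) * x) * (2 * e).
    by rewrite ler_pM2r ?mulr_gt0//; lra.
  by apply: le_trans h3 _; apply: le_trans h4; rewrite expr2; lra.
have [a1 a2] := H x (- e) xe ee'; have [b1 b2] := H x e xe ee.
have [c1 c2] := H e x ee xe; have [d1 d2] := H (- e) x ee' xe.
split.
  have := core _ _ _ _ a1 b1 a2 b2; rewrite /quot_im sqrrN -mulrBl.
  by congr (_ <= _ / _); ring.
have := core _ _ _ _ c1 d1 c2 d2; rewrite /quot_re sqrrN -mulrBl (addrC (e ^+ 2)).
by congr (_ <= _ / _); ring.
Qed.

Definition boundary_sq p q t a := p a (- t) ^+ 2 + q a (- t) ^+ 2 + (p a t ^+ 2 + q a t ^+ 2) +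
  (p (- t) a ^+ 2 + q (- t) a ^+ 2 + (p t a ^+ 2 + q t a ^+ 2)).

Lemma cont_onM (a b : R) (f g : R -> R) : cont_on a b f -> cont_on a b g -> cont_on a b (fun x => f x * g x).
Proof. by move=> cf cg x xab; apply: cvgM; [exact: cf|exact: cg]. Qed.

Lemma cont_boundary_sq p q t : 0 < t -> square_holomorphic p q t -> cont_on (- t) t (boundary_sq p q t).
Proof.
move=> t0 [/cdiff_rect_cont[[px py] [qx qy]] _].
have tt : - t <= t <= t by rewrite lexx andbT; lra.
have tt' : - t <= - t <= t by rewrite lexx /=; lra.
have sq f : cont_on (- t) t f -> cont_on (- t) t (fun x => f x ^+ 2).
  by move=> cf; under eq_fun do rewrite expr2; exact: cont_onM.
by do ![apply: cont_onD]; apply: sq; [exact: px|exact: qx|exact: px|exact: qx|exact: py|exact: qy|exact: py|exact: qy].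
Qed.

(** A form of $2ab\le a^2+b^2$ that makes the linear integrand quadratic. The first term is scaled
    so that four of them, integrated over a side of length $2t$, cost exactly [P], half of the lower
    bound of the contour integral. *)
Lemma amgm_bound (P t Q N : R) : 0 < P -> 0 < t -> t ^+ 2 * Q ^+ 2 <= N ->
  `|Q| <= P / (2 * t) / 4 + 2 / (P * t) * N.
Proof.
move=> P0 t0 QN.
have E : P / (2 * t) / 4 + 2 / (P * t) * N = (P ^+ 2 / 8 + 2 * N) / (P * t) by field; rewrite !gt_eqF.
rewrite E ler_pdivlMr ?mulr_gt0//.
have := sqr_ge0 (P / 4 - t * `|Q|); rewrite -[Q ^+ 2]real_normK ?num_real// in QN.
by move: (`|Q|) QN => z QN; rewrite sqrrB exprMn => h; clear -h QN; lra.
Qed.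

(** The contour integral of $-iF/z$ equals $2\pi p(0)$, but the crude lower bound $2p(0)$ from a
    tiny square suffices. On the large square the integrand is at most $p(0)/(2t)$ plus
    $\frac{2}{p(0)t}$ times the boundary values of $|F|^2$; subtracting leaves the claim. *)
Lemma mean_square_pos p q t : 0 < t -> square_holomorphic p q t -> 0 < p 0 0 ->
  t * p 0 0 ^+ 2 <= 2 * int_ab (- t) t (boundary_sq p q t).
Proof.
move=> t0 H p0; have [Hcd Hq] := H.
have tt : - t <= t by lra.
have t00 : - t <= 0 <= t by apply/andP; split; lra.
have [al [be D]] := Hcd 0 0 t00 t00.
pose K := `|al| + `|be| + 1; have K0 : 0 < K by rewrite ltr_wpDl// addr_ge0.
have [dl dl0 Hd] := D 1 ltr01.
have p08 : 0 < p 0 0 / (8 * (K + 1)) by rewrite divr_gt0// mulr_gt0// addr_gt0.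
pose e := Num.min (Num.min dl t) (p 0 0 / (8 * (K + 1))) / 2.
have e0 : 0 < e by rewrite divr_gt0// !lt_min dl0 t0.
have : e < Num.min (Num.min dl t) (p 0 0 / (8 * (K + 1))) by rewrite /e in e0 *; lra.
rewrite !lt_min => /andP[/andP[/ltW edl et] ep].
have near0 s u : - e <= s <= e -> - e <= u <= e -> `|p s u - p 0 0| <= p 0 0 / 4 /\ `|q s u - q 0 0| <= p 0 0 / 4.
  rewrite -!ler_norml => se ue; have [] := Hd s u (le_trans se edl) (le_trans ue edl).
  rewrite !add0r mul1r => h1 h2.
  have bd (c1 c2 v : R) : `|c1| + `|c2| <= K - 1 -> `|v - (c1 * s + c2 * u)| <= `|s| + `|u| -> `|v| <= p 0 0 / 4.
    move=> hc hv; have := ler_normD (v - (c1 * s + c2 * u)) (c1 * s + c2 * u); rewrite subrK => T.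
    have T2 : `|c1 * s + c2 * u| <= (K - 1) * e.
      apply: le_trans (ler_normD _ _) _; rewrite !normrM.
      apply: (@le_trans _ _ (`|c1| * e + `|c2| * e)); first by rewrite lerD// ler_wpM2l.
      by rewrite -mulrDl ler_wpM2r// ltW.
    have T3 : (K + 1) * e <= p 0 0 / 8.
      have K10 : 0 < 8 * (K + 1) by rewrite mulr_gt0// addr_gt0.
      by move: ep; rewrite (ltr_pdivlMr _ _ K10) => ep'; clear -ep'; lra.
    apply: (@le_trans _ _ ((K + 1) * e)).
      rewrite (_ : (K + 1) * e = (e + e) + (K - 1) * e); last by ring.
      by apply: le_trans T _; rewrite lerD// (le_trans hv)// lerD.
    by apply: le_trans T3 _; rewrite ler_pM2l// lef_pV2 ?posrE// ler_nat.
  split; first by apply: (bd al (- be)); rewrite ?normrN ?/K ?mulNr//; lra.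
  by apply: (bd be al) => //; rewrite /K; lra.
set A := quot_im p q; set B := fun x y => - quot_re p q x y.
have ne x y : x != 0 -> x ^+ 2 + y ^+ 2 != 0.
  by move=> x0; rewrite gt_eqF// ltr_pwDl ?sqr_ge0// lt_neqAle eq_sym sqrf_eq0 x0 sqr_ge0.
have ct r : 0 < r -> r <= t -> [/\ cont_on (- r) r (fun x => A x (- r)), cont_on (- r) r (fun x => A x r),
    cont_on (- r) r (fun y => quot_re p q r y) & cont_on (- r) r (fun y => quot_re p q (- r) y)].
  move=> r0 rt.
  have sub x : - r <= x <= r -> - t <= x <= t by move=> /andP[? ?]; apply/andP; split; lra.
  have rr : - r <= r <= r by rewrite lexx andbT; lra.
  have rr' : - r <= - r <= r by rewrite lexx /=; lra.
  have rn : r != 0 by rewrite gt_eqF.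
  have rn' : - r != 0 by rewrite oppr_eq0 gt_eqF.
  split=> x xr.
  - have yn : x ^+ 2 + (- r) ^+ 2 != 0 by rewrite addrC ne.
    exact: (cdiff_continuous (cdiffN (Hq x (- r) (sub _ xr) (sub _ rr') yn))).1.
  - have yn : x ^+ 2 + r ^+ 2 != 0 by rewrite addrC ne.
    exact: (cdiff_continuous (cdiffN (Hq x r (sub _ xr) (sub _ rr) yn))).1.
  - exact: (cdiff_continuous (Hq r x (sub _ rr) (sub _ xr) (ne _ _ rn))).2.
  - exact: (cdiff_continuous (Hq (- r) x (sub _ rr') (sub _ xr) (ne _ _ rn'))).2.
have CE r : 0 < r -> r <= t -> contour A B (- r) r (- r) r =
    int_ab (- r) r (fun x => A x (- r) - A x r) + int_ab (- r) r (fun y => quot_re p q r y - quot_re p q (- r) y).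
  move=> r0 rt; have [c1 c2 c3 c4] := ct r r0 rt.
  rewrite /contour; congr (_ + _).
  have -> : (fun y => B r y - B (- r) y) = (fun y => quot_re p q (- r) y - quot_re p q r y).
    by apply/funext => y; rewrite /B opprK addrC.
  by rewrite (int_abB c4 c3) (int_abB c3 c4) opprB.
have low : 2 * p 0 0 <= contour A B (- e) e (- e) e.
  have [c1 c2 c3 c4] := ct e e0 (ltW et); rewrite (CE e e0 (ltW et)).
  have ll : - e <= e by lra.
  have half (f g : R -> R) : cont_on (- e) e f -> cont_on (- e) e g ->
      (forall x, - e <= x <= e -> p 0 0 / (2 * e) <= f x - g x) -> p 0 0 <= int_ab (- e) e (fun x => f x - g x).
    move=> cf cg fg; have -> : p 0 0 = int_ab (- e) e (fun=> p 0 0 / (2 * e)).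
      by rewrite int_ab_cst//; field; rewrite gt_eqF.
    by apply: int_ab_le => //; [exact: cont_on_cst|exact: cont_onB].
  have I1 := half _ _ c1 c2 (fun x xe => (boundary_integrand_ge e0 xe p0 near0).1).
  have I2 := half _ _ c3 c4 (fun x xe => (boundary_integrand_ge e0 xe p0 near0).2).
  by rewrite mulr_natl mulr2n lerD.
have up : contour A B (- t) t (- t) t <= p 0 0 + 2 / (p 0 0 * t) * int_ab (- t) t (boundary_sq p q t).
  have [c1 c2 c3 c4] := ct t t0 (lexx t); rewrite (CE t t0 (lexx t)).
  rewrite -int_abD; [|exact: cont_onB..].
  pose k := 2 / (p 0 0 * t); pose m := p 0 0 / (2 * t).
  have k0 : 0 < k by rewrite divr_gt0// mulr_gt0.
  have ptw x : - t <= x <= t -> (A x (- t) - A x t) + (quot_re p q t x - quot_re p q (- t) x) <=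
      m + k * boundary_sq p q t x.
    move=> xt.
    have aux (Q0 N r : R) : Q0 ^+ 2 <= N / r -> t ^+ 2 <= r -> 0 <= N -> `|Q0| <= m / 4 + k * N.
      move=> QN tr N0; have r0 : 0 < r by apply: lt_le_trans tr; rewrite exprn_gt0.
      have QN2 : t ^+ 2 * Q0 ^+ 2 <= N.
        rewrite mulrC -ler_pdivlMr ?exprn_gt0//; apply: le_trans QN _.
        by rewrite ler_wpM2l// lef_pV2 ?posrE ?exprn_gt0.
      by apply: amgm_bound.
    have tn : t != 0 by rewrite gt_eqF.
    have tn' : - t != 0 by rewrite oppr_eq0.
    have n1 : x ^+ 2 + (- t) ^+ 2 != 0 by rewrite addrC ne.
    have n2 : x ^+ 2 + t ^+ 2 != 0 by rewrite addrC ne.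
    have s1 := aux _ _ _ (quot_sqr p q n1).2; have s2 := aux _ _ _ (quot_sqr p q n2).2.
    have s3 := aux _ _ _ (quot_sqr p q (ne t x tn)).1; have s4 := aux _ _ _ (quot_sqr p q (ne (- t) x tn')).1.
    have ge1 (u v : R) : 0 <= u ^+ 2 + v ^+ 2 by rewrite addr_ge0 ?sqr_ge0.
    have {}s1 := s1 _ (ge1 _ _); have {}s2 := s2 _ (ge1 _ _); have {}s3 := s3 _ (ge1 _ _); have {}s4 := s4 _ (ge1 _ _).
    rewrite !sqrrN !lerDr !lerDl !sqr_ge0 in s1 s2 s3 s4.
    have {}s1 := s1 isT; have {}s2 := s2 isT; have {}s3 := s3 isT; have {}s4 := s4 isT.
    rewrite /boundary_sq !mulrDr; rewrite !mulrDr in s1 s2 s3 s4.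
    have a1 := ler_norm (A x (- t)); have a2 := lerNnormlW (lexx `|A x t|).
    have a3 := ler_norm (quot_re p q t x); have a4 := lerNnormlW (lexx `|quot_re p q (- t) x|).
    by rewrite /A in a1 a2 *; lra.
  apply: le_trans (int_ab_le _ _ ptw) _.
  - by apply: cont_onD; exact: cont_onB.
  - apply: cont_onD; first exact: cont_on_cst.
    by apply: cont_onM; [exact: cont_on_cst|exact: cont_boundary_sq].
  rewrite int_abD; [|exact: cont_on_cst|by apply: cont_onM; [exact: cont_on_cst|exact: cont_boundary_sq]].
  rewrite int_ab_cst//; apply: lerD.
    by rewrite le_eqVlt; apply/orP; left; apply/eqP; rewrite /m; field; rewrite gt_eqF.
  rewrite /int_ab RintegralZl//; apply: cont_on_integrable; exact: cont_boundary_sq.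
have := contour_annulus e0 et H; rewrite -/A -/B => E; rewrite E in up.
have := le_trans low up; set I := int_ab _ _ _ => h.
have : p 0 0 <= 2 / (p 0 0 * t) * I by lra.
by rewrite mulrAC ler_pdivlMr ?mulr_gt0// mulrA -expr2 mulrC.
Qed.

Lemma mean_square p q t : 0 < t -> square_holomorphic p q t ->
  t * (p 0 0 ^+ 2 + q 0 0 ^+ 2) <= 4 * int_ab (- t) t (boundary_sq p q t).
Proof.
move=> t0 H; rewrite mulrDr.
have I0 r s : 0 <= int_ab (- t) t (boundary_sq r s t).
  by apply: Rintegral_ge0 => x _; rewrite !addr_ge0 ?sqr_ge0.
have one r s : square_holomorphic r s t -> t * r 0 0 ^+ 2 <= 2 * int_ab (- t) t (boundary_sq r s t).
  move=> hr; have [r0|r0|r0] := ltrgt0P (r 0 0).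
  - exact: mean_square_pos.
  - have := mean_square_pos t0 (square_holomorphic_rot (square_holomorphic_rot hr)); rewrite oppr_gt0 => /(_ r0).
    rewrite sqrrN; congr (_ <= _ * int_ab _ _ _); apply/funext => x.
    by rewrite /boundary_sq !sqrrN.
  - by rewrite r0 expr0n/= mulr0 mulr_ge0.
have h1 := one _ _ H; have := one _ _ (square_holomorphic_rot H).
have -> : boundary_sq q (fun x y => - p x y) t = boundary_sq p q t.
  by apply/funext => x; rewrite /boundary_sq !sqrrN; ring.
by move=> h2; lra.
Qed.

End mean_value_square.

(** * From the Bergman norm to the L^2 norm *)

Section complex_numbers.
Variable R : realType.
Local Open Scope complex_scope.
Implicit Types (z w : R[i]) (a b : R).

Lemma normc_real_ge0 z : `|z| = (Normc.normc z)%:C.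
Proof. by []. Qed.

Lemma normc_sqr z : Normc.normc z ^+ 2 = complex.Re z ^+ 2 + complex.Im z ^+ 2.
Proof. by case: z => a b /=; rewrite sqr_sqrtr// addr_ge0// sqr_ge0. Qed.

Lemma normc_ge0' z : 0 <= Normc.normc z.
Proof. by case: z => a b /=; rewrite sqrtr_ge0. Qed.

Lemma normc_le z : Normc.normc z <= `|complex.Re z| + `|complex.Im z|.
Proof.
rewrite -ler_sqr ?nnegrE ?normc_ge0' ?addr_ge0// normc_sqr sqrrD !real_normK ?num_real//.
by rewrite [leRHS]addrAC lerDl mulrn_wge0// mulr_ge0.
Qed.

Lemma Re_le_normc z : `|complex.Re z| <= Normc.normc z.
Proof.
by rewrite -ler_sqr ?nnegrE ?normc_ge0'// normc_sqr real_normK ?num_real// lerDl sqr_ge0.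
Qed.

Lemma Im_le_normc z : `|complex.Im z| <= Normc.normc z.
Proof.
by rewrite -ler_sqr ?nnegrE ?normc_ge0'// normc_sqr real_normK ?num_real// lerDr sqr_ge0.
Qed.

Lemma complex_pos z : 0 < z -> z = (complex.Re z)%:C /\ 0 < complex.Re z.
Proof. by case: z => a b; rewrite ltcE/= => /andP[/eqP-> a0]. Qed.

Lemma normc_lt z d : 0 < d -> (`|z| < d) = (Normc.normc z < complex.Re d).
Proof.
by move=> /complex_pos[-> d0]; rewrite normc_real_ge0 ltcR.
Qed.

Lemma normc_le_mul z w e : (`|z| <= e%:C * `|w|) = (Normc.normc z <= e * Normc.normc w).
Proof. by rewrite !normc_real_ge0 -rmorphM/= lecR. Qed.

Lemma cdiff_complex (f : R[i] -> R[i]) a b :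
  (exists D : R[i], forall e : R[i], 0 < e -> exists2 d : R[i], 0 < d &
    forall h : R[i], `|h| < d -> `|f ((a +i* b) + h) - f (a +i* b) - D * h| <= e * `|h|) ->
  cdiff (fun x y => complex.Re (f (x +i* y))) (fun x y => complex.Im (f (x +i* y))) a b.
Proof.
move=> [[al be] H]; exists al, be => e e0.
have e0' : 0 < e%:C by rewrite ltcR.
have [d d0 Hd] := H _ e0'.
have [_ rd0] := complex_pos d0.
(* The modulus of $h+ik$ is at most $|h|+|k|$, hence at most two thirds of the complex radius,
   strictly inside it. *)
exists (complex.Re d / 3); first by rewrite divr_gt0.
move=> h k hd kd.
have nhk : Normc.normc (h +i* k) <= `|h| + `|k| by exact: normc_le.
have lt1 : `|h +i* k| < d by rewrite normc_lt//; lra.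
have := Hd _ lt1; rewrite normc_le_mul => H1.
have H2 : Normc.normc (f (a +i* b + (h +i* k)) - f (a +i* b) - (al +i* be) * (h +i* k)) <= e * (`|h| + `|k|).
  by apply: le_trans H1 _; rewrite ler_pM2l.
have E : (a +i* b) + (h +i* k) = (a + h) +i* (b + k) by [].
rewrite E in H2; split.
  apply: le_trans H2; apply: le_trans (Re_le_normc _).
  by case: (f _) => u1 u2; case: (f _) => v1 v2 /=.
apply: le_trans H2; apply: le_trans (Im_le_normc _).
by case: (f _) => u1 u2; case: (f _) => v1 v2 /=; rewrite (addrC (be * h)).
Qed.

Lemma cpointD n (x y : 'rV[R]_n) j a b :
  Defs.cpoint (x + a *: delta_mx ord0 j) (y + b *: delta_mx ord0 j) =
  Defs.cpoint x y + (a +i* b) *: delta_mx ord0 j.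
Proof.
apply/rowP => k; rewrite !mxE eqxx /=; case: (k == j) => /=.
  by rewrite !mulr1.
by rewrite !mulr0 !addr0.
Qed.

Lemma tube_cpoint n (r : R) (x y : 'rV[R]_n) : tube r (Defs.cpoint x y) <-> enorm y < r.
Proof.
rewrite /tube /=; suff -> : map_mx (@complex.Im R) (Defs.cpoint x y) = y by [].
by apply/rowP => k; rewrite !mxE.
Qed.

(** Restriction of [F] to the complex line through $x+iy$ in direction $e_j$. The quotient $F/s$ is
    differentiated over the complex field and only then split into its real and imaginary parts. *)
Lemma holomorphic_square n (r t : R) (F : 'rV[R[i]]_n -> R[i]) (x y : 'rV[R]_n) j : holomorphic_on (tube r) F ->
  (forall b, `|b| <= t -> enorm (y + b *: delta_mx ord0 j) < r) ->
  square_holomorphic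
    (fun a b => complex.Re (F (Defs.cpoint (x + a *: delta_mx ord0 j) (y + b *: delta_mx ord0 j))))
    (fun a b => complex.Im (F (Defs.cpoint (x + a *: delta_mx ord0 j) (y + b *: delta_mx ord0 j)))) t.
Proof.
move=> hF yt.
pose z := Defs.cpoint x y; pose v : 'rV[R[i]]_n := delta_mx ord0 j.
have dF a b : - t <= b <= t -> holomorphic_on [set z + (a +i* b) *: v] F.
  rewrite -ler_norml => bt _ ->; rewrite -cpointD; apply: hF; apply/tube_cpoint; exact: yt.
have E : (fun a b => F (Defs.cpoint (x + a *: delta_mx ord0 j) (y + b *: delta_mx ord0 j))) =
    (fun a b => F (z + (a +i* b) *: v)).
  by apply/funext => a; apply/funext => b; rewrite cpointD.
split=> [a b _ bt|a b _ bt ab0].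
  have := cdiff_complex (f := fun s => F (z + s *: v)) (derivable_eps (derivable_line (dF a b bt _ erefl))).
  by rewrite (_ : (fun a b => complex.Re _) = fun a b => complex.Re (F (z + (a +i* b) *: v))); [rewrite (_ : (fun a b => complex.Im _) = fun a b => complex.Im (F (z + (a +i* b) *: v)))|];
    rewrite //; apply/funext => a'; apply/funext => b'; rewrite cpointD.
have nz : (a +i* b) != 0.
  by apply: contra ab0 => /eqP[-> ->]; rewrite expr0n/= addr0.
have := cdiff_complex (f := fun s => F (z + s *: v) / s) (derivable_eps (derivable_kernel nz (dF a b bt _ erefl))).
congr cdiff; apply/funext => a'; apply/funext => b'; rewrite /quot_re /quot_im cpointD -/z -/v.
  by case: (F _) => p q /=; rewrite mulrN opprK !mulrA -mulrDl.
by case: (F _) => p q /=; rewrite mulrN !mulrA addrC -mulrBl.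
Qed.

End complex_numbers.

(** * From boundary values to averages, one coordinate at a time *)

Section mean_iteration.
Variable R : realType.
Local Notation lb := (@lebesgue_measure R).

(** Integrating the hypothesis over $t$ in $[r/2,r]$ turns the point values $m(\pm t)$ into
    integrals: $\frac{r^2}4m_0\le16rA+4rA$, which is where 80 comes from. *)
Lemma average_bound (m : measurableTypeR R -> \bar R) (m0 : \bar R) (r : R) : 0 < r ->
  measurable_fun setT m -> (forall b, 0 <= m b)%E -> (0 <= m0)%E ->
  (forall t, r / 2 <= t <= r -> ((r / 2)%:E * m0 <= (8 * r)%:E * (m (- t)%R + m t) +
     8%:E * \int[lb]_(b in `[(- r)%R, r]) m b)%E) ->
  (m0 <= (80 / r)%:E * \int[lb]_(b in `[(- r)%R, r]) m b)%E.
Proof.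
move=> r0 mm mge m0ge H; set A := (\int[lb]_(b in _) m b)%E.
have A0 : (0 <= A)%E by exact: integral_ge0.
have mI : measurable (`[r / 2, r]%classic : set (measurableTypeR R)) by [].
have mN : measurable_fun [set: measurableTypeR R] (fun t => m (- t)%R).
  by apply: (measurableT_comp mm); exact: oppr_measurable.
have h1 : (\int[lb]_(t in `[(r / 2)%R, r]) ((r / 2)%:E * m0) <=
    \int[lb]_(t in `[(r / 2)%R, r]) ((8 * r)%:E * (m (- t)%R + m t) + 8%:E * A))%E.
  apply: ge0_le_integral => //.
  - by move=> t _; apply: mule_ge0 => //; rewrite lee_fin divr_ge0// ltW.
  - apply: emeasurable_funD; last exact: measurable_cst.
    by apply: measurable_funTS; apply: measurable_funeM; exact: emeasurable_funD.
have len : lb `[(r / 2)%R, r] = (r / 2)%:E.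
  by rewrite lebesgue_measure_itv/= lte_fin ltr_pdivrMr// ltr_pMr// ltr1n -EFinB; congr EFin; field.
have r8 : (0 <= 8 * r)%R by rewrite mulr_ge0// ltW.
have mT (f : measurableTypeR R -> \bar R) : measurable_fun setT f -> measurable_fun `[r / 2, r] f.
  exact: measurable_funTS.
have mD : measurable_fun setT (fun t : measurableTypeR R => m (- t)%R + m t)%E by exact: emeasurable_funD.
have mZ : measurable_fun setT (fun t : measurableTypeR R => (8 * r)%:E * (m (- t)%R + m t))%E by exact: measurable_funeM.
have D0 t : (0 <= m (- t)%R + m t)%E by rewrite adde_ge0.
have Z0 t : (0 <= (8 * r)%:E * (m (- t)%R + m t))%E by rewrite mule_ge0.
have A80 : (0 <= 8%:E * A)%E by rewrite mule_ge0.
rewrite integral_cst//= len ge0_integralD//= in h1; try exact: mT.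
rewrite integral_cst//= len ge0_integralZl//= in h1; try exact: mT.
rewrite ge0_integralD//= in h1; try exact: mT.
have s2 : (\int[lb]_(t in `[(r / 2)%R, r]) m t <= A)%E.
  apply: ge0_subset_integral => //; first exact: measurable_funTS.
  by move=> t; rewrite /= !in_itv/= => /andP[t1 ->]; rewrite andbT; lra.
have s1 : (\int[lb]_(t in `[(r / 2)%R, r]) m (- t)%R <= A)%E.
  apply: (@le_trans _ _ (\int[lb]_(t in `[(- r)%R, r]) m (- t)%R)%E).
    apply: ge0_subset_integral => //; first exact: measurable_funTS.
    by move=> t; rewrite /= !in_itv/= => /andP[t1 ->]; rewrite andbT; lra.
  rewrite /A le_eqVlt; apply/orP; left; apply/eqP.
  rewrite integral_mkcond [RHS]integral_mkcond.
  have mp : measurable_fun [set: measurableTypeR R] (m \_ `[- r, r]).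
    by apply/(measurable_restrictT m) => //; exact: measurable_funTS.
  have mp0 (b : measurableTypeR R) : (0 <= (m \_ `[(- r)%R, r]) b)%E by rewrite patchE; case: ifP.
  have n1 : (-1 != 0 :> R) by rewrite oppr_eq0 oner_eq0.
  have := ge0_integral_affine 0 n1 mp mp0; rewrite normrN1 invr1 mul1e => <-.
  apply: eq_integral => t _; rewrite mulN1r addr0 !patchE.
  suff -> : (- t \in `[- r, r]%classic) = (t \in `[- r, r]%classic) by [].
  by apply/idP/idP; rewrite !inE/= !in_itv/= => /andP[t1 t2]; apply/andP; split; lra.
have {}h1 : ((r / 2)%:E * m0 * (r / 2)%:E <= (8 * r)%:E * (A + A) + 8%:E * A * (r / 2)%:E)%E.
  apply: le_trans h1 _; apply: leeD => //; apply: lee_wpmul2l; first by rewrite lee_fin.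
  exact: leeD.
have [Aoo|Afin] := eqVneq A +oo%E; first by rewrite Aoo gt0_muley ?leey// lte_fin divr_gt0.
have fA : A = (fine A)%:E by rewrite fineK// ge0_fin_numE// lt_neqAle Afin leey.
have fm : m0 = (fine m0)%:E.
  rewrite fineK// ge0_fin_numE// lt_neqAle leey andbT; apply/eqP => m0oo.
  move: h1; rewrite m0oo fA gt0_muley ?lte_fin ?divr_gt0// gt0_mulye ?lte_fin ?divr_gt0//.
rewrite fA fm -!EFinM -!EFinD lee_fin in h1.
rewrite fA fm -EFinM lee_fin.
move: h1; move: (fine A) (fine m0) => a b h1.
have : r * (r * b) <= r * (80 * a) by lra.
by rewrite ler_pM2l// => h2; rewrite mulrAC ler_pdivlMr// mulrC; lra.
Qed.

(** Induction slices the first coordinate at 0, so the one-dimensional inequality is only ever used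
    at points whose coordinate in the direction of averaging is 0; this keeps all segments inside
    the box. *)
Lemma mean_iterate n (M : 'rV[R]_n -> \bar R) (K r : R) : 0 <= K -> 0 < r ->
  measurable_fun setT M -> (forall y, 0 <= M y)%E ->
  (forall y j, box r y -> y ord0 j = 0 -> (M y <= K%:E * \int[lb]_(b in `[(- r)%R, r]) M (y + b *: delta_mx ord0 j)%R)%E) ->
  (M 0%R <= (K ^+ n)%:E * \int[lebesgue_rV R n]_(y in box r) M y)%E.
Proof.
move=> K0 r0; elim: n M => [|n IH] M mM M0 H.
  have -> : box r = [set: 'rV[R]_0] by apply/seteqP; split=> // x _ [].
  have -> : M = fun=> M 0 by apply/funext => y; congr M; apply/rowP => -[].
  by rewrite integral_cst//= expr0 mul1e diracT mule1.
have mcons (a : R) : measurable_fun setT (fun v : 'rV[R]_n => rV_cons ((a : measurableTypeR R), v)).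
  by apply: (measurableT_comp (@measurable_rV_cons R n)); exact: measurable_pair1.
have cons0 (v : 'rV[R]_n) (b : R) : rV_cons ((0 : measurableTypeR R), v) + b *: delta_mx ord0 ord0 = rV_cons ((b : measurableTypeR R), v).
  apply/rV_ext => [|l]; rewrite mxE [X in _ + X]mxE [X in _ * X]mxE ?rV_consS ?rV_cons0 /=.
    by rewrite mulr1 add0r.
  by rewrite mulr0 addr0.
have consS (v : 'rV[R]_n) (j : 'I_n) (b : R) :
    rV_cons ((0 : measurableTypeR R), v) + b *: delta_mx ord0 (lift ord0 j) = rV_cons ((0 : measurableTypeR R), v + b *: delta_mx ord0 j).
  apply/rV_ext => [|l]; rewrite mxE [X in _ + X]mxE [X in _ * X]mxE ?rV_consS ?rV_cons0 /=.
    by rewrite mulr0 addr0.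
  by rewrite !mxE /= (inj_eq lift_inj).
have boxc (v : 'rV[R]_n) (b : R) : box r (rV_cons ((b : measurableTypeR R), v)) <-> `|b| <= r /\ box r v.
  split=> [h|[h1 h2] i].
    by split=> [|i]; [have := h ord0; rewrite rV_cons0|have := h (lift ord0 i); rewrite rV_consS].
  by have [l ->|->] := unliftP ord0 i; rewrite ?rV_consS ?rV_cons0.
have box0 (v : 'rV[R]_n) : box r v -> box r (rV_cons ((0 : measurableTypeR R), v)).
  by move=> bv; apply/boxc; rewrite normr0 ltW.
have := IH (fun v => M (rV_cons ((0 : measurableTypeR R), v))) (measurableT_comp mM (mcons 0)) (fun v => M0 _) _.
have -> : rV_cons ((0 : measurableTypeR R), 0 : 'rV[R]_n) = 0.
  by apply/rowP => k; have [l ->|->] := unliftP ord0 k; rewrite ?rV_consS ?rV_cons0 !mxE.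
move=> IH1; apply: le_trans (IH1 _) _.
  move=> y j by_ yj; have := H _ (lift ord0 j) (box0 _ by_); rewrite rV_consS => /(_ yj) /le_trans; apply.
  by rewrite le_eqVlt; apply/orP; left; apply/eqP; congr (_ * _)%E; apply: eq_integral => b _; rewrite consS.
rewrite exprSr EFinM -muleA; apply: lee_wpmul2l; first by rewrite lee_fin exprn_ge0.
have mbox m : measurable (@box R m r) by exact: measurable_box.
pose G (p : measurableTypeR R * 'rV[R]_n) : \bar R := ((M \_ (box r)) (rV_cons p))%E.
have mMb : measurable_fun setT (M \_ (box r)).
  by apply/(measurable_restrictT M); [exact: mbox|exact: measurable_funTS].
have Mb0 y : (0 <= (M \_ (box r)) y)%E by rewrite patchE; case: ifP.
have mG : measurable_fun setT G by apply: (measurableT_comp mMb); exact: measurable_rV_cons.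
have G0 p : (0 <= G p)%E by exact: Mb0.
rewrite [X in (_ <= _ * X)%E]integral_mkcond ge0_integral_rV_cons//.
rewrite (@fubini_tonelli _ _ (measurableTypeR R) _ R lb (lebesgue_rV R n) G)//.
have mGn : measurable_fun setT (fun v => \int[lb]_b G (b, v))%E.
  exact: (@measurable_fun_fubini_tonelli_G _ _ (measurableTypeR R) _ R lb G).
rewrite -ge0_integralZl//; last by move=> v _; exact: integral_ge0.
rewrite [leLHS]integral_mkcond; apply: ge0_le_integral => //.
- by move=> v _; rewrite patchE; case: ifP.
- apply/(measurable_restrictT (fun v => M (rV_cons ((0 : measurableTypeR R), v)))) => //.
    exact: mbox.
  by apply: measurable_funTS; exact: (measurableT_comp mM (mcons 0)).
- exact: measurable_funeM.
move=> v _; rewrite patchE; case: ifPn => [|_]; last by apply: mule_ge0; [rewrite lee_fin|exact: integral_ge0].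
rewrite inE => bv; have c0 : rV_cons ((0 : measurableTypeR R), v) ord0 ord0 = 0 by rewrite rV_cons0.
apply: le_trans (H _ ord0 (box0 _ bv) c0) _; apply: lee_wpmul2l; first by rewrite lee_fin.
rewrite integral_mkcond le_eqVlt; apply/orP; left; apply/eqP; apply: eq_integral => b _.
rewrite /G !patchE cons0; congr (if _ then _ else _).
apply/idP/idP; rewrite !inE/= in_itv/= -ler_norml => h.
  by apply/boxc.
by have [] := (boxc v b).1 h.
Qed.

End mean_iteration.

Section bergman_slice.
Variables (R : realType) (n : nat) (rho : R) (F : 'rV[R[i]]_n -> R[i]).
Hypothesis hF : holomorphic_on (tube rho) F.
Local Open Scope complex_scope.
Local Notation mu := (lebesgue_rV R n).
Local Notation lb := (@lebesgue_measure R).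
Local Notation E i := (delta_mx ord0 i : 'rV[R]_n).
Local Notation D := [set p : 'rV[R]_n * 'rV[R]_n | enorm p.2 < rho].

Lemma cpoint_cvg_eps (x y : 'rV[R]_n) (e : R) : enorm y < rho -> 0 < e ->
  exists2 d : R, 0 < d & forall x' y' : 'rV[R]_n,
    (forall i, `|x' ord0 i - x ord0 i| < d) -> (forall i, `|y' ord0 i - y ord0 i| < d) ->
    Normc.normc (F (Defs.cpoint x' y') - F (Defs.cpoint x y)) <= e.
Proof.
move=> yr e0; have dF : holomorphic_on [set Defs.cpoint x y] F by move=> _ ->; apply: hF; apply/tube_cpoint.
have e0' : 0 < e%:C by rewrite ltcR.
have [d d0 Hd] := differentiable_continuous_eps (dF _ erefl) e0'.
have [dE rd0] := complex_pos d0.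
exists (complex.Re d / 2) => [|x' y' xx yy]; first exact: divr_gt0.
have -> : Defs.cpoint x' y' = Defs.cpoint x y + (Defs.cpoint x' y' - Defs.cpoint x y) by rewrite addrC subrK.
rewrite -lecR -normc_real_ge0; apply: Hd.
have : ball_ (fun z : 'rV[R[i]]_n => `|z|) 0 d (Defs.cpoint x' y' - Defs.cpoint x y).
  rewrite -mx_norm_ball; split=> // i j; rewrite /ball/= !mxE sub0r normrN normc_lt//.
  apply: le_lt_trans (normc_le _) _ => /=.
  by have := xx j; have := yy j; lra.
by rewrite /= sub0r normrN.
Qed.

Definition sq_tube (p : 'rV[R]_n * 'rV[R]_n) : R := Normc.normc (F (Defs.cpoint p.1 p.2)) ^+ 2.

Lemma continuous_enorm : continuous (fun y : 'rV[R]_n => enorm y).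
Proof.
move=> y; apply: (@continuous_rV_comp _ _ y (fun x => \sum_(i < n) x ord0 i ^+ 2) Num.sqrt); last exact: sqrt_continuous.
apply: (@continuous_rV_sum _ _ y _ _ (fun i (x : 'rV[R]_n) => x ord0 i ^+ 2)) => i.
by apply: (@continuous_rVM _ _ y (fun x => x ord0 i) (fun x => x ord0 i)); exact: continuous_rV_coord.
Qed.

Lemma open_tube_slice : open D.
Proof.
rewrite (_ : D = snd @^-1` [set y | enorm y < rho])//; apply: open_comp => [p _|]; first exact: cvg_snd.
rewrite (_ : [set y | _] = (fun y : 'rV[R]_n => enorm y) @^-1` [set r | r < rho])//.
by apply: open_comp => [p _|]; [exact: continuous_enorm|exact: open_lt].
Qed.

Lemma continuous_tube_part (g : R[i] -> R) : (forall z w, `|g z - g w| <= Normc.normc (z - w)) ->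
  {in D, continuous (fun p => g (F (Defs.cpoint p.1 p.2)))}.
Proof.
move=> Hg [x y]; rewrite inE/= => yr; apply/cvgrPdist_le => e e0.
have [d d0 Hd] := cpoint_cvg_eps x yr e0.
exists (ball x d, ball y d) => /=; first by split; exact: nbhsx_ballx.
move=> [x' y'] /= [[_ bx] [_ by_]]; rewrite distrC; apply: le_trans (Hg _ _) _; apply: Hd => i.
  by have := bx ord0 i; rewrite /ball/= distrC.
by have := by_ ord0 i; rewrite /ball/= distrC.
Qed.

Lemma continuous_Re_tube : {in D, continuous (fun p => complex.Re (F (Defs.cpoint p.1 p.2)))}.
Proof.
apply: continuous_tube_part => z w; apply: le_trans (Re_le_normc _).
by case: z => a b; case: w.
Qed.

Lemma continuous_Im_tube : {in D, continuous (fun p => complex.Im (F (Defs.cpoint p.1 p.2)))}.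
Proof.
apply: continuous_tube_part => z w; apply: le_trans (Im_le_normc _).
by case: z => a b; case: w.
Qed.

Lemma measurable_sq_tube : measurable_fun D sq_tube.
Proof.
rewrite (_ : sq_tube = fun p => complex.Re (F (Defs.cpoint p.1 p.2)) ^+ 2 + complex.Im (F (Defs.cpoint p.1 p.2)) ^+ 2).
  apply: measurable_funD; apply: measurable_funX; apply: continuous_measurable_rV2 open_tube_slice _.
    exact: continuous_Re_tube.
  exact: continuous_Im_tube.
by apply/funext => p; rewrite /sq_tube normc_sqr.
Qed.

(** Extended by 0 outside the tube, so that Tonelli and translations can be used on the whole
    space. *)
Definition tube_density : 'rV[R]_n * 'rV[R]_n -> \bar R := (EFin \o sq_tube) \_ D.

Definition tube_mass (y : 'rV[R]_n) : \bar R := (\int[mu]_x tube_density (x, y))%E.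

Lemma measurable_tube_density : measurable_fun setT tube_density.
Proof.
apply/(measurable_restrictT (EFin \o sq_tube)); first by apply: open_measurable_rV2; exact: open_tube_slice.
by apply/measurable_EFinP; exact: measurable_sq_tube.
Qed.

Lemma tube_density_ge0 p : (0 <= tube_density p)%E.
Proof. by rewrite /tube_density patchE; case: ifP => // _; rewrite lee_fin sqr_ge0. Qed.

Lemma measurable_tube_mass : measurable_fun setT tube_mass.
Proof.
apply: (@measurable_fun_fubini_tonelli_G _ _ _ _ R mu tube_density).
  exact: measurable_tube_density.
exact: tube_density_ge0.
Qed.

Lemma tube_mass_ge0 y : (0 <= tube_mass y)%E.
Proof. by apply: integral_ge0 => x _; exact: tube_density_ge0. Qed.

Lemma tube_densityE x y : enorm y < rho -> tube_density (x, y) = (sq_tube (x, y))%:E.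
Proof. by move=> yr; rewrite /tube_density patchE mem_set. Qed.

Lemma measurable_line (y v : 'rV[R]_n) : measurable_fun setT (fun a : measurableTypeR R => y + a *: v).
Proof.
apply: measurable_fun_rV => i; under eq_fun do rewrite !mxE.
apply: measurable_funD => //; apply: measurable_funM => //; exact: measurable_id.
Qed.

Lemma measurable_density_slice d (T : measurableType d) (f g : T -> 'rV[R]_n) :
  measurable_fun setT f -> measurable_fun setT g -> measurable_fun setT (fun t => tube_density (f t, g t)).
Proof.
by move=> mf mg; apply: (measurableT_comp measurable_tube_density); exact: measurable_fun_pair.
Qed.

Lemma tube_mass_shift (v y : 'rV[R]_n) : (\int[mu]_x tube_density ((x + v)%R, y))%E = tube_mass y.
Proof.
rewrite (@ge0_integral_rV_shift _ _ v (fun x => tube_density (x, y)))//.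
  by apply: measurable_density_slice => //; exact: measurable_cst.
by move=> x; exact: tube_density_ge0.
Qed.

(** [mean_square] integrated over $x$. Real shifts disappear by translation invariance, so the two
    sides at heights $\pm t$ give a constant times $2t$, and the two vertical sides give the same
    integral over intermediate heights. *)
Lemma tube_mass_mean (y : 'rV[R]_n) (j : 'I_n) (t : R) : 0 < t ->
  (forall b, `|b| <= t -> enorm (y + b *: E j) < rho) ->
  (t%:E * tube_mass y <= 4%:E * ((2 * t)%:E * (tube_mass (y - t *: E j)%R + tube_mass (y + t *: E j)%R) +
     2%:E * \int[lb]_(b in `[(- t)%R, t]) tube_mass (y + b *: E j)%R))%E.
Proof.
move=> t0 yt.
pose HH (p : 'rV[R]_n * measurableTypeR R) : \bar R :=
  (tube_density ((p.1 + p.2 *: E j)%R, (y + (- t) *: E j)%R) + tube_density ((p.1 + p.2 *: E j)%R, (y + t *: E j)%R) +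
  (tube_density ((p.1 + (- t) *: E j)%R, (y + p.2 *: E j)%R) + tube_density ((p.1 + t *: E j)%R, (y + p.2 *: E j)%R)))%E.
have HH0 p : (0 <= HH p)%E by rewrite !adde_ge0 ?tube_density_ge0.
have m1 : measurable_fun setT (fun p : 'rV[R]_n * measurableTypeR R => p.1 + p.2 *: E j).
  apply: measurable_rV_add; first exact: measurable_fst.
  have := measurable_line 0 (E j); under eq_fun do rewrite add0r.
  by move=> /measurableT_comp; apply; exact: measurable_snd.
have m2 : measurable_fun setT (fun p : 'rV[R]_n * measurableTypeR R => y + p.2 *: E j).
  by apply: (measurableT_comp (measurable_line y (E j))); exact: measurable_snd.
have m3 c : measurable_fun setT (fun p : 'rV[R]_n * measurableTypeR R => p.1 + c *: E j).
  by apply: measurable_rV_add; [exact: measurable_fst|exact: measurable_cst].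
have mHH : measurable_fun setT HH.
  apply: emeasurable_funD; apply: emeasurable_funD; apply: measurable_density_slice => //; exact: measurable_cst.
pose I := `[- t, t]%classic : set (measurableTypeR R).
have mI : measurable I by exact: measurable_itv.
have pt x : (t%:E * tube_density (x, y) <= 4%:E * \int[lb]_(a in `[(- t)%R, t]) HH (x, a))%E.
  have hs := holomorphic_square x hF yt.
  have := mean_square t0 hs; have cb := cont_boundary_sq t0 hs.
  set BB := boundary_sq _ _ _ in cb *.
  rewrite !scale0r !addr0 -normc_sqr => h.
  have y0 : enorm y < rho by have := yt 0; rewrite normr0 scale0r addr0; apply; exact: ltW.
  rewrite tube_densityE// -EFinM; apply: (@le_trans _ _ (4 * int_ab (- t) t BB)%:E); first by rewrite lee_fin.
  rewrite EFinM; apply: lee_wpmul2l => //.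
  rewrite /int_ab fineK; last exact: integral_fune_fin_num (cont_on_integrable cb).
  rewrite le_eqVlt; apply/orP; left; apply/eqP; apply: eq_integral => a.
  rewrite inE/= in_itv/= => ta.
  have nt : enorm (y + (- t) *: E j) < rho by apply: yt; rewrite normrN ger0_norm// ltW.
  have ntp : enorm (y + t *: E j) < rho by apply: yt; rewrite ger0_norm// ltW.
  have na : enorm (y + a *: E j) < rho by apply: yt; rewrite ler_norml.
  by rewrite /HH /= !tube_densityE// -!EFinD /BB /boundary_sq /sq_tube /= !normc_sqr.
apply: (@le_trans _ _ (4%:E * \int[mu]_x \int[lb]_(a in `[(- t)%R, t]) HH (x, a))%E).
  have mpr : measurable_fun setT (fun x => \int[lb]_(a in `[(- t)%R, t]) HH (x, a))%E.
    have -> : (fun x => \int[lb]_(a in `[(- t)%R, t]) HH (x, a))%E =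
        (fun x => \int[lb]_a (HH \_ (setT `*` I)) (x, a))%E.
      apply/funext => x; rewrite integral_mkcond; apply: eq_integral => a _; rewrite !patchE.
      by congr (if _ then _ else _); apply/idP/idP; rewrite !inE//= => -[].
    apply: (@measurable_fun_fubini_tonelli_F _ _ _ (measurableTypeR R) R lb (HH \_ (setT `*` I))).
      by apply/(measurable_restrictT HH); [exact: measurableX|exact: measurable_funTS].
    by move=> p; rewrite patchE; case: ifP.
  rewrite /tube_mass -!ge0_integralZl//; first last.
  - exact: ltW.
  - by move=> x _; exact: tube_density_ge0.
  - by apply: measurable_density_slice => //; exact: measurable_cst.
  - by move=> x _; exact: integral_ge0.
  apply: ge0_le_integral => //.
  - by move=> x _; rewrite mule_ge0 ?tube_density_ge0// lee_fin ltW.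
  - by apply: measurable_funeM; apply: measurable_density_slice => //; exact: measurable_cst.
  - exact: measurable_funeM.
apply: lee_wpmul2l => //.
pose HI : 'rV[R]_n * measurableTypeR R -> \bar R := HH \_ (setT `*` I).
have mHI : measurable_fun setT HI.
  by apply/(measurable_restrictT HH); [exact: measurableX|exact: measurable_funTS].
have HI0 p : (0 <= HI p)%E by rewrite /HI patchE; case: ifP.
have -> : (\int[mu]_x \int[lb]_(a in `[(- t)%R, t]) HH (x, a))%E = (\int[mu]_x \int[lb]_a HI (x, a))%E.
  apply: eq_integral => x _; rewrite integral_mkcond; apply: eq_integral => a _; rewrite /HI !patchE.
  by congr (if _ then _ else _); apply/idP/idP; rewrite !inE//= => -[].
rewrite (fubini_tonelli HI mHI HI0).
have -> : (\int[lb]_a \int[mu]_x HI (x, a) = \int[lb]_(a in `[(- t)%R, t])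
    (tube_mass (y - t *: E j)%R + tube_mass (y + t *: E j)%R + 2%:E * tube_mass (y + a *: E j)%R))%E.
  rewrite [RHS]integral_mkcond; apply: eq_integral => a _; rewrite patchE.
  case: ifPn => aI; last first.
    rewrite (_ : point = 0%E)//; apply: integral0_eq => x _; rewrite /HI patchE.
    by case: ifPn => //; rewrite inE => -[_ Ia]; move: aI; rewrite notin_setE => /(_ Ia).
  transitivity (\int[mu]_x HH (x, a))%E.
    by apply: eq_integral => x _; rewrite /HI patchE ifT//; rewrite inE; split => //; rewrite inE in aI.
  have md (u w : 'rV[R]_n) : measurable_fun setT (fun x : 'rV[R]_n => tube_density (x + u, w)).
    apply: measurable_density_slice; last exact: measurable_cst.
    by apply: measurable_rV_add => //; exact: measurable_cst.
  rewrite /HH /= ge0_integralD//; last first.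
  - exact: emeasurable_funD.
  - by move=> x _; rewrite adde_ge0 ?tube_density_ge0.
  - exact: emeasurable_funD.
  - by move=> x _; rewrite adde_ge0 ?tube_density_ge0.
  rewrite !ge0_integralD//; try by move=> x _; exact: tube_density_ge0.
  by rewrite !tube_mass_shift scaleNr (mule_natl _ 2).
have ml : measurable_fun setT (fun a : measurableTypeR R => tube_mass (y + a *: E j)).
  by apply: (measurableT_comp measurable_tube_mass); exact: measurable_line.
have S0 : (0 <= tube_mass (y - t *: E j) + tube_mass (y + t *: E j))%E by rewrite adde_ge0// tube_mass_ge0.
have ml2 : measurable_fun I (fun a => 2%:E * tube_mass (y + a *: E j))%E.
  by apply: measurable_funTS; exact: measurable_funeM.
rewrite ge0_integralD//; try by move=> a _; rewrite mule_ge0// tube_mass_ge0.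
rewrite integral_cst//= lebesgue_measure_itv/= lte_fin ifT; last by rewrite gtrN.
rewrite ge0_integralZl//; try by move=> a _; exact: tube_mass_ge0.
  by rewrite -EFinB opprK -mulr2n -(mulr_natl t) muleC.
exact: measurable_funTS.
Qed.

Lemma tube_mass_average (y : 'rV[R]_n) (j : 'I_n) (r : R) : 0 < r ->
  (forall b, `|b| <= r -> enorm (y + b *: E j) < rho) ->
  (tube_mass y <= (80 / r)%:E * \int[lb]_(b in `[(- r)%R, r]) tube_mass (y + b *: E j)%R)%E.
Proof.
move=> r0 yr.
have ml : measurable_fun setT (fun a : measurableTypeR R => tube_mass (y + a *: E j)).
  by apply: (measurableT_comp measurable_tube_mass); exact: measurable_line.
apply: (@average_bound R (fun b => tube_mass (y + b *: E j)%R)) => //.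
- by move=> b; exact: tube_mass_ge0.
- exact: tube_mass_ge0.
move=> t /andP[rt tr]; have t0 : 0 < t by apply: lt_le_trans rt; exact: divr_gt0.
have yt b : `|b| <= t -> enorm (y + b *: E j) < rho by move=> bt; apply: yr; exact: le_trans tr.
apply: (@le_trans _ _ (t%:E * tube_mass y)%E); first by apply: lee_wpmul2r; rewrite ?tube_mass_ge0// lee_fin.
apply: le_trans (tube_mass_mean t0 yt) _.
rewrite scaleNr; set S := (tube_mass _ + tube_mass _)%E; have S0 : (0 <= S)%E by rewrite adde_ge0// tube_mass_ge0.
rewrite ge0_muleDr; first last.
- by rewrite mule_ge0// integral_ge0// => b _; exact: tube_mass_ge0.
- by rewrite mule_ge0// lee_fin mulr_ge0// ltW.
rewrite !muleA -!EFinM; apply: leeD.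
  by apply: lee_wpmul2r => //; rewrite lee_fin; lra.
rewrite (_ : 4 * 2 = 8 :> R); last by ring.
apply: lee_wpmul2l; first by rewrite lee_fin.
apply: ge0_subset_integral => //.
- exact: measurable_funTS.
- by move=> b _; exact: tube_mass_ge0.
- by move=> b; rewrite /= !in_itv/= => /andP[b1 b2]; apply/andP; split; lra.
Qed.

Lemma enorm_box (r : R) (y : 'rV[R]_n) : box r y -> enorm y ^+ 2 <= n%:R * r ^+ 2.
Proof.
move=> by_; rewrite sqr_sqrtr; last by apply: sumr_ge0 => i _; exact: sqr_ge0.
apply: (@le_trans _ _ (\sum_(i < n) r ^+ 2)); last by rewrite sumr_const card_ord mulr_natl.
apply: ler_sum => i _; rewrite -[y _ _ ^+ 2]real_normK ?num_real// ler_sqr ?nnegrE//.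
exact: le_trans (by_ i).
Qed.

Lemma measurable_enorm : measurable_fun setT (fun y : 'rV[R]_n => enorm y).
Proof. by apply: continuous_measurable_rV; exact: continuous_enorm. Qed.

Lemma weight_ge (s w : R) : 3 / 4 <= w -> w <= 1 -> Num.min 1 ((3 / 4) `^ (s - 1)) <= w `^ (s - 1).
Proof.
move=> w1 w2; have w0 : 0 < w by lra.
rewrite ge_min; have [s1|s1] := leP 1 s; apply/orP.
  by right; apply: ge0_ler_powR; rewrite ?nnegrE ?subr_ge0//; lra.
left; rewrite -[s - 1]opprK opprB powRN invr_ge1 ?unitfE ?gt_eqF ?powR_gt0//.
rewrite [leRHS](_ : 1 = 1 `^ (1 - s) :> R); last by rewrite powR1.
by apply: ge0_ler_powR; rewrite ?nnegrE ?subr_ge0//; lra.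
Qed.

Definition tube_weight (s : R) (y : 'rV[R]_n) : R := Num.max (1 - enorm y ^+ 2 / rho ^+ 2) 0 `^ (s - 1).

Lemma measurable_tube_weight (s : R) : measurable_fun setT (tube_weight s).
Proof.
apply: (measurableT_comp (measurable_powR _)); apply: measurable_maxr => //.
apply: measurable_funB => //; apply: measurable_funM => //; apply: measurable_funX.
exact: measurable_enorm.
Qed.

Lemma bergman_sqnormE (s : R) : bergman_sqnorm s rho F =
  ((rho ^- n)%:E * \int[mu]_y ((tube_weight s y)%:E * tube_mass y))%E.
Proof.
rewrite /bergman_sqnorm; congr (_ * _)%E.
have DE : [set p : 'rV[R]_n * 'rV[R]_n | tube rho (Defs.cpoint p.1 p.2)] = D.
  by apply/seteqP; split=> p h; [exact: (@tube_cpoint R n rho p.1 p.2).1 h|exact: (@tube_cpoint R n rho p.1 p.2).2 h].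
pose G (p : 'rV[R]_n * 'rV[R]_n) : \bar R := ((tube_weight s p.2)%:E * tube_density p)%E.
have W0 y : (0 <= (tube_weight s y)%:E)%E by rewrite lee_fin powR_ge0.
have mG : measurable_fun setT G.
  apply: emeasurable_funM; last exact: measurable_tube_density.
  by apply/measurable_EFinP; apply: (measurableT_comp (measurable_tube_weight s)); exact: measurable_snd.
have G0 p : (0 <= G p)%E by rewrite mule_ge0// tube_density_ge0.
rewrite DE integral_mkcond; transitivity (\int[(mu \x mu)%E]_p G p)%E.
  apply: eq_integral => p _; rewrite /G /tube_density !patchE; case: ifP => _; last by rewrite mule0.
  by rewrite /= -EFinM mulrC.
rewrite (fubini_tonelli2 G mG G0); apply: eq_integral => y _.
rewrite -ge0_integralZl//.
- by apply: measurable_density_slice => //; exact: measurable_cst.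
- by move=> x _; exact: tube_density_ge0.
Qed.

(** The box of half-side $\rho/(2n)$ lies in the ball of radius $\rho/2$, where the weight is
    bounded below. The iterated constant $(80/r)^n=(160n)^n\rho^{-n}$ matches the normalisation of
    the Bergman norm, so the bound is uniform in $\rho$. *)
Lemma tube_mass0_le (s : R) : (0 < n)%N -> 0 < rho ->
  (tube_mass 0 <= ((160 * n%:R) ^+ n / Num.min 1 ((3 / 4) `^ (s - 1)))%:E * bergman_sqnorm s rho F)%E.
Proof.
move=> n0 r0; set c := Num.min 1 _; have c0 : 0 < c by rewrite lt_min ltr01 powR_gt0.
have nR : 0 < n%:R :> R by rewrite ltr0n.
have n1 : 1 <= n%:R :> R by rewrite ler1n.
pose r := rho / (2 * n%:R); have rp : 0 < r by rewrite divr_gt0// mulr_gt0.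
have boxr (y : 'rV[R]_n) : box r y -> enorm y ^+ 2 <= rho ^+ 2 / 4.
  move=> by_; apply: le_trans (enorm_box by_) _.
  have -> : n%:R * r ^+ 2 = rho ^+ 2 / 4 * n%:R^-1 by rewrite /r; field; rewrite gt_eqF.
  by rewrite ger_pMr ?invf_le1// divr_gt0// exprn_gt0.
have boxr1 (y : 'rV[R]_n) : box r y -> enorm y < rho.
  move=> /boxr h; rewrite -ltr_sqr ?nnegrE ?sqrtr_ge0 ?(ltW r0)//; apply: le_lt_trans h _.
  by have := exprn_gt0 2 r0; lra.
have K0 : 0 <= 80 / r by rewrite divr_ge0// ltW.
have := mean_iterate K0 rp measurable_tube_mass tube_mass_ge0.
have st y j : box r y -> y ord0 j = 0 ->
    (tube_mass y <= (80 / r)%:E * \int[lb]_(b in `[(- r)%R, r]) tube_mass (y + b *: E j)%R)%E.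
  move=> by_ yj; apply: tube_mass_average => // b br; apply: boxr1 => i.
  rewrite !mxE eqxx /=; have [->|ij] := eqVneq i j; first by rewrite yj add0r mulr1.
  by rewrite mulr0 addr0.
move=> /(_ st) /le_trans; apply.
rewrite bergman_sqnormE; set I := (\int[mu]_y (_ * _))%E.
have W0 y : (0 <= (tube_weight s y)%:E)%E by rewrite lee_fin powR_ge0.
have cI : (c%:E * \int[mu]_(y in box r) tube_mass y <= I)%E.
  have mbox : measurable (@box R n r) by exact: measurable_box.
  rewrite -ge0_integralZl//; first last.
  - exact: ltW.
  - by move=> y _; exact: tube_mass_ge0.
  - by apply: measurable_funTS; exact: measurable_tube_mass.
  rewrite [leLHS]integral_mkcond; apply: ge0_le_integral => //.
  - by move=> y _; rewrite patchE; case: ifP => // _; rewrite mule_ge0 ?tube_mass_ge0// lee_fin ltW.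
  - apply/(measurable_restrictT (fun y => c%:E * tube_mass y)%E) => //.
    by apply: measurable_funTS; apply: measurable_funeM; exact: measurable_tube_mass.
  - apply: emeasurable_funM; last exact: measurable_tube_mass.
    by apply/measurable_EFinP; exact: measurable_tube_weight.
  move=> y _; rewrite patchE; case: ifPn => [|_]; last by rewrite mule_ge0// tube_mass_ge0.
  rewrite inE => by_; apply: lee_wpmul2r; first exact: tube_mass_ge0.
  rewrite lee_fin /tube_weight; have q : enorm y ^+ 2 / rho ^+ 2 <= 1 / 4.
    by rewrite ler_pdivrMr ?exprn_gt0// mulrC mulrA mulr1; exact: boxr.
  have q0 : 0 <= enorm y ^+ 2 / rho ^+ 2 by rewrite divr_ge0 ?sqr_ge0.
  by rewrite (max_idPl _); [apply: weight_ge; lra|lra].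
have {}cI : (\int[mu]_(y in box r) tube_mass y <= (c^-1)%:E * I)%E.
  by rewrite lee_pdivlMl.
have I0 : (0 <= I)%E by apply: integral_ge0 => y _; rewrite mule_ge0// tube_mass_ge0.
apply: (@le_trans _ _ (((80 / r) ^+ n)%:E * ((c^-1)%:E * I))%E).
  by apply: lee_wpmul2l => //; rewrite lee_fin exprn_ge0.
rewrite !muleA -!EFinM le_eqVlt; apply/orP; left; apply/eqP; congr (_%:E * _)%E.
rewrite (_ : 80 / r = 160 * n%:R / rho); last by rewrite /r; field; rewrite !gt_eqF.
by rewrite expr_div_n mulrAC.
Qed.

Lemma bergman_sq_int (s C : R) : (0 < n)%N -> 0 < rho -> (bergman_norm s rho F <= C%:E)%E ->
  let B := (160 * n%:R) ^+ n / Num.min 1 ((3 / 4) `^ (s - 1)) * C ^+ 2 in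
  (sq_int mu (fun x => complex.Re (F (Defs.cpoint x 0))) <= B%:E)%E /\
  (sq_int mu (fun x => complex.Im (F (Defs.cpoint x 0))) <= B%:E)%E.
Proof.
move=> n0 r0 FC B.
have BN0 : (0 <= bergman_sqnorm s rho F)%E.
  by apply: mule_ge0; [rewrite lee_fin invr_ge0 exprn_ge0// ltW|apply: integral_ge0 => p _; rewrite lee_fin mulr_ge0 ?sqr_ge0 ?powR_ge0].
have Bs : (bergman_sqnorm s rho F <= (C ^+ 2)%:E)%E.
  have C0 : 0 <= C by rewrite -lee_fin; apply: le_trans FC; exact: poweR_ge0.
  move: FC BN0; rewrite /bergman_norm; case: (bergman_sqnorm s rho F) => [b| |]//=.
    rewrite !lee_fin => bC b0; rewrite -[leLHS](sqr_sqrtr b0) -powR12_sqrt// ler_sqr ?nnegrE ?powR_ge0//.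
  by rewrite invr_eq0 pnatr_eq0/= leye_eq.
have z : enorm (0 : 'rV[R]_n) < rho.
  by rewrite /enorm big1 ?sqrtr0// => i _; rewrite mxE expr0n.
have T0 : (tube_mass 0 <= B%:E)%E.
  apply: le_trans (tube_mass0_le s n0 r0) _; rewrite [X in (_ <= X)%E]EFinM; apply: lee_wpmul2l => //.
have md : measurable_fun setT (fun x => tube_density (x, 0)).
  by apply: measurable_density_slice => //; exact: measurable_cst.
have slice (p : R[i] -> R) : (forall w, p w ^+ 2 <= Normc.normc w ^+ 2) ->
    {in D, continuous (fun q => p (F (Defs.cpoint q.1 q.2)))} ->
    (sq_int mu (fun x => p (F (Defs.cpoint x 0))) <= B%:E)%E.
  move=> pn cp; apply: le_trans T0; apply: ge0_le_integral => //.
  - by move=> x _; rewrite lee_fin sqr_ge0.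
  - apply/measurable_EFinP; apply: measurable_funX.
    have mp := continuous_measurable_rV2 open_tube_slice cp.
    have mpair : measurable_fun setT (fun x : 'rV[R]_n => (x, 0 : 'rV[R]_n)) by exact: measurable_pair2.
    pose pr := (fun q => p (F (Defs.cpoint q.1 q.2))) \_ D.
    have mr : measurable_fun setT pr.
      apply/(measurable_restrictT (fun q => p (F (Defs.cpoint q.1 q.2)))) => //.
      by apply: open_measurable_rV2; exact: open_tube_slice.
    rewrite (_ : (fun x => _) = pr \o (fun x => (x, 0))); first exact: measurableT_comp.
    by apply/funext => x /=; rewrite /pr patchE mem_set.
  by move=> x _; rewrite tube_densityE// lee_fin; exact: pn.
split; apply: slice.
- by move=> w; rewrite normc_sqr lerDl sqr_ge0.
- exact: continuous_Re_tube.
- by move=> w; rewrite normc_sqr lerDr sqr_ge0.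
- exact: continuous_Im_tube.
Qed.

End bergman_slice.

(** * Classical solutions satisfy the coordinate-line notion of solution *)

Section classical_solutions.
Variables (R : realType) (n : nat).
Local Notation E i := (delta_mx ord0 i : 'rV[R]_n).

Lemma is_derive_dir (g : 'rV[R]_n * R -> R) (p v : 'rV[R]_n * R) (f : R -> R) (t : R) :
  (forall h, f (h + t) = g (h *: v + p)) -> derivable g p v -> is_derive t (1 : R) f ('D_v g p).
Proof.
move=> fg dg.
have E1 : (fun h : R => h^-1 *: ((f \o shift t) (h *: (1 : R)) - f t)) =
    (fun h : R => h^-1 *: ((g \o shift p) (h *: v) - g p)).
  apply/funext => h /=; rewrite fg -[X in f X]add0r fg scale0r add0r.
  by congr (_ *: (g (_ + p) - _)); rewrite /GRing.scale/= mulr1.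
by apply: DeriveDef; rewrite /derivable /derive E1.
Qed.

Lemma continuous_loc_bounded2 (g : 'rV[R]_n * R -> R) :
  (forall p, half_space p -> {for p, continuous g}) -> loc_bounded2 (fun x r => g (x, r)).
Proof.
move=> cg N a b a0.
have cK : compact ([set x : 'rV[R]_n | forall i, `[- N, N]%classic (x ord0 i)] `*` `[a, b]%classic).
  have c1 : compact [set x : 'rV[R]_n | forall i, `[- N, N]%classic (x ord0 i)].
    exact: (@rV_compact R n (fun=> `[- N, N]%classic) (fun i => @segment_compact R (- N) N)).
  exact: (compact_setX c1 (@segment_compact R a b)).
have wK : {within [set x : 'rV[R]_n | forall i, `[- N, N]%classic (x ord0 i)] `*` `[a, b]%classic, continuous g}.
  apply: continuous_in_subspaceT => p; rewrite inE => -[_ /=]; rewrite in_itv/= => /andP[ap _].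
  by apply: cg; exact: lt_le_trans ap.
have [M [_ HM]] := compact_bounded (continuous_compact wK cK).
exists (M + 1) => x r bx abr; apply: HM; first by rewrite ltrDl.
exists (x, r) => //; split; last by rewrite /= in_itv.
by move=> i /=; rewrite in_itv/= -ler_norml; exact: bx.
Qed.

Lemma lipschitz_line (f df : R -> R) (a c M : R) :
  (forall t, Num.min a c <= t <= Num.max a c -> is_derive t (1 : R) f (df t) /\ `|df t| <= M) ->
  `|f c - f a| <= M * `|c - a|.
Proof.
have main (x y : R) : x <= y -> (forall t, x <= t <= y -> is_derive t (1 : R) f (df t) /\ `|df t| <= M) ->
    `|f y - f x| <= M * `|y - x|.
  move=> xy H; have d1 t : t \in `]x, y[ -> is_derive t (1 : R) f (df t).
    by rewrite in_itv/= => /andP[t1 t2]; apply: (H t _).1; rewrite !ltW.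
  have cf : {within `[x, y], continuous f}.
    apply: derivable_within_continuous => t; rewrite in_itv/= => txy.
    by have [d _] := H t txy; exact: ex_derive.
  have [z zxy ->] := MVT_segment xy d1 cf.
  rewrite normrM; apply: ler_wpM2r => //; rewrite in_itv/= in zxy; exact: (H z zxy).2.
have [ac|ca] := leP a c => H; first exact: main.
by rewrite distrC [X in _ * X]distrC; apply: main => //; exact: ltW.
Qed.

(** [C2_on] asks for continuity of the coordinate derivatives, not of the function itself, so
    compactness bounds only the derivatives. The function is then controlled along the path from
    [(0, a)] that first changes the radius and then one coordinate after another. *)
Lemma loc_bounded2_of_derivatives (v v1 : 'rV[R]_n -> R -> R) (d : 'I_n -> 'rV[R]_n -> R -> R) :
  (forall r : R, 0 < r -> is_derive r (1 : R) (v 0) (v1 0 r)) ->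
  (forall r, 0 < r -> forall i, line_derive (E i) (v ^~ r) (d i ^~ r)) ->
  loc_bounded2 v1 -> (forall i, loc_bounded2 (d i)) -> loc_bounded2 v.
Proof.
move=> dv dd b1 bd N a b a0.
have [M1 HM1] := b1 `|N| a b a0.
have /choice[M HM] : forall i, exists M : R, forall x r, box `|N| x -> a <= r <= b -> `|d i x r| <= M.
  by move=> i; exact: bd.
have box0 : box `|N| (0 : 'rV[R]_n) by move=> i; rewrite mxE normr0.
exists (`|v 0 a| + M1 * `|b - a| + \sum_(i < n) M i * `|N|) => x r bx abr.
have {}bx : box `|N| x by move=> i; apply: le_trans (bx i) _; exact: ler_norm.
have r0 : 0 < r by have /andP[ar _] := abr; exact: lt_le_trans ar.
have /andP[ar rb] := abr.
have H1 : `|v 0 r - v 0 a| <= M1 * `|b - a|.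
  have M10 : 0 <= M1 by apply: le_trans (HM1 0 r box0 abr).
  apply: (@le_trans _ _ (M1 * `|r - a|)).
    apply: (@lipschitz_line _ (v1 0)) => t; rewrite (min_idPl ar) (max_idPr ar) => /andP[t1 t2].
    split; first by apply: dv; exact: lt_le_trans t1.
    by apply: HM1 => //; rewrite t1 (le_trans t2).
  by apply: ler_wpM2l => //; rewrite !ger0_norm ?subr_ge0 ?lerD2r// (le_trans ar).
(* The corner reached after the first [k] coordinates of [x] have been filled in. *)
pose y (k : nat) : 'rV[R]_n := \row_j (if (j < k)%N then x ord0 j else 0).
have yS (i : 'I_n) : y i.+1 = y i + x ord0 i *: E i.
  apply/rowP => j; rewrite !mxE eqxx /= ltnS leq_eqVlt.
  have [->|ji] := eqVneq j i; first by rewrite eqxx ltnn add0r mulr1.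
  by rewrite (_ : (j == i :> nat) = false) ?mulr0 ?addr0//; exact: negbTE.
have H2 (i : 'I_n) : `|v (y i.+1) r - v (y i) r| <= M i * `|N|.
  have Mi0 : 0 <= M i by apply: le_trans (HM i 0 r box0 abr).
  apply: (@le_trans _ _ (M i * `|x ord0 i - 0|)); last by apply: ler_wpM2l => //; rewrite subr0.
  rewrite yS; have := @lipschitz_line (fun h => v (y i + h *: E i) r) (fun h => d i (y i + h *: E i) r) 0 (x ord0 i) (M i).
  rewrite scale0r addr0; apply => t tx; split; first exact: dd.
  apply: HM => // j; rewrite !mxE eqxx /=; have [->|ji] := eqVneq j i.
    rewrite ltnn add0r mulr1; apply: le_trans (bx i).
    move: tx; rewrite minEle maxEle; case: (leP 0 (x ord0 i)) => h /andP[t1 t2].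
      by rewrite !ger0_norm.
    by rewrite !ler0_norm ?lerN2 ?(ltW h).
  by rewrite mulr0 addr0; case: ifP => // _; rewrite normr0.
have y0 : y 0 = 0 by apply/rowP => j; rewrite !mxE.
have yn : y n = x by apply/rowP => j; rewrite !mxE ltn_ord.
have tele : v x r = v 0 a + (v 0 r - v 0 a) + \sum_(i < n) (v (y i.+1) r - v (y i) r).
  have := @telescope_sumr _ 0 n (fun k => v (y k) r) (leq0n n).
  by rewrite big_mkord yn y0 => ->; ring.
rewrite tele; apply: le_trans (ler_normD _ _) _; apply: lerD.
  by apply: le_trans (ler_normD _ _) _; apply: lerD.
by apply: le_trans (ler_norm_sum _ _ _) _; exact: ler_sum.
Qed.

(** Continuity in [x] at fixed radius is assumed in order to have measurable slices; in the
    application it comes from the holomorphic extension. *)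
Lemma C2_ext_sol (s : R) (v : 'rV[R]_n * R -> R) : C2_on (@half_space R n) v ->
  (forall p, half_space p -> \sum_(j < n) 'D_(dir_x R j) ('D_(dir_x R j) v) p + 'D_(dir_rho R n) ('D_(dir_rho R n) v) p +
     (1 - s) / p.2 * 'D_(dir_rho R n) v p = 0) ->
  (forall r, 0 < r -> continuous (fun x => v (x, r))) -> ext_sol s (fun x r => v (x, r)).
Proof.
move=> [C1 C2] pde cv.
have dx j : coord_dir (dir_x R j : 'rV[R]_n * R) by left; exists j.
have dr : coord_dir (dir_rho R n) by right.
have bd u : coord_dir u -> loc_bounded2 (fun x r => 'D_u v (x, r)).
  by move=> du; apply: (@continuous_loc_bounded2 ('D_u v)) => p hp; exact: (C1 u du p hp).2.
have bd2 u w : coord_dir u -> coord_dir w -> loc_bounded2 (fun x r => 'D_w ('D_u v) (x, r)).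
  by move=> du dw; apply: (@continuous_loc_bounded2 ('D_w ('D_u v))) => p hp; exact: (C2 u du w dw p hp).2.
have ir (g : 'rV[R]_n * R -> R) (x : 'rV[R]_n) (r : R) : derivable g (x, r) (dir_rho R n) ->
    is_derive r (1 : R) (fun r => g (x, r)) ('D_(dir_rho R n) g (x, r)).
  move=> dg; apply: is_derive_dir => // h; congr (g _); rewrite /dir_rho /=.
  by apply/pair_eqP; rewrite /= /GRing.scale/= !mulr1 -/(GRing.scale _ _) scaler0 add0r !eqxx.
have ix (g : 'rV[R]_n * R -> R) (j : 'I_n) (r : R) : (forall x, derivable g (x, r) (dir_x R j)) ->
    line_derive (E j) (fun x => g (x, r)) (fun x => 'D_(dir_x R j) g (x, r)).
  move=> dg x t; apply: is_derive_dir => // h; congr (g _); rewrite /dir_x /=.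
  apply/pair_eqP => /=; apply/andP; split; apply/eqP; first by rewrite scalerDl addrCA.
  by rewrite scaler0 add0r.
exists (fun x r => 'D_(dir_rho R n) v (x, r)), (fun x r => 'D_(dir_rho R n) ('D_(dir_rho R n) v) (x, r)).
exists (fun j x r => 'D_(dir_x R j) v (x, r)), (fun j x r => 'D_(dir_x R j) ('D_(dir_x R j) v) (x, r)).
have Dr (r : R) x : 0 < r -> is_derive r (1 : R) (fun r => v (x, r)) ('D_(dir_rho R n) v (x, r)).
  by move=> r0; apply: ir; exact: (C1 _ dr (x, r) r0).1.
have Dx (r : R) j : 0 < r -> line_derive (E j) (fun x => v (x, r)) (fun x => 'D_(dir_x R j) v (x, r)).
  by move=> r0; apply: ix => x; exact: (C1 _ (dx j) (x, r) r0).1.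
split; last by move=> r r0 x; exact: (pde (x, r) r0).
split.
- by move=> r r0; apply: continuous_measurable_rV; exact: cv.
- by move=> r r0 x; split; [exact: Dr|apply: ir; exact: (C2 _ dr _ dr (x, r) r0).1].
- by move=> r r0 j; split; [exact: Dx|apply: ix => x; exact: (C2 _ (dx j) _ (dx j) (x, r) r0).1].
- split; [|exact: bd|exact: bd2].
  exact: (loc_bounded2_of_derivatives (fun r r0 => Dr r 0 r0) (fun r r0 i => Dx r i r0) (bd _ dr) (fun i => bd _ (dx i))).
- by move=> i; split; [exact: bd|exact: bd2].
Qed.

End classical_solutions.

(** * From uniform Bergman bounds to boundary data *)

Section backward.
Variables (R : realType) (n : nat) (s : R) (u : 'rV[R]_n * R -> R[i]).
Local Notation mu := (lebesgue_rV R n).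
Local Notation p := ((n%:R + s) / 2).
Local Open Scope complex_scope.

Lemma enormE (x : 'rV[R]_n) : enorm x ^+ 2 = \sum_(i < n) x ord0 i ^+ 2.
Proof. by rewrite sqr_sqrtr// sumr_ge0// => i _; exact: sqr_ge0. Qed.

Definition poisson_const : R := pi `^ (- (n%:R / 2)) * (Gamma p / `|Gamma s|).

Lemma gen_poissonE (r : R) (x : 'rV[R]_n) : r `^ s * gen_poisson s r x = poisson_const * poisson s r x.
Proof.
rewrite /gen_poisson /poisson /sq_dist enormE /poisson_const; ring.
Qed.

Lemma poisson_const_gt0 : (0 < n)%N -> 0 < s -> 0 < poisson_const.
Proof.
move=> n0 s0; have p0 : 0 < p by rewrite divr_gt0// addr_gt0// ltr0n.
rewrite mulr_gt0 ?powR_gt0 ?pi_gt0// divr_gt0 ?Gamma_gt0// normr_gt0 gt_eqF// Gamma_gt0//.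
Qed.

Lemma Re_sum (I : finType) (F : I -> R[i]) : complex.Re (\sum_i F i) = \sum_i complex.Re (F i).
Proof. by apply: (big_ind2 (fun z x => complex.Re z = x)) => // -[a b] ? [c d] ? /= <- <-. Qed.

Lemma Im_sum (I : finType) (F : I -> R[i]) : complex.Im (\sum_i F i) = \sum_i complex.Im (F i).
Proof. by apply: (big_ind2 (fun z x => complex.Im z = x)) => // -[a b] ? [c d] ? /= <- <-. Qed.

Lemma convolutionE (f : 'rV[R]_n -> R[i]) (g : 'rV[R]_n -> R) x :
  convolution f (fun y => (g y)%:C) x =
  rconv (fun y => complex.Re (f y)) g x +i* rconv (fun y => complex.Im (f y)) g x.
Proof.
rewrite /convolution /cintegral /rconv; congr (_ +i* _); apply: eq_Rintegral => y _.
  by case: (f y) => a b /=; rewrite mulr0 subr0.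
by case: (f y) => a b /=; rewrite mulr0 add0r mulrC.
Qed.

Lemma rconv_scale (c : R) (f g : 'rV[R]_n -> R) x : c != 0 ->
  rconv (fun y => c^-1 * f y) (fun y => c * g y) x = rconv f g x.
Proof. by move=> c0; apply: eq_Rintegral => y _; rewrite mulrACA mulVf// mul1r. Qed.

(** [P] stands for the real or the imaginary part. The extension [F] may depend on the radius; only
    its restriction to real points enters the conclusion. *)
Lemma bergman_bounded_representation (P : R[i] -> R) (B : R) : (0 < n)%N -> 0 < s ->
  (forall z w, `|P z - P w| <= Normc.normc (z - w)) ->
  C2_on (@half_space R n) (fun q => P (u q)) ->
  (forall q, half_space q -> \sum_(j < n) 'D_(dir_x R j) ('D_(dir_x R j) (fun q => P (u q))) q +
     'D_(dir_rho R n) ('D_(dir_rho R n) (fun q => P (u q))) q +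
     (1 - s) / q.2 * 'D_(dir_rho R n) (fun q => P (u q)) q = 0) ->
  (forall r, 0 < r -> exists F : 'rV[R[i]]_n -> R[i], extends_to_tube r (fun x => u (x, r)) F /\
     (sq_int mu (fun x => P (F (Defs.cpoint x 0))) <= B%:E)%E) ->
  exists g, is_L2 mu g /\ forall r x, 0 < r -> P (u (x, r)) = rconv g (poisson s r) x.
Proof.
move=> n0 s0 PL C2 pde HF.
have cP r : 0 < r -> continuous (fun x => P (u (x, r))).
  move=> r0 x; have [F [[hF Fu] _]] := HF r r0; apply/continuous_rVP => e e0.
  have z : enorm (0 : 'rV[R]_n) < r by rewrite /enorm big1 ?sqrtr0// => i _; rewrite mxE expr0n.
  have [d d0 Hd] := cpoint_cvg_eps hF x z e0.
  exists (d / 2) => [|y by_]; first exact: divr_gt0.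
  rewrite -!Fu distrC; apply: le_trans (PL _ _) _; apply: Hd => i; last by rewrite subrr normr0.
  by have := by_ i; rewrite !mxE; lra.
have sv := C2_ext_sol C2 pde cP.
have [|g [Lg Hg]] := ext_sol_representation s0 n0 (B := B) sv cP.
  move=> r r0; have [F [[_ Fu] FB]] := HF r r0; apply: le_trans FB.
  by rewrite (_ : (fun x => P (F _)) = (fun x => P (u (x, r))))//; apply/funext => x; rewrite Fu.
by exists g; split=> // r x r0; exact: Hg.
Qed.

Lemma bergman_bounded_convolution : (0 < n)%N -> 0 < s -> extension_solution s u ->
  (exists C : R, forall rho : R, 0 < rho ->
     exists F : 'rV[R[i]]_n -> R[i],
       [/\ extends_to_tube rho (fun x => u (x, rho)) F,
           bergman_space s rho F &
           (bergman_norm s rho F <= C%:E)%E]) ->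
  exists f : 'rV[R]_n -> R[i],
     L2 f /\
     forall (x : 'rV[R]_n) (rho : R), 0 < rho ->
       u (x, rho) =
       convolution f (fun y => (rho `^ s * gen_poisson s rho y)%:C) x.
Proof.
move=> n0 s0 [cRe cIm pde] [C HC].
have c0 := poisson_const_gt0 n0 s0; set c := poisson_const in c0.
pose B := (160 * n%:R) ^+ n / Num.min 1 ((3 / 4) `^ (s - 1)) * C ^+ 2.
have [g1 [Lg1 Hg1]] : exists g, is_L2 mu g /\ forall r x, 0 < r -> complex.Re (u (x, r)) = rconv g (poisson s r) x.
  apply: (@bergman_bounded_representation _ B) => //.
  - by move=> z w; apply: le_trans (Re_le_normc _); case: z => a b; case: w.
  - move=> q hq; have := congr1 (@complex.Re R) (pde q hq); rewrite /extension_operator.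
    rewrite (_ : \sum_(j < n) 'D_(dir_x R j) ('D_(dir_x R j) _) q =
      complex.Re (\sum_(j < n) cderive (dir_x R j) (cderive (dir_x R j) u) q)); last by rewrite Re_sum.
    by case: (\sum_(_ < n) _) => a b /= <-; rewrite mul0r subr0.
  - move=> r r0; have [F [eF [hF _] FC]] := HC r r0; exists F; split => //.
    exact: (bergman_sq_int hF n0 r0 FC).1.
have [g2 [Lg2 Hg2]] : exists g, is_L2 mu g /\ forall r x, 0 < r -> complex.Im (u (x, r)) = rconv g (poisson s r) x.
  apply: (@bergman_bounded_representation _ B) => //.
  - by move=> z w; apply: le_trans (Im_le_normc _); case: z => a b; case: w.
  - move=> q hq; have := congr1 (@complex.Im R) (pde q hq); rewrite /extension_operator.
    rewrite (_ : \sum_(j < n) 'D_(dir_x R j) ('D_(dir_x R j) _) q =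
      complex.Im (\sum_(j < n) cderive (dir_x R j) (cderive (dir_x R j) u) q)); last by rewrite Im_sum.
    by case: (\sum_(_ < n) _) => a b /= <-; rewrite mul0r addr0.
  - move=> r r0; have [F [eF [hF _] FC]] := HC r r0; exists F; split => //.
    exact: (bergman_sq_int hF n0 r0 FC).2.
exists (fun y => (c^-1 * g1 y) +i* (c^-1 * g2 y)); split.
  have [m1 b1] := is_L2_scale c^-1 Lg1; have [m2 b2] := is_L2_scale c^-1 Lg2.
  split => //=; rewrite (_ : (\int[_]_x _)%E = (sq_int mu (fun y => c^-1 * g1 y)%R + sq_int mu (fun y => c^-1 * g2 y)%R)%E).
    exact: lte_add_pinfty.
  rewrite /sq_int -ge0_integralD//.
  - by apply: eq_integral => x _; rewrite sqr_sqrtr ?addr_ge0 ?sqr_ge0.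
  - by move=> x _; rewrite lee_fin sqr_ge0.
  - by apply/measurable_EFinP; exact: measurable_funX.
  - by move=> x _; rewrite lee_fin sqr_ge0.
  - by apply/measurable_EFinP; exact: measurable_funX.
move=> x r r0; have E : (fun y : 'rV[R]_n => (r `^ s * gen_poisson s r y)%:C) = (fun y => (c * poisson s r y)%:C).
  by apply/funext => y; rewrite gen_poissonE.
rewrite E convolutionE /= !rconv_scale ?gt_eqF// -Hg1// -Hg2//.
by case: (u (x, r)).
Qed.

End backward.

(** * Holomorphic extension of Poisson integrals *)

Section complex_power.
Variable R : realType.
Implicit Types p a b : R.

(* [cpow_re p a b] and [cpow_im p a b] are the real and imaginary parts of (a + ib)^(-p)
   for the principal branch, on the half-plane a > 0. *)
Definition cpow_re p a b : R := (a ^+ 2 + b ^+ 2) `^ (- (p / 2)) * cos (p * atan (b / a)).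
Definition cpow_im p a b : R := - ((a ^+ 2 + b ^+ 2) `^ (- (p / 2)) * sin (p * atan (b / a))).

Lemma sqmod_gt0 a b : 0 < a -> 0 < a ^+ 2 + b ^+ 2.
Proof. by move=> a0; rewrite ltr_pwDl ?sqr_ge0// exprn_gt0. Qed.

Lemma cos_sin_atan a b : 0 < a ->
  cos (atan (b / a)) = a / Num.sqrt (a ^+ 2 + b ^+ 2) /\ sin (atan (b / a)) = b / Num.sqrt (a ^+ 2 + b ^+ 2).
Proof.
move=> a0; have N0 := sqmod_gt0 b a0.
have C : cos (atan (b / a)) = a / Num.sqrt (a ^+ 2 + b ^+ 2).
  rewrite cos_atan (_ : 1 + (b / a) ^+ 2 = (a ^+ 2 + b ^+ 2) / a ^+ 2); last by field; rewrite gt_eqF.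
  by rewrite sqrtrM ?(ltW N0)// sqrtrV ?sqr_ge0// sqrtr_sqr gtr0_norm// invf_div.
split=> //; have := atanK (b / a); rewrite /tan C => /(canRL (mulfVK _)) ->.
  by field; rewrite !gt_eqF// sqrtr_gt0.
by apply: mulf_neq0; rewrite ?invr_neq0// gt_eqF// sqrtr_gt0.
Qed.

Lemma powR_succ_half p N : 0 < N -> N `^ (- ((p + 1) / 2)) = N `^ (- (p / 2)) / Num.sqrt N.
Proof.
move=> N0; rewrite (_ : - ((p + 1) / 2) = - (p / 2) + - (2^-1)); last by lra.
by rewrite powRD ?(gt_eqF N0) ?implybT// (powRN N 2^-1) powR12_sqrt// ltW.
Qed.

(** Real part of $z^{-p-1}=z^{-p}\bar z/|z|^2$, from the addition formula for cosine. It lets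
    derivatives be expressed by the same functions with [p + 1]. *)
Lemma cpow_reS p a b : 0 < a ->
  cpow_re (p + 1) a b = (cpow_re p a b * a + cpow_im p a b * b) / (a ^+ 2 + b ^+ 2).
Proof.
move=> a0; have N0 := sqmod_gt0 b a0; have [C S] := cos_sin_atan b a0.
rewrite /cpow_re /cpow_im (mulrDl p 1 (atan (b / a))) mul1r cosD C S powR_succ_half//.
rewrite -[X in _ = _ / X](sqr_sqrtr (ltW N0)); field.
by rewrite gt_eqF// sqrtr_gt0.
Qed.

Lemma cpow_imS p a b : 0 < a ->
  cpow_im (p + 1) a b = (cpow_im p a b * a - cpow_re p a b * b) / (a ^+ 2 + b ^+ 2).
Proof.
move=> a0; have N0 := sqmod_gt0 b a0; have [C S] := cos_sin_atan b a0.
rewrite /cpow_re /cpow_im (mulrDl p 1 (atan (b / a))) mul1r sinD C S powR_succ_half//.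
rewrite -[X in _ = _ / X](sqr_sqrtr (ltW N0)); field.
by rewrite gt_eqF// sqrtr_gt0.
Qed.

(** $\frac{d}{dt}z^{-p}=-p\,z^{-p-1}\dot z$ along a straight line, in real and imaginary parts. *)
Lemma is_derive_cpow p a b da db t : 0 < a + t * da ->
  is_derive t (1 : R) (fun t => cpow_re p (a + t * da) (b + t * db))
    (- p * (cpow_re (p + 1) (a + t * da) (b + t * db) * da - cpow_im (p + 1) (a + t * da) (b + t * db) * db)) /\
  is_derive t (1 : R) (fun t => cpow_im p (a + t * da) (b + t * db))
    (- p * (cpow_im (p + 1) (a + t * da) (b + t * db) * da + cpow_re (p + 1) (a + t * da) (b + t * db) * db)).
Proof.
move=> A0; have lin (c d : R) : is_derive t (1 : R) (fun t : R => c + t * d) d.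
  apply: is_derive_eq (is_deriveD (is_derive_cst c t (1 : R)) (is_deriveM (is_derive_id t (1 : R)) (is_derive_cst d t (1 : R)))) _.
  by rewrite /GRing.scale/=; ring.
have hA := lin a da; have hB := lin b db.
have N0 := sqmod_gt0 (b + t * db) A0.
have hN : is_derive t (1 : R) (fun t : R => (a + t * da) ^+ 2 + (b + t * db) ^+ 2)
    (2 * ((a + t * da) * da + (b + t * db) * db)).
  apply: is_derive_eq (is_deriveD (is_deriveX 2 hA) (is_deriveX 2 hB)) _.
  by rewrite /GRing.scale/= expr1; ring.
have hP := @is_derive1_comp R (fun y => y `^ (- (p / 2))) (fun t : R => (a + t * da) ^+ 2 + (b + t * db) ^+ 2) t _ _ (is_derive_powR (- (p / 2)) N0) hN.
have A1 : a + t * da != 0 by rewrite gt_eqF.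
have hQ : is_derive t (1 : R) (fun t : R => (b + t * db) / (a + t * da))
    ((db * (a + t * da) - (b + t * db) * da) / (a + t * da) ^+ 2).
  have hI : is_derive t (1 : R) (fun t : R => (a + t * da)^-1) (- da / (a + t * da) ^+ 2) :=
    @is_derive_inv R (fun t : R => a + t * da) t da A1 hA.
  apply: is_derive_eq (is_deriveM hB hI) _.
  by rewrite /GRing.scale/=; field.
have hT := @is_derive1_comp R atan (fun t : R => (b + t * db) / (a + t * da)) t _ _ (is_derive1_atan _) hQ.
have hpT : is_derive t (1 : R) (fun t : R => p * atan ((b + t * db) / (a + t * da)))
    (p * (((a + t * da) * db - (b + t * db) * da) / ((a + t * da) ^+ 2 + (b + t * db) ^+ 2))).
  apply: is_derive_eq (@is_deriveZ R R R _ p t 1 _ hT) _.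
  rewrite /GRing.scale/=; field.
  by rewrite A1 (gt_eqF N0).
have hC := @is_derive1_comp R cos (fun t : R => p * atan ((b + t * db) / (a + t * da))) t _ _ (is_derive_cos _) hpT.
have hS := @is_derive1_comp R sin (fun t : R => p * atan ((b + t * db) / (a + t * da))) t _ _ (is_derive_sin _) hpT.
rewrite cpow_reS// cpow_imS//; split.
  apply: is_derive_eq (is_deriveM hP hC) _.
  by rewrite /cpow_re /cpow_im /GRing.scale/=; field; rewrite gt_eqF.
apply: is_derive_eq (is_deriveN (is_deriveM hP hS)) _.
by rewrite /cpow_re /cpow_im /GRing.scale/=; field; rewrite gt_eqF.
Qed.

Lemma sqmod_powR_le p a b m : 0 <= p -> 0 < m -> m ^+ 2 <= a ^+ 2 + b ^+ 2 ->
  (a ^+ 2 + b ^+ 2) `^ (- (p / 2)) <= m `^ (- p).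
Proof.
move=> p0 m0 mN; have N0 : 0 < a ^+ 2 + b ^+ 2 by apply: lt_le_trans mN; exact: exprn_gt0.
have -> : m `^ (- p) = (m ^+ 2) `^ (- (p / 2)).
  by rewrite -powR_mulrn ?(ltW m0)// -powRrM; congr (_ `^ _); field.
rewrite !powRN lef_pV2 ?posrE ?powR_gt0 ?exprn_gt0//.
by apply: ge0_ler_powR; rewrite ?nnegrE ?sqr_ge0 ?(ltW N0)// divr_ge0.
Qed.

Lemma cpow_le p a b m : 0 <= p -> 0 < m -> m <= a ->
  `|cpow_re p a b| <= m `^ (- p) /\ `|cpow_im p a b| <= m `^ (- p).
Proof.
move=> p0 m0 ma; have H : (a ^+ 2 + b ^+ 2) `^ (- (p / 2)) <= m `^ (- p).
  apply: sqmod_powR_le => //; apply: (@le_trans _ _ (a ^+ 2)); last by rewrite lerDl sqr_ge0.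
  by rewrite ler_sqr ?nnegrE ?(ltW m0)// (le_trans (ltW m0)).
rewrite /cpow_re /cpow_im normrN !normrM !(ger0_norm (powR_ge0 _ _)).
by split; apply: le_trans H; apply: ler_piMr; rewrite ?powR_ge0// ler_norml ?cos_geN1 ?cos_le1 ?sin_geN1 ?sin_le1.
Qed.

Lemma taylor1 (f f1 f2 : R -> R) (M : R) :
  (forall t : R, 0 <= t <= 1 -> [/\ is_derive t (1 : R) f (f1 t), is_derive t (1 : R) f1 (f2 t) & `|f2 t| <= M]) ->
  `|f 1 - f 0 - f1 0| <= M.
Proof.
move=> H; have M0 : 0 <= M by have [|_ _ h] := H 0; [rewrite lexx ler01|exact: le_trans h].
have f1b t : 0 <= t <= 1 -> `|f1 t - f1 0| <= M.
  move=> /andP[t0 t1]; apply: (@le_trans _ _ (M * `|t - 0|)).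
    apply: (@lipschitz_line _ f1 f2) => u; rewrite (min_idPl t0) (max_idPr t0) => /andP[u0 ut].
    by have [|_ ? ?] := H u; rewrite ?u0 ?(le_trans ut).
  by rewrite subr0 ger0_norm// ler_piMr.
have := @lipschitz_line R (fun t => f t - t * f1 0) (fun t => f1 t - f1 0) 0 1 M.
rewrite mul1r mul0r subr0 subr0 normr1 mulr1 addrAC; apply => t.
rewrite (min_idPl ler01) (max_idPr ler01) => t01; split; last exact: f1b.
have [d1 _ _] := H t t01.
apply: is_derive_eq (is_deriveB d1 (is_deriveM (is_derive_id t (1 : R)) (is_derive_cst (f1 0) t (1 : R)))) _.
by rewrite /GRing.scale/=; ring.
Qed.

(** The half-plane $\mathrm{Re}\,z\ge m$ is convex, so the segment stays in it and the second
    derivative $p(p+1)z^{-p-2}(dz)^2$ is bounded there by a power of [m]. *)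
Lemma cpow_taylor p a b da db m : 0 <= p -> 0 < m -> m <= a -> m <= a + da ->
  let M := 2 * p * (p + 1) * m `^ (- (p + 2)) * (da ^+ 2 + db ^+ 2) in
  `|cpow_re p (a + da) (b + db) - cpow_re p a b - (- p * (cpow_re (p + 1) a b * da - cpow_im (p + 1) a b * db))| <= M /\
  `|cpow_im p (a + da) (b + db) - cpow_im p a b - (- p * (cpow_im (p + 1) a b * da + cpow_re (p + 1) a b * db))| <= M.
Proof.
move=> p0 m0 ma mda M.
have At t : 0 <= t <= 1 -> m <= a + t * da.
  move=> /andP[t0 t1]; have -> : a + t * da = (1 - t) * a + t * (a + da) by ring.
  have -> : m = (1 - t) * m + t * m by ring.
  by apply: lerD; apply: ler_wpM2l; rewrite ?subr_ge0.
have arith (x y c : R) : `|x| <= c -> `|y| <= c ->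
    `|(x * da - y * db) * da - (y * da + x * db) * db| <= 2 * c * (da ^+ 2 + db ^+ 2) /\
    `|(y * da + x * db) * da + (x * da - y * db) * db| <= 2 * c * (da ^+ 2 + db ^+ 2).
  move=> xc yc; have c0 : 0 <= c by apply: le_trans xc.
  have E1 : `|da ^+ 2 - db ^+ 2| <= da ^+ 2 + db ^+ 2.
    by rewrite ler_norml; have := sqr_ge0 da; have := sqr_ge0 db => h1 h2; apply/andP; split; lra.
  have E2 : `|2 * da * db| <= da ^+ 2 + db ^+ 2.
    rewrite ler_norml; have h1 := sqr_ge0 (da - db); have h2 := sqr_ge0 (da + db).
    by rewrite sqrrB in h1; rewrite sqrrD in h2; apply/andP; split; lra.
  have tr (u v w z : R) : `|u| <= c -> `|v| <= c -> `|w| <= da ^+ 2 + db ^+ 2 -> `|z| <= da ^+ 2 + db ^+ 2 ->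
      `|u * w + v * z| <= 2 * c * (da ^+ 2 + db ^+ 2).
    move=> uc vc ws zs; apply: le_trans (ler_normD _ _) _; rewrite !normrM.
    rewrite -mulrA (mulrDl 1 1) !mul1r; apply: lerD; exact: ler_pM.
  split.
    rewrite (_ : _ - _ = x * (da ^+ 2 - db ^+ 2) + (- y) * (2 * da * db)); last by ring.
    by apply: tr; rewrite ?normrN.
  rewrite (_ : _ + _ = y * (da ^+ 2 - db ^+ 2) + x * (2 * da * db)); last by ring.
  exact: tr.
have D p' t : 0 <= t <= 1 -> _ := fun h => @is_derive_cpow p' a b da db t (lt_le_trans m0 (At t h)).
pose X q t := cpow_re q (a + t * da) (b + t * db).
pose Y q t := cpow_im q (a + t * da) (b + t * db).
have p1 : p + 1 + 1 = p + 2 by lra.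
have bd t : 0 <= t <= 1 -> `|X (p + 2) t| <= m `^ (- (p + 2)) /\ `|Y (p + 2) t| <= m `^ (- (p + 2)).
  by move=> h; apply: cpow_le => //; [exact: addr_ge0|exact: At].
have c2 : 0 <= p * (p + 1) by rewrite mulr_ge0// addr_ge0.
have fin (z : R) : `|z| <= 2 * m `^ (- (p + 2)) * (da ^+ 2 + db ^+ 2) -> `|p * (p + 1) * z| <= M.
  move=> h; rewrite normrM (ger0_norm c2) /M.
  rewrite (_ : _ * (da ^+ 2 + db ^+ 2) = p * (p + 1) * (2 * m `^ (- (p + 2)) * (da ^+ 2 + db ^+ 2))); last by ring.
  exact: ler_wpM2l.
have lc (f g : R -> R) (df dg c d : R) t : is_derive t (1 : R) f df -> is_derive t (1 : R) g dg ->
    is_derive t (1 : R) (fun t => - p * (f t * c + g t * d)) (- p * (df * c + dg * d)).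
  move=> hf hg; have h := is_deriveD (is_deriveM hf (is_derive_cst c t (1 : R))) (is_deriveM hg (is_derive_cst d t (1 : R))).
  apply: is_derive_eq (@is_deriveZ R R R _ (- p) t 1 _ h) _.
  by rewrite /GRing.scale/=; ring.
split.
  have := @taylor1 (X p) (fun t => - p * (X (p + 1) t * da + Y (p + 1) t * - db))
    (fun t => p * (p + 1) * ((X (p + 2) t * da - Y (p + 2) t * db) * da - (Y (p + 2) t * da + X (p + 2) t * db) * db)) M.
  rewrite /X /Y !mul1r !mul0r !addr0 mulrN; apply => t t01.
  have [d1 _] := D p t t01; have [e1 e2] := D (p + 1) t t01; have [b1 b2] := bd t t01; split.
  - by apply: is_derive_eq d1 _; ring.
  - by apply: is_derive_eq (lc _ _ _ _ da (- db) t e1 e2) _; rewrite p1; ring.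
  - by apply: fin; exact: (arith _ _ _ b1 b2).1.
have := @taylor1 (Y p) (fun t => - p * (Y (p + 1) t * da + X (p + 1) t * db))
  (fun t => p * (p + 1) * ((Y (p + 2) t * da + X (p + 2) t * db) * da + (X (p + 2) t * da - Y (p + 2) t * db) * db)) M.
rewrite /X /Y !mul1r !mul0r !addr0; apply => t t01.
have [_ d1] := D p t t01; have [e1 e2] := D (p + 1) t t01; have [b1 b2] := bd t t01; split.
- by apply: is_derive_eq d1 _; ring.
- by apply: is_derive_eq (lc _ _ _ _ da db t e2 e1) _; rewrite p1; ring.
- by apply: fin; exact: (arith _ _ _ b1 b2).2.
Qed.

End complex_power.

(** * The kernel on the tube and its expansion *)

Section tube_kernel.
Variables (R : realType) (n : nat).
Implicit Types (x y u v : 'rV[R]_n) (r p : R).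

(** With [q_im], the real and imaginary parts of $r^2+\sum_j(u_j+iy_j)^2$; inside the tube the real
    part is positive, so the principal power is available. *)
Definition q_re r u y : R := r ^+ 2 + \sum_(j < n) (u ord0 j ^+ 2 - y ord0 j ^+ 2).
Definition q_im u y : R := 2 * \sum_(j < n) u ord0 j * y ord0 j.
Definition kernel_re p r u y : R := cpow_re p (q_re r u y) (q_im u y).
Definition kernel_im p r u y : R := cpow_im p (q_re r u y) (q_im u y).

Lemma coord_le_enorm y j : `|y ord0 j| <= enorm y.
Proof.
rewrite -ler_sqr ?nnegrE ?sqrtr_ge0// enormE real_normK ?num_real//.
by rewrite (bigD1 j)//= lerDl sumr_ge0// => i _; exact: sqr_ge0.
Qed.

(** $(u+v)^2\ge u^2/2-v^2$ coordinatewise sacrifices half of $|u|^2$ to absorb the real shift, and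
    [e] is small enough that the shifts use at most half of $d=r^2-|y|^2$. The bound is uniform in
    [u], which makes it usable under the integral. *)
Lemma q_re_ge r y : 0 < r -> enorm y < r -> exists k e : R, [/\ 0 < k, 0 < e, e <= 1 &
  forall (u v w : 'rV[R]_n), (forall j, `|v ord0 j| <= e) -> (forall j, `|w ord0 j| <= e) ->
    k * sq_dist 1 u <= q_re r (u + v) (y + w)].
Proof.
move=> r0 yr; pose d := r ^+ 2 - enorm y ^+ 2.
have d0 : 0 < d by rewrite subr_gt0 ltr_sqr ?nnegrE ?sqrtr_ge0 ?(ltW r0).
have n1 : 0 < n%:R + 1 :> R by rewrite ltr_wpDl.
have c0 : 0 < 8 * (n%:R + 1) * (r + 1) by rewrite !mulr_gt0// addr_gt0.
pose e := Num.min 1 (d / (8 * (n%:R + 1) * (r + 1))).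
have e0 : 0 < e by rewrite lt_min ltr01 divr_gt0.
have e1 : e <= 1 by rewrite ge_min lexx.
have ed : e * (8 * (n%:R + 1) * (r + 1)) <= d by rewrite -ler_pdivlMr// ge_min lexx orbT.
exists (Num.min (1 / 2) (d / 2)), e; split => //.
  by rewrite lt_min !divr_gt0.
move=> u v w ve we.
have per j : u ord0 j ^+ 2 / 2 - y ord0 j ^+ 2 - e * (2 * (r + 1)) <= (u + v) ord0 j ^+ 2 - (y + w) ord0 j ^+ 2.
  rewrite !mxE; have := ve j; have := we j; have := le_trans (coord_le_enorm y j) (ltW yr).
  move: (u ord0 j) (v ord0 j) (y ord0 j) (w ord0 j) => a b c f cr fe be.
  have h1 : b ^+ 2 <= e by rewrite -real_normK ?num_real// expr2 -[leRHS]mulr1; apply: ler_pM => //; exact: le_trans e1.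
  have h2 : f ^+ 2 <= e by rewrite -real_normK ?num_real// expr2 -[leRHS]mulr1; apply: ler_pM => //; exact: le_trans e1.
  have h3 : c * f <= r * e by apply: le_trans (ler_norm _) _; rewrite normrM; exact: ler_pM.
  have := sqr_ge0 (a + 2 * b).
  by rewrite !sqrrD; lra.
have low : \sum_(j < n) (u ord0 j ^+ 2 / 2 - y ord0 j ^+ 2 - e * (2 * (r + 1))) <= \sum_(j < n) ((u + v) ord0 j ^+ 2 - (y + w) ord0 j ^+ 2).
  by apply: ler_sum => j _; exact: per.
rewrite 2!big_split/= !sumrN -mulr_suml sumr_const card_ord -!enormE -[_ *+ n]mulr_natl in low.
rewrite /q_re; apply: (@le_trans _ _ (r ^+ 2 + (enorm u ^+ 2 / 2 - enorm y ^+ 2 - n%:R * (e * (2 * (r + 1)))))); last by rewrite lerD2l.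
rewrite /sq_dist expr1n -enormE mulrDr mulr1.
set U := enorm u ^+ 2 in low *; have U0 : 0 <= U by exact: sqr_ge0.
have k1 : Num.min (1 / 2) (d / 2) <= d / 2 by rewrite ge_min lexx orbT.
have k2 : Num.min (1 / 2) (d / 2) * U <= 1 / 2 * U by apply: ler_wpM2r => //; rewrite ge_min lexx.
have nn : n%:R * (e * (2 * (r + 1))) <= d / 2.
  have h : 0 <= e * (r + 1) by rewrite mulr_ge0 ?(ltW e0)// addr_ge0 ?(ltW r0).
  have h2 : 0 <= n%:R * (e * (r + 1)) by rewrite mulr_ge0.
  have E1 : e * (8 * (n%:R + 1) * (r + 1)) = 8 * (n%:R * (e * (r + 1))) + 8 * (e * (r + 1)) by ring.
  have E2 : n%:R * (e * (2 * (r + 1))) = 2 * (n%:R * (e * (r + 1))) by ring.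
  by rewrite E1 in ed; rewrite E2; lra.
have dE : d = r ^+ 2 - enorm y ^+ 2 by [].
by clearbody d e U; lra.
Qed.

Lemma measurable_cpow d (T : measurableType d) p (a b : T -> R) : measurable_fun setT a -> measurable_fun setT b ->
  (forall t, 0 < a t) ->
  measurable_fun setT (fun t => cpow_re p (a t) (b t)) /\ measurable_fun setT (fun t => cpow_im p (a t) (b t)).
Proof.
move=> ma mb a0.
have mN : measurable_fun setT (fun t => (a t ^+ 2 + b t ^+ 2) `^ (- (p / 2))).
  by apply: (measurableT_comp (measurable_powR _)); apply: measurable_funD; exact: measurable_funX.
have mT : measurable_fun setT (fun t => p * atan (b t / a t)).
  apply: measurable_funM => //; apply: (measurableT_comp (f := @atan R)).
    by apply: continuous_measurable_fun => z; exact: continuous_atan.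
  apply: measurable_funM => //; rewrite (_ : (fun t => _) = fun t => a t `^ (-1)).
    exact: (measurableT_comp (measurable_powR _)).
  by apply/funext => t; rewrite powR_inv1// ltW.
have cs (f : R -> R) : continuous f -> measurable_fun setT (fun t => (a t ^+ 2 + b t ^+ 2) `^ (- (p / 2)) * f (p * atan (b t / a t))).
  move=> cf; apply: measurable_funM => //; apply: (measurableT_comp (f := f)) => //.
  exact: continuous_measurable_fun.
split; first by apply: cs; exact: continuous_cos.
rewrite /cpow_im; under eq_fun do rewrite -mulN1r.
by apply: measurable_funM => //; apply: cs; exact: continuous_sin.
Qed.

Lemma measurable_coord_sub x j : measurable_fun setT (fun t : 'rV[R]_n => (x - t) ord0 j).
Proof.
under eq_fun do rewrite !mxE; apply: measurable_funB => //; exact: measurable_rV_coord.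
Qed.

Lemma measurable_tube_kernel p r x y v : (forall t : 'rV[R]_n, 0 < q_re r (x - t + v) y) ->
  measurable_fun setT (fun t : 'rV[R]_n => kernel_re p r (x - t + v) y) /\
  measurable_fun setT (fun t : 'rV[R]_n => kernel_im p r (x - t + v) y).
Proof.
move=> q0; have mc j : measurable_fun setT (fun t : 'rV[R]_n => (x - t + v) ord0 j).
  under eq_fun do rewrite mxE; apply: measurable_funD => //; exact: measurable_coord_sub.
apply: measurable_cpow => //.
  apply: measurable_funD => //; apply: measurable_sum => j; apply: measurable_funB => //.
  by apply: measurable_funX.
apply: measurable_funM => //; apply: measurable_sum => j; exact: measurable_funM.
Qed.

Lemma sq_dist1_ge1 u : 1 <= sq_dist 1 u.
Proof. by rewrite /sq_dist expr1n lerDl sumr_ge0// => i _; exact: sqr_ge0. Qed.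

Lemma coord_le_sq_dist u j : `|u ord0 j| <= Num.sqrt (sq_dist 1 u).
Proof.
rewrite -ler_sqr ?nnegrE ?sqrtr_ge0// sqr_sqrtr ?(ltW (sq_dist_gt0 u ltr01))// real_normK ?num_real//.
by rewrite /sq_dist expr1n (bigD1 j)//= addrCA lerDl addr_ge0// sumr_ge0// => i _; exact: sqr_ge0.
Qed.

Definition grad_re p r j u y : R := - (2 * p) * (kernel_re (p + 1) r u y * u ord0 j - kernel_im (p + 1) r u y * y ord0 j).
Definition grad_im p r j u y : R := - (2 * p) * (kernel_re (p + 1) r u y * y ord0 j + kernel_im (p + 1) r u y * u ord0 j).

(** The increment of $q$ grows like $\sqrt D$ with $D=1+|u|^2$, so its square costs one power of
    $D$; the second derivative of $q^{-p}$ gains two. The remainder therefore has at least the decay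
    $D^{-p}$ of the kernel, and one dominating function serves for kernel, gradient and
    remainder. *)
Lemma kernel_taylor p r y k e : 0 <= p -> 0 < r -> enorm y < r -> 0 < k -> e <= 1 ->
  (forall (u v w : 'rV[R]_n), (forall j, `|v ord0 j| <= e) -> (forall j, `|w ord0 j| <= e) ->
    k * sq_dist 1 u <= q_re r (u + v) (y + w)) ->
  exists C, 0 <= C /\ forall (d : R) (u v w : 'rV[R]_n), 0 <= d <= e -> (forall j, `|v ord0 j| <= d) -> (forall j, `|w ord0 j| <= d) ->
    `|kernel_re p r (u + v) (y + w) - kernel_re p r u y
      - \sum_(j < n) (v ord0 j * grad_re p r j u y + - w ord0 j * grad_im p r j u y)| <= C * d ^+ 2 * sq_dist 1 u `^ (- p) /\
    `|kernel_im p r (u + v) (y + w) - kernel_im p r u y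
      - \sum_(j < n) (w ord0 j * grad_re p r j u y + v ord0 j * grad_im p r j u y)| <= C * d ^+ 2 * sq_dist 1 u `^ (- p).
Proof.
have sub_le (a b c : R) : 0 <= a -> 0 <= b -> a <= c -> b <= c -> `|a - b| <= c.
  by move=> *; rewrite ler_norml; apply/andP; split; lra.
move=> p0 r0 yr k0 e1 Hq; pose K := n%:R * (2 * r + 4).
have K0 : 0 <= K by rewrite mulr_ge0// addr_ge0// mulr_ge0// ltW.
pose C1 := 2 * p * (p + 1) * k `^ (- (p + 2)) * (2 * K ^+ 2).
pose C2 := 3 * n%:R * p * k `^ (- (p + 1)).
have c2 : 0 <= 2 * p * (p + 1) by rewrite mulr_ge0 ?addr_ge0// mulr_ge0.
have C10 : 0 <= C1.
  by apply: mulr_ge0; apply: mulr_ge0 => //; rewrite ?powR_ge0 ?sqr_ge0.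
have C20 : 0 <= C2.
  by apply: mulr_ge0; [apply: mulr_ge0 => //; exact: mulr_ge0|exact: powR_ge0].
exists (C1 + C2); split=> [|d u v w /andP[d0 de] vd wd]; first exact: addr_ge0.
set D := sq_dist 1 u; have D1 : 1 <= D := sq_dist1_ge1 u.
have D0 : 0 < D := lt_le_trans ltr01 D1.
have ve j : `|v ord0 j| <= e := le_trans (vd j) de.
have we j : `|w ord0 j| <= e := le_trans (wd j) de.
have q1 := Hq u v w ve we.
have z0 j : `|(0 : 'rV[R]_n) ord0 j| <= e by rewrite mxE normr0 (le_trans d0 de).
have q2 := Hq u 0 0 z0 z0; rewrite !addr0 in q2.
pose da := \sum_(j < n) (2 * (u ord0 j * v ord0 j - y ord0 j * w ord0 j) + (v ord0 j ^+ 2 - w ord0 j ^+ 2)).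
pose db := \sum_(j < n) (2 * (u ord0 j * w ord0 j + v ord0 j * y ord0 j) + 2 * (v ord0 j * w ord0 j)).
have Ea : q_re r (u + v) (y + w) = q_re r u y + da.
  rewrite /q_re -addrA -big_split/=; congr (_ + _); apply: eq_bigr => j _; rewrite !mxE; ring.
have Eb : q_im (u + v) (y + w) = q_im u y + db.
  rewrite /q_im !mulr_sumr -big_split/=; apply: eq_bigr => j _; rewrite !mxE; ring.
have d1 : d <= 1 := le_trans de e1.
pose S := Num.sqrt D; have S1 : 1 <= S by rewrite -[1]sqrtr1 ler_wsqrtr.
have S2 : S ^+ 2 = D by rewrite sqr_sqrtr// ltW.
have us j : `|u ord0 j| <= S := coord_le_sq_dist u j.
have yj j : `|y ord0 j| <= r := le_trans (coord_le_enorm y j) (ltW yr).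
have sumle (f : 'I_n -> R) c : (forall j, `|f j| <= c) -> `|\sum_j f j| <= n%:R * c.
  move=> fc; apply: le_trans (ler_norm_sum _ _ _) _.
  by apply: (@le_trans _ _ (\sum_(j < n) c)); [exact: ler_sum|rewrite sumr_const card_ord mulr_natl].
have pr (a b A B : R) : `|a| <= A -> `|b| <= B -> `|a * b| <= A * B by move=> h1 h2; rewrite normrM; exact: ler_pM.
have arith (a b c f A : R) : `|a| <= S * d -> `|b| <= r * d -> `|c| <= d * d -> `|f| <= d * d ->
    `|2 * (a + b) + (c + f)| <= d * (2 * r + 4) * S.
  move=> h1 h2 h3 h4; have dd : d * d <= d * 1 by apply: ler_wpM2l.
  have dS : d * 1 <= d * S by apply: ler_wpM2l.
  have rS : r * d * 1 <= r * d * S by apply: ler_wpM2l => //; rewrite mulr_ge0// ltW.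
  have E : d * (2 * r + 4) * S = 2 * (r * d * S) + 4 * (d * S) by ring.
  rewrite E; have := ler_normD (2 * (a + b)) (c + f); have := ler_normD a b; have := ler_normD c f.
  by rewrite (normrM 2) (ger0_norm (ler0n _ 2)); lra.
have bda : `|da| <= d * K * S.
  rewrite (_ : d * K * S = n%:R * (d * (2 * r + 4) * S)); last by rewrite /K; ring.
  apply: sumle => j; apply: (arith _ _ _ _ 0); rewrite ?normrN; [exact: pr|exact: pr| |].
    by rewrite expr2; exact: pr.
  by rewrite expr2; exact: pr.
have bdb : `|db| <= d * K * S.
  rewrite (_ : d * K * S = n%:R * (d * (2 * r + 4) * S)); last by rewrite /K; ring.
  apply: sumle => j; rewrite [2 * (v ord0 j * _)](_ : _ = v ord0 j * w ord0 j + v ord0 j * w ord0 j); last by ring.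
  by apply: (arith _ _ _ _ 0); [exact: pr|rewrite mulrC; exact: pr|exact: pr|exact: pr].
have sq (z : R) : `|z| <= d * K * S -> z ^+ 2 <= d ^+ 2 * K ^+ 2 * D.
  by move=> h; rewrite -S2 -!exprMn -real_normK ?num_real// ler_sqr ?nnegrE// (le_trans _ h).
have kD : 0 < k * D by rewrite mulr_gt0.
have pw q : (k * D) `^ (- q) = k `^ (- q) * D `^ (- q) by rewrite powRM// ltW.
have Dle q c : 0 <= c -> D `^ (- (q + c)) <= D `^ (- q).
  by move=> c0; apply: ler_powR => //; rewrite lerN2 lerDl.
have M1 : 2 * p * (p + 1) * (k * D) `^ (- (p + 2)) * (da ^+ 2 + db ^+ 2) <= C1 * d ^+ 2 * D `^ (- p).
  rewrite pw; apply: (@le_trans _ _ (2 * p * (p + 1) * (k `^ (- (p + 2)) * D `^ (- (p + 2))) * (2 * (d ^+ 2 * K ^+ 2 * D)))).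
    apply: ler_wpM2l; first by rewrite mulr_ge0// mulr_ge0 ?powR_ge0.
    by rewrite (mulrDl 1 1) !mul1r; apply: lerD; exact: sq.
  have E : D `^ (- (p + 2)) * D = D `^ (- (p + 1)).
    rewrite -[X in _ * X](powRr1 (ltW D0)) -powRD ?(gt_eqF D0) ?implybT//; congr (_ `^ _); lra.
  rewrite (_ : _ * (2 * _) = C1 * d ^+ 2 * (D `^ (- (p + 2)) * D)); last by rewrite /C1; ring.
  by rewrite E; apply: ler_wpM2l; [rewrite mulr_ge0// sqr_ge0|exact: Dle].
have p10 : 0 <= p + 1 by rewrite addr_ge0.
have [g1 g2] := @cpow_le R (p + 1) (q_re r u y) (q_im u y) (k * D) p10 kD q2.
have bg (A B : R) : `|A| <= n%:R * d ^+ 2 -> `|B| <= 2 * (n%:R * d ^+ 2) -> forall G1 G2,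
   `|G1| <= (k * D) `^ (- (p + 1)) -> `|G2| <= (k * D) `^ (- (p + 1)) -> `|- p * (G1 * A + G2 * B)| <= C2 * d ^+ 2 * D `^ (- p).
  move=> hA hB G1 G2 h1 h2; rewrite normrM normrN (ger0_norm p0).
  apply: (@le_trans _ _ (p * ((k * D) `^ (- (p + 1)) * (n%:R * d ^+ 2) + (k * D) `^ (- (p + 1)) * (2 * (n%:R * d ^+ 2))))).
    by apply: ler_wpM2l => //; apply: le_trans (ler_normD _ _) _; apply: lerD; exact: pr.
  rewrite pw (_ : p * _ = C2 * d ^+ 2 * D `^ (- (p + 1))); last by rewrite /C2; ring.
  by apply: ler_wpM2l; [rewrite mulr_ge0// sqr_ge0|exact: Dle].
pose a2 := \sum_(j < n) (v ord0 j ^+ 2 - w ord0 j ^+ 2); pose b2 := \sum_(j < n) 2 * (v ord0 j * w ord0 j).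
have ba2 : `|a2| <= n%:R * d ^+ 2.
  apply: sumle => j; have := vd j; have := wd j; move: (v ord0 j) (w ord0 j) => a b hb ha.
  have h1 : a ^+ 2 <= d ^+ 2 by rewrite -real_normK ?num_real// ler_sqr ?nnegrE.
  have h2 : b ^+ 2 <= d ^+ 2 by rewrite -[b ^+ 2]real_normK ?num_real// ler_sqr ?nnegrE.
  by apply: sub_le => //; exact: sqr_ge0.
have bb2 : `|b2| <= 2 * (n%:R * d ^+ 2).
  rewrite (_ : 2 * _ = n%:R * (2 * (d * d))); last by ring.
  have h2 : `|2| <= 2 :> R by rewrite ger0_norm.
  by apply: sumle => j; exact: (pr _ _ _ _ h2 (pr _ _ _ _ (vd j) (wd j))).
have [t1 t2] := @cpow_taylor R p (q_re r u y) (q_im u y) da db (k * D) p0 kD q2 (eq_ind _ (fun z => k * D <= z) q1 _ Ea).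
rewrite -Ea -Eb in t1 t2.
have fin (X Y Z : R) : `|X - Y| <= C1 * d ^+ 2 * D `^ (- p) -> `|Y - Z| <= C2 * d ^+ 2 * D `^ (- p) -> `|X - Z| <= (C1 + C2) * d ^+ 2 * D `^ (- p).
  move=> h1 h2; rewrite (_ : X - Z = (X - Y) + (Y - Z)); last by ring.
  by rewrite !mulrDl; apply: le_trans (ler_normD _ _) _; exact: lerD.
have g2' : `|- kernel_im (p + 1) r u y| <= (k * D) `^ (- (p + 1)) by rewrite normrN.
have Lda : da = 2 * (\sum_(j < n) (u ord0 j * v ord0 j - y ord0 j * w ord0 j)) + a2 by rewrite mulr_sumr -big_split.
have Ldb : db = 2 * (\sum_(j < n) (u ord0 j * w ord0 j + v ord0 j * y ord0 j)) + b2 by rewrite mulr_sumr -big_split.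
split.
  apply: fin (le_trans t1 M1) _.
  rewrite (_ : _ - _ = - p * (kernel_re (p + 1) r u y * a2 + - kernel_im (p + 1) r u y * b2)); first exact: (bg _ _ ba2 bb2 _ _ g1 g2').
  rewrite Lda Ldb (_ : \sum_(j < n) (v ord0 j * grad_re p r j u y + - w ord0 j * grad_im p r j u y) =
    - p * (kernel_re (p + 1) r u y * (2 * \sum_(j < n) (u ord0 j * v ord0 j - y ord0 j * w ord0 j)) -
      kernel_im (p + 1) r u y * (2 * \sum_(j < n) (u ord0 j * w ord0 j + v ord0 j * y ord0 j)))).
    by rewrite /kernel_re /kernel_im; ring.
  rewrite !mulr_sumr -sumrB mulr_sumr; apply: eq_bigr => j _; rewrite /grad_re /grad_im; ring.
apply: fin (le_trans t2 M1) _.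
rewrite (_ : _ - _ = - p * (kernel_im (p + 1) r u y * a2 + kernel_re (p + 1) r u y * b2)); first exact: (bg _ _ ba2 bb2 _ _ g2 g1).
rewrite Lda Ldb (_ : \sum_(j < n) (w ord0 j * grad_re p r j u y + v ord0 j * grad_im p r j u y) =
  - p * (kernel_im (p + 1) r u y * (2 * \sum_(j < n) (u ord0 j * v ord0 j - y ord0 j * w ord0 j)) +
    kernel_re (p + 1) r u y * (2 * \sum_(j < n) (u ord0 j * w ord0 j + v ord0 j * y ord0 j)))).
  by rewrite /kernel_re /kernel_im; ring.
rewrite !mulr_sumr -big_split/= mulr_sumr; apply: eq_bigr => j _; rewrite /grad_re /grad_im; ring.
Qed.

End tube_kernel.

Section dominated.
Variables (R : realType) (n : nat) (Q g : 'rV[R]_n -> R).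
Local Notation mu := (lebesgue_rV R n).
Hypotheses (mg : measurable_fun setT g) (Q0 : forall t, 0 <= Q t).
Hypothesis gQ : mu.-integrable setT (fun t => (g t * Q t)%:E).

Definition dominated (k : 'rV[R]_n -> R) := measurable_fun setT k /\ exists C : R, forall t, `|k t| <= C * Q t.

Lemma dominated_integrable k : dominated k -> mu.-integrable setT (fun t => (g t * k t)%:E).
Proof.
move=> [mk [C kC]]; have iC := integrableZl measurableT C gQ.
apply: le_integrable iC => //; first by apply/measurable_EFinP; exact: measurable_funM.
move=> t _; rewrite -EFinM !abse_EFin lee_fin mulrCA !normrM.
apply: ler_wpM2l => //; rewrite -normrM; apply: le_trans (kC t) _; exact: ler_norm.
Qed.

Lemma dominated_lin (a : R) k k' : dominated k -> dominated k' -> dominated (fun t => a * k t + k' t).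
Proof.
move=> [mk [C kC]] [mk' [C' kC']]; split.
  by apply: measurable_funD => //; exact: measurable_funM.
exists (`|a| * C + C') => t; rewrite mulrDl; apply: le_trans (ler_normD _ _) _; apply: lerD => //.
by rewrite normrM -mulrA; exact: ler_wpM2l.
Qed.

Lemma Rintegral_dominated_lin (a : R) k k' : dominated k -> dominated k' ->
  \int[mu]_t (g t * (a * k t + k' t)) = a * \int[mu]_t (g t * k t) + \int[mu]_t (g t * k' t).
Proof.
move=> dk dk'; have ik := dominated_integrable dk; have ik' := dominated_integrable dk'.
rewrite -RintegralZl// -RintegralD//.
  by apply: eq_Rintegral => t _; ring.
exact: (integrableZl measurableT a ik).
Qed.

Lemma Rintegral_dominated_le (C : R) k : dominated k -> (forall t, `|k t| <= C * Q t) ->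
  `|\int[mu]_t (g t * k t)| <= C * \int[mu]_t `|g t * Q t|.
Proof.
move=> dk kC; have ik := dominated_integrable dk.
apply: le_trans (le_normr_Rintegral measurableT ik) _.
rewrite -RintegralZl//; last by apply: (integrable_abse gQ).
apply: le_Rintegral => //.
- exact: (integrable_abse ik).
- exact: (integrableZl measurableT C (integrable_abse gQ)).
move=> t _; rewrite !normrM mulrCA; apply: ler_wpM2l => //.
by rewrite (ger0_norm (Q0 t)).
Qed.

Lemma dominated_sum (I : Type) (q : seq I) (c : I -> R) (k : I -> 'rV[R]_n -> R) : (forall i, dominated (k i)) ->
  dominated (fun t => \sum_(i <- q) c i * k i t) /\
  \int[mu]_t (g t * \sum_(i <- q) c i * k i t) = \sum_(i <- q) c i * \int[mu]_t (g t * k i t).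
Proof.
move=> dk; elim: q => [|i q [d1 IH]].
  rewrite (_ : (fun t => \sum_(i <- [::]) _) = fun=> 0); last by apply/funext => t; rewrite big_nil.
  split; first by split=> //; exists 0 => t; rewrite normr0 mul0r.
  rewrite big_nil /Rintegral (eq_integral (fun=> 0%E)) ?integral0// => t _.
  by rewrite big_nil mulr0.
have E : (fun t => \sum_(j <- i :: q) c j * k j t) = (fun t => c i * k i t + \sum_(j <- q) c j * k j t).
  by apply/funext => t; rewrite big_cons.
rewrite E; split; first exact: dominated_lin.
rewrite big_cons -IH -Rintegral_dominated_lin//.
by apply: eq_Rintegral => t _; rewrite big_cons.
Qed.

(** Linearity of the integral on functions dominated by [Q] transports the pointwise expansion of
    the kernel to the integrals. *)
Lemma dominated_taylor (k1 k0 : 'rV[R]_n -> R) (b1 b2 : 'I_n -> 'rV[R]_n -> R) (c1 c2 : 'I_n -> R) (C : R) :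
  dominated k1 -> dominated k0 -> (forall j, dominated (b1 j)) -> (forall j, dominated (b2 j)) ->
  (forall t, `|k1 t - k0 t - \sum_(j < n) (c1 j * b1 j t + c2 j * b2 j t)| <= C * Q t) ->
  `|\int[mu]_t (g t * k1 t) - \int[mu]_t (g t * k0 t) -
    \sum_(j < n) (c1 j * \int[mu]_t (g t * b1 j t) + c2 j * \int[mu]_t (g t * b2 j t))| <= C * \int[mu]_t `|g t * Q t|.
Proof.
move=> d1 d0 db1 db2 H.
have [s1 e1] := dominated_sum (index_enum _) c1 db1.
have [s2 e2] := dominated_sum (index_enum _) c2 db2.
have dz : dominated (fun=> 0) by split=> //; exists 0 => t; rewrite normr0 mul0r.
have h1 := dominated_lin 1 s1 s2; have h2' := dominated_lin (-1) h1 d1.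
have h3 := dominated_lin (-1) d0 h2'.
rewrite big_split/= -e1 -e2.
have abs_eq (a b c d : R) : `|a - b - (c + d)| = `|- b + (- (c + d) + a)| by congr `|_|; ring.
have := @Rintegral_dominated_le C _ h3; rewrite Rintegral_dominated_lin// Rintegral_dominated_lin// Rintegral_dominated_lin//.
rewrite mul1r !mulN1r => hh; rewrite abs_eq; apply: hh => t.
apply: le_trans (H t); rewrite le_eqVlt; apply/orP; left; apply/eqP; congr `|_|.
by rewrite big_split/=; ring.
Qed.

End dominated.

(** * Complex differentiability of the extended Poisson integral *)

Section poisson_tube_extension.
Variables (R : realType) (n : nat) (s r : R) (g : 'rV[R]_n -> R).
Local Notation mu := (lebesgue_rV R n).
Local Notation p := ((n%:R + s) / 2).
Hypotheses (s0 : 0 < s) (n0 : (0 < n)%N) (r0 : 0 < r) (Lg : is_L2 mu g).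
Local Open Scope complex_scope.

Definition tube_ext_re (x y : 'rV[R]_n) : R := \int[mu]_t (g t * kernel_re p r (x - t) y).
Definition tube_ext_im (x y : 'rV[R]_n) : R := \int[mu]_t (g t * kernel_im p r (x - t) y).

Definition tube_ext (z : 'rV[R[i]]_n) : R[i] :=
  tube_ext_re (map_mx (@complex.Re R) z) (map_mx (@complex.Im R) z) +i*
  tube_ext_im (map_mx (@complex.Re R) z) (map_mx (@complex.Im R) z).

Lemma tube_ext_diff (x y : 'rV[R]_n) : enorm y < r -> exists (L1 L2 : 'I_n -> R) (C e : R), [/\ 0 <= C, 0 < e &
  forall (d : R) (v w : 'rV[R]_n), 0 <= d <= e -> (forall j, `|v ord0 j| <= d) -> (forall j, `|w ord0 j| <= d) ->
   `|tube_ext_re (x + v) (y + w) - tube_ext_re x y - \sum_(j < n) (v ord0 j * L1 j + - w ord0 j * L2 j)| <= C * d ^+ 2 /\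
   `|tube_ext_im (x + v) (y + w) - tube_ext_im x y - \sum_(j < n) (w ord0 j * L1 j + v ord0 j * L2 j)| <= C * d ^+ 2].
Proof.
move=> yr; have p0 : 0 < p by rewrite divr_gt0// addr_gt0// ltr0n.
have [k [e [k0 e0 e1 Hq]]] := q_re_ge r0 yr.
have [C [C0 HT]] := kernel_taylor (ltW p0) r0 yr k0 e1 Hq.
pose Q (t : 'rV[R]_n) := poisson s 1 (x - t).
have QE t : Q t = sq_dist 1 (x - t) `^ (- p) by rewrite /Q /poisson powR1 mul1r.
have [LQ mQ] : is_L2 mu Q /\ measurable_fun setT Q.
  have L : is_L2 mu Q := is_L2_reflect x (is_L2_poisson s0 n0 ltr01).
  by split=> //; exact: L.1.
have Q0 t : 0 <= Q t by rewrite QE powR_ge0.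
have gQ := is_L2_mul_integrable Lg LQ.
have mg := Lg.1.
have zz (d : R) j : 0 <= d -> `|(0 : 'rV[R]_n) ord0 j| <= d by rewrite mxE normr0.
have dk (d : R) (v w : 'rV[R]_n) : d <= e -> (forall j, `|v ord0 j| <= d) -> (forall j, `|w ord0 j| <= d) ->
    dominated Q (fun t => kernel_re p r (x + v - t) (y + w)) /\ dominated Q (fun t => kernel_im p r (x + v - t) (y + w)).
  move=> de vd wd; have hq u := Hq u v w (fun j => le_trans (vd j) de) (fun j => le_trans (wd j) de).
  have qp (t : 'rV[R]_n) : 0 < q_re r (x - t + v) (y + w).
    by apply: lt_le_trans (hq (x - t)); rewrite mulr_gt0// sq_dist_gt0.
  have E : (fun t : 'rV[R]_n => x + v - t) = (fun t => x - t + v) by apply/funext => t; rewrite addrAC.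
  have [m1 m2] := measurable_tube_kernel p qp.
  have kl (t : 'rV[R]_n) : `|kernel_re p r (x - t + v) (y + w)| <= k `^ (- p) * Q t /\ `|kernel_im p r (x - t + v) (y + w)| <= k `^ (- p) * Q t.
    have D0 := sq_dist_gt0 (x - t) (ltr01 : 0 < 1 :> R).
    rewrite QE -powRM ?(ltW k0) ?(ltW D0)//.
    by apply: cpow_le; rewrite ?mulr_gt0 ?(ltW p0).
  have E2 (f : 'rV[R]_n -> R) : (fun t => f (x + v - t)) = (fun t => f (x - t + v)).
    by apply/funext => t; rewrite addrAC.
  rewrite (E2 (fun u => kernel_re p r u (y + w))) (E2 (fun u => kernel_im p r u (y + w))).
  by split; split=> //; exists (k `^ (- p)) => t; have [] := kl t.
have [dk0 dk0'] := dk 0 0 0 (ltW e0) (fun j => zz 0 j (lexx _)) (fun j => zz 0 j (lexx _)).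
rewrite !addr0 in dk0 dk0'.
have hq0 u := Hq u 0 0 (fun j => zz e j (ltW e0)) (fun j => zz e j (ltW e0)).
have db j : dominated Q (fun t => grad_re p r j (x - t) y) /\ dominated Q (fun t => grad_im p r j (x - t) y).
  have qp (t : 'rV[R]_n) : 0 < q_re r (x - t + 0) y.
    by have := hq0 (x - t); rewrite !addr0; apply: lt_le_trans; rewrite mulr_gt0// sq_dist_gt0.
  have [m1 m2] := measurable_tube_kernel (p + 1) qp.
  have mc := measurable_coord_sub x j.
  have mcst : measurable_fun setT (fun=> y ord0 j : R) by [].
  rewrite (_ : (fun t => kernel_re _ _ _ _) = (fun t : 'rV[R]_n => kernel_re (p + 1) r (x - t) y)) in m1; last by apply/funext => t; rewrite addr0.
  rewrite (_ : (fun t => kernel_im _ _ _ _) = (fun t : 'rV[R]_n => kernel_im (p + 1) r (x - t) y)) in m2; last by apply/funext => t; rewrite addr0.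
  pose B := 2 * p * (k `^ (- (p + 1)) * (1 + r)).
  have bound (t : 'rV[R]_n) (K1 K2 : R) : `|K1| <= k `^ (- (p + 1)) * sq_dist 1 (x - t) `^ (- (p + 1)) ->
      `|K2| <= k `^ (- (p + 1)) * sq_dist 1 (x - t) `^ (- (p + 1)) ->
      `|- (2 * p) * (K1 * (x - t) ord0 j + K2 * y ord0 j)| <= B * Q t.
    move=> h1 h2; set D := sq_dist 1 (x - t) in h1 h2; have D1 : 1 <= D := sq_dist1_ge1 _.
    have D0 : 0 < D := lt_le_trans ltr01 D1.
    have us := coord_le_sq_dist (x - t) j; rewrite -/D in us.
    have sD : Num.sqrt D <= D.
      rewrite -[leRHS]ger0_norm ?(ltW D0)// -sqrtr_sqr ler_sqrt ?sqr_ge0// expr2.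
      by rewrite ler_peMr// ltW.
    have yj : `|y ord0 j| <= r * D.
      apply: le_trans (coord_le_enorm y j) _; apply: le_trans (ltW yr) _; rewrite ler_peMr// ltW//.
    have E : D `^ (- (p + 1)) * D = D `^ (- p).
      by rewrite -[X in _ * X](powRr1 (ltW D0)) -powRD ?(gt_eqF D0) ?implybT//; congr (_ `^ _); lra.
    have p20 : 0 <= 2 * p by rewrite mulr_ge0// ltW.
    rewrite [leLHS]normrM normrN (ger0_norm p20) QE -/D -E /B.
    rewrite (_ : 2 * p * _ * _ = 2 * p * (k `^ (- (p + 1)) * D `^ (- (p + 1)) * D + k `^ (- (p + 1)) * D `^ (- (p + 1)) * (r * D))); last by ring.
    apply: ler_wpM2l => //.
    apply: le_trans (ler_normD _ _) _; rewrite !normrM; apply: lerD; apply: ler_pM => //.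
    exact: le_trans us sD.
  have kl (t : 'rV[R]_n) : `|kernel_re (p + 1) r (x - t) y| <= k `^ (- (p + 1)) * sq_dist 1 (x - t) `^ (- (p + 1)) /\
     `|kernel_im (p + 1) r (x - t) y| <= k `^ (- (p + 1)) * sq_dist 1 (x - t) `^ (- (p + 1)).
    have D0 := sq_dist_gt0 (x - t) (ltr01 : 0 < 1 :> R).
    rewrite -powRM ?(ltW k0) ?(ltW D0)//.
    apply: cpow_le; rewrite ?mulr_gt0//; first by rewrite addr_ge0// ltW.
    by have := hq0 (x - t); rewrite !addr0.
  split; split.
  - by apply: measurable_funM => //; apply: measurable_funB; exact: measurable_funM.
  - exists B => t; have [k1 k2] := kl t; rewrite /grad_re -(mulNr (kernel_im (p + 1) r (x - t) y)).
    by apply: bound => //; rewrite normrN.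
  - by apply: measurable_funM => //; apply: measurable_funD; exact: measurable_funM.
  - by exists B => t; have [k1 k2] := kl t; rewrite /grad_im [X in `|_ * X|]addrC; exact: bound.
exists (fun j => \int[mu]_t (g t * grad_re p r j (x - t) y)), (fun j => \int[mu]_t (g t * grad_im p r j (x - t) y)).
exists (C * \int[mu]_t `|g t * Q t|), e; split=> // [|d v w dd vd wd].
  by apply: mulr_ge0 => //; apply: Rintegral_ge0.
have /andP[_ de] := dd; have [dk1 dk1'] := dk d v w de vd wd.
have HT' t := HT d (x - t) v w dd vd wd.
rewrite mulrAC; split.
  have HH := @dominated_taylor R n Q g mg Q0 gQ (fun t => kernel_re p r (x + v - t) (y + w)) (fun t => kernel_re p r (x - t) y)
    (fun j t => grad_re p r j (x - t) y) (fun j t => grad_im p r j (x - t) y) (fun j => v ord0 j) (fun j => - w ord0 j) (C * d ^+ 2)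
    dk1 dk0 (fun j => (db j).1) (fun j => (db j).2).
  by apply: HH => t; rewrite QE (addrAC x v); exact: (HT' t).1.
have HH := @dominated_taylor R n Q g mg Q0 gQ (fun t => kernel_im p r (x + v - t) (y + w)) (fun t => kernel_im p r (x - t) y)
  (fun j t => grad_re p r j (x - t) y) (fun j t => grad_im p r j (x - t) y) (fun j => w ord0 j) (fun j => v ord0 j) (C * d ^+ 2)
  dk1' dk0' (fun j => (db j).1) (fun j => (db j).2).
by apply: HH => t; rewrite QE (addrAC x v); exact: (HT' t).2.
Qed.

Lemma holomorphic_tube_ext : holomorphic_on (tube r) tube_ext.
Proof.
move=> z zr; set x := map_mx (@complex.Re R) z; set y := map_mx (@complex.Im R) z.
have yr : enorm y < r by [].
have [L1 [L2 [C [e [C0 e0 H]]]]] := tube_ext_diff x yr.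
(* The real expansion has Cauchy-Riemann form: [L1] and [L2] occur exactly as in multiplication of
   the increment by $L_1+iL_2$, so they make up the complex gradient. *)
apply: (@differentiable_eps R[i] n tube_ext z (\row_j (L1 j +i* L2 j))) => c c0.
have [-> rc0] := complex_pos c0; set b := complex.Re c in rc0 *.
pose d := Num.min e (b / (2 * C + 1)).
have C1 : 0 < 2 * C + 1 by rewrite ltr_wpDl// mulr_ge0.
have d0 : 0 < d by rewrite lt_min e0 divr_gt0.
exists d%:C; first by rewrite ltcR.
move=> h hd.
pose v := map_mx (@complex.Re R) h; pose w := map_mx (@complex.Im R) h.
have hE : `|h| = (complex.Re `|h|)%:C by have := normr_ge0 h; case: `|h| => a a'; rewrite lecE/= => /andP[/eqP-> _].
set q := complex.Re `|h| in hE.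
have q0 : 0 <= q by have := normr_ge0 h; rewrite hE lecR.
have qd : q < d by move: hd; rewrite hE ltcR.
have hj j : Normc.normc (h ord0 j) <= q.
  apply/ler_addgt0Pr => a a0; apply: ltW.
  have : ball_ (fun z : 'rV[R[i]]_n => `|z|) 0 (q + a)%:C h.
    by rewrite /= sub0r normrN hE ltcR ltrDl.
  by rewrite -mx_norm_ball => -[qa /(_ ord0 j)]; rewrite /ball/= mxE sub0r normrN (normc_lt _ qa).
have vq j : `|v ord0 j| <= q by rewrite mxE; apply: le_trans (Re_le_normc _) (hj j).
have wq j : `|w ord0 j| <= q by rewrite mxE; apply: le_trans (Im_le_normc _) (hj j).
have qe : 0 <= q <= e by rewrite q0 (le_trans (ltW qd))// ge_min lexx.
have [H1 H2] := H q v w qe vq wq.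
rewrite hE -rmorphM/= normc_real_ge0 lecR.
apply: le_trans (normc_le _) _.
have xv : map_mx (@complex.Re R) (z + h) = x + v by apply/rowP => j; rewrite !mxE; case: (z ord0 j) => ? ?; case: (h ord0 j).
have yw : map_mx (@complex.Im R) (z + h) = y + w by apply/rowP => j; rewrite !mxE; case: (z ord0 j) => ? ?; case: (h ord0 j).
have fin : C * q ^+ 2 + C * q ^+ 2 <= b * q.
  have : q * (2 * C + 1) <= b by rewrite -ler_pdivlMr// (le_trans (ltW qd))// ge_min lexx orbT.
  move=> h1; have := ler_wpM2r q0 h1; have := mulr_ge0 q0 q0; rewrite expr2; lra.
apply: le_trans fin; apply: lerD.
  apply: le_trans H1; rewrite le_eqVlt; apply/orP; left; apply/eqP; congr `|_|.
  rewrite /tube_ext xv yw -/x -/y.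
  rewrite (_ : \sum_(j < n) (v ord0 j * L1 j + - w ord0 j * L2 j) =
     complex.Re (\sum_(j < n) (\row_j (L1 j +i* L2 j)) ord0 j * h ord0 j)); last first.
    rewrite Re_sum; apply: eq_bigr => j _; rewrite !mxE; case: (h ord0 j) => a a' /=; ring.
  by case: (\sum_(_ < n) _).
apply: le_trans H2; rewrite le_eqVlt; apply/orP; left; apply/eqP; congr `|_|.
rewrite /tube_ext xv yw -/x -/y.
rewrite (_ : \sum_(j < n) (w ord0 j * L1 j + v ord0 j * L2 j) =
   complex.Im (\sum_(j < n) (\row_j (L1 j +i* L2 j)) ord0 j * h ord0 j)); last first.
  rewrite Im_sum; apply: eq_bigr => j _; rewrite !mxE; case: (h ord0 j) => a a' /=; ring.
by case: (\sum_(_ < n) _).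
Qed.

End poisson_tube_extension.

(** * Slice estimates of the kernel *)

Section singular_integrals.
Variable R : realType.
Local Notation lb := (@lebesgue_measure R).
Implicit Types (a b c e h q : R).

Lemma two_powers0_le1 q w : 0 <= q -> two_powers 0 q w <= 1.
Proof.
move=> q0; rewrite /two_powers; case: (leP `|w| 1) => w1; first by rewrite oppr0 powRr0.
have one : 1 `^ q = 1 :> R by rewrite powR1.
by rewrite powRN invf_le1 ?powR_gt0 ?(lt_trans ltr01 w1)// -[leLHS]one; apply: ge0_ler_powR; rewrite ?nnegrE// ltW.
Qed.

(** Sum of the integrals of the two majorants [two_powers b 2] and [two_powers 0 q] used on a
    line. *)
Definition line_const b q : R := (2 / (1 - b) + 2) + (2 + 2 / (q - 1)).

Lemma integral_two_powers0 q : 1 < q -> (\int[lb]_x (two_powers 0 q x)%:E <= (2 + 2 / (q - 1))%:E)%E.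
Proof.
move=> q1; apply: le_trans (integral_two_powers ltr01 q1) _.
by rewrite subr0 divr1.
Qed.

(** With $d=c/a$, $|c+xa|=|a||x+d|$. Where $|x+d|\le1$ the singular factor is kept and the decay
    bounded by 1; elsewhere the reverse. The bound depends neither on [c] nor on the floor [e]. *)
Lemma integral_line_bound b q h e c a : 0 <= b -> b < 1 -> 1 < q -> 0 < h -> 0 < e -> h <= `|a| ->
  (\int[lb]_x (two_powers 0 q x * Num.max e `|c + x * a| `^ (- b))%:E <= (line_const b q * h `^ (- b))%:E)%E.
Proof.
move=> b0 b1 q1 h0 e0 ha.
have q0 : 0 <= q by apply: le_trans (ltW q1).
have a0 : a != 0 by rewrite -normr_gt0 (lt_le_trans h0).
pose d := c / a.
pose T : measurableTypeR R -> R := fun x => two_powers b 2 (x + d) + two_powers 0 q x.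
have mtp b' q' : measurable_fun [set: measurableTypeR R] (two_powers b' q') := @measurable_two_powers R b' q'.
have msh : measurable_fun [set: measurableTypeR R] (fun x => two_powers b 2 (x + d)).
  apply: (measurableT_comp (mtp b 2)); apply: measurable_funD => //; exact: measurable_id.
have mT : measurable_fun setT T by exact: measurable_funD.
have mL : measurable_fun [set: measurableTypeR R] (fun x => two_powers 0 q x * Num.max e `|c + x * a| `^ (- b)).
  apply: measurable_funM; first exact: mtp.
  apply: (measurableT_comp (measurable_powR (- b))); apply: measurable_maxr => //.
  apply: (measurableT_comp (@normr_measurable R setT)); apply: measurable_funD => //.
  by apply: measurable_funM => //; exact: measurable_id.
have pos x : 0 <= two_powers 0 q x * Num.max e `|c + x * a| `^ (- b).
  by rewrite mulr_ge0 ?two_powers_ge0 ?powR_ge0.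
have T0 x : 0 <= T x by rewrite addr_ge0// two_powers_ge0.
(* The zero of $c+xa$ is left out; it is a single point, hence a null set. *)
have pt x : x != - d -> two_powers 0 q x * Num.max e `|c + x * a| `^ (- b) <= h `^ (- b) * T x.
  move=> xd; have xd0 : 0 < `|x + d| by rewrite normr_gt0 addr_eq0.
  have E : `|c + x * a| = `|a| * `|x + d| by rewrite -normrM; congr `|_|; rewrite /d; field.
  have m0 : 0 < `|c + x * a| by rewrite E mulr_gt0// normr_gt0.
  have h1 : Num.max e `|c + x * a| `^ (- b) <= h `^ (- b) * `|x + d| `^ (- b).
    rewrite -powRM ?(ltW h0) ?(ltW xd0)// !powRN lef_pV2 ?posrE ?powR_gt0 ?mulr_gt0 ?lt_max ?e0//.
    apply: ge0_ler_powR; rewrite ?nnegrE ?mulr_ge0 ?(ltW h0)//.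
      by rewrite le_max (ltW e0).
    by rewrite le_max E ler_wpM2r ?orbT.
  apply: (@le_trans _ _ (two_powers 0 q x * (h `^ (- b) * `|x + d| `^ (- b)))).
    by apply: ler_wpM2l => //; exact: two_powers_ge0.
  rewrite mulrCA; apply: ler_wpM2l; first exact: powR_ge0.
  rewrite /T {2}/two_powers; case: (leP `|x + d| 1) => xd1.
    rewrite -[leLHS]addr0; apply: lerD; last exact: two_powers_ge0.
    by apply: ler_piMl; [exact: powR_ge0|exact: two_powers0_le1].
  rewrite -[leLHS]add0r; apply: lerD; first exact: powR_ge0.
  apply: ler_piMr; first exact: two_powers_ge0.
  have one : 1 `^ b = 1 :> R by rewrite powR1.
  rewrite powRN invf_le1 ?powR_gt0// -[leLHS]one.
  by apply: ge0_ler_powR; rewrite ?nnegrE// ltW.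
apply: (@le_trans _ _ (\int[lb]_x (h `^ (- b) * T x)%:E)%E).
  apply: ae_ge0_le_integral => //.
  - by move=> x _; rewrite lee_fin.
  - exact/measurable_EFinP.
  - by move=> x _; rewrite lee_fin mulr_ge0 ?powR_ge0.
  - by apply/measurable_EFinP; exact: measurable_funM.
  exists [set - d]; split => //; first exact: lebesgue_measure_set1.
  move=> x /= nx; apply: contrapT => /eqP xd; apply: nx => _; rewrite lee_fin; exact: pt.
under eq_integral do rewrite EFinM.
rewrite ge0_integralZl//; first last.
- by rewrite lee_fin powR_ge0.
- by move=> x _; rewrite lee_fin.
- exact/measurable_EFinP.
rewrite mulrC EFinM; apply: lee_wpmul2l; first by rewrite lee_fin powR_ge0.
rewrite /T; under eq_integral do rewrite EFinD.
rewrite ge0_integralD//; first last.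
- exact/measurable_EFinP.
- by move=> x _; rewrite lee_fin two_powers_ge0.
- exact/measurable_EFinP.
- by move=> x _; rewrite lee_fin two_powers_ge0.
rewrite /line_const EFinD; apply: leeD; last exact: integral_two_powers0.
have mE : measurable_fun [set: measurableTypeR R] (fun x => (two_powers b 2 x)%:E) by apply/measurable_EFinP; exact: mtp.
have E0 x : (0 <= (two_powers b 2 x)%:E)%E by rewrite lee_fin two_powers_ge0.
have -> : (\int[lb]_x (two_powers b 2 (x + d))%:E = \int[lb]_x (two_powers b 2 (1 * x + d))%:E)%E.
  by apply: eq_integral => x _; rewrite mul1r.
rewrite (ge0_integral_affine d (oner_neq0 R) mE E0) normr1 invr1 mul1e.
apply: le_trans (integral_two_powers b1 _) _; first by rewrite ltr1n.
have e2 : 2 - 1 = 1 :> R by ring.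
by rewrite lee_fin e2 divr1.
Qed.

Lemma line_const_ge b q : b < 1 -> 1 < q -> 0 <= 2 + 2 / (q - 1) <= line_const b q.
Proof.
move=> b1 q1; have h1 : 0 <= 2 / (1 - b) by rewrite divr_ge0// subr_ge0 ltW.
have h2 : 0 <= 2 / (q - 1) by rewrite divr_ge0// subr_ge0 ltW.
by rewrite /line_const; apply/andP; split; lra.
Qed.

Lemma integral_prod_two_powers n b q : b < 1 -> 1 < q ->
  (\int[lebesgue_rV R n]_x (\prod_(i < n) two_powers 0 q (x ord0 i))%:E <= (line_const b q ^+ n)%:E)%E.
Proof.
move=> b1 q1; have /andP[k0 k1] := line_const_ge b1 q1.
rewrite (@ge0_integral_prod R n (fun=> two_powers 0 q)); first last.
- by move=> _ x; exact: two_powers_ge0.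
- by move=> _; exact: measurable_two_powers.
have I0 : (0 <= \int[lb]_w (two_powers 0 q w)%:E)%E.
  by apply: integral_ge0 => x _; rewrite lee_fin two_powers_ge0.
have I1 := integral_two_powers0 q1.
elim: n => [|n IH]; first by rewrite big_ord0.
rewrite big_ord_recl exprS EFinM; apply: lee_pmul => //.
  by rewrite big_const_ord; elim: (n) => //= m IHm; exact: mule_ge0.
by apply: le_trans I1 _; rewrite lee_fin.
Qed.

(** Only the coordinate [j] with $|y_j|\ge h$ crosses the singular hyperplane transversally: it is
    integrated innermost, all other coordinates being absorbed into the constant [c], which is
    arbitrary for that purpose. *)
Lemma integral_hyperplane_bound n b q h e c (y : 'rV[R]_n) (j : 'I_n) :
  0 <= b -> b < 1 -> 1 < q -> 0 < h -> 0 < e -> h <= `|y ord0 j| ->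
  (\int[lebesgue_rV R n]_x (\prod_(i < n) two_powers 0 q (x ord0 i) *
      Num.max e `|c + \sum_(i < n) x ord0 i * y ord0 i| `^ (- b))%:E <= (line_const b q ^+ n * h `^ (- b))%:E)%E.
Proof.
move=> b0 b1 q1 h0 e0; have /andP[k0 k1] := line_const_ge b1 q1.
have K0 : 0 <= line_const b q by exact: le_trans k1.
elim: n c y j => [c y []//|n IH c y j hj].
set f := fun x : 'rV[R]_n.+1 => \prod_(i < n.+1) two_powers 0 q (x ord0 i) *
  Num.max e `|c + \sum_(i < n.+1) x ord0 i * y ord0 i| `^ (- b).
have mf : measurable_fun setT f.
  apply: measurable_funM.
    apply: measurable_prod => i _; apply: (measurableT_comp (@measurable_two_powers R 0 q)).
    exact: measurable_rV_coord.
  apply: (measurableT_comp (measurable_powR (- b))); apply: measurable_maxr => //.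
  apply: (measurableT_comp (@normr_measurable R setT)); apply: measurable_funD => //.
  by apply: measurable_sum => i; apply: measurable_funM => //; exact: measurable_rV_coord.
have f0 x : 0 <= f x by rewrite mulr_ge0 ?powR_ge0// prodr_ge0// => i _; exact: two_powers_ge0.
have mEf : measurable_fun setT (fun x => (f x)%:E) by exact/measurable_EFinP.
have fE (a : measurableTypeR R) (v : 'rV[R]_n) : f (rV_cons (a, v)) =
    two_powers 0 q a * (\prod_(i < n) two_powers 0 q (v ord0 i) *
      Num.max e `|c + a * y ord0 ord0 + \sum_(i < n) v ord0 i * y ord0 (lift ord0 i)| `^ (- b)).
  rewrite /f !big_ord_recl rV_cons0 /= mulrA addrA.
  have -> : \prod_(i < n) two_powers 0 q (rV_cons (a, v) ord0 (lift ord0 i)) = \prod_(i < n) two_powers 0 q (v ord0 i).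
    by apply: eq_bigr => i _; rewrite rV_consS.
  suff -> : \sum_(i < n) rV_cons (a, v) ord0 (lift ord0 i) * y ord0 (lift ord0 i) =
      \sum_(i < n) v ord0 i * y ord0 (lift ord0 i) by [].
  by apply: eq_bigr => i _; rewrite rV_consS.
pose G (p : measurableTypeR R * 'rV[R]_n) : \bar R := (f (rV_cons p))%:E.
rewrite (_ : (\int[_]_x _)%E = (\int[lb]_a \int[lebesgue_rV R n]_v G (a, v))%E); last first.
  by apply: (ge0_integral_rV_cons mEf) => x; rewrite lee_fin.
have mG : measurable_fun setT G by apply: (measurableT_comp mEf); exact: measurable_rV_cons.
have G0 p : (0 <= G p)%E by rewrite lee_fin.
have mtp : measurable_fun [set: measurableTypeR R] (two_powers 0 q) := @measurable_two_powers R 0 q.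
have mprod : measurable_fun setT (fun v : 'rV[R]_n => \prod_(i < n) two_powers 0 q (v ord0 i)).
  apply: measurable_prod => i _; apply: (measurableT_comp (@measurable_two_powers R 0 q)).
  exact: measurable_rV_coord.
have prod0 (v : 'rV[R]_n) : 0 <= \prod_(i < n) two_powers 0 q (v ord0 i).
  by apply: prodr_ge0 => i _; exact: two_powers_ge0.
have [k jk|j0] := unliftP ord0 j.
  pose y' : 'rV[R]_n := \row_i y ord0 (lift ord0 i).
  apply: (@le_trans _ _ (\int[lb]_a ((two_powers 0 q a)%:E * (line_const b q ^+ n * h `^ (- b))%:E))%E).
    apply: ge0_le_integral => //.
    - by move=> a _; apply: integral_ge0 => v _; rewrite lee_fin.
    - exact: (@measurable_fun_fubini_tonelli_F _ _ _ _ R (lebesgue_rV R n) G).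
    - by apply: emeasurable_funM => //; exact/measurable_EFinP.
    move=> a _.
    have GE v : G (a, v) = ((two_powers 0 q a)%:E * (\prod_(i < n) two_powers 0 q (v ord0 i) *
      Num.max e `|c + a * y ord0 ord0 + \sum_(i < n) v ord0 i * y ord0 (lift ord0 i)| `^ (- b))%:E)%E.
      by rewrite /G fE EFinM.
    under eq_integral do rewrite GE.
    rewrite ge0_integralZl//.
    - apply: lee_wpmul2l; first by rewrite lee_fin two_powers_ge0.
      have hk : h <= `|y' ord0 k| by rewrite mxE -jk.
      apply: le_trans (IH (c + a * y ord0 ord0) y' k hk).
      rewrite le_eqVlt; apply/orP; left; apply/eqP; apply: eq_integral => v _.
      by congr (_ * (Num.max e `|_ + _| `^ _))%:E; apply: eq_bigr => i _; rewrite mxE.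
    - apply/measurable_EFinP; apply: measurable_funM => //.
      apply: (measurableT_comp (measurable_powR (- b))); apply: measurable_maxr => //.
      apply: (measurableT_comp (@normr_measurable R setT)); apply: measurable_funD => //.
      by apply: measurable_sum => i; apply: measurable_funM => //; exact: measurable_rV_coord.
    - by move=> v _; rewrite lee_fin mulr_ge0// powR_ge0.
    - by rewrite lee_fin two_powers_ge0.
  rewrite ge0_integralZr//; first last.
  - by rewrite lee_fin mulr_ge0 ?powR_ge0 ?exprn_ge0.
  - by move=> a _; rewrite lee_fin two_powers_ge0.
  - exact/measurable_EFinP.
  rewrite exprS -mulrA [leRHS]EFinM; apply: lee_wpmul2r; first by rewrite lee_fin mulr_ge0 ?powR_ge0 ?exprn_ge0.
  by apply: le_trans (integral_two_powers0 q1) _; rewrite lee_fin.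
have hj0 : h <= `|y ord0 ord0| by rewrite -j0.
rewrite (@fubini_tonelli _ _ (measurableTypeR R) _ R lb (lebesgue_rV R n) G)//.
apply: (@le_trans _ _ (\int[lebesgue_rV R n]_v ((\prod_(i < n) two_powers 0 q (v ord0 i))%:E * (line_const b q * h `^ (- b))%:E))%E).
  apply: ge0_le_integral => //.
  - by move=> v _; apply: integral_ge0 => a _.
  - exact: (@measurable_fun_fubini_tonelli_G _ _ (measurableTypeR R) _ R lb G).
  - by apply: emeasurable_funM => //; exact/measurable_EFinP.
  move=> v _.
  have E (a : measurableTypeR R) : G (a, v) = ((\prod_(i < n) two_powers 0 q (v ord0 i))%:E *
      (two_powers 0 q a * Num.max e `|c + (\sum_(i < n) v ord0 i * y ord0 (lift ord0 i)) + a * y ord0 ord0| `^ (- b))%:E)%E.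
    by rewrite /G fE -EFinM addrAC mulrCA.
  under eq_integral do rewrite E.
  rewrite ge0_integralZl//; first by apply: lee_wpmul2l; [rewrite lee_fin|exact: integral_line_bound].
  - apply/measurable_EFinP; apply: measurable_funM => //.
    apply: (measurableT_comp (measurable_powR (- b))); apply: measurable_maxr => //.
    apply: (measurableT_comp (@normr_measurable R setT)); apply: measurable_funD => //.
    by apply: measurable_funM => //; exact: measurable_id.
  - by move=> a _; rewrite lee_fin mulr_ge0 ?two_powers_ge0 ?powR_ge0.
  - by rewrite lee_fin.
rewrite ge0_integralZr//; first last.
- by rewrite lee_fin mulr_ge0 ?powR_ge0.
- by move=> v _; rewrite lee_fin.
- exact/measurable_EFinP.
rewrite exprSr -mulrA [leRHS]EFinM; apply: lee_wpmul2r; first by rewrite lee_fin mulr_ge0 ?powR_ge0.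
exact: integral_prod_two_powers.
Qed.

(** The weight left over when slice estimates meet the Bergman weight; any $b>0$ makes it integrable
    up to the sphere. *)
Definition ball_weight n b (y : 'rV[R]_n) : R :=
  if enorm y ^+ 2 < 1 then (1 - enorm y ^+ 2) `^ (b - 1) else 0.

Lemma ball_weight_ge0 n b (y : 'rV[R]_n) : 0 <= ball_weight b y.
Proof. by rewrite /ball_weight; case: ifP => // _; exact: powR_ge0. Qed.

Lemma measurable_ball_weight n b : measurable_fun setT (fun y : 'rV[R]_n => ball_weight b y).
Proof.
have mE := @measurable_enorm R n.
apply: measurable_fun_ifT => //.
  by apply: measurable_fun_ltr => //; exact: measurable_funX.
apply: (measurableT_comp (measurable_powR (b - 1))); apply: measurable_funB => //.
exact: measurable_funX.
Qed.

Definition interval_weight b (t : measurableTypeR R) : R := if t ^+ 2 < 1 then (1 - t ^+ 2) `^ (b - 1) else 0.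

Lemma measurable_interval_weight b : measurable_fun setT (interval_weight b).
Proof.
have mid : measurable_fun [set: measurableTypeR R] (fun t : measurableTypeR R => t ^+ 2).
  by apply: measurable_funX; exact: measurable_id.
apply: measurable_fun_ifT => //; first exact: measurable_fun_ltr.
by apply: (measurableT_comp (measurable_powR (b - 1))); exact: measurable_funB.
Qed.

Lemma interval_weight_ge0 b t : 0 <= interval_weight b t.
Proof. by rewrite /interval_weight; case: ifP => // _; exact: powR_ge0. Qed.

Lemma integral_interval_weight b : 0 < b -> b < 1 ->
  (\int[lb]_t (interval_weight b t)%:E <= (4 / b + 4)%:E)%E.
Proof.
move=> b0 b1; have b1' : 1 - b < 1 by lra.
pose T (t : measurableTypeR R) := (two_powers (1 - b) 2 (1 * t + 1))%:E : \bar R.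
pose T' (t : measurableTypeR R) := (two_powers (1 - b) 2 (-1 * t + 1))%:E : \bar R.
have mtp : measurable_fun [set: measurableTypeR R] (fun x => (two_powers (1 - b) 2 x)%:E).
  by apply/measurable_EFinP; exact: measurable_two_powers.
have maff (a : R) : measurable_fun [set: measurableTypeR R] (fun t => (two_powers (1 - b) 2 (a * t + 1))%:E).
  apply: (measurableT_comp mtp); apply: measurable_funD; last exact: measurable_cst.
  by apply: measurable_funM; [exact: measurable_cst|exact: measurable_id].
have tp0 (x : R) : (0 <= (two_powers (1 - b) 2 x)%:E)%E by rewrite lee_fin two_powers_ge0.
apply: (@le_trans _ _ (\int[lb]_t (T t + T' t))%E).
  apply: ge0_le_integral => //.
  - by move=> t _; rewrite lee_fin interval_weight_ge0.
  - by apply/measurable_EFinP; exact: measurable_interval_weight.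
  - by apply: emeasurable_funD; exact: maff.
  move=> t _; rewrite /T /T' -EFinD lee_fin /interval_weight; case: ifPn => [t1|_]; last by rewrite addr_ge0// two_powers_ge0.
  have {}t1 : `|t| < 1 by rewrite -(expr_lt1 (n := 2))// real_normK ?num_real.
  have d0 : 0 < 1 - `|t| by rewrite subr_gt0.
  have step : (1 - t ^+ 2) `^ (b - 1) <= two_powers (1 - b) 2 (1 - `|t|).
    rewrite /two_powers ger0_norm ?(ltW d0)// ifT; last by rewrite gerBl.
    rewrite opprB -[b - 1]opprB !powRN lef_pV2 ?posrE ?powR_gt0//; last first.
      by rewrite -real_normK ?num_real// subr_gt0 expr_lt1.
    apply: ge0_ler_powR; rewrite ?nnegrE ?(ltW d0) ?subr_ge0 ?(ltW b1)//.
      by rewrite -real_normK ?num_real// expr_le1// ltW.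
    by rewrite lerD2l lerN2 -real_normK ?num_real// expr2 ler_piMr// ltW.
  apply: le_trans step _; rewrite mul1r mulN1r; case: (ger0P t) => t0.
    by rewrite [- t + 1]addrC lerDr two_powers_ge0.
  by rewrite opprK [t + 1]addrC lerDl two_powers_ge0.
rewrite ge0_integralD//; try exact: maff; try by move=> t _; exact: tp0.
have aff (a : R) : a != 0 -> `|a| = 1 -> (\int[lb]_t (two_powers (1 - b) 2 (a * t + 1))%:E <= (2 / b + 2)%:E)%E.
  move=> a0 a1; have := ge0_integral_affine 1 a0 mtp tp0; rewrite a1 invr1 mul1e => ->.
  have e2 : 2 - 1 = 1 :> R by ring.
  by apply: le_trans (integral_two_powers b1' _) _; [rewrite ltr1n|rewrite lee_fin subKr e2 divr1].
rewrite (_ : 4 / b + 4 = (2 / b + 2) + (2 / b + 2)); last by lra.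
rewrite EFinD; apply: leeD; apply: aff; rewrite ?oner_eq0 ?oppr_eq0 ?oner_eq0 ?normrN1 ?normr1//.
Qed.

(** Slicing: with $A=1-|v|^2$ and $a=\sqrt A\,a'$, the inner integral is $\sqrt A\,A^{b-1}$ times
    the one-dimensional integral, and $\sqrt A\le1$ returns the weight in one dimension less. *)
Lemma integral_ball_weight n b : 0 < b -> b < 1 ->
  (\int[lebesgue_rV R n]_y (ball_weight b y)%:E <= ((4 / b + 4) ^+ n)%:E)%E.
Proof.
move=> b0 b1; elim: n => [|n IH].
  rewrite /= integral_dirac//; last by apply/measurable_EFinP; exact: measurable_ball_weight.
  by rewrite diracT mul1e expr0 lee_fin /ball_weight enormE big_ord0 ltr01 subr0 powR1.
have K0 : 0 <= 4 / b + 4 by rewrite addr_ge0// divr_ge0// ltW.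
have mw m : measurable_fun setT (fun y : 'rV[R]_m => (ball_weight b y)%:E).
  by apply/measurable_EFinP; exact: measurable_ball_weight.
rewrite ge0_integral_rV_cons//; last by move=> x; rewrite lee_fin ball_weight_ge0.
pose G (p : measurableTypeR R * 'rV[R]_n) : \bar R := (ball_weight b (rV_cons p))%:E.
have mG : measurable_fun setT G by apply: (measurableT_comp (mw n.+1)); exact: measurable_rV_cons.
have G0 p : (0 <= G p)%E by rewrite lee_fin ball_weight_ge0.
rewrite (@fubini_tonelli _ _ (measurableTypeR R) _ R lb (lebesgue_rV R n) G)//.
apply: (@le_trans _ _ (\int[lebesgue_rV R n]_v ((4 / b + 4)%:E * (ball_weight b v)%:E))%E); last first.
  rewrite ge0_integralZl//; try by move=> v _; rewrite lee_fin ball_weight_ge0.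
    by rewrite exprS EFinM; apply: lee_wpmul2l; rewrite ?lee_fin.
  exact: mw.
apply: ge0_le_integral => //.
- by move=> v _; apply: integral_ge0.
- exact: (@measurable_fun_fubini_tonelli_G _ _ (measurableTypeR R) _ R lb G).
- by apply: measurable_funeM; exact: mw.
move=> v _.
have cE (a : measurableTypeR R) : enorm (rV_cons (a, v)) ^+ 2 = a ^+ 2 + enorm v ^+ 2.
  rewrite !enormE big_ord_recl rV_cons0; congr (_ + _).
  by apply: eq_bigr => i _; rewrite rV_consS.
rewrite /ball_weight; case: ifPn => v1; last first.
  rewrite mule0 integral0_eq// => a _; rewrite /G /ball_weight cE ifF//.
  by rewrite -leNgt in v1; apply/negbTE; rewrite -leNgt; apply: le_trans v1 _; rewrite lerDr sqr_ge0.
set A := 1 - enorm v ^+ 2; have A0 : 0 < A by rewrite subr_gt0.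
have A1 : A <= 1 by rewrite gerBl sqr_ge0.
pose sA := Num.sqrt A; have sA0 : 0 < sA by rewrite sqrtr_gt0.
have sA2 : sA ^+ 2 = A by rewrite sqr_sqrtr// ltW.
have GE (a : R) : G (sA * a, v) = ((A `^ (b - 1))%:E * (interval_weight b a)%:E)%E.
  rewrite /G /ball_weight cE /interval_weight -EFinM exprMn sA2.
  have E : (A * a ^+ 2 + enorm v ^+ 2 < 1) = (a ^+ 2 < 1) by rewrite -ltrBrDr -/A gtr_pMr.
  rewrite E; case: ifPn => a1; last by rewrite mulr0.
  by rewrite opprD addrCA -/A [- _ + _]addrC -[X in X - _]mulr1 -mulrBr powRM ?(ltW A0)// subr_ge0 ltW.
have mGv : measurable_fun [set: measurableTypeR R] (fun a => G (a, v)).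
  by apply: (measurableT_comp mG); exact: measurable_pair2.
have EI : (\int[lb]_a G ((sA * a + 0)%R, v) = \int[lb]_a ((A `^ (b - 1))%:E * (interval_weight b a)%:E))%E.
  by apply: eq_integral => a _; rewrite addr0; exact: GE.
have := ge0_integral_affine 0 (lt0r_neq0 sA0) mGv (fun a => G0 (a, v)).
rewrite EI ge0_integralZl//; first last.
- by rewrite lee_fin powR_ge0.
- by move=> t _; rewrite lee_fin interval_weight_ge0.
- by apply/measurable_EFinP; exact: measurable_interval_weight.
rewrite gtr0_norm// => e.
have -> : (\int[lb]_a G (a, v) = sA%:E * ((A `^ (b - 1))%:E * \int[lb]_x (interval_weight b x)%:E))%E.
  by rewrite e muleA -EFinM divff ?gt_eqF// mul1e.
have I0 : (0 <= \int[lb]_x (interval_weight b x)%:E)%E.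
  by apply: integral_ge0 => t _; rewrite lee_fin interval_weight_ge0.
rewrite muleCA muleC; apply: lee_wpmul2r; first by rewrite lee_fin powR_ge0.
rewrite -[leRHS]mul1e; apply: lee_pmul => //; first by rewrite lee_fin ltW.
  by rewrite lee_fin -[leRHS]sqrtr1 ler_wsqrtr.
exact: integral_interval_weight.
Qed.

End singular_integrals.

(** * The $L^1$ mass of the kernel on horizontal slices, with the gain of a power of $d$ *)

Section kernel_mass.
Variables (R : realType) (n : nat) (s : R).
Hypotheses (n0 : (0 < n)%N) (s0 : 0 < s).
Local Notation mu := (lebesgue_rV R n).
Local Notation p := ((n%:R + s) / 2).
Local Notation b := (Num.min s 1 / 4).
Implicit Types (x y : 'rV[R]_n) (r : R).

Definition sqmod r x y : R := q_re r x y ^+ 2 + q_im x y ^+ 2.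

Lemma measurable_sqmod r y : measurable_fun setT (fun x => sqmod r x y).
Proof.
have mc i : measurable_fun setT (fun x : 'rV[R]_n => x ord0 i) := @measurable_rV_coord R n i.
apply: measurable_funD; apply: measurable_funX.
  apply: measurable_funD => //; apply: measurable_sum => i; apply: measurable_funB => //.
  exact: measurable_funX.
by apply: measurable_funM => //; apply: measurable_sum => i; exact: measurable_funM.
Qed.

Lemma b_bounds : [/\ 0 < b, b < 1 & 2 * b < s].
Proof.
have m0 : 0 < Num.min s 1 by rewrite lt_min s0 ltr01.
have m1 : Num.min s 1 <= 1 by rewrite ge_min lexx orbT.
have ms : Num.min s 1 <= s by rewrite ge_min lexx.
by split; lra.
Qed.

Lemma sqmod_scale1 (d : R) x y : 0 < d -> d = 1 - enorm y ^+ 2 ->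
  q_re 1 (Num.sqrt d *: x) y = d * sq_dist 1 x /\
  q_im (Num.sqrt d *: x) y = 2 * Num.sqrt d * \sum_(i < n) x ord0 i * y ord0 i.
Proof.
move=> d0 dE; have s2 : Num.sqrt d ^+ 2 = d by rewrite sqr_sqrtr// ltW.
split.
  rewrite /q_re /sq_dist expr1n sumrB -[X in _ - X]enormE addrCA -dE mulrDr mulr1 addrC mulr_sumr; congr (_ + _).
  by apply: eq_bigr => i _; rewrite mxE exprMn s2.
by rewrite /q_im -[RHS]mulrA [X in _ = _ * X]mulr_sumr; congr (_ * _); apply: eq_bigr => i _; rewrite mxE mulrA.
Qed.

(** Either some $|y_j|\ge h$ and the imaginary part $2x\cdot y$ helps, or [y] is far from the unit
    sphere and the kernel is comparable to the Poisson kernel. In the first case $x$ is rescaled by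
    $\sqrt d$; exponent $p-b$ is spent on the real part $d(1+|x|^2)$ and exponent $b$ on $\sqrt
    d\max(\sqrt d,|x\cdot y|)$. The powers of $d$ combine to $\frac n2-(p-b)-\frac
    b2=-\frac{s-b}2$. *)
Lemma kernel_mass1 : exists2 K : R, 0 <= K & forall y, enorm y < 1 ->
  (\int[mu]_x (sqmod 1 x y `^ (- (p / 2)))%:E <= (K * (1 - enorm y ^+ 2) `^ (- ((s - b) / 2)))%:E)%E.
Proof.
have [b0 b1 bs] := b_bounds.
have nR : 0 < n%:R :> R by rewrite ltr0n.
have p0 : 0 < p by rewrite divr_gt0// addr_gt0.
(* $(n+s')/2=p-b$: after giving up the exponent $b$, the remaining kernel is still a Poisson kernel
   of positive order, with coordinate decay $q=1+s'/n$. *)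
pose s' := s - 2 * b; have s'0 : 0 < s' by rewrite subr_gt0.
pose q := 2 * ((n%:R + s') / 2 / n%:R).
have q1 : 1 < q.
  by rewrite (_ : q = 1 + s' / n%:R) ?ltrDl ?divr_gt0// /q; field; rewrite gt_eqF.
(* If all coordinates are at most [h] then $|y|^2\le1/(4n)\le1/4$, hence $d\ge3/4$ in the second
   case. *)
pose h : R := (2 * n%:R)^-1; have h0 : 0 < h by rewrite invr_gt0 mulr_gt0.
pose Ka := line_const b q ^+ n * h `^ (- b).
pose Kb := (3 / 4) `^ (- p) * fine (\int[mu]_x (poisson s 1 x)%:E).
have /andP[k0 k1] := line_const_ge b1 q1.
have Ka0 : 0 <= Ka by rewrite mulr_ge0 ?powR_ge0 ?exprn_ge0// (le_trans k0).
have Kb0 : 0 <= Kb.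
  rewrite mulr_ge0 ?powR_ge0// fine_ge0// integral_ge0// => x _; rewrite lee_fin ltW// poisson_gt0//.
exists (Ka + Kb) => [|y y1]; first exact: addr_ge0.
have mf : measurable_fun setT (fun x => (sqmod 1 x y `^ (- (p / 2)))%:E).
  by apply/measurable_EFinP; apply: (measurableT_comp (measurable_powR _)); exact: measurable_sqmod.
have f0 x : (0 <= (sqmod 1 x y `^ (- (p / 2)))%:E)%E by rewrite lee_fin powR_ge0.
set d := 1 - enorm y ^+ 2; have d0 : 0 < d by rewrite subr_gt0 expr_lt1// sqrtr_ge0.
have d1 : d <= 1 by rewrite gerBl sqr_ge0.
rewrite [(Ka + Kb) * _]mulrDl; have [/existsP[j hj]|nj] := boolP [exists j, h <= `|y ord0 j|].
  apply: (@le_trans _ _ (Ka * d `^ (- ((s - b) / 2)))%:E); last first.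
    by rewrite lee_fin lerDl mulr_ge0 ?powR_ge0.
  pose sg := Num.sqrt d; have sg0 : 0 < sg by rewrite sqrtr_gt0.
  have sg2 : sg ^+ 2 = d by rewrite sqr_sqrtr// ltW.
  have -> : (\int[mu]_x (sqmod 1 x y `^ (- (p / 2)))%:E =
      (sg ^+ n)%:E * \int[mu]_x (sqmod 1 (sg *: x) y `^ (- (p / 2)))%:E)%E.
    rewrite (ge0_integral_rV_scale (lt0r_neq0 sg0) mf f0) muleA -EFinM gtr0_norm// divff ?mul1e//.
    by rewrite gt_eqF// exprn_gt0.
  pose T x := \prod_(i < n) two_powers 0 q (x ord0 i) * Num.max sg `|0 + \sum_(i < n) x ord0 i * y ord0 i| `^ (- b).
  have mT : measurable_fun setT T.
    apply: measurable_funM.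
      apply: measurable_prod => i _; apply: (measurableT_comp (@measurable_two_powers R 0 q)).
      exact: measurable_rV_coord.
    apply: (measurableT_comp (measurable_powR (- b))); apply: measurable_maxr => //.
    apply: (measurableT_comp (@normr_measurable R setT)); apply: measurable_funD => //.
    by apply: measurable_sum => i; apply: measurable_funM => //; exact: measurable_rV_coord.
  have T0 x : 0 <= T x by rewrite mulr_ge0 ?powR_ge0// prodr_ge0// => i _; exact: two_powers_ge0.
  pose c := d `^ (- (p - b)) * sg `^ (- b).
  have c0 : 0 <= c by rewrite mulr_ge0 ?powR_ge0.
  have pb0 : 0 <= p - b by rewrite subr_ge0; have := nR; lra.
  have pt x : sqmod 1 (sg *: x) y `^ (- (p / 2)) <= c * T x.
    have [E1 E2] := sqmod_scale1 x d0 (erefl : d = 1 - enorm y ^+ 2); rewrite -/sg in E1 E2.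
    have D0 := sq_dist_gt0 x (ltr01 : 0 < 1 :> R).
    set z := \sum_(i < n) x ord0 i * y ord0 i in E2.
    have N1 : (d * sq_dist 1 x) ^+ 2 <= sqmod 1 (sg *: x) y by rewrite /sqmod E1 lerDl sqr_ge0.
    have N0 : 0 < sqmod 1 (sg *: x) y by apply: lt_le_trans N1; rewrite exprn_gt0// mulr_gt0.
    have N2 : (sg * Num.max sg `|0 + z|) ^+ 2 <= sqmod 1 (sg *: x) y.
      rewrite add0r maxEle; case: ifP => _.
        rewrite /sqmod E2 !exprMn real_normK ?num_real//.
        have h1 := sqr_ge0 (q_re 1 (sg *: x) y); have h2 := mulr_ge0 (sqr_ge0 sg) (sqr_ge0 z).
        by rewrite -addrC -!mulrA ; lra.
      rewrite -expr2 sg2; apply: le_trans N1; rewrite ler_sqr ?nnegrE ?mulr_ge0 ?(ltW d0) ?(ltW D0)//.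
      by rewrite ler_peMr ?(ltW d0)// sq_dist1_ge1.
    rewrite (_ : - (p / 2) = - ((p - b) / 2) + - (b / 2)); last by lra.
    rewrite powRD ?(gt_eqF N0) ?implybT// /c /T mulrACA; apply: ler_pM; rewrite ?powR_ge0//.
      apply: (@le_trans _ _ ((d * sq_dist 1 x) `^ (- (p - b)))); first by apply: sqmod_powR_le; rewrite ?mulr_gt0.
      rewrite powRM ?(ltW d0) ?(ltW D0)//; apply: ler_wpM2l; first exact: powR_ge0.
      have := @poisson1_le_prod R n s' s'0 n0 x; rewrite /poisson powR1 mul1r; apply: le_trans.
      by rewrite le_eqVlt; apply/orP; left; apply/eqP; congr (_ `^ _); rewrite /s'; lra.
    rewrite -powRM ?(ltW sg0) ?le_max ?(ltW sg0)//; apply: sqmod_powR_le => //; first exact: ltW.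
    by rewrite mulr_gt0// lt_max sg0.
  apply: (@le_trans _ _ ((sg ^+ n)%:E * (c * Ka)%:E)%E).
    apply: lee_wpmul2l; first by rewrite lee_fin exprn_ge0// ltW.
    apply: (@le_trans _ _ (\int[mu]_x (c * T x)%:E)%E).
      apply: ge0_le_integral => //.
      - apply/measurable_EFinP; apply: (measurableT_comp (measurable_powR _)).
        apply: (measurableT_comp (measurable_sqmod 1 y)).
        by have := measurable_rV_affine sg (0 : 'rV[R]_n); under eq_fun do rewrite addr0.
      - by apply/measurable_EFinP; exact: measurable_funM.
      - by move=> x _; rewrite lee_fin.
    under eq_integral do rewrite EFinM.
    rewrite ge0_integralZl//; first last.
    - by move=> x _; rewrite lee_fin.
    - exact/measurable_EFinP.
    rewrite [leRHS]EFinM; apply: lee_wpmul2l; first by rewrite lee_fin.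
    exact: (integral_hyperplane_bound 0 (ltW b0) b1 q1 h0 sg0 hj).
  rewrite -EFinM lee_fin le_eqVlt; apply/orP; left; apply/eqP.
  rewrite mulrA [RHS]mulrC; congr (_ * _).
  rewrite /c -powR_mulrn ?(ltW sg0)// /sg -powR12_sqrt ?(ltW d0)// -!powRrM mulrCA -!powRD ?(gt_eqF d0) ?implybT//.
  by congr (_ `^ _); lra.
have yj j : `|y ord0 j| <= h by rewrite leNgt; apply: contra nj => hj; apply/existsP; exists j; exact: ltW.
have d34 : 3 / 4 <= d.
  have := enorm_box yj => e1.
  have : n%:R * h ^+ 2 <= 1 / 4.
    rewrite /h (_ : n%:R * _ = 1 / 4 * n%:R^-1); last by field; rewrite gt_eqF.
    by rewrite ler_piMr// invf_le1// ler1n.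
  by rewrite /d; lra.
have I1 : (\int[mu]_x (poisson s 1 x)%:E)%E \is a fin_num.
  exact: integral_fune_fin_num (integrable_poisson s0 n0 ltr01).
apply: (@le_trans _ _ Kb%:E); last first.
  rewrite lee_fin -[leLHS]add0r; apply: lerD; first by rewrite mulr_ge0 ?powR_ge0.
  rewrite -[leLHS]mulr1; apply: ler_wpM2l => //.
  rewrite powRN invr_ge1 ?unitfE ?gt_eqF ?powR_gt0//.
  have one : 1 `^ ((s - b) / 2) = 1 :> R by rewrite powR1.
  by rewrite -[leRHS]one; apply: ge0_ler_powR; rewrite ?nnegrE ?(ltW d0)//; lra.
rewrite [leRHS]EFinM fineK// -ge0_integralZl//; first last.
- by move=> x _; rewrite lee_fin ltW// poisson_gt0.
- by apply/measurable_EFinP; exact: measurable_poisson.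
apply: ge0_le_integral => //.
- by apply: measurable_funeM; apply/measurable_EFinP; exact: measurable_poisson.
move=> x _; rewrite -EFinM lee_fin /poisson powR1 mul1r.
have D0 := sq_dist_gt0 x (ltr01 : 0 < 1 :> R).
rewrite -powRM ?(ltW D0)//; apply: sqmod_powR_le; [exact: ltW|by rewrite mulr_gt0|].
have qd : q_re 1 x y = d + \sum_(i < n) x ord0 i ^+ 2.
  by rewrite /q_re expr1n sumrB -[X in _ - X]enormE addrCA addrC.
apply: (@le_trans _ _ (q_re 1 x y ^+ 2)); last by rewrite lerDl sqr_ge0.
have X0 : 0 <= \sum_(i < n) x ord0 i ^+ 2 by apply: sumr_ge0 => i _; exact: sqr_ge0.
rewrite ler_sqr ?nnegrE ?mulr_ge0 ?(ltW D0)//; last by rewrite qd addr_ge0// ltW.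
by rewrite qd /sq_dist expr1n; lra.
Qed.

Lemma sqmod_scale r x y : 0 < r -> sqmod r (r *: x) (r *: y) = (r ^+ 2) ^+ 2 * sqmod 1 x y.
Proof.
move=> r0; rewrite /sqmod.
have -> : q_re r (r *: x) (r *: y) = r ^+ 2 * q_re 1 x y.
  by rewrite /q_re mulrDr expr1n mulr1 mulr_sumr; congr (_ + _); apply: eq_bigr => i _; rewrite !mxE; ring.
have -> : q_im (r *: x) (r *: y) = r ^+ 2 * q_im x y.
  by rewrite /q_im [RHS]mulrCA [X in _ = _ * X]mulr_sumr; congr (_ * _); apply: eq_bigr => i _; rewrite !mxE; ring.
ring.
Qed.

(** Dilation by [r]: the modulus squared is homogeneous of degree 4, so the mass scales by
    $r^{n-2p}=r^{-s}$. *)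
Lemma kernel_mass : exists2 K : R, 0 <= K & forall r y, 0 < r -> enorm y < 1 ->
  (\int[mu]_x (sqmod r x (r *: y) `^ (- (p / 2)))%:E <= (r `^ (- s) * (K * (1 - enorm y ^+ 2) `^ (- ((s - b) / 2))))%:E)%E.
Proof.
have [K K0 HK] := kernel_mass1; exists K => // r y r0 y1.
have mf : measurable_fun setT (fun x => (sqmod r x (r *: y) `^ (- (p / 2)))%:E).
  by apply/measurable_EFinP; apply: (measurableT_comp (measurable_powR _)); exact: measurable_sqmod.
have f0 x : (0 <= (sqmod r x (r *: y) `^ (- (p / 2)))%:E)%E by rewrite lee_fin powR_ge0.
have -> : (\int[mu]_x (sqmod r x (r *: y) `^ (- (p / 2)))%:E =
    (r ^+ n)%:E * \int[mu]_x (sqmod r (r *: x) (r *: y) `^ (- (p / 2)))%:E)%E.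
  rewrite (ge0_integral_rV_scale (lt0r_neq0 r0) mf f0) muleA -EFinM gtr0_norm// divff ?mul1e//.
  by rewrite gt_eqF// exprn_gt0.
have E x : (sqmod r (r *: x) (r *: y) `^ (- (p / 2)))%:E = ((r `^ (- (2 * p)))%:E * (sqmod 1 x y `^ (- (p / 2)))%:E)%E.
  rewrite sqmod_scale// powRM ?exprn_ge0 ?(ltW r0) ?addr_ge0 ?sqr_ge0// EFinM; congr (_%:E * _)%E.
  by rewrite -exprM -powR_mulrn ?(ltW r0)// -powRrM; congr (_ `^ _); rewrite natrM; field.
rewrite (eq_integral (fun x => (r `^ (- (2 * p)))%:E * (sqmod 1 x y `^ (- (p / 2)))%:E)%E); last by move=> x _; exact: E.
rewrite ge0_integralZl//; first last.
- by rewrite lee_fin powR_ge0.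
- by move=> x _; rewrite lee_fin powR_ge0.
- by apply/measurable_EFinP; apply: (measurableT_comp (measurable_powR _)); exact: measurable_sqmod.
rewrite muleA -EFinM [leRHS]EFinM -powR_mulrn ?(ltW r0)// -powRD ?(gt_eqF r0) ?implybT//.
rewrite (_ : n%:R + - (2 * p) = - s); last by field.
by apply: lee_wpmul2l; [rewrite lee_fin powR_ge0|exact: HK].
Qed.

End kernel_mass.

(** * Uniform Bergman bounds for the extension *)

Section tube_ext_bound.
Variables (R : realType) (n : nat) (s : R).
Hypotheses (n0 : (0 < n)%N) (s0 : 0 < s).
Local Notation mu := (lebesgue_rV R n).
Local Notation p := ((n%:R + s) / 2).
Local Open Scope complex_scope.

Lemma map_mx_cpoint (x y : 'rV[R]_n) :
  map_mx (@complex.Re R) (Defs.cpoint x y) = x /\ map_mx (@complex.Im R) (Defs.cpoint x y) = y.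
Proof. by split; apply/rowP => j; rewrite !mxE. Qed.

Lemma enormZ (r : R) (y : 'rV[R]_n) : 0 < r -> enorm (r *: y) = r * enorm y.
Proof.
move=> r0; rewrite /enorm (_ : \sum_(i < n) _ = r ^+ 2 * \sum_(i < n) y ord0 i ^+ 2).
  by rewrite sqrtrM ?sqr_ge0// sqrtr_sqr gtr0_norm.
by rewrite mulr_sumr; apply: eq_bigr => i _; rewrite mxE exprMn.
Qed.

(** At fixed height the real and imaginary parts are convolutions of [g] with kernels bounded by the
    same modulus, so Young's inequality gives each of them a factor $M^2$. *)
Lemma tube_ext_mass (r M : R) (g : 'rV[R]_n -> R) (y : 'rV[R]_n) : 0 < r -> is_L2 mu g -> enorm y < r -> 0 <= M ->
  (\int[mu]_x (sqmod r x y `^ (- (p / 2)))%:E <= M%:E)%E ->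
  (tube_mass r (tube_ext s r g) y <= (2 * M ^+ 2)%:E * sq_int mu g)%E.
Proof.
move=> r0 Lg yr M0 HM; have p0 : 0 < p by rewrite divr_gt0// addr_gt0// ltr0n.
have [k [e [k0 e0 e1 Hq]]] := q_re_ge r0 yr.
have zz j : `|(0 : 'rV[R]_n) ord0 j| <= e by rewrite mxE normr0 ltW.
have qp (t : 'rV[R]_n) : 0 < q_re r (0 - t + 0) y.
  by have := Hq (0 - t) 0 0 zz zz; rewrite [y + 0]addr0; apply: lt_le_trans; rewrite mulr_gt0// sq_dist_gt0.
have mrefl (f : 'rV[R]_n -> R) : measurable_fun setT (fun t : 'rV[R]_n => f (0 - t + 0)) -> measurable_fun setT f.
  move=> mf; rewrite (_ : f = (fun t => f (0 - t + 0)) \o (fun t => 0 - t)).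
    by apply: (measurableT_comp mf); apply: measurable_rV_sub => //; exact: measurable_cst.
  by apply/funext => t /=; rewrite addr0 !sub0r opprK.
have [m1 m2] := measurable_tube_kernel p qp.
have {}m1 := mrefl (fun u => kernel_re p r u y) m1; have {}m2 := mrefl (fun u => kernel_im p r u y) m2.
have kle x : `|kernel_re p r x y| <= sqmod r x y `^ (- (p / 2)) /\ `|kernel_im p r x y| <= sqmod r x y `^ (- (p / 2)).
  rewrite /kernel_re /kernel_im /cpow_re /cpow_im normrN !normrM !(ger0_norm (powR_ge0 _ _)).
  by split; apply: ler_piMr; rewrite ?powR_ge0// ler_norml ?cos_geN1 ?cos_le1 ?sin_geN1 ?sin_le1.
have bound (K : 'rV[R]_n -> R) : measurable_fun setT K -> (forall x, `|K x| <= sqmod r x y `^ (- (p / 2))) ->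
    (sq_int mu (rconv g K) <= (M ^+ 2)%:E * sq_int mu g)%E.
  move=> mK Kle.
  have I1 : (\int[mu]_x `|K x|%:E <= M%:E)%E.
    apply: le_trans HM; apply: ge0_le_integral => //.
    - by apply/measurable_EFinP; exact: (measurableT_comp (@normr_measurable R setT)).
    - by apply/measurable_EFinP; apply: (measurableT_comp (measurable_powR _)); exact: measurable_sqmod.
    - by move=> x _; rewrite lee_fin.
  have iK : mu.-integrable setT (EFin \o K).
    apply/integrableP; split; first exact/measurable_EFinP.
    by apply: le_lt_trans (I1) _; rewrite ltry.
  apply: le_trans (sq_int_conv_le Lg iK) _; apply: lee_wpmul2r; first exact: sq_int_ge0.
  rewrite lee_fin ler_sqr ?nnegrE//; last by apply: Rintegral_ge0.
  rewrite -lee_fin; apply: le_trans (I1); rewrite /Rintegral fineK//.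
  by rewrite ge0_fin_numE; [apply: le_lt_trans (I1) _; rewrite ltry|exact: integral_ge0].
have b1 := bound _ m1 (fun x => (kle x).1); have b2 := bound _ m2 (fun x => (kle x).2).
have mc (K : 'rV[R]_n -> R) : measurable_fun setT K -> measurable_fun setT (rconv g K).
  by move=> mK; apply: measurable_conv => //; exact: Lg.1.
have -> : tube_mass r (tube_ext s r g) y =
    (sq_int mu (rconv g (fun u => kernel_re p r u y)) + sq_int mu (rconv g (fun u => kernel_im p r u y)))%E.
  rewrite /sq_int -ge0_integralD//.
  - apply: eq_integral => x _; rewrite tube_densityE//= -EFinD /sq_tube normc_sqr /tube_ext /=.
    by have [-> ->] := map_mx_cpoint x y.
  - by move=> x _; rewrite lee_fin sqr_ge0.
  - by apply/measurable_EFinP; apply: measurable_funX; exact: mc.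
  - by move=> x _; rewrite lee_fin sqr_ge0.
  - by apply/measurable_EFinP; apply: measurable_funX; exact: mc.
rewrite (_ : 2 * M ^+ 2 = M ^+ 2 + M ^+ 2); last by ring.
have M2 : (0 <= (M ^+ 2)%:E)%E by rewrite lee_fin sqr_ge0.
rewrite EFinD (ge0_muleDl _ M2 M2); exact: (leeD b1 b2).
Qed.

Lemma holomorphic_lin (K : numFieldType) (D : set 'rV[K]_n) (F G : 'rV[K]_n -> K) (c : K) :
  holomorphic_on D F -> holomorphic_on D G -> holomorphic_on D (fun z => F z + c * G z).
Proof.
by move=> hF hG z Dz; apply: (differentiableD (hF z Dz)); exact: (differentiableZ c (hG z Dz)).
Qed.

Lemma normc_lin_sqr (z w : R[i]) : Normc.normc (z + 'i * w) ^+ 2 <= 2 * Normc.normc z ^+ 2 + 2 * Normc.normc w ^+ 2.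
Proof.
rewrite !normc_sqr; case: z => a c; case: w => a' c' /=.
rewrite !mul0r !mul1r sub0r add0r.
have := sqr_ge0 (a + c'); have := sqr_ge0 (c - a').
by rewrite !sqrrD !sqrrN; lra.
Qed.

(** Substituting $ry$ for $y$ cancels $\rho^{-n}$ and reduces the weight to the unit ball. The
    squared slice mass $d^{-(s-b)}$ times $d^{s-1}$ is $d^{b-1}$. The 4 in the constant is 2 for
    splitting $|z+iw|^2$ times 2 for real and imaginary kernels; the factor $r^{-2s}$ awaits data
    scaled by $r^s$. *)
Lemma bergman_tube_ext : exists2 K : R, 0 <= K & forall (r : R) (g1 g2 : 'rV[R]_n -> R), 0 < r ->
  is_L2 mu g1 -> is_L2 mu g2 ->
  let F := fun z => tube_ext s r g1 z + 'i * tube_ext s r g2 z in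
  holomorphic_on (tube r) F /\
  (bergman_sqnorm s r F <= (K * (r `^ (- s)) ^+ 2)%:E * (sq_int mu g1 + sq_int mu g2))%E.
Proof.
have [K K0 HK] := @kernel_mass R n s n0 s0; have [b0 b1 bs] := b_bounds s0; set b := Num.min s 1 / 4 in HK b0 b1 bs.
exists (4 * K ^+ 2 * (4 / b + 4) ^+ n).
  by rewrite !mulr_ge0 ?sqr_ge0// exprn_ge0// addr_ge0// divr_ge0// ltW.
move=> r g1 g2 r0 L1 L2 F.
have h1 := holomorphic_tube_ext s0 n0 r0 L1; have h2 := holomorphic_tube_ext s0 n0 r0 L2.
have hF : holomorphic_on (tube r) F by exact: holomorphic_lin.
split=> //; set N := (sq_int mu g1 + sq_int mu g2)%E.
have N0 : (0 <= N)%E by rewrite adde_ge0// sq_int_ge0.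
have mW : measurable_fun setT (fun y => (tube_weight r s y)%:E * tube_mass r F y)%E.
  apply: emeasurable_funM; last exact: measurable_tube_mass.
  by apply/measurable_EFinP; exact: measurable_tube_weight.
have W0 y : (0 <= (tube_weight r s y)%:E * tube_mass r F y)%E.
  by rewrite mule_ge0 ?tube_mass_ge0// lee_fin powR_ge0.
rewrite bergman_sqnormE//.
have := ge0_integral_rV_scale (lt0r_neq0 r0) mW W0; rewrite gtr0_norm// => <-.
have massF y : enorm y < r -> (tube_mass r F y <= 2%:E * (tube_mass r (tube_ext s r g1) y + tube_mass r (tube_ext s r g2) y))%E.
  move=> yr; have md (G : 'rV[R[i]]_n -> R[i]) : holomorphic_on (tube r) G -> measurable_fun setT (fun x => tube_density r G (x, y)).
    by move=> hG; apply: measurable_density_slice => //; exact: measurable_cst.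
  have m1 := md _ h1; have m2 := md _ h2.
  have d0 G x : (0 <= tube_density r G (x, y))%E := tube_density_ge0 r G (x, y).
  rewrite /tube_mass -ge0_integralD// -ge0_integralZl//; first last.
  - by move=> x _; rewrite adde_ge0.
  - exact: emeasurable_funD.
  apply: ge0_le_integral => //.
  - exact: md.
  - by apply: measurable_funeM; exact: emeasurable_funD.
  move=> x _; rewrite !tube_densityE// -EFinD -EFinM lee_fin mulrDr /sq_tube; exact: normc_lin_sqr.
pose A := 4 * K ^+ 2 * (r `^ (- s)) ^+ 2.
have A0 : 0 <= A by apply: mulr_ge0; [apply: mulr_ge0 => //; exact: sqr_ge0|exact: sqr_ge0].
apply: (@le_trans _ _ (\int[mu]_y ((ball_weight b y)%:E * (A%:E * N)))%E); last first.
  rewrite ge0_integralZr//; first last.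
  - by rewrite mule_ge0// lee_fin.
  - by move=> y _; rewrite lee_fin ball_weight_ge0.
  - by apply/measurable_EFinP; exact: measurable_ball_weight.
  rewrite muleA; apply: lee_wpmul2r => //.
  rewrite (_ : _ * _ * _ * _ = (4 / b + 4) ^+ n * A); last by rewrite /A; ring.
  by rewrite [leRHS]EFinM; apply: lee_wpmul2r; [rewrite lee_fin|exact: integral_ball_weight].
have mWr : measurable_fun setT (fun y : 'rV[R]_n => (tube_weight r s (r *: y))%:E * tube_mass r F (r *: y))%E.
  apply: (measurableT_comp mW).
  by have := measurable_rV_affine r (0 : 'rV[R]_n); under eq_fun do rewrite addr0.
have mB : measurable_fun setT (fun y : 'rV[R]_n => (ball_weight b y)%:E * (A%:E * N))%E.
  apply: emeasurable_funM; last exact: measurable_cst.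
  by apply/measurable_EFinP; exact: measurable_ball_weight.
apply: (ge0_le_integral mu measurableT (fun y _ => W0 (r *: y)) mWr mB).
move=> y _; rewrite /ball_weight.
have yE : (enorm y ^+ 2 < 1) = (enorm y < 1) by rewrite expr_lt1// sqrtr_ge0.
case: ifPn; rewrite yE => y1; last first.
  have -> : tube_mass r F (r *: y) = 0%E.
    apply: integral0_eq => x _; rewrite /tube_density patchE ifF//; apply/negbTE; rewrite notin_setE /= enormZ//.
    by rewrite gtr_pMr// => h; rewrite h in y1.
  by rewrite mule0 mul0e.
have yr : enorm (r *: y) < r by rewrite enormZ// gtr_pMr.
set d := 1 - enorm y ^+ 2; have d0 : 0 < d by rewrite subr_gt0 yE.
pose M := r `^ (- s) * (K * d `^ (- ((s - b) / 2))).
have M0 : 0 <= M by rewrite !mulr_ge0 ?powR_ge0.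
have HM := HK r y r0 y1; rewrite -/d -/M in HM.
have t1 := tube_ext_mass r0 L1 yr M0 HM; have t2 := tube_ext_mass r0 L2 yr M0 HM.
have wE : tube_weight r s (r *: y) = d `^ (s - 1).
  rewrite /tube_weight enormZ// exprMn mulrAC divff ?gt_eqF ?exprn_gt0// mul1r.
  by rewrite (max_idPl _) ?(ltW d0).
rewrite wE; apply: (@le_trans _ _ ((d `^ (s - 1))%:E * (2%:E * ((2 * M ^+ 2)%:E * N)))%E).
  apply: lee_wpmul2l; first by rewrite lee_fin powR_ge0.
  apply: le_trans (massF _ yr) _; apply: lee_wpmul2l => //.
  by rewrite /N ge0_muleDr ?sq_int_ge0//; exact: leeD.
rewrite !muleA -!EFinM; apply: lee_wpmul2r => //; rewrite lee_fin.
rewrite /M /A !exprMn -[_ `^ (- ((s - b) / 2)) ^+ 2]powR_mulrn ?powR_ge0// -powRrM.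
have E : d `^ (b - 1) = d `^ (s - 1) * d `^ (- ((s - b) / 2) * 2%:R).
  by rewrite -powRD ?(gt_eqF d0) ?implybT//; congr (_ `^ _); lra.
by rewrite E le_eqVlt; apply/orP; left; apply/eqP; ring.
Qed.

Lemma convolution_bergman_bounded (u : 'rV[R]_n * R -> R[i]) :
  (exists f : 'rV[R]_n -> R[i],
     L2 f /\
     forall (x : 'rV[R]_n) (rho : R), 0 < rho ->
       u (x, rho) =
       convolution f (fun y => (rho `^ s * gen_poisson s rho y)%:C) x) ->
  exists C : R, forall rho : R, 0 < rho ->
     exists F : 'rV[R[i]]_n -> R[i],
       [/\ extends_to_tube rho (fun x => u (x, rho)) F,
           bergman_space s rho F &
           (bergman_norm s rho F <= C%:E)%E].
Proof.
move=> [f [[m1 m2 Lf] uE]]; have [K K0 HK] := bergman_tube_ext.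
pose f1 x := complex.Re (f x); pose f2 x := complex.Im (f x).
have sum : (sq_int mu f1 + sq_int mu f2 < +oo)%E.
  rewrite /sq_int -ge0_integralD//.
  - apply: le_lt_trans Lf; rewrite le_eqVlt; apply/orP; left; apply/eqP; apply: eq_integral => x _.
    by rewrite -EFinD normc_sqr.
  - by move=> x _; rewrite lee_fin sqr_ge0.
  - by apply/measurable_EFinP; exact: measurable_funX.
  - by move=> x _; rewrite lee_fin sqr_ge0.
  - by apply/measurable_EFinP; exact: measurable_funX.
have L1 : is_L2 mu f1 by split=> //; apply: le_lt_trans sum; rewrite leeDl// sq_int_ge0.
have L2 : is_L2 mu f2 by split=> //; apply: le_lt_trans sum; rewrite leeDr// sq_int_ge0.
pose c := poisson_const n s.
pose N := fine (sq_int mu f1 + sq_int mu f2).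
have NE : (sq_int mu f1 + sq_int mu f2)%E = N%:E by rewrite fineK// ge0_fin_numE// adde_ge0// sq_int_ge0.
pose B := K * c ^+ 2 * N.
have N0 : 0 <= N by rewrite fine_ge0// adde_ge0// sq_int_ge0.
have B0 : 0 <= B by apply: mulr_ge0 => //; apply: mulr_ge0 => //; exact: sqr_ge0.
exists (B `^ 2^-1) => r r0.
(* The prefactor $r^s$ of the Poisson kernel is put into the data, where it cancels $r^{-s}$ and
   makes the bound independent of the radius. *)
pose g1 x := c * r `^ s * f1 x; pose g2 x := c * r `^ s * f2 x.
have [hF bF] := HK r g1 g2 r0 (is_L2_scale _ L1) (is_L2_scale _ L2).
set F := (fun z => _) in hF bF; exists F.
have sqZ (a : R) g : is_L2 mu g -> sq_int mu (fun x => a * g x) = ((a ^+ 2)%:E * sq_int mu g)%E.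
  move=> [mg _]; rewrite /sq_int -ge0_integralZl//.
  - by apply: eq_integral => x _; rewrite exprMn EFinM.
  - by apply/measurable_EFinP; exact: measurable_funX.
  - by move=> x _; rewrite lee_fin sqr_ge0.
  - by rewrite lee_fin sqr_ge0.
have {}bF : (bergman_sqnorm s r F <= B%:E)%E.
  apply: le_trans bF _; rewrite !sqZ// -ge0_muleDr ?sq_int_ge0// NE -!EFinM lee_fin.
  have rs : r `^ s * r `^ (- s) = 1 by rewrite -powRD ?subrr ?powRr0// (gt_eqF r0) implybT.
  rewrite le_eqVlt; apply/orP; left; apply/eqP; rewrite /B exprMn.
  rewrite (_ : K * c ^+ 2 * N = K * c ^+ 2 * N * (r `^ s * r `^ (- s)) ^+ 2); last by rewrite rs expr1n mulr1.
  by ring.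
split.
- split=> // x; rewrite uE//.
  have -> : (fun y : 'rV[R]_n => (r `^ s * gen_poisson s r y)%:C) = (fun y => (c * poisson s r y)%:C).
    by apply/funext => y; rewrite gen_poissonE.
  rewrite convolutionE /F /tube_ext; have [-> ->] := map_mx_cpoint x (0 : 'rV[R]_n).
  (* At real points the complex power degenerates: its angle is 0, so the kernel is real and equals
     the Poisson kernel without the factor $r^s$. *)
  have q0 (v : 'rV[R]_n) : q_re r v 0 = sq_dist r v /\ q_im v 0 = 0.
    rewrite /q_re /q_im /sq_dist; split; last by rewrite big1 ?mulr0// => i _; rewrite mxE mulr0.
    by congr (_ + _); apply: eq_bigr => i _; rewrite mxE expr0n subr0.
  have kr (v : 'rV[R]_n) : kernel_re p r v 0 = sq_dist r v `^ (- p).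
    have [e1 e2] := q0 v; rewrite /kernel_re e1 e2 /cpow_re mul0r atan0 mulr0 cos0 mulr1 expr0n addr0.
    by rewrite -powR_mulrn ?(ltW (sq_dist_gt0 v r0))// -powRrM; congr (_ `^ _); field.
  have ki (v : 'rV[R]_n) : kernel_im p r v 0 = 0.
    by have [e1 e2] := q0 v; rewrite /kernel_im e2 /cpow_im mul0r atan0 mulr0 sin0 mulr0 oppr0.
  have im0 (g : 'rV[R]_n -> R) : tube_ext_im s r g x 0 = 0.
    rewrite /tube_ext_im /Rintegral (eq_integral (fun=> 0%E)) ?integral0// => t _.
    by rewrite ki mulr0.
  have re0 (g : 'rV[R]_n -> R) : tube_ext_re s r (fun t => c * r `^ s * g t) x 0 = rconv g (fun y => c * poisson s r y) x.
    by apply: eq_Rintegral => t _; rewrite kr /poisson; ring.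
  rewrite !im0 !re0; apply/eqP; rewrite eq_complex /=.
  by rewrite !mul0r !mul1r !subr0 !addr0 !add0r !eqxx.
- by split=> //; apply: le_lt_trans bF _; rewrite ltry.
have BN0 : (0 <= bergman_sqnorm s r F)%E.
  rewrite bergman_sqnormE// mule_ge0 ?lee_fin ?invr_ge0 ?exprn_ge0 ?(ltW r0)// integral_ge0// => y _.
  by rewrite mule_ge0 ?tube_mass_ge0// lee_fin powR_ge0.
move: bF BN0; rewrite /bergman_norm; case: (bergman_sqnorm s r F) => [a| |]//=.
rewrite !lee_fin => aB a0; apply: ge0_ler_powR; rewrite ?nnegrE//.
Qed.

End tube_ext_bound.

Local Open Scope complex_scope.

Theorem theorem2p7 (R : realType) (n : nat) (s : R) (u : 'rV[R]_n * R -> R[i]) :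
  (1 <= n)%N -> 0 < s -> extension_solution s u ->
  (exists f : 'rV[R]_n -> R[i],
     L2 f /\
     forall (x : 'rV[R]_n) (rho : R), 0 < rho ->
       u (x, rho) =
       convolution f (fun y => (rho `^ s * gen_poisson s rho y)%:C) x)
  <->
  (exists C : R, forall rho : R, 0 < rho ->
     exists F : 'rV[R[i]]_n -> R[i],
       [/\ extends_to_tube rho (fun x => u (x, rho)) F,
           bergman_space s rho F &
           (bergman_norm s rho F <= C%:E)%E]).
Proof.
move=> n1 s0 sol; split; first exact: convolution_bergman_bounded.
exact: bergman_bounded_convolution.
Qed.
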